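(* Among the eleven compact-hyperbolic root bases of rank three listed in the context, the shadow $\Xi$ is nonzero for exactly one, namely the root basis with Gram matrix $\begin{pmatrix}4&-6&0\\-6&12&-6\\0&-6&6\end{pmatrix}$ of determinant $-72$ (the member of absolute determinant $72$ of the chain $(1,2,1,3)$).
   Context: **Root bases.** A rank-three symmetrizable hyperbolic generalized Cartan matrix is an integral $3\times3$ matrix $A$ with $a_{ii}=2$, $a_{ij}\le0$ for $i\ne j$, $a_{ij}=0\iff a_{ji}=0$, $a_{ij}a_{ji}\le4$, connected Dynkin diagram, $a_{12}a_{23}a_{31}=a_{21}a_{32}a_{13}$, and symmetrised Gram $G=\mathrm{diag}(d_1,d_2,d_3)A$ ($d_i$ coprime positive integers, $G$ symmetric) of signature $(2,1)$. It is compact hyperbolic if $a_{ij}a_{ji}\le3$ for all $i\ne j$ (every proper principal submatrix is of finite type). A root basis is $A$ together with $G$, taken up to simultaneous permutation of rows and columns. There are eleven compact-hyperbolic root bases; writing $(a,b,c;x,y,z)$ for $\begin{pmatrix} a & x & y \\ x & b & z \\ y & z & c \end{pmatrix}$, their Grams are: (2,4,2;-2,-1,-2), (2,4,4;-2,-2,-2), (2,6,4;-3,-2,0), (4,12,2;-6,-2,0), (2,6,12;-3,0,-6), (4,12,6;-6,0,-6), (2,6,2;-3,0,-3), (2,6,6;-3,-3,0), (6,18,2;-9,-3,0), (2,6,2;-3,-1,-3), (2,6,6;-3,-3,-3). The chain $(1,2,1,3)$ consists of the third to sixth of these; its name is the concatenation of the sorted pairs $(|a_{ij}|,|a_{ji}|)$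 with $(0,0)$ dropped. **Lattice and Weil representation.** $L=\mathbb Z^3$ with bilinear form $(x,y)=x^TGy$; $L'$ is the dual lattice, $D(L)=L'/L$, $q(\gamma)=\tfrac12(\gamma,\gamma)\bmod1$. $\rho_L$ is the representation of $\mathrm{Mp}_2(\mathbb Z)$ on $\mathbb C[D(L)]$ with $\rho_L(T)e_\gamma=e(q(\gamma))e_\gamma$ and $\rho_L(S)e_\gamma=\frac{e(-1/8)}{\sqrt{|D(L)|}}\sum_\delta e(-(\gamma,\delta))e_\delta$, $e(x)=e^{2\pi ix}$. $S_{5/2}(\rho_L)$ is the space of weight-$5/2$ cusp forms for $\rho_L$, with $h=\sum_\gamma\sum_{n\in q(\gamma)+\mathbb Z,\,n>0}c_h(\gamma,n)q^ne_\gamma$. **Menu, functional, shadow.** A reflective vector is a primitive $v\in\mathbb Z^3$ with $n=v^TGv>0$ and $2d\equiv0\pmod n$, where $d=\gcd(Gv)$ is the gcd of the entries of $Gv$. The menu $M$ is the finite set of all values $m=n/(2d^2)$ for reflective $v$. Put $$\lambda(h)=\sum_{m\in M}\ \sum_{\gamma\in D(L):\,q(\gamma)\equiv m\ (\mathrm{mod}\ 1)}c_h(\gamma,m)\qquad(h\in S_{5/2}(\rho_L)).$$ The shadow $\Xi\in S_{5/2}(\rho_L)$ is the element representing $\lambda$ for the Petersson inner product; $\Xi\neq0$ if and only if $\lambda\ne0$. *)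

(* Defs.v *)
From HB Require Import structures.
From mathcomp Require Import all_boot all_order all_algebra.
From mathcomp Require Import complex ring lra zify.
From mathcomp Require Import all_classical all_reals all_analysis.
Set Implicit Arguments.
Unset Strict Implicit.
Unset Printing Implicit Defensive.
Import Order.TTheory GRing.Theory Num.Theory.
Import numFieldNormedType.Exports.
Local Open Scope classical_set_scope.
Local Open Scope ring_scope.
Local Open Scope complex_scope.

Definition signature21 (G : 'M[int]_3) : Prop :=
  exists (P : 'M[rat]_3) (s : 'rV[rat]_3),
    [/\ P \in unitmx, forall i, 0 < s 0 i &
        P^T *m map_mx intr G *m P =
        diag_mx (\row_i if i == ord_max then - s 0 i else s 0 i)].

Record root_basis (A G : 'M[int]_3) : Prop := RootBasis {
  rb_diag : forall i, A i i = 2;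
  rb_offdiag : forall i j, i != j -> A i j <= 0;
  rb_zero : forall i j, A i j = 0 <-> A j i = 0;
  rb_le4 : forall i j, i != j -> A i j * A j i <= 4;
  rb_connected : forall i j, connect [rel k l | A k l != 0] i j;
  rb_cycle : forall i j k, A i j * A j k * A k i = A j i * A k j * A i k;
  rb_gram : exists d : 'rV[int]_3,
    [/\ forall i, 0 < d 0 i, \big[gcdz/0]_i d 0 i = 1,
        G = diag_mx d *m A & G^T = G];
  rb_signature : signature21 G
}.

Definition compact_hyperbolic (A G : 'M[int]_3) : Prop :=
  root_basis A G /\ forall i j, i != j -> A i j * A j i <= 3.

Definition gram (a b c x y z : int) : 'M[int]_3 :=
  \matrix_(i, j) (nth [::] [:: [:: a; x; y]; [:: x; b; z]; [:: y; z; c]] i)`_j.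

Definition chain_1213 : seq 'M[int]_3 :=
  [:: gram 2 6 4 (-3) (-2) 0; gram 4 12 2 (-6) (-2) 0;
      gram 2 6 12 (-3) 0 (-6); gram 4 12 6 (-6) 0 (-6)].

Definition compact_grams : seq 'M[int]_3 :=
  [:: gram 2 4 2 (-2) (-1) (-2); gram 2 4 4 (-2) (-2) (-2)]
  ++ chain_1213 ++
  [:: gram 2 6 2 (-3) 0 (-3); gram 2 6 6 (-3) (-3) 0;
      gram 6 18 2 (-9) (-3) 0; gram 2 6 2 (-3) (-1) (-3);
      gram 2 6 6 (-3) (-3) (-3)].

Lemma det_gram (a b c x y z : int) : \det (gram a b c x y z) =
  a * b * c + 2 * x * y * z - a * z ^+ 2 - b * y ^+ 2 - c * x ^+ 2.
Proof.
rewrite (expand_det_row _ ord0) !big_ord_recl big_ord0 /cofactor.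
rewrite !(expand_det_row _ ord0) !big_ord_recl !big_ord0 /cofactor !det_mx11 !mxE /=.
rewrite /bump /=; ring.
Qed.

Lemma signature_gram (a b c x y z : int) : 0 < a -> 0 < a * b - x ^+ 2 ->
  \det (gram a b c x y z) < 0 -> signature21 (gram a b c x y z).
Proof.
rewrite det_gram => a0 m0 d0.
pose q (n : int) : rat := n%:~R.
have qa : 0 < q a by rewrite ltr0z.
have qm : 0 < q a * q b - q x ^+ 2 by move: m0; rewrite -(ltr0z rat) rmorphB rmorphM rmorphXn.
have qd : q a * q b * q c + 2 * q x * q y * q z - q a * q z ^+ 2 - q b * q y ^+ 2 - q c * q x ^+ 2 < 0.
  move: d0; rewrite -(ltrz0 rat) !(rmorphB, rmorphD, rmorphM, rmorphXn) /=.
  by [].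
pose m := q a * q b - q x ^+ 2.
pose P : 'M[rat]_3 := \matrix_(i, j)
  (nth [::] [:: [:: 1; - q x / q a; (q x * q z - q b * q y) / m];
                [:: 0; 1; (q x * q y - q a * q z) / m]; [:: 0; 0; 1]] i)`_j.
have a_n0 : q a != 0 by rewrite gt_eqF.
have m_n0 : m != 0 by rewrite gt_eqF.
exists P, (\row_j [:: q a; m / q a; - (q a * q b * q c + 2 * q x * q y * q z - q a * q z ^+ 2 - q b * q y ^+ 2 - q c * q x ^+ 2) / m]`_j).
split.
- rewrite unitmxE (_ : \det P = 1) ?unitr1 // -det_tr det_trig.
    by rewrite !big_ord_recl big_ord0 !mxE /= !mulr1.
  by apply/is_trig_mxP => -[[|[|[|//]]] ?] [[|[|[|//]]] ?] //=; rewrite !mxE.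
- case=> [[|[|[|//]]] ?]; rewrite !mxE //=; first by rewrite divr_gt0.
  by rewrite divr_gt0 // oppr_gt0.
- apply/matrixP => -[[|[|[|//]]] i3] [[|[|[|//]]] j3];
  rewrite !mxE !big_ord_recl !big_ord0 !mxE !big_ord_recl !big_ord0 !mxE /= -?/(q _) /m; field;
  by rewrite ?a_n0 ?m_n0.
Qed.

Definition cartan_of (G : 'M[int]_3) : 'M[int]_3 :=
  \matrix_(i, j) divz (2 * G i j) (G i i).

Lemma connect_hub (T : finType) (e : rel T) k :
  (forall i, i != k -> e i k && e k i) -> forall i j, connect e i j.
Proof.
move=> H i j; apply: (@connect_trans _ _ k).
  by case: (eqVneq i k) => [->|/H/andP[ik _]]; [exact: connect0|exact: connect1].
by case: (eqVneq j k) => [->|/H/andP[_ ik]]; [exact: connect0|exact: connect1].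
Qed.

Lemma ord3P (P : 'I_3 -> Prop) :
  P ord0 -> P (lift ord0 ord0) -> P ord_max -> forall i, P i.
Proof.
  move=> p0 p1 p2 [[|[|[|//]]] i3].
  - by rewrite (_ : Ordinal _ = ord0) //; apply: val_inj.
  - by rewrite (_ : Ordinal _ = lift ord0 ord0) //; apply: val_inj.
  - by rewrite (_ : Ordinal _ = ord_max) //; apply: val_inj.
Qed.

Lemma compact_grams_hyperbolic (G : 'M[int]_3) :
  G \in compact_grams -> exists A, compact_hyperbolic A G.
Proof.
move=> GC; exists (cartan_of G); move: GC.
rewrite /compact_grams /chain_1213 !(mem_cat, inE).
move=> /orP[/orP[]|/orP[/or4P[]|/orP[|/orP[|/orP[|/orP[]]]]]] /eqP ->;
(split; last by (apply: ord3P; apply: ord3P => //; rewrite !mxE));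
(split;
[ by apply: ord3P; rewrite !mxE
| by apply: ord3P; apply: ord3P => //; rewrite !mxE
| by apply: ord3P; apply: ord3P; rewrite !mxE
| by apply: ord3P; apply: ord3P => //; rewrite !mxE
| (apply: (@connect_hub _ _ ord0); apply: ord3P => //; by rewrite /= !mxE) ||
  (apply: (@connect_hub _ _ (lift ord0 ord0)); apply: ord3P => //; by rewrite /= !mxE) ||
  (apply: (@connect_hub _ _ ord_max); apply: ord3P => //; by rewrite /= !mxE)
| by do 3!apply: ord3P; rewrite !mxE
| match goal with |- context [_ = _ *m cartan_of (gram ?a ?b ?c _ _ _)] =>
   exists (\row_j [:: divz a 2; divz b 2; divz c 2]`_j); split;
   [ by apply: ord3P; rewrite mxE
   | by rewrite !big_ord_recl big_ord0 !mxE
   | by apply/matrixP; apply: ord3P; apply: ord3P; rewrite mul_diag_mx !mxE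
   | by apply/matrixP; apply: ord3P; apply: ord3P; rewrite !mxE ] end
| by apply: signature_gram => //; rewrite det_gram]).
Qed.

Definition bform (G : 'M[int]_3) (u v : 'cV[rat]_3) : rat :=
  (u^T *m map_mx intr G *m v) 0 0.

Definition in_dual (G : 'M[int]_3) (u : 'cV[rat]_3) : bool :=
  [forall i, (map_mx intr G *m u) i 0 \is a Num.int].

Definition frac_vec (N : nat) (g : 'cV['I_N]_3) : 'cV[rat]_3 :=
  \col_i ((g i 0 : nat)%:R / N%:R).

(** L'/L.  With N = |det G| one has N L' <= L, so every class of L'/L has exactly
    one representative g/N with entries of g in {0, ..., N-1}; see
    [disc_repP]. *)
Definition disc (G : 'M[int]_3) : finType :=
  {g : 'cV['I_(`|\det G|%N)]_3 | in_dual G (frac_vec g)}.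

Definition disc_rep (G : 'M[int]_3) (g : disc G) : 'cV[rat]_3 := frac_vec (val g).

Lemma disc_repP (G : 'M[int]_3) (u : 'cV[rat]_3) :
  \det G != 0 -> in_dual G u ->
  exists! g : disc G, forall i, (u - disc_rep g) i 0 \is a Num.int.
Proof.
move=> dG0 /forallP uG.
have N0 : (0 < `|\det G|)%N by rewrite absz_gt0.
set N := `|\det G|%N in N0.
have NQ : (N%:R : rat) != 0 by rewrite pnatr_eq0 -lt0n.
have intP (r : rat) : r \is a Num.int -> exists z : int, r = z%:~R.
  by move/intrP.
have [w Hw] : exists w : 'cV[int]_3, map_mx intr G *m u = map_mx intr w.
  have /(_ _)/cid := (fun i => intP _ (uG i)) => H.
  exists (\col_i projT1 (H i)); apply/matrixP => i j.
  by rewrite !mxE (ord1 j); case: (H i) => z /= <-; rewrite mxE.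
have [t Ht] : exists t : 'cV[int]_3, N%:R *: u = map_mx intr t.
  have E : (\det G)%:~R *: u = map_mx intr (\adj G *m w) :> 'cV[rat]_3.
    rewrite map_mxM -Hw mulmxA -map_mxM mul_adj_mx.
    by rewrite map_scalar_mx mul_scalar_mx.
  have : N%:R = (\det G)%:~R :> rat \/ N%:R = - (\det G)%:~R :> rat.
    have -> : N%:R = `|\det G|%:~R :> rat by rewrite /N -abszE.
    have [h|h] := boolP (0 <= \det G); first by left; rewrite ger0_norm.
    by right; rewrite ltr0_norm ?ltNge // intrN.
  case=> ->; first by eexists; exact: E.
  by exists (- (\adj G *m w)); rewrite scaleNr E map_mxN.
have uE i : u i 0 = (t i 0)%:~R / N%:R.
  apply: (mulfI NQ); rewrite mulrCA divff // mulr1.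
  by have /matrixP/(_ i 0) := Ht; rewrite !mxE.
have tlt i : (`|modz (t i ord0) N| < N)%N.
  rewrite -ltz_nat gez0_abs ?modz_ge0 ?ltz_mod //; lia.
pose g0 : 'cV['I_N]_3 := \col_i Ordinal (tlt i).
have dif i : (u - frac_vec g0) i 0 = (divz (t i 0) N)%:~R.
  rewrite !mxE uE -mulrBl; apply: (mulIf NQ); rewrite mulfVK //=.
  have := divz_eq (t i 0) N => {1}->.
  rewrite intrD intrM -[_%:R in X in _ - X]/((`|_|%N : int)%:~R) gez0_abs ?modz_ge0 ?addrK //; lia.
have g0G : in_dual G (frac_vec g0).
  apply/forallP => i.
  have -> : (map_mx intr G *m frac_vec g0) i 0 =
      (map_mx intr G *m u) i 0 - (map_mx intr G *m (u - frac_vec g0)) i 0 :> rat.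
    by rewrite mulmxBr; move: (_ *m u) (_ *m _) => X Y; rewrite !mxE; ring.
  apply: rpredB; first exact: uG.
  by rewrite mxE; apply: rpred_sum => k _; rewrite dif mxE rpredM ?intr_int.
exists (exist _ g0 g0G); split=> [i|[g gG] /= Hg]; first by rewrite dif intr_int.
apply: val_inj => /=; apply/matrixP => i j; rewrite (ord1 j) {j}.
apply: val_inj => /=.
have : (u - disc_rep (exist _ g gG)) i 0 - (u - frac_vec g0) i 0 \is a Num.int.
  by rewrite rpredB // ?Hg // dif intr_int.
rewrite /disc_rep /= => /intP [z].
have -> : (u - frac_vec g) i 0 - (u - frac_vec g0) i 0 =
   ((nat_of_ord (g0 i 0))%:R - (nat_of_ord (g i 0))%:R) / N%:R :> rat.
  by rewrite !mxE; field; exact: NQ.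
move/(congr1 (fun x => x * N%:R)); rewrite mulfVK //.
rewrite !pmulrn -intrB -intrM => /eqP; rewrite eqr_int => /eqP.
have := ltn_ord (g0 i 0); have := ltn_ord (g i 0).
rewrite -/N; set p := nat_of_ord (g i 0); set q := nat_of_ord (g0 i 0).
move: p q => p q pN qN E.
have [z0|[z0|z0]] : z = 0 \/ (1 <= z \/ z <= -1) by lia.
- by move: E; rewrite z0 mul0r; lia.
- have : N%:Z <= z * N by nia.
  lia.
- have : z * N <= - N%:Z by nia.
  lia.
Qed.

(** A representative in rat of q(g), which is defined modulo 1. *)
Definition qval (G : 'M[int]_3) (g : disc G) : rat :=
  bform G (disc_rep g) (disc_rep g) / 2.

(** e(z) = exp(2 pi i z). *)
Definition e2pi (R : realType) (z : R[i]) : R[i] :=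
  (expR (- (2 * pi * complex.Im z)))%:C *
  (cos (2 * pi * complex.Re z) +i* sin (2 * pi * complex.Re z)).

Definition e2pi_rat (R : realType) (r : rat) : R[i] := e2pi (ratr r : R)%:C.

(** C[D(L)]; the value of v at g is the coefficient of the basis vector e_g. *)
Definition group_space (R : realType) (G : 'M[int]_3) : Type :=
  {ffun disc G -> R[i]}.

(** Linear extensions of rho_L(T) e_g = e(q(g)) e_g and of
    rho_L(S) e_g = e(-1/8) / sqrt |D(L)| * sum_d e(- (g, d)) e_d. *)
Definition weilT (R : realType) (G : 'M[int]_3) (v : group_space R G) :
    group_space R G :=
  [ffun g => e2pi_rat R (qval g) * v g].

Definition weilS (R : realType) (G : 'M[int]_3) (v : group_space R G) :
    group_space R G :=
  [ffun d => e2pi_rat R (- (1 / 8)) / (Num.sqrt (#|disc G|%:R : R))%:C *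
     \sum_g e2pi_rat R (- bform G (disc_rep g) (disc_rep d)) * v g].

(** c g n is the coefficient of q^n e_g.  The exponents n > 0 in q(g) + Z are
    enumerated as the fractional part of q(g) plus k, k = 0, 1, 2, ...; when
    q(g) is an integer the term k = 0 vanishes by the support condition. *)
Definition q_expansion (R : realType) (G : 'M[int]_3)
    (h : R[i] -> group_space R G) (c : disc G -> rat -> R[i]) : Prop :=
  (forall g n, c g n != 0 -> 0 < n /\ n - qval g \is a Num.int) /\
  forall g (tau : R[i]), 0 < complex.Im tau ->
    let n k : rat := qval g - (Num.floor (qval g))%:~R + k%:R in
    series (fun k => c g (n k) * e2pi ((ratr (n k) : R)%:C * tau) : R[i]^o)
      @ \oo --> (h tau g : R[i]^o).

(** S_{5/2}(rho_L).  As T and S generate Mp_2(Z), with S = ((0,-1;1,0), sqrt tau),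
    the transformation law is imposed on T and S; [sqrtc] is the principal square
    root.  Functions on the upper half-plane are extended by 0 to all of C, so
    that equality of forms is equality of functions. *)
Record cusp_form (R : realType) (G : 'M[int]_3)
    (h : R[i] -> group_space R G) : Prop := CuspForm {
  cf_off : forall tau : R[i], complex.Im tau <= 0 -> h tau = [ffun=> 0];
  cf_holomorphic : forall g (tau : R[i]), 0 < complex.Im tau ->
    derivable (fun z : R[i]^o => h z g : R[i]^o) tau 1;
  cf_T : forall tau : R[i], 0 < complex.Im tau -> h (tau + 1) = weilT (h tau);
  cf_S : forall tau : R[i], 0 < complex.Im tau ->
    h (- tau^-1) = [ffun g => sqrtc tau ^+ 5 * weilS (h tau) g];
  cf_cusp : exists c, q_expansion h c
}.

Definition fourier_coef (R : realType) (G : 'M[int]_3)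
    (h : R[i] -> group_space R G) (g : disc G) (n : rat) : R[i] :=
  xget 0 [set a | exists2 c, q_expansion h c & c g n = a].

(** Petersson inner product: integral over the standard fundamental domain of
    <f, h> y^(5/2) dx dy / y^2. *)
Definition fundamental_domain (R : realType) : set (R * R) :=
  [set z | [/\ 0 < z.2, `|z.1| <= 1 / 2 & 1 <= z.1 ^+ 2 + z.2 ^+ 2]].

Definition petersson (R : realType) (G : 'M[int]_3)
    (f h : R[i] -> group_space R G) : R[i] :=
  let mu := (@lebesgue_measure R \x @lebesgue_measure R)%E in
  let F (z : R * R) : R[i] :=
    (\sum_g f (z.1 +i* z.2) g * (h (z.1 +i* z.2) g)^* ) *
    (z.2 `^ (5 / 2) / z.2 ^+ 2)%:C in
  (\int[mu]_(z in @fundamental_domain R) complex.Re (F z)) +i*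
  (\int[mu]_(z in @fundamental_domain R) complex.Im (F z)).

Definition gcd_entries (v : 'cV[int]_3) : int := \big[gcdz/0]_i v i 0.

Definition norm2 (G : 'M[int]_3) (v : 'cV[int]_3) : int := (v^T *m G *m v) 0 0.

Definition reflective (G : 'M[int]_3) (v : 'cV[int]_3) : Prop :=
  [/\ gcd_entries v = 1, 0 < norm2 G v &
      (norm2 G v %| 2 * gcd_entries (G *m v))%Z].

Definition menu (G : 'M[int]_3) : set rat :=
  [set m | exists2 v, reflective G v &
     m = (norm2 G v)%:~R / (2 * (gcd_entries (G *m v))%:~R ^+ 2)].

Lemma gcd_entries_dvd (v : 'cV[int]_3) k : (gcd_entries v %| v k ord0)%Z.
Proof.
suff H (r : seq 'I_3) : k \in r -> (\big[gcdz/0]_(i <- r) v i ord0 %| v k ord0)%Z.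
  by rewrite /gcd_entries H // mem_index_enum.
elim: r => // i r IH; rewrite inE big_cons => /predU1P[->|/IH].
  exact: dvdz_gcdl.
exact: dvdz_trans (dvdz_gcdr _ _).
Qed.

Lemma menu_finite (G : 'M[int]_3) : \det G != 0 -> finite_set (menu G).
Proof.
move=> dG0; set N := `|\det G|%N.
pose f (p : nat * nat) : rat := p.1%:R / (2 * p.2%:R ^+ 2).
apply: (@sub_finite_set _ _ (f @` (`I_(2 * N).+1 `*` `I_N.+1))); last first.
  by apply: finite_image; apply: finite_setX; exact: finite_II.
move=> m [v [v1 n0 nd] ->].
have N0 : (0 < N)%N by rewrite absz_gt0.
set d := gcd_entries (G *m v) in nd *; set n := norm2 G v in n0 nd *.
have d0 : 0 <= d.
  by rewrite /d /gcd_entries big_ord_recl.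
have dN : (d %| \det G)%Z.
  rewrite -[X in (_ %| X)%Z]mulr1 -v1 /gcd_entries.
  apply: (big_ind (fun x => d %| \det G * x)%Z) => [|x y dx dy|i _].
  - by rewrite mulr0 dvdz0.
  - have [a [b <-]] := Bezoutz x y.
    by rewrite mulrDr !(mulrCA (\det G)) rpredD // dvdz_mull.
  - have -> : \det G * v i 0 = (\adj G *m (G *m v)) i 0.
      by rewrite mulmxA mul_adj_mx mul_scalar_mx mxE.
    rewrite mxE; apply: rpred_sum => k _; apply: dvdz_mull.
    exact: gcd_entries_dvd.
have dnz : d != 0 by apply: contraNneq dG0 => d00; move: dN; rewrite d00 dvd0z.
have dleN : (`|d| <= N)%N by apply: dvdn_leq => //; move: dN; rewrite dvdzE.
have nle : (`|n| <= 2 * `|d|)%N.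
  apply: dvdn_leq; first lia.
  by move: nd; rewrite dvdzE abszM.
exists (`|n|%N, `|d|%N); first by split => /=; lia.
rewrite /f /=; congr (_ / (2 * _ ^+ 2)).
- by rewrite -[LHS]/((`|n|%N : int)%:~R) gez0_abs // ltW.
- by rewrite -[LHS]/((`|d|%N : int)%:~R) gez0_abs.
Qed.

(** The outer sum is over a finite set; see [menu_finite]. *)
Definition lambda (R : realType) (G : 'M[int]_3)
    (h : R[i] -> group_space R G) : R[i] :=
  \sum_(m \in menu G)
    \sum_(g : disc G | qval g - m \is a Num.int) fourier_coef h g m.

Definition is_shadow (R : realType) (G : 'M[int]_3)
    (Xi : R[i] -> group_space R G) : Prop :=
  cusp_form Xi /\ forall h, cusp_form h -> lambda h = petersson h Xi.

(* Main.v *)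
From HB Require Import structures.
Require Import Defs.
From mathcomp Require Import all_boot all_order all_algebra all_fingroup.
From mathcomp Require Import complex ring lra zify.
From mathcomp Require Import all_classical all_reals all_analysis.
From mathcomp Require Import measurable_realfun.
Set Implicit Arguments.
Unset Strict Implicit.
Unset Printing Implicit Defensive.
Import Order.TTheory GRing.Theory Num.Theory.
Import numFieldNormedType.Exports.
Local Open Scope classical_set_scope.
Local Open Scope ring_scope.
Local Open Scope complex_scope.

(** With w = e(tau/144), every component of a cusp form for rho_L is a power series in w whose
    exponents lie in one class modulo 144.  Averaging a form h over the isometries of the discriminant
    form multiplies lambda(h) by their number, so lambda only sees invariant forms.

    A vector-valued form of weight r/2 whose components vanish at infinity to order more than r/24
    (6r in w) is zero: sum |f_x|^2 / |eta|^(2r) is bounded, invariant under SL_2(Z) and attains its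
    maximum, so it is constant.  For ten of the lattices every invariant form is zero.  Contracting it
    with theta functions, or multiplying suitable combinations of its components, raises the order
    past that bound, or reaches equality, where the quotients by the power of eta are constant and the
    action of S excludes them.

    On the lattice of determinant -72 the same arguments show that an invariant form is determined by
    its coefficient at q^(1/12), and symmetrizing eta^2 u u theta over three coordinates gives an
    invariant form whose coefficients at q^(1/12), q^(1/6) and q^(1/2) are -2 (on 12 classes), 4 (on 12
    classes) and 0.  The menu meets the exponents of rho_L exactly in 1/12, 1/6 and possibly 1/2, because
    1/4 would require a reflective vector of norm 2 or 8, while norms are squares modulo 3.  Hence lambda
    equals -24 + 48 = 24 on this form, and the shadow is a nonzero multiple of its average.

    The inversion formulas of the theta functions come from Poisson summation, obtained from the
    Fejer kernel and a shift of the line of integration. *)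


(** Neither a dimension formula nor the valence formula is used. A cusp form comes with its
    expansion, so power series on the unit disc suffice: synthetic division yields orders of zeros,
    continuity and a local maximum principle. The obstacle is the size of the orders. In weight 5/2
    the bound is 30 in w, and of the five modules that occur only the one of order 12 has every
    class at or above it; classes of order 24, 24, 16 and 12 occur in those of orders 24, 36, 108
    and 72. Products help because S and T permute, up to constants, the norms of a few combinations
    of components: the product has to meet the bound only on average, and does so with equality.
    Symmetry enters at equality, where the surviving classes form one orbit or two, and relations
    from S dispose of them. For determinant -72 the product of eta^2 with theta functions has the
    right weight, but its T-eigenvalues are off by a cube root of unity; a permutation of the three
    values indexed by the number of nonzero coordinates modulo 3 repairs this. *)

Definition csum (R : realType) (u : nat -> R[i]) : R[i] :=
  limn (series (fun k => complex.Re (u k))) +i* limn (series (fun k => complex.Im (u k))).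

HB.lock Definition PS (R : realType) (a : nat -> R[i]) (w : R[i]) : R[i] :=
  csum (fun k => a k * w ^+ k).

(** The norm of [R[i]] takes its values in [R[i]]; a real-valued modulus keeps every estimate within
    linear arithmetic over [R]. *)
HB.lock Definition md (R : realType) (z : R[i]) : R := Normc.normc z.

(** * Modulus, limits and geometrically dominated sums of complex numbers *)

Section Modulus.
Variable R : realType.
Local Notation C := R[i].
Local Notation md := (@md R).
Local Notation PS := (@PS R).
Local Notation csum := (@csum R).

Lemma md_ge0 z : 0 <= md z.
Proof. by rewrite unlock; case: z => a b; rewrite /= sqrtr_ge0. Qed.

Lemma md0 : md 0 = 0. Proof. rewrite unlock; exact: Normc.normc0. Qed.
Lemma md1 : md 1 = 1. Proof. rewrite unlock; exact: Normc.normc1. Qed.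
Lemma mdM z w : md (z * w) = md z * md w. Proof. rewrite unlock; exact: Normc.normcM. Qed.
Lemma mdV z : md z^-1 = (md z)^-1. Proof. rewrite unlock; exact: Normc.normcV. Qed.
Lemma mdN z : md (- z) = md z. Proof. rewrite unlock; exact: normcN. Qed.
Lemma mdD z w : md (z + w) <= md z + md w. Proof. rewrite unlock; exact: le_normcD. Qed.
Lemma mdB z w : md (z - w) <= md z + md w.
Proof. by rewrite -(mdN w) mdD. Qed.
Lemma mdBC z w : md (z - w) = md (w - z).
Proof. by rewrite -mdN opprB. Qed.
Lemma md_eq0 z : (md z == 0) = (z == 0).
Proof.
by apply/eqP/eqP => [|->]; [rewrite unlock; exact: Normc.eq0_normc|exact: md0].
Qed.
Lemma md_gt0 z : (0 < md z) = (z != 0).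
Proof. by rewrite lt_neqAle md_ge0 andbT eq_sym md_eq0. Qed.
Lemma mdX z n : md (z ^+ n) = md z ^+ n.
Proof. by elim: n => [|n IH]; rewrite ?expr0 ?md1 // !exprS mdM IH. Qed.
Lemma md_sum (I : Type) (r : seq I) (P : pred I) (F : I -> C) :
  md (\sum_(i <- r | P i) F i) <= \sum_(i <- r | P i) md (F i).
Proof.
elim/big_rec2: _ => [|i y x _ h]; first by rewrite md0.
by apply: le_trans (mdD _ _) _; rewrite lerD2l.
Qed.
Lemma md_sqr z : md z ^+ 2 = complex.Re z ^+ 2 + complex.Im z ^+ 2.
Proof. by rewrite unlock; case: z => a b; rewrite /= sqr_sqrtr // addr_ge0 ?sqr_ge0. Qed.
Lemma md_real (x : R) : md x%:C = `|x|.
Proof. by rewrite unlock /= expr0n addr0 sqrtr_sqr. Qed.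
Lemma md_conj z : md (conjc z) = md z.
Proof. by rewrite unlock; case: z => a b; rewrite /= sqrrN. Qed.
Lemma md_Re z : `|complex.Re z| <= md z.
Proof.
rewrite -ler_sqr ?nnegrE ?md_ge0 // md_sqr real_normK ?num_real; have := sqr_ge0 (complex.Im z); lra.
Qed.
Lemma md_Im z : `|complex.Im z| <= md z.
Proof.
rewrite -ler_sqr ?nnegrE ?md_ge0 // md_sqr real_normK ?num_real; have := sqr_ge0 (complex.Re z); lra.
Qed.
Lemma md_le_ReIm z : md z <= `|complex.Re z| + `|complex.Im z|.
Proof.
have h1 := normr_ge0 (complex.Re z); have h2 := normr_ge0 (complex.Im z).
rewrite -ler_sqr ?nnegrE ?md_ge0 ?addr_ge0 ?normr_ge0 // md_sqr sqrrD !real_normK ?num_real //.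
have : 0 <= `|complex.Re z| * `|complex.Im z| by rewrite mulr_ge0.
rewrite -mulr_natl; lra.
Qed.
Lemma mulcJ z : z * conjc z = (md z ^+ 2)%:C.
Proof.
rewrite md_sqr; case: z => a b /=; apply/eqP; rewrite eq_complex /=.
by apply/andP; split; apply/eqP; ring.
Qed.
Lemma conjcM (z w : C) : conjc (z * w) = conjc z * conjc w. Proof. exact: rmorphM. Qed.
Lemma conjcB (z w : C) : conjc (z - w) = conjc z - conjc w. Proof. exact: rmorphB. Qed.
Lemma conjc_sum (I : Type) (r : seq I) (P : pred I) (F : I -> C) :
  conjc (\sum_(i <- r | P i) F i) = \sum_(i <- r | P i) conjc (F i).
Proof. exact: rmorph_sum. Qed.
Lemma normC_md (z : C) : `|z| = (md z)%:C.
Proof. by rewrite unlock; case: z => a b; rewrite normc_def. Qed.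
Lemma md_natr n : md n%:R = n%:R.
Proof. by rewrite -[n%:R](rmorph_nat (real_complex R)) md_real normr_nat. Qed.
Lemma md_triB z w : md z - md w <= md (z - w).
Proof. by rewrite lerBlDr -{1}(subrK w z) mdD. Qed.
Lemma cReD (z w : C) : complex.Re (z + w) = complex.Re z + complex.Re w.
Proof. by case: z w => [? ?] []. Qed.
Lemma cImD (z w : C) : complex.Im (z + w) = complex.Im z + complex.Im w.
Proof. by case: z w => [? ?] []. Qed.
Lemma cReN (z : C) : complex.Re (- z) = - complex.Re z.
Proof. by case: z. Qed.
Lemma cImN (z : C) : complex.Im (- z) = - complex.Im z.
Proof. by case: z. Qed.
Lemma cReM (z w : C) : complex.Re (z * w) =
  complex.Re z * complex.Re w - complex.Im z * complex.Im w.
Proof. by case: z w => [? ?] []. Qed.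
Lemma cImM (z w : C) : complex.Im (z * w) =
  complex.Re z * complex.Im w + complex.Im z * complex.Re w.
Proof. by case: z w => [? ?] []. Qed.
Lemma Re_sum (I : Type) (r : seq I) (P : pred I) (F : I -> C) :
  complex.Re (\sum_(i <- r | P i) F i) = \sum_(i <- r | P i) complex.Re (F i).
Proof. by elim/big_rec2: _ => [//|i y x _ <-]; rewrite cReD. Qed.
Lemma Im_sum (I : Type) (r : seq I) (P : pred I) (F : I -> C) :
  complex.Im (\sum_(i <- r | P i) F i) = \sum_(i <- r | P i) complex.Im (F i).
Proof. by elim/big_rec2: _ => [//|i y x _ <-]; rewrite cImD. Qed.
Lemma complex_eqP (z w : C) : complex.Re z = complex.Re w ->
  complex.Im z = complex.Im w -> z = w.
Proof. by case: z w => [? ?] [? ?] /= -> ->. Qed.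

(** Convergence for the real modulus; [cvg_ctends] relates it to the filter limit in the definition
    of a q-expansion. *)
Definition ctends (u : nat -> C) (l : C) :=
  forall e : R, 0 < e -> exists N, forall n, (N <= n)%N -> md (u n - l) < e.

Lemma geo_small (K t e : R) : 0 <= t < 1 -> 0 < e ->
  exists N, forall n, (N <= n)%N -> K * t ^+ n < e.
Proof.
move=> /andP[t0 t1] e0.
have := @cvg_geometric R `|K| t; rewrite ger0_norm // => /(_ t1).
move/cvgrPdist_lt => /(_ e e0) [N _ hN]; exists N => n Nn.
have := hN n Nn; rewrite /= sub0r normrN /geometric /= normrM normr_id normrX (ger0_norm t0).
by apply: le_lt_trans; rewrite ler_wpM2r ?exprn_ge0 // ler_norm.
Qed.

Lemma ctends_geo u l (K t : R) : 0 <= t < 1 ->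
  (forall n, md (u n - l) <= K * t ^+ n) -> ctends u l.
Proof.
move=> ht h e /(geo_small K ht) [N hN]; exists N => n /hN; exact: le_lt_trans.
Qed.

Lemma ctends_uniq u l l' : ctends u l -> ctends u l' -> l = l'.
Proof.
move=> h h'; apply/eqP; rewrite -subr_eq0 -md_eq0 eq_le md_ge0 andbT.
apply/ler_addgt0Pr => e e0; rewrite add0r.
have e20 : 0 < e / 2 by rewrite divr_gt0.
have [N hN] := h _ e20; have [N' hN'] := h' _ e20.
have h1 := hN _ (leq_maxl N N'); have h2 := hN' _ (leq_maxr N N').
have -> : l - l' = (u (maxn N N') - l') - (u (maxn N N') - l) by ring.
apply: le_trans (mdB _ _) _; lra.
Qed.

Lemma ctends_cst l : ctends (fun=> l) l.
Proof. by move=> e e0; exists 0%N => n _; rewrite subrr md0. Qed.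

Lemma ctendsD u v l m : ctends u l -> ctends v m -> ctends (fun n => u n + v n) (l + m).
Proof.
move=> h h' e e0; have e20 : 0 < e / 2 by rewrite divr_gt0.
have [N hN] := h _ e20; have [N' hN'] := h' _ e20.
exists (maxn N N') => n; rewrite geq_max => /andP[/hN h1 /hN' h2].
have -> : u n + v n - (l + m) = (u n - l) + (v n - m) by ring.
apply: le_lt_trans (mdD _ _) _; lra.
Qed.

Lemma ctends_bounded u l : ctends u l -> exists2 K, 0 < K & forall n, md (u n) <= K.
Proof.
move=> /(_ 1 ltr01) [N hN].
exists (md l + 1 + \sum_(i < N) md (u i)) => [|n].
  have := md_ge0 l; have : 0 <= \sum_(i < N) md (u i) by apply: sumr_ge0 => i _; exact: md_ge0.
  lra.
have s0 : 0 <= \sum_(i < N) md (u i) by apply: sumr_ge0 => i _; exact: md_ge0.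
have [nN|Nn] := ltnP n N.
  rewrite (bigD1 (Ordinal nN)) //=; have := md_ge0 l.
  have : 0 <= \sum_(i < N | i != Ordinal nN) md (u i) by apply: sumr_ge0 => i _; exact: md_ge0.
  lra.
have := hN n Nn; have := md_triB (u n) l; lra.
Qed.

Lemma ctendsM u v l m : ctends u l -> ctends v m -> ctends (fun n => u n * v n) (l * m).
Proof.
move=> h h' e e0.
have [K K0 hK] := ctends_bounded h.
have M0 := md_ge0 m.
have e1 : 0 < e / 2 / (md m + 1) by rewrite !divr_gt0 //; lra.
have e2 : 0 < e / 2 / K by rewrite !divr_gt0.
have [N hN] := h _ e1; have [N' hN'] := h' _ e2.
exists (maxn N N') => n; rewrite geq_max => /andP[/hN h1 /hN' h2].
have -> : u n * v n - l * m = u n * (v n - m) + (u n - l) * m by ring.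
apply: le_lt_trans (mdD _ _) _; rewrite !mdM.
have : md (u n) * md (v n - m) < e / 2.
  apply: le_lt_trans (_ : K * md (v n - m) < _); first by rewrite ler_wpM2r ?md_ge0.
  by rewrite mulrC -ltr_pdivlMr.
have : md (u n - l) * md m <= e / 2.
  apply: le_trans (_ : md (u n - l) * (md m + 1) <= _).
    by rewrite ler_wpM2l ?md_ge0 //; lra.
  by rewrite -ler_pdivlMr ?ltW //; lra.
lra.
Qed.

Lemma ctendsZ u l c : ctends u l -> ctends (fun n => c * u n) (c * l).
Proof. by move=> h; apply: ctendsM h; exact: ctends_cst. Qed.

Lemma ctends_ext u v l : u =1 v -> ctends u l -> ctends v l.
Proof. by move=> uv h e /h [N hN]; exists N => n /hN; rewrite uv. Qed.

Lemma ctends_shift u l : ctends u l -> ctends (fun n => u n.+1) l.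
Proof. by move=> h e /h [N hN]; exists N => n Nn; apply: hN; rewrite (leq_trans Nn). Qed.

Lemma ctends_le u l (M : R) : ctends u l -> (forall n, md (u n) <= M) -> md l <= M.
Proof.
move=> h hM; apply/ler_addgt0Pr => e e0; have [N hN] := h e e0.
have := hN N (leqnn _); have := hM N; have := md_triB l (u N); rewrite mdBC; lra.
Qed.

Lemma ctends_squeeze u v l : ctends u l -> (forall e : R, 0 < e -> exists N,
   forall n, (N <= n)%N -> md (u n - v n) < e) -> ctends v l.
Proof.
move=> h h' e e0; have e20 : 0 < e / 2 by rewrite divr_gt0.
have [N hN] := h _ e20; have [N' hN'] := h' _ e20.
exists (maxn N N') => n; rewrite geq_max => /andP[/hN h1 /hN' h2].
have -> : v n - l = (u n - l) - (u n - v n) by ring.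
apply: le_lt_trans (mdB _ _) _; lra.
Qed.

Lemma geo_sum_le (t : R) p : 0 <= t < 1 -> \sum_(k < p) t ^+ k <= (1 - t)^-1.
Proof.
move=> /andP[t0 t1]; rewrite -[leRHS]mul1r ler_pdivlMr ?subr_gt0 //.
rewrite -[leLHS]opprK -mulrN opprB mulrC -subrX1 opprB.
have := exprn_ge0 p t0; lra.
Qed.

(** Stated for any subadditive [f], so that it serves both the absolute value on [R] and the modulus
    on [C]. *)
Lemma geo_tail (V : zmodType) (f : V -> R) (v : nat -> V) (K t : R) n m :
  0 <= K -> (forall x y, f (x + y) <= f x + f y) -> f 0 = 0 ->
  0 <= t < 1 -> (forall k, f (v k) <= K * t ^+ k) -> (n <= m)%N ->
  f (\sum_(k < m) v k - \sum_(k < n) v k) <= K * t ^+ n / (1 - t).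
Proof.
move=> K0 fD f0 ht h /subnKC <-; have /andP[t0 t1] := ht.
rewrite big_split_ord /= addrAC subrr add0r.
have fS (I : Type) (r : seq I) (F : I -> V) : f (\sum_(i <- r) F i) <= \sum_(i <- r) f (F i).
  elim/big_rec2: _ => [|i y x _ hh]; first by rewrite f0.
  by apply: le_trans (fD _ _) _; rewrite lerD2l.
apply: le_trans (fS _ _ _) _.
apply: le_trans (ler_sum _ (fun (k : 'I_(m - n)) _ => h (n + k)%N)) _.
under eq_bigr do rewrite exprD mulrA.
by rewrite -mulr_sumr ler_wpM2l ?mulr_ge0 ?exprn_ge0 // geo_sum_le.
Qed.

Lemma rsum_geo (v : nat -> R) (K t : R) n : 0 <= t < 1 -> (forall k, `|v k| <= K * t ^+ k) ->
  `| \sum_(k < n) v k - limn (series v)| <= K * t ^+ n / (1 - t).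
Proof.
move=> ht h; have /andP[t0 t1] := ht.
have K0 : 0 <= K by have := h 0%N; rewrite expr0 mulr1; exact: le_trans.
have cv : cvgn (series v).
  apply: normed_cvg; apply: (@series_le_cvg _ _ (geometric K t)) => [k|k|k|].
  - exact: normr_ge0.
  - by rewrite /geometric /= mulr_ge0 // exprn_ge0.
  - exact: h.
  - by apply: is_cvg_geometric_series; rewrite ger0_norm.
apply/ler_addgt0Pr => e e0.
move/cvgrPdist_lt : (cv) => /(_ e e0) [N _ hN].
have := hN (maxn N n) (leq_maxl _ _); rewrite /series /= big_mkord => h1.
have := @geo_tail R (fun x => `|x|) v K t n (maxn N n) K0 (@ler_normD R R) (normr0 R) ht h (leq_maxr _ _).
move=> h2; move: h1 h2.
set S1 := \sum_(k < n) v k; set S2 := \sum_(k < maxn N n) v k; set L := limn _ => h1 h2.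
have -> : S1 - L = - (L - S2) - (S2 - S1) by ring.
apply: le_trans (ler_normB _ _) _; rewrite normrN; lra.
Qed.

Lemma csumP (u : nat -> C) (K t : R) n : 0 <= t < 1 -> (forall k, md (u k) <= K * t ^+ k) ->
  md (\sum_(k < n) u k - csum u) <= 2 * (K * t ^+ n / (1 - t)).
Proof.
move=> ht h; apply: le_trans (md_le_ReIm _) _.
rewrite cReD cImD cReN cImN Re_sum Im_sum /= mulr2n mulrDl mul1r lerD //.
  by apply: rsum_geo => // k; apply: le_trans (md_Re _) (h k).
by apply: rsum_geo => // k; apply: le_trans (md_Im _) (h k).
Qed.

Lemma csum_tends (u : nat -> C) (K t : R) : 0 <= t < 1 -> (forall k, md (u k) <= K * t ^+ k) ->
  ctends (fun n => \sum_(k < n) u k) (csum u).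
Proof.
move=> ht h; apply: (@ctends_geo _ _ (2 * K / (1 - t)) t) => // n.
by apply: le_trans (csumP n ht h) _; rewrite le_eqVlt; apply/orP; left; apply/eqP; ring.
Qed.

Lemma csum_le (u : nat -> C) (K t : R) : 0 <= t < 1 -> (forall k, md (u k) <= K * t ^+ k) ->
  md (csum u) <= K / (1 - t).
Proof.
move=> ht h; apply: ctends_le (csum_tends ht h) _ => n.
have K0 : 0 <= K by have := h 0%N; rewrite expr0 mulr1; exact/le_trans/md_ge0.
have := @geo_tail C md u K t 0 n K0 mdD md0 ht h (leq0n _).
by rewrite big_ord0 subr0 expr0 mulr1.
Qed.

Lemma csum_recl (u : nat -> C) (K t : R) : 0 <= t < 1 -> (forall k, md (u k) <= K * t ^+ k) ->
  csum u = u 0%N + csum (fun k => u k.+1).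
Proof.
move=> ht h; apply: (@ctends_uniq (fun n => \sum_(k < n.+1) u k)).
  by apply: (@ctends_shift (fun n => \sum_(k < n) u k)); exact: csum_tends ht h.
apply: (ctends_ext (u := fun n => u 0%N + \sum_(k < n) u k.+1)).
  by move=> n; rewrite big_ord_recl.
apply: ctendsD; first exact: ctends_cst.
apply: (csum_tends (K := K * t) ht) => k.
by rewrite -mulrA -exprS h.
Qed.

(** * Power series on the unit disc *)

(** Radius of convergence at least 1, in Abel's form: bounded terms at each radius r < 1 dominate
    the series geometrically at every smaller radius. *)
Definition good (a : nat -> C) := forall r : R, 0 < r < 1 ->
  exists K, forall k, md (a k) * r ^+ k <= K.

Lemma good_bound a (w : C) : good a -> md w < 1 ->
  exists K t, [/\ 0 <= K, 0 <= t < 1 & forall k, md (a k * w ^+ k) <= K * t ^+ k].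
Proof.
move=> ga w1; have w0 := md_ge0 w.
have r01 : 0 < (1 + md w) / 2 < 1 by apply/andP; split; lra.
have [K hK] := ga _ r01; have /andP[r0 r1] := r01.
exists K, (md w / ((1 + md w) / 2)); split.
- by apply: le_trans (hK 0%N); rewrite expr0 mulr1 md_ge0.
- apply/andP; split; first by rewrite divr_ge0 // ltW.
  rewrite ltr_pdivrMr //; lra.
- move=> k; rewrite mdM mdX expr_div_n mulrA ler_pdivlMr ?exprn_gt0 //.
  by rewrite mulrAC ler_wpM2r ?exprn_ge0.
Qed.

Lemma PS_tends a w : good a -> md w < 1 -> ctends (fun n => \sum_(k < n) a k * w ^+ k) (PS a w).
Proof. by move=> ga /(good_bound ga) [K [t [_ ht h]]]; rewrite PS.unlock; apply: csum_tends ht h. Qed.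

Lemma PS_uniq a w l : good a -> md w < 1 ->
  ctends (fun n => \sum_(k < n) a k * w ^+ k) l -> PS a w = l.
Proof. by move=> ga w1 h; apply: ctends_uniq (PS_tends ga w1) h. Qed.

(** The terms of a convergent series are bounded. This is how the pointwise convergence in the
    definition of a q-expansion becomes a statement about the radius of convergence. *)
Lemma good_from_tends (a : nat -> C) : (forall w : C, md w < 1 -> exists l,
  ctends (fun n => \sum_(k < n) a k * w ^+ k) l) -> good a.
Proof.
move=> h r /andP[r0 r1].
have rw : md (r%:C) = r by rewrite md_real ger0_norm // ltW.
have [|l hl] := h r%:C; first by rewrite rw.
have [K K0 hK] := ctends_bounded hl; exists (K + K) => k.
have -> : md (a k) * r ^+ k = md (\sum_(i < k.+1) a i * r%:C ^+ i - \sum_(i < k) a i * r%:C ^+ i).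
  by rewrite big_ord_recr /= addrAC subrr add0r mdM mdX rw.
by apply: le_trans (mdB _ _) _; rewrite lerD.
Qed.

Lemma goodD a b : good a -> good b -> good (fun k => a k + b k).
Proof.
move=> ga gb r r01; have [K hK] := ga r r01; have [L hL] := gb r r01.
exists (K + L) => k; have /andP[r0 _] := r01.
apply: le_trans (_ : (md (a k) + md (b k)) * r ^+ k <= _).
  by rewrite ler_wpM2r ?mdD // exprn_ge0 // ltW.
by rewrite mulrDl lerD.
Qed.

Lemma goodZ c a : good a -> good (fun k => c * a k).
Proof.
move=> ga r r01; have [K hK] := ga r r01; exists (md c * K) => k.
by rewrite mdM -mulrA ler_wpM2l ?md_ge0.
Qed.

Lemma good_bdd a (K : R) : (forall k, md (a k) <= K) -> good a.
Proof.
move=> h r /andP[r0 r1]; exists K => k; rewrite -[leRHS]mulr1.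
by apply: ler_pM; rewrite ?md_ge0 ?exprn_ge0 ?exprn_ile1 // ltW.
Qed.

Lemma PSD a b w : good a -> good b -> md w < 1 ->
  PS (fun k => a k + b k) w = PS a w + PS b w.
Proof.
move=> ga gb w1; apply: PS_uniq => //; first exact: goodD.
apply: ctends_ext (ctendsD (PS_tends ga w1) (PS_tends gb w1)) => n.
by rewrite -big_split; apply: eq_bigr => k _; rewrite mulrDl.
Qed.

Lemma PSZ c a w : good a -> md w < 1 -> PS (fun k => c * a k) w = c * PS a w.
Proof.
move=> ga w1; apply: PS_uniq => //; first exact: goodZ.
apply: ctends_ext (ctendsZ c (PS_tends ga w1)) => n.
by rewrite mulr_sumr; apply: eq_bigr => k _; rewrite mulrA.
Qed.

Definition mono (m : nat) : nat -> C := fun k => (k == m)%:R.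

Lemma good_mono m : good (mono m).
Proof. by apply: (@good_bdd _ 1) => k; rewrite md_natr; case: eqP. Qed.

Lemma PS_mono m w : md w < 1 -> PS (mono m) w = w ^+ m.
Proof.
move=> w1; apply: PS_uniq => //; first exact: good_mono.
move=> e e0; exists m.+1 => n mn; rewrite (bigD1 (Ordinal mn)) //= /mono eqxx mul1r.
rewrite big1 ?addr0 ?subrr ?md0 // => i; rewrite -val_eqE /= => /negbTE ->.
by rewrite mul0r.
Qed.

Lemma PS0 a : PS a 0 = a 0%N.
Proof.
rewrite PS.unlock.
apply: (@ctends_uniq (fun n => \sum_(k < n.+1) a k * 0 ^+ k)).
  apply: (@ctends_shift (fun n => \sum_(k < n) a k * 0 ^+ k)); apply: (@csum_tends _ (md (a 0%N)) 0) => [|k]; first by rewrite lexx ltr01.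
  by case: k => [|k]; rewrite ?expr0 ?mulr1 // !expr0n !mulr0 md0.
apply: (ctends_ext (u := fun=> a 0%N)); last exact: ctends_cst.
move=> n; rewrite big_ord_recl expr0 mulr1 big1 ?addr0 // => i _.
by rewrite /= exprS mul0r mulr0.
Qed.

(** The coefficients of (PS a w - PS a w0) / (w - w0). *)
Definition tailat (a : nat -> C) (w0 : C) (n : nat) := PS (fun i => a (n + i)%N) w0.

Definition synth a w0 m := tailat a w0 m.+1.

Section Synthetic.
Variables (a : nat -> C) (K r : R).
Hypothesis r0 : 0 < r.
Hypothesis ha : forall k, md (a k) * r ^+ k <= K.

Let tail_term w0 n i : md w0 < r -> md (a (n + i)%N * w0 ^+ i) <= K / r ^+ n * (md w0 / r) ^+ i.
Proof.
move=> w0r; rewrite mdM mdX expr_div_n mulrA ler_pdivlMr ?exprn_gt0 //.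
rewrite mulrAC; apply: ler_wpM2r; first by rewrite exprn_ge0 ?md_ge0.
by rewrite ler_pdivlMr ?exprn_gt0 // -mulrA -exprD addnC.
Qed.

Let t01 w0 : md w0 < r -> 0 <= md w0 / r < 1.
Proof. by move=> h; rewrite divr_ge0 ?md_ge0 ?ltW //= ltr_pdivrMr // mul1r. Qed.

Lemma tailat_recl w0 n : md w0 < r -> tailat a w0 n = a n + w0 * tailat a w0 n.+1.
Proof.
move=> h; rewrite /tailat PS.unlock (csum_recl (t01 h) (fun i => tail_term n i h)).
rewrite addn0 expr0 mulr1; congr (_ + _).
have E1 := csum_tends (t01 h) (fun i => tail_term n.+1 i h).
apply: (@ctends_uniq (fun m => \sum_(k < m) (a (n + k.+1)%N * w0 ^+ k.+1))).
  apply: (csum_tends (K := K / r ^+ n * (md w0 / r)) (t01 h)) => k.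
  by rewrite -mulrA -exprS tail_term.
apply: ctends_ext (ctendsZ w0 E1) => m; rewrite mulr_sumr.
by apply: eq_bigr => k _; rewrite addnS addSn exprS; ring.
Qed.

Lemma tailat_bound w0 m : md w0 < r -> md (tailat a w0 m) * r ^+ m <= K * r / (r - md w0).
Proof.
move=> h; rewrite /tailat PS.unlock.
have := csum_le (t01 h) (fun i => tail_term m i h).
set x := md _ => hx; apply: le_trans (ler_wpM2r (exprn_ge0 m (ltW r0)) hx) _.
rewrite le_eqVlt; apply/orP; left; apply/eqP; field.
by rewrite !subr_eq0 expf_neq0 ?gt_eqF.
Qed.

Lemma synth_bound w0 m : md w0 < r -> md (synth a w0 m) * r ^+ m <= K / (r - md w0).
Proof.
move=> h; rewrite -(ler_pM2r r0) -mulrA -exprSr.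
by apply: le_trans (tailat_bound m.+1 h) _; rewrite mulrAC.
Qed.

Lemma synth_partial w0 w n : md w0 < r ->
  (w - w0) * (\sum_(m < n) synth a w0 m * w ^+ m) =
  \sum_(m < n) a m * w ^+ m - tailat a w0 0 + tailat a w0 n * w ^+ n.
Proof.
move=> h; elim: n => [|n IH]; first by rewrite !big_ord0 mulr0 expr0; ring.
rewrite !big_ord_recr /= mulrDr IH /synth (tailat_recl n h) exprS; ring.
Qed.

End Synthetic.

Lemma good_synth a w0 : good a -> md w0 < 1 -> good (synth a w0).
Proof.
move=> ga w01 r /andP[r0 r1]; have w00 := md_ge0 w0.
pose s := Num.max ((1 + md w0) / 2) r.
have s1 : 0 < s < 1 by rewrite /s lt_max r0 orbT gt_max r1 andbT; lra.
have [K hK] := ga s s1; have /andP[s0 _] := s1.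
have ws : md w0 < s by rewrite /s lt_max; apply/orP; left; lra.
exists (K / (s - md w0)) => k; apply: le_trans (synth_bound s0 hK k ws).
rewrite ler_wpM2l ?md_ge0 //; apply: lerXn2r; rewrite ?nnegrE ?(ltW r0) ?(ltW s0) //.
by rewrite /s le_max lexx orbT.
Qed.

Lemma n_geo_bdd (t : R) n : 0 <= t < 1 -> n%:R * t ^+ n <= (1 - t)^-1.
Proof.
move=> ht; apply: le_trans (geo_sum_le n ht); have /andP[t0 t1] := ht.
rewrite mulr_natl -[leLHS](_ : \sum_(k < n) t ^+ n = _); last first.
  by rewrite sumr_const card_ord.
by apply: ler_sum => k _; apply: ler_wiXn2l (ltnW (ltn_ord k)); rewrite ?t0 // ltW.
Qed.

Lemma n_geo_small (K t e : R) : 0 <= t < 1 -> 0 < e ->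
  exists N, forall n, (N <= n)%N -> K * n%:R * t ^+ n < e.
Proof.
move=> /andP[t0 t1] e0; pose s := (1 + t) / 2; pose u := t / s.
have s0 : 0 < s by rewrite /s; lra.
have s01 : 0 <= s < 1 by rewrite ltW //= /s; lra.
have u01 : 0 <= u < 1 by rewrite /u divr_ge0 ?(ltW s0) //= ltr_pdivrMr // /s; lra.
have [N hN] := geo_small (`|K| / (1 - u)) s01 e0; exists N => n /hN; apply: le_lt_trans.
have -> : t = u * s by rewrite /u mulfVK // gt_eqF.
rewrite exprMn mulrA ler_wpM2r ?exprn_ge0 ?(ltW s0) // -mulrA.
have := n_geo_bdd n u01; have : 0 <= n%:R * u ^+ n by rewrite mulr_ge0 ?exprn_ge0 //; case/andP: u01.
move: (n%:R * _) => x x0 hx; apply: le_trans (ler_norm _) _.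
by rewrite normrM (ger0_norm x0) ler_wpM2l.
Qed.

(** The limit of Horner's scheme [synth_partial]: the term left over after n steps is a tail times
    w^n, which [tailat_bound] sends to 0. *)
Lemma synthP a w0 w : good a -> md w0 < 1 -> md w < 1 ->
  PS a w - PS a w0 = (w - w0) * PS (synth a w0) w.
Proof.
move=> ga w01 w1; have w00 := md_ge0 w0; have wg0 := md_ge0 w.
pose r := (1 + Num.max (md w0) (md w)) / 2.
have m1 : Num.max (md w0) (md w) < 1 by rewrite gt_max w01.
have m2 : md w0 <= Num.max (md w0) (md w) by rewrite le_max lexx.
have m3 : md w <= Num.max (md w0) (md w) by rewrite le_max lexx orbT.
have r01 : 0 < r < 1 by rewrite /r; apply/andP; split; lra.
have [K hK] := ga r r01; have /andP[r0 r1] := r01.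
have w0r : md w0 < r by rewrite /r; lra.
have wr : md w < r by rewrite /r; lra.
have gs := good_synth ga w01.
symmetry; apply: (@ctends_uniq (fun n => (w - w0) * \sum_(m < n) synth a w0 m * w ^+ m)).
  exact: ctendsZ (PS_tends gs w1).
apply: ctends_squeeze (ctendsD (PS_tends ga w1) (ctends_cst (- PS a w0))) _ => e e0.
have t01 : 0 <= md w / r < 1 by rewrite divr_ge0 ?(ltW r0) //= ltr_pdivrMr // mul1r.
have [N hN] := geo_small (K * r / (r - md w0)) t01 e0; exists N => n /hN; apply: le_lt_trans.
rewrite (synth_partial r0 hK w n w0r) (_ : _ - _ = - (tailat a w0 n * w ^+ n)); last first.
  by rewrite /tailat; ring.
rewrite mdN mdM mdX expr_div_n mulrA ler_pdivlMr ?exprn_gt0 // mulrAC.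
by apply: ler_wpM2r; [rewrite exprn_ge0|exact: tailat_bound].
Qed.

Definition conv (a b : nat -> C) : nat -> C := fun n => \sum_(i < n.+1) a i * b (n - i)%N.

Lemma good_conv a b : good a -> good b -> good (conv a b).
Proof.
move=> ga gb r /andP[r0 r1].
have s01 : 0 < (1 + r) / 2 < 1 by apply/andP; split; lra.
have [K hK] := ga _ s01; have [L hL] := gb _ s01; move: s01 hK hL.
set s := (1 + r) / 2 => s01 hK hL; have /andP[s0 s1] := s01.
have t01 : 0 <= r / s < 1 by rewrite divr_ge0 ?ltW //= ltr_pdivrMr // mul1r /s; lra.
have K0 : 0 <= K by apply: le_trans (hK 0%N); rewrite expr0 mulr1 md_ge0.
have L0 : 0 <= L by apply: le_trans (hL 0%N); rewrite expr0 mulr1 md_ge0.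
exists (K * L * ((1 - r / s)^-1 + 1)) => n.
have hc : md (conv a b n) * s ^+ n <= K * L * n.+1%:R.
  apply: le_trans (ler_wpM2r (exprn_ge0 n (ltW s0)) (md_sum _ _ _)) _.
  rewrite mulr_suml; apply: le_trans (_ : \sum_(i < n.+1) K * L <= _); last first.
    by rewrite sumr_const card_ord mulr_natr.
  apply: ler_sum => i _; have i_n : (i <= n)%N by rewrite -ltnS.
  have -> : s ^+ n = s ^+ i * s ^+ (n - i) by rewrite -exprD subnKC.
  rewrite mdM mulrACA.
  by apply: ler_pM; rewrite ?mulr_ge0 ?md_ge0 ?exprn_ge0 ?(ltW s0).
have -> : r ^+ n = s ^+ n * (r / s) ^+ n by rewrite -exprMn mulrCA mulfV ?mulr1 // gt_eqF.
rewrite mulrA; apply: le_trans (ler_wpM2r _ hc) _; first by rewrite exprn_ge0; case/andP: t01.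
rewrite -[leLHS]mulrA; apply: ler_wpM2l; first by rewrite mulr_ge0.
rewrite -natr1 mulrDl mul1r lerD ?n_geo_bdd //.
by case/andP: t01 => ? ?; rewrite exprn_ile1 // ltW.
Qed.

Lemma conv_partial a b w n : \sum_(k < n) conv a b k * w ^+ k =
  \sum_(i < n) a i * w ^+ i * \sum_(j < n - i) b j * w ^+ j.
Proof.
elim: n => [|n IH]; first by rewrite !big_ord0.
rewrite big_ord_recr /= IH [RHS]big_ord_recr /= subSn // subnn big_ord1 expr0.
rewrite /conv big_ord_recr /= subnn mulrDl addrA -!mulrA (mulrC (b 0%N)) !mulrA mulr1.
congr (_ + _); rewrite mulr_suml -big_split; apply: eq_bigr => i _ /=.
rewrite subSn ?(ltnW (ltn_ord i)) // big_ord_recr /= mulrDr; congr (_ + _).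
have -> : w ^+ n = w ^+ i * w ^+ (n - i) by rewrite -exprD subnKC // ltnW.
ring.
Qed.

(** By [conv_partial] the partial sum of the Cauchy product misses, for each i < n, a tail of the
    second series starting at n - i. With a common ratio v each error is O(v^i v^(n-i)), so the
    total is O(n v^n). *)
Lemma PSM a b w : good a -> good b -> md w < 1 -> PS (conv a b) w = PS a w * PS b w.
Proof.
move=> ga gb w1; apply: PS_uniq => //; first exact: good_conv.
have [K [t [K0 t01 hK]]] := good_bound ga w1.
have [L [u [L0 u01 hL]]] := good_bound gb w1.
pose v := Num.max t u.
have v01 : 0 <= v < 1.
  by rewrite /v le_max gt_max; case/andP: t01 => -> ->; case/andP: u01 => _ ->.
have [v0 v1] := andP v01.
have tv k : t ^+ k <= v ^+ k.
  by apply: lerXn2r; rewrite ?nnegrE //; [case/andP: t01|rewrite /v le_max lexx].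
have uv k : u ^+ k <= v ^+ k.
  by apply: lerXn2r; rewrite ?nnegrE //; [case/andP: u01|rewrite /v le_max lexx orbT].
apply: ctends_squeeze (ctendsM (PS_tends ga w1) (ctends_cst (PS b w))) _ => e e0.
have [N hN] := n_geo_small (K * (2 * L / (1 - v))) v01 e0.
exists N => n /hN; apply: le_lt_trans.
rewrite conv_partial mulr_suml -sumrB; apply: le_trans (md_sum _ _ _) _.
apply: le_trans (_ : \sum_(i < n) K * (2 * L / (1 - v)) * v ^+ n <= _); last first.
  by rewrite sumr_const card_ord -[leLHS]mulr_natr mulrAC.
apply: ler_sum => i _; rewrite -mulrBr mdM.
have -> : v ^+ n = v ^+ i * v ^+ (n - i) by rewrite -exprD subnKC // ltnW.
rewrite mulrACA.
apply: ler_pM; rewrite ?md_ge0 //.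
  by apply: le_trans (hK i) _; rewrite ler_wpM2l.
rewrite mdBC PS.unlock; apply: le_trans (csumP (K := L) (n - i) v01 _) _ => [k|].
  by apply: le_trans (hL k) _; rewrite ler_wpM2l.
by rewrite le_eqVlt; apply/orP; left; apply/eqP; ring.
Qed.

Lemma PS_bdd a (rho : R) : good a -> 0 <= rho < 1 ->
  exists2 M, 0 < M & forall w, md w <= rho -> md (PS a w) <= M.
Proof.
move=> ga /andP[h0 h1]; have r01 : 0 < (1 + rho) / 2 < 1 by apply/andP; split; lra.
have [K hK] := ga _ r01; move: r01 hK; set r := _ / 2 => r01 hK; have /andP[r0 r1] := r01.
have rr : rho / r < 1 by rewrite ltr_pdivrMr // /r; lra.
have K0 : 0 <= K by apply: le_trans (hK 0%N); rewrite expr0 mulr1 md_ge0.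
exists (K / (1 - rho / r) + 1) => [|w hw].
  by rewrite ltr_wpDl // divr_ge0 // subr_ge0 ltW.
apply: le_trans (_ : K / (1 - rho / r) <= _); last by rewrite lerDl.
rewrite PS.unlock; apply: csum_le => [|k]; first by rewrite rr divr_ge0 // ltW.
rewrite mdM mdX expr_div_n mulrA ler_pdivlMr ?exprn_gt0 // mulrAC.
apply: ler_pM; rewrite ?mulr_ge0 ?md_ge0 ?exprn_ge0 ?(ltW r0) ?md_ge0 //.
by apply: lerXn2r; rewrite ?nnegrE ?md_ge0.
Qed.

(** The difference is (w - w0) times the quotient series, which is bounded on a disc around w0. *)
Lemma PS_cont a w0 (e : R) : good a -> md w0 < 1 -> 0 < e ->
  exists2 d : R, 0 < d & forall w, md (w - w0) < d -> md w < 1 /\ md (PS a w - PS a w0) < e.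
Proof.
move=> ga w01 e0; have w00 := md_ge0 w0.
have rho01 : 0 <= (1 + md w0) / 2 < 1 by apply/andP; split; lra.
have [M M0 hM] := PS_bdd (good_synth ga w01) rho01.
exists (Num.min ((1 - md w0) / 2) (e / M)); first by rewrite lt_min !divr_gt0 ?subr_gt0.
move=> w; rewrite lt_min => /andP[h1 h2]; have := md_triB w w0.
have h3 : md w <= (1 + md w0) / 2 by have := md_triB w w0; lra.
have w1 : md w < 1 by lra.
split=> //; rewrite synthP // mdM; apply: le_lt_trans (_ : md (w - w0) * M < e).
  by rewrite ler_wpM2l ?md_ge0 ?hM.
by rewrite -ltr_pdivlMr.
Qed.

(** Divide by w - w0 until the quotient is nonzero at w0. If this never happens, each division costs
    at most a factor 1/(r - |w0|) in the coefficient bounds, so the value at w is O((|w - w0|/(r -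
    |w0|))^j) for all j and vanishes. The radius (1 - rho)/2 does not depend on w0, which later
    allows a walk in steps of fixed length. *)
Lemma PS_order a w0 (rho : R) : good a -> md w0 <= rho -> rho < 1 ->
  (forall w, md w < 1 -> md (w - w0) < (1 - rho) / 2 -> PS a w = 0) \/
  (exists j b, [/\ good b, PS b w0 != 0 &
     forall w, md w < 1 -> PS a w = (w - w0) ^+ j * PS b w]).
Proof.
move=> ga w0r r1; have w00 := md_ge0 w0.
pose D j := iter j (fun b => synth b w0) a.
have w01 : md w0 < 1 by lra.
have gD j : good (D j) by elim: j => //= j IHj; exact: good_synth.
have DS j w : md w < 1 -> PS (D j) w - PS (D j) w0 = (w - w0) * PS (D j.+1) w.
  by move=> w1; apply: synthP.
have [[j hj]|hall] := pselect (exists j, PS (D j) w0 != 0).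
  right; have [m hm mmin] := find_ex_minn (ex_intro (fun j => PS (D j) w0 != 0) j hj).
  exists m, (D m); split=> // w w1.
  elim: {hj j} m hm mmin => [|m IH] hm mmin; first by rewrite expr0 mul1r.
  have z : forall i, (i <= m)%N -> PS (D i) w0 = 0.
    by move=> i im; apply/eqP; apply: contraLR im => /mmin; rewrite -ltnNge.
  have key : forall i, (i <= m.+1)%N -> PS a w = (w - w0) ^+ i * PS (D i) w.
    elim=> [|i IHi] im; first by rewrite expr0 mul1r.
    by rewrite IHi ?(ltnW im) // exprSr -mulrA -DS // z // subr0.
  exact: key.
left=> w w1 hw.
have z j : PS (D j) w0 = 0.
  by apply/eqP; apply: contrapT => h; apply: hall; exists j; apply/negP.
have key j : PS a w = (w - w0) ^+ j * PS (D j) w.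
  by elim: j => [|j IH]; rewrite ?expr0 ?mul1r // IH exprSr -mulrA -DS // z subr0.
have r01 : 0 < (1 + rho) / 2 < 1 by apply/andP; split; lra.
have [K hK] := ga _ r01; move: r01 hK; set r := (1 + rho) / 2 => r01 hK.
have /andP[r0 _] := r01.
have K0 : 0 <= K by apply: le_trans (hK 0%N); rewrite expr0 mulr1 md_ge0.
have w0r' : md w0 < r by rewrite /r; lra.
have wr : md w < r by have := md_triB w w0; rewrite /r; lra.
have dpos : 0 < r - md w0 by rewrite subr_gt0.
have bD j : forall k, md (D j k) * r ^+ k <= K / (r - md w0) ^+ j.
  elim: j => [|j IH] k; first by rewrite expr0 invr1 mulr1.
  have -> : K / (r - md w0) ^+ j.+1 = K / (r - md w0) ^+ j / (r - md w0).
    by rewrite exprSr invfM mulrA.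
  exact: synth_bound.
have t01 : 0 <= md w / r < 1 by rewrite divr_ge0 ?md_ge0 ?(ltW r0) //= ltr_pdivrMr // mul1r.
have bP j : md (PS (D j) w) <= K / (r - md w0) ^+ j / (1 - md w / r).
    rewrite PS.unlock; apply: csum_le => // k; rewrite mdM mdX expr_div_n mulrA ler_pdivlMr ?exprn_gt0 // mulrAC.
  by apply: ler_wpM2r; [rewrite exprn_ge0 ?md_ge0|exact: bD].
apply/eqP; rewrite -md_eq0 eq_le md_ge0 andbT; apply/ler_addgt0Pr => e e0; rewrite add0r.
have u01 : 0 <= md (w - w0) / (r - md w0) < 1.
  by rewrite divr_ge0 ?md_ge0 ?(ltW dpos) //= ltr_pdivrMr // mul1r /r; lra.
have [N /(_ N (leqnn _)) hN] := geo_small (K / (1 - md w / r)) u01 e0.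
apply: le_trans (ltW hN); rewrite (key N) mdM mdX expr_div_n mulrA mulrAC mulrC.
by apply: ler_wpM2r; [rewrite exprn_ge0 ?md_ge0|rewrite mulrAC; exact: bP].
Qed.

(** Induction through the shift, which is synthetic division at 0; continuity supplies the value of
    the shifted series at w = 0, where the factor w cannot be cancelled. *)
Lemma PS_coef0 a (d : R) : good a -> 0 < d ->
  (forall w, md w < 1 -> md w < d -> PS a w = 0) -> forall k, a k = 0.
Proof.
move=> ga d0 h k; elim: k a ga h => [|k IH] a ga h.
  by rewrite -PS0; apply: h; rewrite md0.
have m0 : md 0 < 1 by rewrite md0.
have <- : synth a 0 k = a k.+1.
    by rewrite /synth /tailat PS0 addn0.
apply: IH; first exact: good_synth.
have nz w : md w < 1 -> md w < d -> w != 0 -> PS (synth a 0) w = 0.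
  move=> w1 wd wn0; have := synthP ga m0 w1; rewrite subr0 !h ?md0 // subrr.
  by move/esym/eqP; rewrite mulf_eq0 (negbTE wn0) => /eqP.
move=> w w1 wd; have [->|] := eqVneq w 0; last exact: nz.
apply/eqP; rewrite -md_eq0 eq_le md_ge0 andbT; apply/ler_addgt0Pr => e e0; rewrite add0r.
have [d' d'0 hd'] := PS_cont (good_synth ga m0) m0 e0.
pose x : R := Num.min (1 / 2) (Num.min (d / 2) (d' / 2)).
have x0 : 0 < x by rewrite /x !lt_min !divr_gt0.
have hx : x < 1 /\ x < d /\ x < d'.
  have [l1 [l2 l3]] : x <= 1 / 2 /\ x <= d / 2 /\ x <= d' / 2.
    by rewrite /x !ge_min !lexx ?orbT.
  by split; [|split]; lra.
have mx : md x%:C = x by rewrite md_real ger0_norm // ltW.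
have [|x1 hx'] := hd' x%:C; first by rewrite subr0 mx; case: hx => ? [].
apply: ltW; move: hx'; rewrite nz ?mx ?sub0r ?mdN; [by []|by case: hx|by case: hx=> ? []|].
by rewrite -md_eq0 mx gt_eqF.
Qed.

Lemma PS_inj a b (d : R) : good a -> good b -> 0 < d ->
  (forall w, md w < 1 -> md w < d -> PS a w = PS b w) -> a =1 b.
Proof.
move=> ga gb d0 h k; apply/eqP; rewrite -subr_eq0; apply/eqP.
have gN : good (fun k => -1 * b k) by exact: goodZ.
rewrite -mulN1r; apply: (@PS_coef0 (fun k => a k + -1 * b k) d) => // [|w w1 wd].
  exact: goodD.
by rewrite PSD // PSZ // h // mulN1r subrr.
Qed.

(** The maximum principle for g/q, stated without a series for the quotient. If g - lam q had a zero
    of finite order j at w0, a j-th root gives a direction in which its leading term is a positive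
    multiple of lam q, and there |g| exceeds |lam q|. *)
Lemma PS_no_local_max g q (lam w0 : C) (rho d : R) : good g -> good q ->
  md w0 <= rho -> rho < 1 -> 0 < d ->
  PS g w0 = lam * PS q w0 -> lam * PS q w0 != 0 ->
  (forall w, md w < 1 -> md (w - w0) < d -> md (PS g w) <= md (lam * PS q w)) ->
  forall w, md w < 1 -> md (w - w0) < (1 - rho) / 2 -> PS g w = lam * PS q w.
Proof.
move=> gg gq w0r r1 d0 eq0 nz hmax; have w01 : md w0 < 1 by lra.
pose a := fun k => g k + - lam * q k.
have gn : good (fun k => - lam * q k) by exact: goodZ.
have ga : good a by exact: goodD.
have aE w : md w < 1 -> PS a w = PS g w - lam * PS q w.
  by move=> w1; rewrite PSD // PSZ // mulNr.
have [h|[j [b [gb b0 hb]]]] := PS_order ga w0r r1.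
  by move=> w w1 wd; apply: subr0_eq; rewrite -aE //; exact: h.
exfalso; have j0 : (0 < j)%N.
  case: j hb => // /(_ w0 w01); rewrite expr0 mul1r aE // eq0 subrr => /esym/eqP.
  by rewrite (negbTE b0).
pose c := lam * PS q w0; pose B0 := PS b w0.
have c0 : 0 < md c by rewrite md_gt0.
have B00 : 0 < md B0 by rewrite md_gt0.
have [|d1 d10 hd1] := @PS_cont b w0 (md B0 / 8) gb w01; first by rewrite divr_gt0.
have [|d2 d20 hd2] := @PS_cont (fun k => lam * q k) w0 (md c / 8) (goodZ lam gq) w01.
  by rewrite divr_gt0.
pose dd := Num.min 1 (Num.min d (Num.min d1 d2)).
have dd0 : 0 < dd by rewrite /dd !lt_min ltr01 d0 d10 d20.
(* The positive multiple is scaled so that z has modulus exactly dd/2, inside all the discs used. *)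
pose t : R := (dd / 2) ^+ j * (md B0 / md c).
have t0 : 0 < t by rewrite /t mulr_gt0 ?divr_gt0 // exprn_gt0 // divr_gt0.
pose z : C := j.-root (t%:C * (c / B0)).
have zj : z ^+ j = t%:C * (c / B0) by rewrite /z rootCK.
have mz : md z = dd / 2.
  apply/eqP; rewrite -(@eqrXn2 _ j) ?md_ge0 ?divr_ge0 ?(ltW dd0) //.
  rewrite -mdX zj mdM md_real ger0_norm ?(ltW t0) // [md (c / B0)]mdM mdV /t.
  move: (md c) (md B0) c0 B00 => x y x0 y0.
  by apply/eqP; field; rewrite !gt_eqF.
have zdd : md z < dd by rewrite mz; lra.
have : dd <= d /\ dd <= d1 /\ dd <= d2.
  by rewrite /dd !ge_min !lexx !orbT.
move=> [l0 [l1 l2]]; pose w := w0 + z.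
have wz : w - w0 = z by rewrite /w addrAC subrr add0r.
have [|w1 hB] := hd1 w; first by rewrite wz (lt_le_trans zdd).
have [|_ hc] := hd2 w; first by rewrite wz (lt_le_trans zdd).
rewrite !PSZ // in hc; pose c' := lam * PS q w; pose B := PS b w.
have := hmax w w1; rewrite wz => /(_ (lt_le_trans zdd l0)); apply/negP; rewrite -ltNge.
have -> : PS g w = c' + z ^+ j * B by rewrite -wz -hb // aE // /c'; ring.
rewrite zj -/c'.
have mc' : md c' > 7 / 8 * md c.
  have := md_triB c c'; rewrite mdBC => h; have := le_lt_trans h hc; rewrite -/c; lra.
have c'0 : c' != 0 by rewrite -md_gt0; apply: le_lt_trans mc'; rewrite mulr_ge0 // ltW.
(* [eta] collects the relative errors of replacing B by B0 and c' by c. Both are below 1/8, so |eta|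
   < 1 and |1 + t + t eta| > 1. *)
pose eta := (c * (B - B0) + B0 * (c - c')) / (c' * B0).
have -> : c' + t%:C * (c / B0) * B = c' * (1 + t%:C + t%:C * eta).
  by rewrite /eta; field; rewrite c'0 -md_eq0 gt_eqF.
rewrite mdM -[ltLHS]mulr1 ltr_pM2l ?md_gt0 //.
have me : md eta < 1.
  rewrite /eta mdM mdV mdM ltr_pdivrMr ?mulr_gt0 ?md_gt0 // ?mul1r.
  have e0 : md (c * (B - B0) + B0 * (c - c')) <= md c * md (B - B0) + md B0 * md (c' - c).
    by apply: le_trans (mdD _ _) _; rewrite [md (c * _)]mdM [md (B0 * _)]mdM (mdBC c).
  apply: le_lt_trans e0 _.
  have e1 : md c * md (B - B0) < md c * (md B0 / 8) by rewrite ltr_pM2l.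
  have e2 : md B0 * md (c' - c) < md B0 * (md c / 8) by rewrite ltr_pM2l.
  have e3 : 7 / 8 * md c * md B0 < md c' * md B0 by rewrite ltr_pM2r.
  have : 0 < md c * md B0 by rewrite mulr_gt0.
  lra.
have := md_triB (1 + t%:C) (- (t%:C * eta)); rewrite opprK mdN mdM.
have -> : (1 + t%:C : C) = (1 + t)%:C by rewrite rmorphD.
rewrite !md_real !ger0_norm ?(ltW t0) ?addr_ge0 ?(ltW t0) //.
have : t * md eta < t * 1 by rewrite ltr_pM2l.
rewrite rmorphD /=; lra.
Qed.

(** * Cauchy-Schwarz and the maximum principle for sums of squares *)

Section CauchySchwarz.
Variables (I : finType) (v p : I -> C).
Let S0 := \sum_i md (v i) ^+ 2.
Let g := \sum_i conjc (v i) * p i.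

(** Lagrange's identity: the defect in the Cauchy-Schwarz inequality is itself a sum of squares, so
    the inequality and its equality case follow together. *)
Lemma lagrange_sum : \sum_i md (S0%:C * p i - g * v i) ^+ 2 =
  S0 ^+ 2 * (\sum_i md (p i) ^+ 2) - S0 * md g ^+ 2.
Proof.
have E : S0%:C = \sum_i v i * conjc (v i) :> C.
  by rewrite rmorph_sum; apply: eq_bigr => i _; rewrite mulcJ.
clearbody S0.
have G : conjc g = \sum_i v i * conjc (p i).
  by rewrite conjc_sum; apply: eq_bigr => i _; rewrite conjcM conjcK.
apply: complexI; rewrite rmorph_sum /=.
have K i : (md (S0%:C * p i - g * v i) ^+ 2)%:C = S0%:C ^+ 2 * (p i * conjc (p i)) -
    S0%:C * g * (v i * conjc (p i)) - S0%:C * conjc g * (conjc (v i) * p i) + g * conjc g * (v i * conjc (v i)).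
  rewrite -mulcJ; move: (g) (v i) (p i) => g' vi pi; rewrite conjcB !conjcM conjc_real; ring.
rewrite (eq_bigr _ (fun i _ => K i)) big_split !sumrB -!mulr_sumr /= -E -G.
have -> : (S0 ^+ 2 * (\sum_i md (p i) ^+ 2) - S0 * md g ^+ 2)%:C =
  S0%:C ^+ 2 * (\sum_i p i * conjc (p i)) - S0%:C * (g * conjc g).
  rewrite rmorphB !rmorphM /= mulcJ -expr2; congr (_ * _ - _); last by rewrite expr2 rmorphM.
  by rewrite rmorph_sum; apply: eq_bigr => i _; rewrite mulcJ.
rewrite -[\sum_i conjc (v i) * p i]/g; ring.
Qed.

Lemma cauchy_schwarz : md g ^+ 2 <= S0 * \sum_i md (p i) ^+ 2.
Proof.
have h : 0 <= \sum_i md (S0%:C * p i - g * v i) ^+ 2 by apply: sumr_ge0 => i _; exact: sqr_ge0.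
have S00 : 0 <= S0 by apply: sumr_ge0 => i _; exact: sqr_ge0.
have [S0z|S0n] := eqVneq S0 0.
  have vz i : v i = 0.
    move/eqP: S0z; rewrite psumr_eq0 => [/allP /(_ i (mem_index_enum _))|? _]; last exact: sqr_ge0.
    by rewrite sqrf_eq0 md_eq0 => /eqP.
  rewrite /g big1 => [|i _]; last by rewrite vz conjc0 mul0r.
  by rewrite md0 expr0n S0z mul0r.
have S0p : 0 < S0 by rewrite lt_neqAle eq_sym S0n.
by move: h; rewrite lagrange_sum expr2 -mulrA -mulrBr pmulr_rge0 // subr_ge0.
Qed.

Lemma cauchy_schwarz_eq : md g ^+ 2 = S0 * \sum_i md (p i) ^+ 2 ->
  forall i, S0%:C * p i = g * v i.
Proof.
move=> h i; have := lagrange_sum; rewrite h mulrA -expr2 subrr => /eqP.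
rewrite psumr_eq0 => [/allP /(_ i (mem_index_enum _))|? _]; last exact: sqr_ge0.
by rewrite sqrf_eq0 md_eq0 subr_eq0 => /eqP.
Qed.
End CauchySchwarz.

Section StrongMaximum.
Variables (I : finType) (P : I -> nat -> C) (q : nat -> C) (M : R).
Hypothesis gP : forall i, good (P i).
Hypothesis gq : good q.
Hypothesis q_neq0 : forall w, md w < 1 -> PS q w != 0.
Hypothesis hM : forall w, md w < 1 -> \sum_i md (PS (P i) w) ^+ 2 <= M * md (PS q w).

Let nrm w := \sum_i md (PS (P i) w) ^+ 2.
Let eqat w := nrm w = M * md (PS q w).
(** A single power series standing for the whole vector: it equals the sum of squares at w0, and by
    Cauchy-Schwarz its square is at most [nrm w0 * nrm w] elsewhere. *)
Let g (w0 : C) : nat -> C := fun k => \sum_i conjc (PS (P i) w0) * P i k.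

Let good_sum (J : Type) (r : seq J) (c : J -> C) (a : J -> nat -> C) : (forall j, good (a j)) ->
  good (fun k => \sum_(j <- r) c j * a j k) /\
  forall w, md w < 1 -> PS (fun k => \sum_(j <- r) c j * a j k) w = \sum_(j <- r) c j * PS (a j) w.
Proof.
move=> ga; elim: r => [|j r [IH1 IH2]].
  have E : (fun k : nat => \sum_(j <- [::]) c j * a j k) = (fun k => 0 * mono 0 k).
    by apply: funext => k; rewrite big_nil mul0r.
  rewrite E; split => [|w w1]; first exact/goodZ/good_mono.
  by rewrite PSZ ?mul0r ?big_nil //; exact: good_mono.
have E : (fun k : nat => \sum_(j <- j :: r) c j * a j k) =
   (fun k => c j * a j k + \sum_(j <- r) c j * a j k).
  by apply: funext => k; rewrite big_cons.
rewrite E; split => [|w w1]; first by apply: goodD => //; exact: goodZ.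
by rewrite PSD ?PSZ ?IH2 ?big_cons //; exact: goodZ.
Qed.

Let gg w0 : good (g w0). Proof. by case: (good_sum (index_enum I) (fun i => conjc (PS (P i) w0)) gP). Qed.
Let gE w0 w : md w < 1 -> PS (g w0) w = \sum_i conjc (PS (P i) w0) * PS (P i) w.
Proof. by case: (good_sum (index_enum I) (fun i => conjc (PS (P i) w0)) gP) => _; apply. Qed.

Let lam w0 := PS (g w0) w0 ^+ 2 / PS q w0.

Let g_self w0 : md w0 < 1 -> PS (g w0) w0 = (nrm w0)%:C.
Proof.
move=> w01; rewrite gE // rmorph_sum; apply: eq_bigr => i _.
by rewrite mulrC mulcJ.
Qed.

Let nrm_ge0 w : 0 <= nrm w. Proof. by apply: sumr_ge0 => i _; exact: sqr_ge0. Qed.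

Let md_lam w0 : md w0 < 1 -> eqat w0 -> md (lam w0) = nrm w0 * M.
Proof.
move=> w01 e; rewrite mdM mdV mdX g_self // md_real ger0_norm // expr2 {2}e.
by rewrite -!mulrA mulfV ?mulr1 // md_eq0 q_neq0.
Qed.

(** The square of [g w0] is bounded by [nrm w0 * M] times |q|, with equality at w0, so
    [PS_no_local_max] applies. The square is needed because q bounds squares of the components. *)
Let local_eq w0 rho : md w0 <= rho -> rho < 1 -> eqat w0 -> nrm w0 != 0 ->
  forall w, md w < 1 -> md (w - w0) < (1 - rho) / 2 -> PS (g w0) w ^+ 2 = lam w0 * PS q w.
Proof.
move=> w0r r1 e nz; have w01 : md w0 < 1 by lra.
have E w : md w < 1 -> PS (conv (g w0) (g w0)) w = PS (g w0) w ^+ 2.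
  by move=> w1; rewrite PSM.
move=> w w1 hw; rewrite -E //; apply: (PS_no_local_max (good_conv (gg w0) (gg w0)) gq w0r r1 ltr01) => //.
- by rewrite E // /lam mulfVK // q_neq0.
- by rewrite /lam mulfVK ?q_neq0 // expf_neq0 // g_self // -md_eq0 md_real normr_eq0.
- move=> {w hw} w {w1}w1 _; rewrite E // mdX mdM md_lam // -mulrA gE //.
  by apply: le_trans (cauchy_schwarz _ _) _; apply: ler_wpM2l; [exact: nrm_ge0|exact: hM].
Qed.

Let local_eqat w0 rho : md w0 <= rho -> rho < 1 -> eqat w0 -> nrm w0 != 0 ->
  forall w, md w < 1 -> md (w - w0) < (1 - rho) / 2 -> eqat w.
Proof.
move=> w0r r1 e nz w w1 hw; have w01 : md w0 < 1 by lra.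
have h := local_eq w0r r1 e nz w1 hw.
have := congr1 md h; rewrite mdX mdM md_lam // gE // => h'.
apply/eqP; rewrite eq_le hM //=.
have := cauchy_schwarz (fun i => PS (P i) w0) (fun i => PS (P i) w).
rewrite -/(nrm w0) -/(nrm w) h' -mulrA ler_pM2l //.
by rewrite lt_neqAle eq_sym nz nrm_ge0.
Qed.

(** Equality at one point spreads to nearby points and reaches 0. There the square of [g 0] is a
    multiple of q on the whole disc, and equality in Cauchy-Schwarz makes every component
    proportional to [g 0]. *)
Lemma strong_max w0 : md w0 < 1 -> eqat w0 -> forall i j w, md w < 1 ->
  PS (P i) w * PS (P j) w * PS q 0 = PS (P i) 0 * PS (P j) 0 * PS q w.
Proof.
move=> w01 e i j w w1; have z1 : md 0 < 1 by rewrite md0.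
have nrm0 u : nrm u = 0 -> forall k, PS (P k) u = 0.
  move=> nz k; move/eqP: nz; rewrite psumr_eq0 => [|? _]; last exact: sqr_ge0.
  by move=> /allP /(_ k (mem_index_enum _)); rewrite sqrf_eq0 md_eq0 => /eqP.
have [M0|Mn] := eqVneq M 0.
  have nz u : md u < 1 -> nrm u = 0.
    by move=> u1; apply/eqP; rewrite eq_le nrm_ge0 andbT; apply: le_trans (hM u1) _; rewrite M0 mul0r.
  by rewrite (nrm0 w (nz w w1)) (nrm0 0 (nz 0 z1)) !mul0r.
have nzat u : md u < 1 -> eqat u -> nrm u != 0.
  by move=> u1 ->; rewrite mulf_neq0 // md_eq0 q_neq0.
have e0 : eqat 0.
  pose rho := md w0; pose d := (1 - rho) / 4.
  have d0 : 0 < d by rewrite /d /rho; lra.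
  (* The walk to the centre goes along a radius. All points visited satisfy |u| <= rho, so equality
     holds in a disc of radius 2d around each of them, and every step has length d. *)
  have H n u : md u <= rho -> md u <= n%:R * d -> eqat u -> eqat 0.
    elim: n u => [|n IH] u ur; first by rewrite mul0r -(md0) => h; suff -> : u = 0 by
      []; apply/eqP; rewrite -md_eq0 eq_le md_ge0 andbT -md0.
    move=> un eu; have [small|big] := leP (md u) d.
      apply: (local_eqat ur w01 eu) => //; first by apply: nzat => //; rewrite /rho in ur; lra.
      by rewrite sub0r mdN; rewrite /d in small d0; lra.
    have u0 : 0 < md u by apply: lt_trans big.
    pose s := 1 - d / md u; have s0 : 0 <= s by rewrite /s subr_ge0 ler_pdivrMr // mul1r ltW.
    have sE : s * md u = md u - d by rewrite /s mulrBl mul1r mulfVK // gt_eqF.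
    have ms : md (s%:C * u) = md u - d by rewrite mdM md_real ger0_norm.
    apply: (IH (s%:C * u)).
    - by rewrite ms; lra.
    - by rewrite ms; move: un; rewrite -natr1 mulrDl mul1r; lra.
    apply: (local_eqat ur w01 eu) => //.
    - by apply: nzat => //; rewrite /rho in ur; lra.
    - by rewrite ms; rewrite /rho in ur; lra.
    have -> : s%:C * u - u = - ((d / md u)%:C * u) by rewrite /s rmorphB rmorph1; ring.
    rewrite mdN mdM md_real normf_div (ger0_norm (md_ge0 u)) mulfVK ?gt_eqF //.
    by rewrite gtr0_norm //; rewrite /d in d0 *; lra.
  have [n hn] : exists n : nat, md w0 <= n%:R * d.
    exists (Num.truncn (md w0 / d)).+1; rewrite -ler_pdivrMr //; apply/ltW; apply: truncnS_gt.
  exact: (H n w0).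
have nz0 := nzat 0 z1 e0.
have L := local_eq (le_refl _) z1 e0 nz0.
(* [L] gives the identity only for |w| < 1/2; equality of coefficients extends it to the unit
   disc. *)
have gl : forall w, md w < 1 -> PS (g 0) w ^+ 2 = lam 0 * PS q w.
  move=> u u1; rewrite expr2 -PSM // -PSZ //; congr (PS _ u); apply: funext.
  apply: (@PS_inj _ _ (1 / 2)) => [|||v v1 hv]; rewrite ?divr_gt0 //.
  - exact: good_conv.
  - exact: goodZ.
  - by rewrite PSM // PSZ // -expr2 L // subr0 md0 subr0.
have ew : eqat w.
  apply/eqP; rewrite eq_le hM //=.
  have := cauchy_schwarz (fun i => PS (P i) 0) (fun i => PS (P i) w).
  have := congr1 md (gl w w1); rewrite mdX mdM md_lam // gE // => ->.
  rewrite -/(nrm 0) -/(nrm w) -mulrA ler_pM2l //.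
  by rewrite lt_neqAle eq_sym nz0 nrm_ge0.
have CS := @cauchy_schwarz_eq I (fun i => PS (P i) 0) (fun i => PS (P i) w).
have {}CS k : (nrm 0)%:C * PS (P k) w = PS (g 0) w * PS (P k) 0.
  rewrite gE //; apply: CS; rewrite -gE // -mdX gl // mdM md_lam // -/(nrm 0) -/(nrm w) ew.
  by rewrite -mulrA.
have nzC : (nrm 0)%:C != 0 :> C by rewrite -md_eq0 md_real normr_eq0.
apply: (mulfI nzC); apply: (mulfI nzC).
transitivity ((nrm 0)%:C * PS (P i) w * ((nrm 0)%:C * PS (P j) w) * PS q 0); first by ring.
rewrite !CS; transitivity (PS (g 0) w ^+ 2 * (PS (P i) 0 * PS (P j) 0 * PS q 0)); first by ring.
rewrite gl // /lam -(g_self z1); field; exact: q_neq0.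
Qed.

End StrongMaximum.

End Modulus.

(** * The upper half-plane and the variable w *)

Section UpperHalfPlane.
Variable R : realType.
Local Notation C := R[i].
Local Notation md := (@md R).
Local Notation PS := (@PS R).
Local Notation Re := complex.Re.
Local Notation Im := complex.Im.

Lemma e2piD (z w : C) : e2pi (z + w) = e2pi z * e2pi w.
Proof.
rewrite /e2pi cReD cImD !mulrDr opprD expRD cosD sinD rmorphM /=.
set a := expR _; set b := expR _; apply/eqP; rewrite eq_complex /=.
by apply/andP; split; apply/eqP; ring.
Qed.

Lemma e2pi0 : e2pi (0 : C) = 1.
Proof.
by rewrite /e2pi /= mulr0 oppr0 expR0 cos0 sin0; apply/eqP; rewrite eq_complex /= !mulr0 !mul0r mulr1 subr0 addr0 !eqxx.
Qed.

Lemma md_e2pi (z : C) : md (e2pi z) = expR (- (2 * pi * Im z)).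
Proof.
rewrite /e2pi mdM md_real ger0_norm ?expR_ge0 // -[RHS]mulr1; congr (_ * _).
apply/eqP; rewrite -sqrp_eq1 ?md_ge0 // md_sqr /= cos2Dsin2 //.
Qed.

Lemma e2pi_neq0 (z : C) : e2pi z != 0.
Proof. by rewrite -md_gt0 md_e2pi expR_gt0. Qed.

Lemma e2piN (z : C) : e2pi (- z) = (e2pi z)^-1.
Proof.
by apply: (mulfI (e2pi_neq0 z)); rewrite -e2piD subrr e2pi0 mulfV // e2pi_neq0.
Qed.

Lemma e2piX (z : C) n : e2pi (n%:R * z) = e2pi z ^+ n.
Proof.
by elim: n => [|n IH]; rewrite ?mul0r ?e2pi0 // -natr1 mulrDl mul1r e2piD IH exprSr.
Qed.

Lemma conjc_e2pi (x : R) : conjc (e2pi x%:C) = e2pi (- x%:C).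
Proof.
rewrite /e2pi /= oppr0 !mulr0 oppr0 expR0 mulrN cosN sinN.
by apply/eqP; rewrite eq_complex /= !mul0r !mul1r !subr0 !addr0 !eqxx.
Qed.

Lemma md_e2pi_real (x : R) : md (e2pi x%:C) = 1.
Proof. by rewrite md_e2pi /= mulr0 oppr0 expR0. Qed.

Lemma e2pi1 : e2pi (1 : C) = 1.
Proof.
have E : 2 * pi * Re (1 : C) = pi *+ 2 by rewrite /= mulr1 mulr_natl.
rewrite /e2pi E cos2pi sin2pi /= mulr0 oppr0 expR0.
by rewrite (_ : 1 +i* 0 = 1) // mulr1.
Qed.

Lemma e2pi_int (m : int) : e2pi (m%:~R : C) = 1.
Proof.
have H n : e2pi (n%:R : C) = 1 by rewrite -[n%:R]mulr1 e2piX e2pi1 expr1n.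
case: m => n; first by rewrite -pmulrn H.
by rewrite NegzE mulrNz -pmulrn e2piN H invr1.
Qed.

Lemma Im_invN (tau : C) : Im (- tau^-1) = Im tau / md tau ^+ 2.
Proof. by rewrite cImN md_sqr; case: tau => a b /=; rewrite opprK. Qed.

Lemma Im_gt0_neq0 (tau : C) : 0 < Im tau -> tau != 0.
Proof. by move=> h; apply: contraTneq h => ->; rewrite ltxx. Qed.

Lemma Im_invN_gt0 (tau : C) : 0 < Im tau -> 0 < Im (- tau^-1).
Proof.
move=> h; rewrite Im_invN divr_gt0 // exprn_gt0 // md_gt0; exact: Im_gt0_neq0.
Qed.

Lemma strip_shift (P : C -> Prop) : (forall t, 0 < Im t -> P (t + 1) <-> P t) ->
  forall t, 0 < Im t -> exists2 u : C, [/\ Im u = Im t, - (1 / 2) <= Re u & Re u < 1 / 2] & P u <-> P t.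
Proof.
move=> hP; have Tn t (n : nat) : 0 < Im t -> P (t + n%:R) <-> P t.
  move=> t0; elim: n => [|n IH]; first by rewrite addr0.
  by rewrite -IH -natr1 addrA; apply: hP; rewrite cImD -(rmorph_nat (real_complex R)) /= addr0.
have Tz t (n : int) : 0 < Im t -> P (t + n%:~R) <-> P t.
  move=> t0; case: n => n; first by rewrite -pmulrn; exact: Tn.
  rewrite NegzE mulrNz -pmulrn -(Tn (t - n.+1%:R) n.+1) ?subrK //.
  by rewrite cImD cImN -(rmorph_nat (real_complex R)) /= oppr0 addr0.
move=> t t0; pose m := Num.floor (Re t + 1 / 2); exists (t + (- m)%:~R); last exact: Tz.
have It : Im (t + (- m)%:~R) = Im t by rewrite cImD intrN cImN -(rmorph_int (real_complex R)) /= oppr0 addr0.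
have Rt : Re (t + (- m)%:~R) = Re t - m%:~R by rewrite cReD intrN cReN -(rmorph_int (real_complex R)) /=.
have hm : m%:~R <= Re t + 1 / 2 by exact: ge_floor.
have hm' : Re t + 1 / 2 < m%:~R + 1 by rewrite -intrD1 floorD1_gt.
by rewrite Rt; split=> //; lra.
Qed.

(** After a translation |Re t| <= 1/2; if also Im t < 1/2, then |t|^2 <= 1/2 and S at least doubles
    the imaginary part. Finitely many steps reach height 1/2, so no exact fundamental domain is
    needed. *)
Lemma half_plane_ind (P : C -> Prop) :
  (forall tau, 0 < Im tau -> P (tau + 1) -> P tau) ->
  (forall tau, 0 < Im tau -> P tau -> P (tau + 1)) ->
  (forall tau, 0 < Im tau -> P (- tau^-1) -> P tau) ->
  (forall tau, 1 / 2 <= Im tau -> P tau) -> forall tau, 0 < Im tau -> P tau.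
Proof.
move=> T1 T2 S0 H.
have key n : forall tau, 0 < Im tau -> 1 / 2 <= 2 ^+ n * Im tau -> P tau.
  elim: n => [|n IH] tau t0; first by rewrite expr0 [_ * Im _]mul1r; exact: H.
  move=> h; have [big|small] := leP (1 / 2) (Im tau); first exact: H.
  have [|t' [It r1 r2] <-] := strip_shift (P := P) _ t0; first by move=> t u; split; [exact: T1|exact: T2].
  have t'0 : 0 < Im t' by rewrite It.
  apply: S0 => //; apply: IH; first exact: Im_invN_gt0.
  have hR : Re t' ^+ 2 <= 1 / 4 by nra.
  have hI : Im t' ^+ 2 <= 1 / 4 by rewrite It; nra.
  rewrite Im_invN; have m0 : 0 < md t' ^+ 2 by rewrite exprn_gt0 // md_gt0 Im_gt0_neq0.
  rewrite mulrA ler_pdivlMr //; apply: le_trans (_ : 1 / 2 * (1 / 2) <= _).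
    by rewrite ler_wpM2l // md_sqr; lra.
  by move: h; rewrite exprSr It; lra.
move=> tau t0; have [n hn] : exists n : nat, (2 * Im tau)^-1 <= n%:R.
  by exists (Num.truncn (2 * Im tau)^-1).+1; apply/ltW; apply: truncnS_gt.
apply: (key n) => //.
have : n%:R <= 2 ^+ n :> R by rewrite -natrX ler_nat ltnW // ltn_expl.
move=> h2; have h3 := le_trans hn h2.
by move: h3; rewrite -[leLHS]mul1r ler_pdivrMr ?mulr_gt0 //; lra.
Qed.

Lemma Re_divn (z : C) n : Re (z / n%:R) = Re z / n%:R.
Proof.
have -> : (n%:R : C)^-1 = (n%:R^-1)%:C by rewrite fmorphV rmorph_nat.
by rewrite cReM /= mulr0 subr0.
Qed.

Lemma Im_divn (z : C) n : Im (z / n%:R) = Im z / n%:R.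
Proof.
have -> : (n%:R : C)^-1 = (n%:R^-1)%:C by rewrite fmorphV rmorph_nat.
by rewrite cImM /= mulr0 add0r.
Qed.

(** 144 clears the denominators of q on all the discriminant forms, of the theta functions used and
    of eta^2; the bilinear form then has denominator 72. *)
Definition wq (tau : C) : C := e2pi (tau / 144%:R).

Lemma md_wq tau : md (wq tau) = expR (- (2 * pi * (Im tau / 144%:R))).
Proof.
by rewrite md_e2pi Im_divn.
Qed.

Lemma md_wq_lt1 tau : 0 < Im tau -> md (wq tau) < 1.
Proof.
by move=> h; rewrite md_wq expR_lt1 oppr_lt0 !mulr_gt0 // ?invr_gt0 ?pi_gt0.
Qed.

Lemma wq_neq0 tau : wq tau != 0. Proof. exact: e2pi_neq0. Qed.

Lemma unit_angle (c s : R) : c ^+ 2 + s ^+ 2 = 1 -> exists a, cos a = c /\ sin a = s.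
Proof.
move=> h; have hc : -1 <= c <= 1 by nra.
have hs : Num.sqrt (1 - c ^+ 2) = `|s| by rewrite -sqrtr_sqr -h addrAC subrr add0r.
have [s0|s0] := leP 0 s.
  by exists (acos c); rewrite acosK ?in_itv //= sin_acos // hs ger0_norm.
exists (- acos c); rewrite cosN sinN acosK ?in_itv //= sin_acos // hs ltr0_norm //.
by rewrite opprK.
Qed.

Lemma wq_surj w : w != 0 -> md w < 1 -> exists2 tau, 0 < Im tau & wq tau = w.
Proof.
move=> wn0 w1; have m0 : 0 < md w by rewrite md_gt0.
have [a [ca sa]] : exists a, cos a = Re w / md w /\ sin a = Im w / md w.
  by apply: unit_angle; rewrite !expr_div_n -mulrDl -md_sqr mulfV // expf_neq0 // gt_eqF.
have p0 := pi_gt0 R; have pn0 : pi != 0 :> R by rewrite gt_eqF.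
pose x := 144%:R * a / (2 * pi); pose y := - (144%:R * ln (md w) / (2 * pi)).
exists (x +i* y) => /=.
  by rewrite /y oppr_gt0 pmulr_llt0 ?invr_gt0 ?mulr_gt0 // pmulr_rlt0 // ln_lt0 // m0.
have E : (x +i* y) / 144%:R = (a / (2 * pi)) +i* (- (ln (md w) / (2 * pi))) :> C.
  by apply: complex_eqP; rewrite ?Re_divn ?Im_divn /= /x /y;
    move: (pi : R) pn0 => p pn0; field; exact: pn0.
rewrite /wq E /e2pi /= mulrCA mulfV ?mulr1 ?mulf_neq0 ?gt_eqF //.
rewrite mulrN opprK mulrCA mulfV ?mulr1 ?mulf_neq0 ?gt_eqF // lnK ?posrE //.
rewrite ca sa; apply/eqP; rewrite eq_complex /= !mul0r subr0 addr0.
have E2 x' : md w * (x' / md w) = x' by rewrite mulrCA mulfV ?mulr1 // gt_eqF.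
by rewrite !E2 !eqxx.
Qed.

(** The value w = 0 is not attained by [wq] and represents the cusp. *)
Definition hasq (f : C -> C) (a : nat -> C) :=
  good a /\ forall tau, 0 < Im tau -> f tau = PS a (wq tau).

Definition vge (m : nat) (a : nat -> C) := forall k, (k < m)%N -> a k = 0.

Lemma PS_shift1 (a : nat -> C) w : good a -> md w < 1 ->
  good (fun k => a k.+1) /\ PS a w = a 0%N + w * PS (fun k => a k.+1) w.
Proof.
move=> ga w1; have m0 : md 0 < 1 by rewrite md0.
have E : synth a 0 = (fun k => a k.+1).
  by apply: funext => k; rewrite /synth /tailat PS0 addn0.
rewrite -E; split; first exact: good_synth.
by have := synthP ga m0 w1; rewrite subr0 PS0 => <-; rewrite addrC subrK.
Qed.

Lemma PS_shift m (a : nat -> C) : good a -> vge m a ->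
  good (fun k => a (m + k)%N) /\
  forall w, md w < 1 -> PS a w = w ^+ m * PS (fun k => a (m + k)%N) w.
Proof.
have m0 : md 0 < 1 by rewrite md0.
elim: m a => [|m IH] a ga va; first by split=> // w w1; rewrite expr0 mul1r.
have [g1 _] := PS_shift1 ga m0.
have v1 : vge m (fun k => a k.+1) by move=> k km; apply: va.
have [g2 h2] := IH _ g1 v1; split=> // w w1.
have [_ ->] := PS_shift1 ga w1; rewrite va // add0r h2 // exprS mulrA.
by [].
Qed.

Lemma md_PS_continuous (a : nat -> C) (p : R * R) : good a -> md (p.1 +i* p.2) < 1 ->
  {for p, continuous (fun z : R * R => md (PS a (z.1 +i* z.2)))}.
Proof.
move=> ga p1; apply/cvgrPdist_lt => e e0.
have [d d0 hd] := PS_cont ga p1 e0.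
have d2 : 0 < d / 2 by rewrite divr_gt0.
have c1 : (fst : R * R -> R) @ nbhs p --> p.1 by exact: cvg_fst.
have c2 : (snd : R * R -> R) @ nbhs p --> p.2 by exact: cvg_snd.
move/cvgrPdist_lt : c1 => /(_ _ d2) c1; move/cvgrPdist_lt : c2 => /(_ _ d2) c2.
near=> z.
have zd : md ((z.1 +i* z.2) - (p.1 +i* p.2)) < d.
  apply: le_lt_trans (md_le_ReIm _) _ => /=.
  have h1 : `|z.1 - p.1| < d / 2.
    by rewrite distrC; near: z.
  have h2 : `|z.2 - p.2| < d / 2.
    by rewrite distrC; near: z.
  lra.
have [_ h] := hd _ zd.
rewrite ltr_norml; have h1 := md_triB (PS a (p.1 +i* p.2)) (PS a (z.1 +i* z.2)).
have h2 := md_triB (PS a (z.1 +i* z.2)) (PS a (p.1 +i* p.2)).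
rewrite mdBC in h1; apply/andP; split; lra.
Unshelve. all: by end_near. Qed.

(** * Liouville's theorem for vectors of modular forms *)

Section Liouville.
Variables (I : finType) (f : I -> C -> C) (A : I -> nat -> C) (D : C -> C) (dd : nat -> C) (m : nat).
Hypothesis fA : forall i, hasq (f i) (A i).
Hypothesis Ddd : hasq D dd.
Hypothesis vA : forall i, vge m (A i).
Hypothesis vD : vge (2 * m) dd.
Hypothesis lead : dd (2 * m)%N != 0.
Hypothesis D_neq0 : forall tau, 0 < Im tau -> D tau != 0.
Hypothesis inv_T : forall tau, 0 < Im tau ->
  (\sum_i md (f i (tau + 1)) ^+ 2) * md (D tau) = (\sum_i md (f i tau) ^+ 2) * md (D (tau + 1)).
Hypothesis inv_S : forall tau, 0 < Im tau ->
  (\sum_i md (f i (- tau^-1)) ^+ 2) * md (D tau) = (\sum_i md (f i tau) ^+ 2) * md (D (- tau^-1)).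

Let P i k := A i (m + k)%N.
Let q k := dd (2 * m + k)%N.

Let gP i : good (P i). Proof. by case: (PS_shift (fA i).1 (@vA i)). Qed.
Let gq : good q. Proof. by case: (PS_shift Ddd.1 vD). Qed.

Let fE i tau : 0 < Im tau -> f i tau = wq tau ^+ m * PS (P i) (wq tau).
Proof.
move=> t0; rewrite (fA i).2 //; have [_ ->] := PS_shift (fA i).1 (@vA i) => //.
exact: md_wq_lt1.
Qed.

Let DE tau : 0 < Im tau -> D tau = wq tau ^+ (2 * m) * PS q (wq tau).
Proof.
move=> t0; rewrite Ddd.2 //; have [_ ->] := PS_shift Ddd.1 vD => //.
exact: md_wq_lt1.
Qed.

Let q_neq0 w : md w < 1 -> PS q w != 0.
Proof.
move=> w1; have [->|wn0] := eqVneq w 0; first by rewrite PS0 /q addn0.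
have [tau t0 <-] := wq_surj wn0 w1.
by have := D_neq0 t0; rewrite DE // mulf_eq0 negb_or => /andP[].
Qed.

(** The invariant quotient, as a function on the disc and on the half-plane. The powers of w cancel,
    so [phi] is also defined at the cusp. *)
Let phi w := (\sum_i md (PS (P i) w) ^+ 2) / md (PS q w).
Let psi tau := (\sum_i md (f i tau) ^+ 2) / md (D tau).

Let psiE tau : 0 < Im tau -> psi tau = phi (wq tau).
Proof.
move=> t0; rewrite /psi /phi DE // mdM mdX.
have -> : \sum_i md (f i tau) ^+ 2 = md (wq tau) ^+ (2 * m) * \sum_i md (PS (P i) (wq tau)) ^+ 2.
  rewrite mulr_sumr; apply: eq_bigr => i _.
  by rewrite fE // mdM mdX exprMn -exprM mulnC.
have n1 : md (wq tau) ^+ (2 * m) != 0 by rewrite expf_neq0 // md_eq0 wq_neq0.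
have n2 : md (PS q (wq tau)) != 0 by rewrite md_eq0 q_neq0 // md_wq_lt1.
by field; rewrite n1 n2.
Qed.

(** The modulus of w on the line Im tau = 1/2, the height to which [half_plane_ind] reduces; the
    closed disc of radius [r0] is therefore a compact set that meets every orbit and contains the
    cusp. *)
Let r0 : R := expR (- (2 * pi * (1 / 2 / 144%:R))).

Let phi_cont (p : R * R) : md (p.1 +i* p.2) < 1 ->
  {for p, continuous (fun z : R * R => phi (z.1 +i* z.2))}.
Proof.
move=> p1; apply: cvgM; last first.
  by apply: cvgV; [rewrite md_eq0 q_neq0|exact: md_PS_continuous].
apply: cvg_big => // [|i _]; first exact: add_continuous.
by apply: cvgM; apply: md_PS_continuous.
Qed.

Let r0_lt1 : r0 < 1.
Proof. by rewrite /r0 expR_lt1 oppr_lt0 !mulr_gt0 ?invr_gt0 ?pi_gt0. Qed.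

Let max_attained : exists2 w0, md w0 <= r0 & forall w, md w <= r0 -> phi w <= phi w0.
Proof.
have r00 : 0 <= r0 by exact: expR_ge0.
pose K : set (R * R) := [set z | md (z.1 +i* z.2) <= r0].
have cK : compact K.
  apply: (@subclosed_compact _ K (`[- r0, r0]%classic `*` `[- r0, r0]%classic)).
  - have -> : K = (fun z : R * R => z.1 * z.1 + z.2 * z.2) @^-1` [set x | x <= r0 ^+ 2].
      apply/seteqP; split => z; rewrite /K /= -!expr2 => h.
        by rewrite -[leLHS](md_sqr (z.1 +i* z.2)) lerXn2r ?nnegrE ?md_ge0.
      by rewrite -ler_sqr ?nnegrE ?md_ge0 // md_sqr.
    apply: preimage_closed; last exact: closed_le.
    move=> z _; apply: cvgD; apply: cvgM; solve [exact: cvg_fst|exact: cvg_snd].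
  - apply: compact_setX; exact: segment_compact.
  - move=> z; rewrite /K /= => h; rewrite !in_itv /= -!ler_norml.
    by split; apply: le_trans h; [exact: (md_Re (z.1 +i* z.2))|exact: (md_Im (z.1 +i* z.2))].
have K0 : K !=set0 by exists (0, 0); rewrite /K /= (_ : 0 +i* 0 = 0 :> C) // md0.
have [|z Kz hz] := @compact_EVT_max _ R (fun z => phi (z.1 +i* z.2)) K K0 cK.
  apply: continuous_in_subspaceT => z; rewrite inE /K /= => h.
  by apply: phi_cont; apply: le_lt_trans h r0_lt1.
exists (z.1 +i* z.2); first by move: Kz; rewrite inE.
by move=> [x y] w1; apply: (hz (x, y)); rewrite inE.
Qed.

(** The maximum of [phi] over the compact disc is a global maximum by invariance, so [strong_max]
    applies at an interior point of the unit disc. The invariance hypotheses are cross-multiplied to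
    avoid division. *)
Lemma liouville i j tau : 0 < Im tau ->
  f i tau * f j tau * dd (2 * m)%N = A i m * A j m * D tau.
Proof.
move=> t0; have [w0 w0r hmax] := max_attained.
have w01 : md w0 < 1 := le_lt_trans w0r r0_lt1.
have psiT t : 0 < Im t -> psi (t + 1) = psi t.
  move=> h; have h1 : 0 < Im (t + 1) by rewrite cImD /= addr0.
  by apply/eqP; rewrite eqr_div ?md_eq0 ?D_neq0 //; apply/eqP/inv_T.
have psiS t : 0 < Im t -> psi (- t^-1) = psi t.
  move=> h; have h1 := Im_invN_gt0 h.
  by apply/eqP; rewrite eqr_div ?md_eq0 ?D_neq0 //; apply/eqP/inv_S.
have hpsi : forall t, 0 < Im t -> psi t <= phi w0.
  apply: half_plane_ind => t ht.
  - by rewrite psiT.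
  - by rewrite psiT.
  - by rewrite psiS.
  - have ht' : 0 < Im t by lra.
    rewrite psiE //; apply: hmax; rewrite md_wq /r0 ler_expR lerN2.
    by rewrite ler_wpM2l ?mulr_ge0 ?pi_ge0 // ler_wpM2r // invr_ge0.
have hphi w : md w < 1 -> phi w <= phi w0.
  move=> w1; have [->|wn0] := eqVneq w 0.
    by apply: hmax; rewrite md0 expR_ge0.
  by have [t ht <-] := wq_surj wn0 w1; rewrite -psiE // hpsi.
have w1 := md_wq_lt1 t0.
have := @strong_max R I P q (phi w0) gP gq q_neq0 _ w0 w01 _ i j (wq tau) w1.
rewrite !PS0 /P /q !addn0 => SM.
rewrite fE // (fE j) // DE // -/(P i) -/(P j) -/q mul2n -addnn exprD.
transitivity (wq tau ^+ m * wq tau ^+ m * (PS (P i) (wq tau) * PS (P j) (wq tau) * dd (2 * m)%N)).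
  by rewrite mul2n -addnn; ring.
rewrite SM; first by rewrite -/q; ring.
  move=> w wl; rewrite -ler_pdivrMr; first exact: hphi.
  by rewrite md_gt0 q_neq0.
by rewrite /phi mulfVK // md_eq0 q_neq0.
Qed.

End Liouville.
End UpperHalfPlane.

Opaque e2pi.

(** * Complex-valued functions of a real variable and moving lines of integration *)

Section ThetaInversion.
Variable R : realType.
Local Notation C := R[i].
Local Notation md := (@md R).
Local Notation PS := (@PS R).
Local Notation Re := complex.Re.
Local Notation Im := complex.Im.
Local Notation mu := (@lebesgue_measure R).

Definition ccont (f : R -> C) := continuous (fun x => Re (f x)) /\ continuous (fun x => Im (f x)).

Definition cderiv (F f : R -> C) := forall x,
  is_derive x (1 : R) (fun t => Re (F t)) (Re (f x)) /\ is_derive x (1 : R) (fun t => Im (F t)) (Im (f x)).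

Lemma cderiv_ccont F f : cderiv F f -> ccont F.
Proof.
by move=> h; split=> x; have [h1 h2] := h x; apply: differentiable_continuous;
  apply/derivable1_diffP; exact: ex_derive.
Qed.

Lemma cderiv_ext F f g : cderiv F f -> (forall x, f x = g x) -> cderiv F g.
Proof. by move=> h e x; rewrite -e. Qed.

Lemma cderiv_cst (c : C) : cderiv (fun=> c) (fun=> 0).
Proof. by move=> x; split; exact: is_derive_cst. Qed.

Lemma cderiv_id : cderiv (fun x => x%:C) (fun=> 1).
Proof. by move=> x; split; [exact: is_derive_id|exact: is_derive_cst]. Qed.

Lemma cderivD F f G g : cderiv F f -> cderiv G g -> cderiv (fun x => F x + G x) (fun x => f x + g x).
Proof.
move=> hF hG x; have [h1 h2] := hF x; have [h3 h4] := hG x; rewrite cReD cImD; split.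
  have -> : (fun t => Re (F t + G t)) = (fun t => Re (F t)) + (fun t => Re (G t)).
    by apply: funext => t; rewrite cReD.
  exact: is_deriveD.
have -> : (fun t => Im (F t + G t)) = (fun t => Im (F t)) + (fun t => Im (G t)).
  by apply: funext => t; rewrite cImD.
exact: is_deriveD.
Qed.

Lemma cderivM F f G g : cderiv F f -> cderiv G g ->
  cderiv (fun x => F x * G x) (fun x => f x * G x + F x * g x).
Proof.
move=> hF hG x; have [h1 h2] := hF x; have [h3 h4] := hG x; rewrite cReD cImD !cReM !cImM; split.
  have -> : (fun t => Re (F t * G t)) = (fun t => Re (F t)) * (fun t => Re (G t)) -
    (fun t => Im (F t)) * (fun t => Im (G t)).
    by apply: funext => t; rewrite cReM.
  by apply: (is_derive_eq (is_deriveB (is_deriveM h1 h3) (is_deriveM h2 h4))); rewrite /GRing.scale /=; ring.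
have -> : (fun t => Im (F t * G t)) = (fun t => Re (F t)) * (fun t => Im (G t)) +
    (fun t => Im (F t)) * (fun t => Re (G t)).
  by apply: funext => t; rewrite cImM.
by apply: (is_derive_eq (is_deriveD (is_deriveM h1 h4) (is_deriveM h2 h3))); rewrite /GRing.scale /=; ring.
Qed.

Definition i2pi : C := 0 +i* (2 * pi).

Transparent e2pi.
Lemma cderiv_e2pi p p' : cderiv p p' ->
  cderiv (fun x => e2pi (p x)) (fun x => i2pi * p' x * e2pi (p x)).
Proof.
move=> hp x; have [h1 h2] := hp x.
have hE : is_derive x (1 : R) (fun t => expR (- (2 * pi * Im (p t))))
    (expR (- (2 * pi * Im (p x))) * - (2 * pi * Im (p' x))).
  exact: (is_derive1_comp (is_derive_expR _) (is_deriveN (is_deriveZ (2 * pi) h2))).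
have hA : is_derive x (1 : R) (fun t => 2 * pi * Re (p t)) (2 * pi * Re (p' x)).
  exact: (is_deriveZ (2 * pi) h1).
have hc := @is_derive1_comp _ cos _ x _ _ (is_derive_cos _) hA.
have hs := @is_derive1_comp _ sin _ x _ _ (is_derive_sin _) hA.
rewrite -mulrA !cReM !cImM !cReM !cImM /e2pi /=; split.
  have -> : (fun t => Re (e2pi (p t))) =
     (fun t => expR (- (2 * pi * Im (p t)))) * (cos \o (fun t => 2 * pi * Re (p t))).
    by apply: funext => t; rewrite /e2pi /= mul0r subr0.
  by apply: (is_derive_eq (is_deriveM hE hc)); rewrite /GRing.scale /=; ring.
have -> : (fun t => Im (e2pi (p t))) =
   (fun t => expR (- (2 * pi * Im (p t)))) * (sin \o (fun t => 2 * pi * Re (p t))).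
  by apply: funext => t; rewrite /e2pi /= mul0r addr0.
by apply: (is_derive_eq (is_deriveM hE hs)); rewrite /GRing.scale /=; ring.
Qed.

Opaque e2pi.
(** Only unit intervals are integrated over; an integral along a line is a sum of such pieces. *)
Definition cint (f : R -> C) : C :=
  (\int[mu]_(x in `[0, 1]) Re (f x)) +i* (\int[mu]_(x in `[0, 1]) Im (f x)).

Lemma cont_integrable (f : R -> R) : continuous f -> mu.-integrable `[0, 1] (EFin \o f).
Proof.
move=> cf; apply: continuous_compact_integrable; first exact: segment_compact.
exact: continuous_subspaceT.
Qed.

Lemma ccontD f g : ccont f -> ccont g -> ccont (fun x => f x + g x).
Proof.
move=> [f1 f2] [g1 g2]; split=> x.
  by under eq_fun do rewrite cReD; apply: continuousD; [exact: f1|exact: g1].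
by under eq_fun do rewrite cImD; apply: continuousD; [exact: f2|exact: g2].
Qed.

Lemma ccontM f g : ccont f -> ccont g -> ccont (fun x => f x * g x).
Proof.
move=> [f1 f2] [g1 g2]; split=> x.
  under eq_fun do rewrite cReM.
  by apply: cvgB; apply: cvgM; solve [exact: f1|exact: g1|exact: f2|exact: g2].
under eq_fun do rewrite cImM.
by apply: cvgD; apply: cvgM; solve [exact: f1|exact: g1|exact: f2|exact: g2].
Qed.

Lemma ccont_cst c : ccont (fun=> c). Proof. by split=> x; exact: cst_continuous. Qed.

Lemma ccont_sum (I : Type) (r : seq I) (f : I -> R -> C) : (forall i, ccont (f i)) ->
  ccont (fun x => \sum_(i <- r) f i x).
Proof.
move=> h; elim: r => [|i r IH].
  have -> : (fun x => \sum_(j <- [::]) f j x) = (fun=> 0) by apply: funext => x; rewrite big_nil.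
  exact: ccont_cst.
by under eq_fun do rewrite big_cons; exact: ccontD.
Qed.

Lemma cintD f g : ccont f -> ccont g -> cint (fun x => f x + g x) = cint f + cint g.
Proof.
move=> [f1 f2] [g1 g2]; apply: complex_eqP; rewrite ?cReD ?cImD /cint /=.
  by under eq_Rintegral do rewrite cReD; rewrite RintegralD //; exact: cont_integrable.
by under eq_Rintegral do rewrite cImD; rewrite RintegralD //; exact: cont_integrable.
Qed.

Lemma cintZ c f : ccont f -> cint (fun x => c * f x) = c * cint f.
Proof.
move=> [f1 f2]; apply: complex_eqP; rewrite ?cReM ?cImM /cint /=.
  under eq_Rintegral do rewrite cReM.
  rewrite RintegralB //; last 2 first.
  - by apply: cont_integrable => x; apply: continuousM; [exact: cst_continuous|exact: f1].
  - by apply: cont_integrable => x; apply: continuousM; [exact: cst_continuous|exact: f2].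
  by rewrite !RintegralZl //; exact: cont_integrable.
under eq_Rintegral do rewrite cImM.
rewrite RintegralD //; last 2 first.
- by apply: cont_integrable => x; apply: continuousM; [exact: cst_continuous|exact: f2].
- by apply: cont_integrable => x; apply: continuousM; [exact: cst_continuous|exact: f1].
by rewrite !RintegralZl //; exact: cont_integrable.
Qed.

Lemma cint_cst c : cint (fun=> c) = c.
Proof.
rewrite /cint !Rintegral_cst //= lebesgue_measure_itv /= lte_fin ltr01 sube0 /= !mulr1.
by case: c.
Qed.

Lemma cint_sum (I : Type) (r : seq I) (f : I -> R -> C) : (forall i, ccont (f i)) ->
  cint (fun x => \sum_(i <- r) f i x) = \sum_(i <- r) cint (f i).
Proof.
move=> h; elim: r => [|i r IH].
  have -> : (fun x => \sum_(j <- [::]) f j x) = (fun=> 0) by apply: funext => x; rewrite big_nil.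
  by rewrite cint_cst big_nil.
have -> : (fun x => \sum_(j <- i :: r) f j x) = (fun x => f i x + \sum_(j <- r) f j x).
  by apply: funext => x; rewrite big_cons.
by rewrite big_cons cintD ?IH //; exact: ccont_sum.
Qed.

Lemma eq_cint f g : (forall x, 0 <= x <= 1 -> f x = g x) -> cint f = cint g.
Proof.
move=> h; rewrite /cint; congr (_ +i* _); apply: eq_Rintegral => x; rewrite inE /= in_itv /= => xi;
  by rewrite h.
Qed.

Lemma md_cint_le f g : ccont f -> ccont g ->
  (forall x, 0 <= x <= 1 -> md (f x) <= Re (g x)) -> md (cint f) <= Re (cint g).
Proof.
move=> cf cg h; have [->|n0] := eqVneq (cint f) 0.
  rewrite md0 /cint /=; apply: Rintegral_ge0 => x /=; rewrite in_itv /= => xi.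
  exact: le_trans (md_ge0 _) (h x xi).
(* A unimodular factor rotates the integral onto the positive axis, where its modulus is the
   integral of a real part. *)
pose u := conjc (cint f) / (md (cint f))%:C.
have m0 : md (cint f) != 0 by rewrite md_eq0.
have mu1 : md u = 1 by rewrite /u mdM mdV md_conj md_real ger0_norm ?md_ge0 // mulfV.
have -> : md (cint f) = Re (u * cint f).
  suff -> : u * cint f = (md (cint f))%:C by [].
  have mC : (md (cint f))%:C != 0 :> C by rewrite -md_eq0 md_real normr_eq0.
  by apply: (mulIf mC); rewrite /u mulrAC mulfVK // mulrC mulcJ expr2 rmorphM.
rewrite -cintZ // /cint /=; apply: le_Rintegral => //.
- by apply: cont_integrable; have [] := ccontM (ccont_cst u) cf.
- by apply: cont_integrable; case: cg.
- move=> x /=; rewrite in_itv /= => xi; apply: le_trans (h x xi).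
  by apply: le_trans (ler_norm _) _; apply: le_trans (md_Re _) _; rewrite mdM mu1 mul1r.
Qed.

Lemma md_cint_bound f (K : R) : ccont f ->
  (forall x, 0 <= x <= 1 -> md (f x) <= K) -> md (cint f) <= K.
Proof.
move=> cf h; have -> : K = Re (cint (fun=> K%:C)) by rewrite cint_cst.
by apply: md_cint_le => //; exact: ccont_cst.
Qed.

Lemma cint_deriv F f : cderiv F f -> ccont f -> cint f = F 1 - F 0.
Proof.
move=> hF [c1 c2]; have [d1 d2] := cderiv_ccont hF.
have ftc (G g : R -> R) : (forall x, is_derive x (1 : R) G (g x)) -> continuous g -> continuous G ->
    \int[mu]_(x in `[0, 1]) g x = G 1 - G 0.
  move=> hG cg cG; rewrite /Rintegral (@continuous_FTC2 _ g G) //.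
  - exact: continuous_subspaceT.
  - split; [by move=> x _; case: (hG x)| |].
      by apply: cvg_at_right_filter; exact: cG.
    by apply: cvg_at_left_filter; exact: cG.
  - by move=> x _; rewrite derive1E; apply: derive_val.
apply: complex_eqP; rewrite ?cReD ?cImD ?cReN ?cImN /cint /=.
  by apply: (ftc (fun x => Re (F x))) => // x; case: (hF x).
by apply: (ftc (fun x => Im (F x))) => // x; case: (hF x).
Qed.

(** The first-order term is split off the increment of an integral that depends on a parameter; this
    shape is the one met in [homotopy_bound]. *)
Lemma cint_comb c f g k : ccont f -> ccont g -> ccont k ->
  cint f - cint g = c * cint k + cint (fun x => f x + (- (g x + c * k x))).
Proof.
move=> cf cg ck.
have c1 : ccont (fun x => c * k x) by apply: ccontM => //; exact: ccont_cst.
have c2 : ccont (fun x => g x + c * k x) by exact: ccontD.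
have E : (fun x => - (g x + c * k x)) = (fun x => -1 * (g x + c * k x)).
  by apply: funext => x; rewrite mulN1r.
have c3 : ccont (fun x => - (g x + c * k x)).
  by rewrite E; apply: ccontM => //; exact: ccont_cst.
by rewrite (cintD cf c3) E cintZ // cintD // cintZ //; ring.
Qed.

Lemma md_i2pi : md i2pi = 2 * pi.
Proof.
have -> : i2pi = (0 +i* 1) * (2 * pi)%:C by apply: complex_eqP; rewrite ?cReM ?cImM /i2pi /=; ring.
rewrite mdM md_real ger0_norm ?mulr_ge0 ?pi_ge0 //.
have -> : md (0 +i* 1) = 1 by apply/eqP; rewrite -sqrp_eq1 ?md_ge0 // md_sqr /= expr0n add0r expr1n.
by rewrite mul1r.
Qed.

Lemma md_e2pi_le (v : C) : md (e2pi v) <= expR (2 * pi * md v).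
Proof.
rewrite md_e2pi ler_expR -mulrN ler_wpM2l ?mulr_ge0 ?pi_ge0 //.
by apply: le_trans (md_Im v); rewrite -normrN ler_norm.
Qed.

Lemma e2pi_ray (v : C) : cderiv (fun t => e2pi (t%:C * v)) (fun t => i2pi * v * e2pi (t%:C * v)).
Proof.
apply: cderiv_ext (cderiv_e2pi (cderivM cderiv_id (cderiv_cst v))) _ => x /=.
by rewrite mul1r mulr0 addr0.
Qed.

Lemma e2pi_ray_cont (v : C) : ccont (fun t => e2pi (t%:C * v)).
Proof. exact: cderiv_ccont (e2pi_ray v). Qed.

Lemma e2pi_bound1 (v : C) (V : R) : md v <= V -> md (e2pi v - 1) <= 2 * pi * V * expR (2 * pi * V).
Proof.
move=> vV; have p0 := pi_ge0 R.
have V0 : 0 <= V := le_trans (md_ge0 v) vV.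
have c := ccontM (ccont_cst (i2pi * v)) (e2pi_ray_cont v).
have -> : e2pi v - 1 = cint (fun t => i2pi * v * e2pi (t%:C * v)).
  by rewrite (cint_deriv (e2pi_ray v) c) rmorph0 mul0r rmorph1 mul1r e2pi0.
apply: md_cint_bound => // x /andP[x0 x1]; rewrite mdM mdM md_i2pi.
apply: ler_pM; rewrite ?mulr_ge0 ?md_ge0 //; first by rewrite ler_wpM2l ?mulr_ge0.
apply: le_trans (md_e2pi_le _) _; rewrite ler_expR ler_wpM2l ?mulr_ge0 //.
rewrite mdM md_real ger0_norm //; apply: le_trans vV; rewrite -[leRHS]mul1r.
by rewrite ler_wpM2r ?md_ge0.
Qed.

Lemma e2pi_bound2 (v : C) (V : R) : md v <= V ->
  md (e2pi v - 1 - i2pi * v) <= (2 * pi * V) ^+ 2 * expR (2 * pi * V).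
Proof.
move=> vV; have p0 := pi_ge0 R.
have V0 : 0 <= V := le_trans (md_ge0 v) vV.
have c1 := e2pi_ray_cont v.
have c2 := ccontM (ccont_cst (i2pi * v)) c1.
have c3 : ccont (fun t => e2pi (t%:C * v) + -1) by apply: ccontD => //; exact: ccont_cst.
have -> : e2pi v - 1 - i2pi * v = cint (fun t => i2pi * v * (e2pi (t%:C * v) + -1)).
  rewrite cintZ // cintD ?cint_cst //; last exact: ccont_cst.
  rewrite mulrDr -cintZ // (cint_deriv (e2pi_ray v) c2) rmorph0 mul0r rmorph1 mul1r e2pi0.
  by rewrite mulrN1.
apply: md_cint_bound => [|x /andP[x0 x1]]; first by apply: ccontM => //; exact: ccont_cst.
rewrite mdM mdM md_i2pi expr2 -[leRHS]mulrA.
apply: ler_pM; rewrite ?mulr_ge0 ?md_ge0 //; first by rewrite ler_wpM2l ?mulr_ge0.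
apply: e2pi_bound1; rewrite mdM md_real ger0_norm //; apply: le_trans vV; rewrite -[leRHS]mul1r.
by rewrite ler_wpM2r ?md_ge0.
Qed.

(** Subdivision into n parts adds n quadratic errors K/n^2, which tend to 0. This replaces
    differentiation under the integral sign. *)
Lemma small_increments (D : R -> C) (e K : R) : 0 <= K ->
  (forall s h, 0 <= s -> 0 <= h -> s + h <= 1 -> md (D (s + h) - D s) <= e * h + K * h ^+ 2) ->
  md (D 1 - D 0) <= e.
Proof.
move=> K0 H; apply/ler_addgt0Pr => d d0.
pose n := (Num.truncn (K / d)).+1.
have n0 : 0 < n%:R :> R by rewrite ltr0n.
have nd : K / n%:R <= d.
  by rewrite ler_pdivrMr // mulrC -ler_pdivrMr //; apply/ltW; apply: truncnS_gt.
have step k : (k <= n)%N -> md (D (k%:R / n%:R) - D 0) <= k%:R * (e / n%:R + K / n%:R ^+ 2).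
  elim: k => [|k IH] kn; first by rewrite mul0r subrr md0 mul0r.
  have E : k.+1%:R / n%:R = k%:R / n%:R + n%:R^-1 :> R by rewrite -natr1 mulrDl mul1r.
  have -> : D (k.+1%:R / n%:R) - D 0 = (D (k.+1%:R / n%:R) - D (k%:R / n%:R)) + (D (k%:R / n%:R) - D 0) by ring.
  apply: le_trans (mdD _ _) _.
  have -> : k.+1%:R * (e / n%:R + K / n%:R ^+ 2) = (e / n%:R + K / n%:R ^+ 2) + k%:R * (e / n%:R + K / n%:R ^+ 2).
    by rewrite -natr1; ring.
  apply: lerD; last by rewrite IH // ltnW.
  rewrite E -exprVn; apply: H; rewrite ?divr_ge0 ?invr_ge0 ?ler0n //.
  by rewrite -E ler_pdivrMr // mul1r ler_nat.
have := step n (leqnn _); rewrite mulfV ?gt_eqF // => h; apply: le_trans h _.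
rewrite mulrDr mulrCA mulfV ?gt_eqF // mulr1 lerD2l.
apply: le_trans nd; rewrite le_eqVlt; apply/orP; left; apply/eqP.
by rewrite expr2 invfM mulrCA !mulrA mulfK ?gt_eqF.
Qed.

Definition gauss (sigma z : C) : C := e2pi (sigma * z ^+ 2 / 2).

Definition dgauss (sigma z : C) : C := i2pi * (sigma * z) * gauss sigma z.

Lemma cderiv_gauss sigma p p' : cderiv p p' ->
  cderiv (fun x => gauss sigma (p x)) (fun x => p' x * dgauss sigma (p x)).
Proof.
move=> hp; have h := cderivM (cderiv_cst (sigma / 2)) (cderivM hp hp).
have -> : (fun x => gauss sigma (p x)) = (fun x => e2pi (sigma / 2 * (p x * p x))).
  by apply: funext => x; rewrite /gauss; congr e2pi; ring.
apply: cderiv_ext (cderiv_e2pi h) _ => x; rewrite /dgauss /gauss.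
have -> : sigma * p x ^+ 2 / 2 = sigma / 2 * (p x * p x) by ring.
by field.
Qed.

Lemma gauss_taylor sigma (B Y : R) : 0 <= B -> 0 <= Y -> exists2 K : R, 0 <= K &
  forall p eta (h : R), md p <= B -> md eta <= Y -> 0 <= h <= 1 ->
  md (gauss sigma (p + h%:C * eta) - gauss sigma p - h%:C * eta * dgauss sigma p) <= K * h ^+ 2 /\
  md (gauss sigma (p + h%:C * eta) - gauss sigma p) <= K * h.
Proof.
move=> B0 Y0; have p0 := pi_ge0 R; have s0 := md_ge0 sigma.
pose U := md sigma * (B * Y + Y ^+ 2).
have U0 : 0 <= U by rewrite /U mulr_ge0 ?addr_ge0 ?mulr_ge0 ?sqr_ge0.
pose G := expR (2 * pi * (md sigma * B ^+ 2)).
have G0 : 0 <= G := expR_ge0 _.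
pose E := expR (2 * pi * U); have E0 : 0 <= E := expR_ge0 _.
pose K := G * ((2 * pi * U) ^+ 2 * E + 2 * pi * (md sigma * Y ^+ 2)) + G * (2 * pi * U * E).
exists K => [|p eta h hp he /andP[h0 h1]].
  have t1 : 0 <= 2 * pi * U by apply: mulr_ge0 => //; apply: mulr_ge0.
  have t2 : 0 <= 2 * pi * (md sigma * Y ^+ 2).
    by apply: mulr_ge0; apply: mulr_ge0 => //; apply: sqr_ge0.
  by rewrite /K; apply: addr_ge0; apply: mulr_ge0 => //; [apply: addr_ge0 => //; apply: mulr_ge0|exact: mulr_ge0]; rewrite ?sqr_ge0.
(* Since (p + h eta)^2 - p^2 = 2h (p eta + h eta^2/2), the Gaussian at the moved point is the old
   value times e(h u). *)
pose u := sigma * (p * eta + h%:C * eta ^+ 2 / 2).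
have hu : md u <= U.
  rewrite /u mdM ler_wpM2l //; apply: le_trans (mdD _ _) _; rewrite lerD //.
    by rewrite mdM ler_pM ?md_ge0.
  rewrite mdM mdV md_natr mdM mdX md_real ger0_norm //.
  have : md eta ^+ 2 <= Y ^+ 2 by rewrite lerXn2r ?nnegrE ?md_ge0.
  have := sqr_ge0 (md eta); set a := _ ^+ 2; set b := _ ^+ 2 => a0 ab.
  have : h * a <= 1 * b by rewrite ler_pM.
  have : 0 <= h * a by rewrite mulr_ge0.
  lra.
have hv : md (h%:C * u) <= h * U by rewrite mdM md_real ger0_norm // ler_wpM2l.
have hv' : h * U <= U by rewrite -[leRHS]mul1r ler_wpM2r.
have gE : gauss sigma (p + h%:C * eta) = gauss sigma p * e2pi (h%:C * u).
  by rewrite /gauss -e2piD /u; congr e2pi; field.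
have gp : md (gauss sigma p) <= G.
  apply: le_trans (md_e2pi_le _) _; rewrite ler_expR ler_wpM2l ?mulr_ge0 //.
  rewrite mdM mdV md_natr mdM mdX.
  have : md p ^+ 2 <= B ^+ 2 by rewrite lerXn2r ?nnegrE ?md_ge0.
  have := sqr_ge0 (md p); set a := _ ^+ 2; set b := _ ^+ 2 => a0 ab.
  have : md sigma * a <= md sigma * b by rewrite ler_wpM2l.
  have : 0 <= md sigma * a by rewrite mulr_ge0.
  lra.
have eU : expR (2 * pi * (h * U)) <= E by rewrite ler_expR ler_wpM2l ?mulr_ge0.
have hh : h ^+ 2 = h * h by [].
split.
  have -> : gauss sigma (p + h%:C * eta) - gauss sigma p - h%:C * eta * dgauss sigma p =
    gauss sigma p * ((e2pi (h%:C * u) - 1 - i2pi * (h%:C * u)) + i2pi * (h%:C ^+ 2 * (sigma * eta ^+ 2 / 2))).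
    by rewrite gE /dgauss /u; field.
  rewrite mdM; apply: le_trans (_ : G * ((2 * pi * U) ^+ 2 * E + 2 * pi * (md sigma * Y ^+ 2)) * h ^+ 2 <= _); last first.
    rewrite ler_wpM2r ?sqr_ge0 // /K lerDl; apply: mulr_ge0 => //; apply: mulr_ge0 => //.
    by apply: mulr_ge0 => //; apply: mulr_ge0.
  rewrite -[leRHS]mulrA; apply: ler_pM; rewrite ?md_ge0 //.
  apply: le_trans (mdD _ _) _; rewrite mulrDl lerD //.
    apply: le_trans (e2pi_bound2 hv) _.
    have -> : (2 * pi * U) ^+ 2 * E * h ^+ 2 = (2 * pi * (h * U)) ^+ 2 * E by ring.
    by apply: ler_wpM2l => //; exact: sqr_ge0.
  rewrite mdM md_i2pi mdM mdX md_real ger0_norm // mdM mdV md_natr mdM mdX.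
  have : md eta ^+ 2 <= Y ^+ 2 by rewrite lerXn2r ?nnegrE ?md_ge0.
  have := sqr_ge0 (md eta); set a := md eta ^+ 2; set b := _ ^+ 2 => a0 ab.
  rewrite -[leRHS]mulrA ler_wpM2l ?mulr_ge0 // mulrC ler_wpM2r ?sqr_ge0 //.
  have : md sigma * a <= md sigma * b by rewrite ler_wpM2l.
  have : 0 <= md sigma * a by rewrite mulr_ge0.
  lra.
have -> : gauss sigma (p + h%:C * eta) - gauss sigma p = gauss sigma p * (e2pi (h%:C * u) - 1).
  by rewrite gE; ring.
rewrite mdM; apply: le_trans (_ : G * (2 * pi * U * E) * h <= _); last first.
  rewrite ler_wpM2r // /K lerDr; apply: mulr_ge0 => //; apply: addr_ge0.
    by apply: mulr_ge0 => //; exact: sqr_ge0.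
  by apply: mulr_ge0; apply: mulr_ge0 => //; exact: sqr_ge0.
rewrite -[leRHS]mulrA; apply: ler_pM; rewrite ?md_ge0 //.
apply: le_trans (e2pi_bound1 hv) _.
have -> : 2 * pi * U * E * h = 2 * pi * (h * U) * E by ring.
by apply: ler_wpM2l => //; apply: mulr_ge0; apply: mulr_ge0.
Qed.

(** The homotopy z = (a0 + s a1)(x + n) + s zeta: the s-derivative of g(z) dz/dx is the x-derivative of g(z) dz/ds. *)
Section Homotopy.
Variables (sigma a0 a1 zeta : C) (N : nat).
Let alpha (s : R) := a0 + s%:C * a1.
Let zz (s y : R) : C := alpha s * y%:C + s%:C * zeta.
Let node (n : nat) (x : R) : R := x + n%:R - N%:R.
Let J s := \sum_(n < 2 * N) cint (fun x => alpha s * gauss sigma (zz s (node n x))).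
Let bdry s (y : R) := (a1 * y%:C + zeta) * gauss sigma (zz s y).

Let node_deriv n : cderiv (fun x => (node n x)%:C) (fun=> 1).
Proof.
have -> : (fun x => (node n x)%:C) = (fun x : R => x%:C + (n%:R - N%:R)%:C).
  by apply: funext => x; rewrite /node -addrA rmorphD.
by apply: cderiv_ext (cderivD cderiv_id (cderiv_cst _)) _ => x; rewrite addr0.
Qed.

Let zz_deriv s n : cderiv (fun x => zz s (node n x)) (fun=> alpha s).
Proof.
apply: cderiv_ext (cderivD (cderivM (cderiv_cst (alpha s)) (node_deriv n)) (cderiv_cst (s%:C * zeta))) _ => x.
by rewrite mul0r add0r mulr1 addr0.
Qed.

Let bdry_deriv s n : cderiv (fun x => bdry s (node n x))
  (fun x => a1 * gauss sigma (zz s (node n x)) +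
     (a1 * (node n x)%:C + zeta) * (alpha s * dgauss sigma (zz s (node n x)))).
Proof.
have h1 := cderivD (cderivM (cderiv_cst a1) (node_deriv n)) (cderiv_cst zeta).
apply: cderiv_ext (cderivM h1 (cderiv_gauss sigma (zz_deriv s n))) _ => x.
by rewrite mul0r add0r mulr1 addr0.
Qed.

Let gz_cont s n : ccont (fun x => gauss sigma (zz s (node n x))).
Proof. exact: cderiv_ccont (cderiv_gauss sigma (zz_deriv s n)). Qed.

Let db_cont s n : ccont (fun x => a1 * gauss sigma (zz s (node n x)) +
     (a1 * (node n x)%:C + zeta) * (alpha s * dgauss sigma (zz s (node n x)))).
Proof.
apply: ccontD; first by apply: ccontM; [exact: ccont_cst|exact: gz_cont].
apply: ccontM.
  by apply: ccontD; [apply: ccontM; [exact: ccont_cst|exact: cderiv_ccont (node_deriv n)]|exact: ccont_cst].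
apply: ccontM; first exact: ccont_cst.
apply: ccontM; last exact: gz_cont.
apply: ccontM; first exact: ccont_cst.
apply: ccontM; first exact: ccont_cst.
exact: cderiv_ccont (zz_deriv s n).
Qed.

(** Cauchy's theorem for a Gaussian on a truncated line: moving the line changes the integral by no
    more than the two ends contribute. It is used with a1 = 0 for translations and with zeta = 0 for
    rotations. *)
Lemma homotopy_bound (e : R) : 0 <= e ->
  (forall s : R, 0 <= s <= 1 -> md (bdry s N%:R) + md (bdry s (- N%:R)) <= e) ->
  md (J 1 - J 0) <= e.
Proof.
move=> e0 he.
pose M : R := 2 * N%:R + 1.
have M0 : 0 <= M by rewrite /M addr_ge0 ?mulr_ge0.
pose Al := md a0 + md a1; pose B := Al * M + md zeta; pose Y := md a1 * M + md zeta.
have Al0 : 0 <= Al by rewrite addr_ge0 ?md_ge0.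
have B0 : 0 <= B by rewrite addr_ge0 ?mulr_ge0 ?md_ge0.
have Y0 : 0 <= Y by rewrite addr_ge0 ?mulr_ge0 ?md_ge0.
have [K K0 hK] := gauss_taylor sigma B0 Y0.
have node_le n x : (n < 2 * N)%N -> 0 <= x <= 1 -> `|node n x| <= M.
  move=> nN /andP[x0 x1]; rewrite /node /M ler_norml.
  have : n%:R <= 2 * N%:R :> R by rewrite -natrM ler_nat ltnW.
  have := ler0n R n; have := ler0n R N; move=> a b c; apply/andP; split; lra.
apply: (@small_increments J e (\sum_(n < 2 * N) (Al * K + md a1 * K))).
  by apply: sumr_ge0 => n _; rewrite addr_ge0 ?mulr_ge0 ?md_ge0.
move=> s h s0 h0 sh1.
have s01 : 0 <= s <= 1 by rewrite s0 /=; lra.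
have h01 : 0 <= h <= 1 by rewrite h0 /=; lra.
(* Over each unit interval the integral is a difference of boundary terms at consecutive nodes, so
   only the outermost two remain. *)
have tele : \sum_(n < 2 * N) cint (fun x => a1 * gauss sigma (zz s (node n x)) +
     (a1 * (node n x)%:C + zeta) * (alpha s * dgauss sigma (zz s (node n x)))) =
   bdry s N%:R - bdry s (- N%:R).
  rewrite (eq_bigr (fun n : 'I_(2 * N) => bdry s (n.+1%:R - N%:R) - bdry s (n%:R - N%:R))); last first.
    move=> n _; rewrite (cint_deriv (bdry_deriv s n) (db_cont s n)) /node.
    by rewrite add0r -natr1 (addrC 1).
  rewrite -(big_mkord xpredT (fun n => bdry s (n.+1%:R - N%:R) - bdry s (n%:R - N%:R))).
  rewrite telescope_sumr // mul2n -addnn natrD addrK sub0r //.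
have -> : J (s + h) - J s = h%:C * (bdry s N%:R - bdry s (- N%:R)) +
   \sum_(n < 2 * N) cint (fun x => alpha (s + h) * gauss sigma (zz (s + h) (node n x)) +
      (- (alpha s * gauss sigma (zz s (node n x)) + h%:C * (a1 * gauss sigma (zz s (node n x)) +
     (a1 * (node n x)%:C + zeta) * (alpha s * dgauss sigma (zz s (node n x))))))).
  rewrite -tele /J mulr_sumr -sumrB -big_split /=; apply: eq_bigr => n _.
  have cA t : ccont (fun x => alpha t * gauss sigma (zz t (node n x))).
    by apply: ccontM; [exact: ccont_cst|exact: gz_cont].
  have cB := db_cont s n.
  exact: (cint_comb _ (cA (s + h)) (cA s) cB).
apply: le_trans (mdD _ _) _; rewrite lerD //.
  rewrite mdM md_real ger0_norm // mulrC ler_wpM2r //.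
  by apply: le_trans (mdB _ _) _; exact: he.
rewrite mulr_suml; apply: le_trans (md_sum _ _ _) _; apply: ler_sum => n _.
apply: md_cint_bound => [|x hx].
  apply: ccontD; first by apply: ccontM; [exact: ccont_cst|exact: gz_cont].
  have -> : (fun x => - (alpha s * gauss sigma (zz s (node n x)) + h%:C * (a1 * gauss sigma (zz s (node n x)) +
     (a1 * (node n x)%:C + zeta) * (alpha s * dgauss sigma (zz s (node n x)))))) =
    (fun x => -1 * (alpha s * gauss sigma (zz s (node n x)) + h%:C * (a1 * gauss sigma (zz s (node n x)) +
     (a1 * (node n x)%:C + zeta) * (alpha s * dgauss sigma (zz s (node n x)))))).
    by apply: funext => x; rewrite mulN1r.
  apply: ccontM; first exact: ccont_cst.
  apply: ccontD; first by apply: ccontM; [exact: ccont_cst|exact: gz_cont].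
  by apply: ccontM; [exact: ccont_cst|exact: db_cont].
have nl := node_le n x (ltn_ord n) hx.
set y := node n x in nl *; set p := zz s y; pose eta := a1 * y%:C + zeta.
have asle : md (alpha s) <= Al.
  apply: le_trans (mdD _ _) _; rewrite lerD2l mdM md_real ger0_norm //.
  by rewrite -[leRHS]mul1r ler_wpM2r ?md_ge0 //; case/andP: s01.
have pB : md p <= B.
  apply: le_trans (mdD _ _) _; rewrite lerD //.
    by rewrite mdM md_real ler_pM ?md_ge0.
  rewrite mdM md_real ger0_norm // -[leRHS]mul1r ler_wpM2r ?md_ge0 //; by case/andP: s01.
have eY : md eta <= Y.
  apply: le_trans (mdD _ _) _; rewrite lerD //.
  by rewrite mdM md_real ler_wpM2l ?md_ge0.
have zE : zz (s + h) y = p + h%:C * eta.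
  by rewrite /p /zz /eta /alpha rmorphD /=; ring.
have [k1 k2] := hK p eta h pB eY h01.
rewrite zE -/eta.
have -> : alpha (s + h) * gauss sigma (p + h%:C * eta) -
   (alpha s * gauss sigma p + h%:C * (a1 * gauss sigma p + eta * (alpha s * dgauss sigma p))) =
   alpha s * (gauss sigma (p + h%:C * eta) - gauss sigma p - h%:C * eta * dgauss sigma p) +
   a1 * (h%:C * (gauss sigma (p + h%:C * eta) - gauss sigma p)).
  by rewrite /alpha rmorphD /=; ring.
apply: le_trans (mdD _ _) _; rewrite [(_ + md a1 * K) * _]mulrDl; apply: lerD; rewrite mdM.
  by rewrite -[leRHS]mulrA; apply: ler_pM => //; exact: md_ge0.
rewrite -[leRHS]mulrA ler_wpM2l ?md_ge0 // mdM md_real ger0_norm // expr2.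
by rewrite mulrA (mulrC (K * h)) ler_wpM2l.
Qed.

End Homotopy.

Lemma md_gauss sigma z : md (gauss sigma z) = expR (- (pi * Im (sigma * z ^+ 2))).
Proof. by rewrite /gauss md_e2pi Im_divn; congr expR; field. Qed.

(** A geometric majorant is all that the summation lemmas need. The ratio is below 1/2, which leaves
    room for the linear factor of [dgauss], estimated by 2^n in [gauss_decay_int]. The constant c
    comes from completing the square in n. *)
Lemma gauss_decay sigma (W : R) : 0 < Im sigma -> 0 <= W ->
  exists K t : R, [/\ 0 <= K, 0 <= t, 2 * t < 1 & forall (x : R) w n, md w <= W -> `|x| = n%:R ->
    md (gauss sigma (x%:C + w)) <= K * t ^+ n].
Proof.
move=> s0 W0; have p0 := pi_gt0 R; pose S := md sigma; have S0 : 0 <= S := md_ge0 _.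
pose c := (1 + 2 * S * W) ^+ 2 / (4 * Im sigma).
exists (expR (pi * (S * W ^+ 2 + c))), (expR (- pi)); split=> [|||x w n wW xn].
- exact: expR_ge0.
- exact: expR_ge0.
- rewrite expRN ltr_pdivrMr ?expR_gt0 // mul1r; apply: lt_le_trans (expR_ge1Dx _).
  by have := @pi_ge2 R; lra.
have e1 : expR (- pi) ^+ n = expR (n%:R * - pi) :> R by rewrite expRM_natl.
rewrite md_gauss e1 -expRD ler_expR.
suff : n%:R - c - S * W ^+ 2 <= Im (sigma * (x%:C + w) ^+ 2).
  move=> /(ler_wpM2l (ltW p0)); lra.
have -> : Im (sigma * (x%:C + w) ^+ 2) = Im sigma * n%:R ^+ 2 + 2 * x * Im (sigma * w) + Im (sigma * w ^+ 2).
  by rewrite -xn real_normK ?num_real //; case: (sigma) (w) => [? ?] [? ?] /=; ring.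
have i1 : - (S * W ^+ 2) <= Im (sigma * w ^+ 2).
  have := md_Im (sigma * w ^+ 2); rewrite mdM mdX ler_norml => /andP[+ _]; apply: le_trans.
  rewrite lerN2; apply: ler_wpM2l => //; apply: lerXn2r => //; exact: md_ge0.
have i2 : - (2 * n%:R * (S * W)) <= 2 * x * Im (sigma * w).
  have h : `|x * Im (sigma * w)| <= n%:R * (S * W).
    rewrite normrM xn; apply: ler_wpM2l => //; apply: le_trans (md_Im _) _; rewrite mdM.
    exact: ler_wpM2l.
  by move: h; rewrite ler_norml => /andP[h _]; lra.
have i3 : n%:R - c <= Im sigma * n%:R ^+ 2 - 2 * n%:R * (S * W).
  suff : 0 <= (2 * Im sigma * n%:R - (1 + 2 * S * W)) ^+ 2 / (4 * Im sigma).
    have -> : (2 * Im sigma * n%:R - (1 + 2 * S * W)) ^+ 2 / (4 * Im sigma) =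
      Im sigma * n%:R ^+ 2 - n%:R * (1 + 2 * S * W) + c.
      by rewrite /c; field; rewrite gt_eqF.
    by lra.
  by rewrite divr_ge0 ?sqr_ge0 // mulr_ge0 // ltW.
lra.
Qed.

End ThetaInversion.

(** * Poisson summation and the inversion of theta series *)

Section Poisson.
Variable R : realType.
Local Notation C := R[i].
Local Notation md := (@md R).
Local Notation Re := complex.Re.
Local Notation Im := complex.Im.

(** ** Sums over the integers *)

(** Pairing n with [Negz n], that is -(n+1), makes the partial sums run over the windows from -N to
    N-1; see [bisum]. *)
Definition zs (f : int -> C) : C := csum (fun n => f n%:Z + f (Negz n)).

Lemma bisum (V : zmodType) (f : int -> V) N :
  \sum_(n < 2 * N) f (n%:Z - N%:Z) = \sum_(n < N) (f n%:Z + f (Negz n)).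
Proof.
elim: N => [|N IH]; first by rewrite !big_ord0.
have -> : (2 * N.+1 = (2 * N).+2)%N by lia.
rewrite big_ord_recl big_ord_recr /= big_ord_recr /= -IH.
have -> : 0%:Z - N.+1%:Z = Negz N by lia.
have -> : (bump 0 (2 * N))%:Z - N.+1%:Z = N%:Z by rewrite /bump; lia.
rewrite [LHS]addrC -[LHS]addrA; congr (_ + _).
by apply: eq_bigr => i _; congr f; rewrite /bump /=; lia.
Qed.

Definition zgeo (f : int -> C) := exists K t : R,
  0 <= t < 1 /\ forall n, md (f n%:Z) <= K * t ^+ n /\ md (f (Negz n)) <= K * t ^+ n.

Lemma zgeo_pair f : zgeo f -> exists K t : R, 0 <= t < 1 /\ forall n, md (f n%:Z + f (Negz n)) <= K * t ^+ n.
Proof.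
move=> [K [t [ht h]]]; exists (K + K), t; split=> // n; have [h1 h2] := h n.
by apply: le_trans (mdD _ _) _; rewrite mulrDl lerD.
Qed.

Lemma zs_tends f : zgeo f -> ctends (fun N => \sum_(n < 2 * N) f (n%:Z - N%:Z)) (zs f).
Proof.
move=> /zgeo_pair [K [t [ht h]]]; apply: ctends_ext (csum_tends ht h) => N.
by rewrite bisum.
Qed.

Lemma zs_uniq f l : zgeo f -> ctends (fun N => \sum_(n < 2 * N) f (n%:Z - N%:Z)) l -> zs f = l.
Proof. by move=> /zs_tends h /(ctends_uniq h). Qed.

Lemma eq_zs f g : f =1 g -> zs f = zs g.
Proof. by move=> /funext ->. Qed.

Lemma zgeo_le f g : zgeo g -> (forall n, md (f n) <= md (g n)) -> zgeo f.
Proof.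
by move=> [K [t [ht h]]] fg; exists K, t; split=> // n; have [h1 h2] := h n; split;
  apply: le_trans (fg _) _.
Qed.

Lemma ctends_sum (I : Type) (r : seq I) (u : I -> nat -> C) l : (forall i, ctends (u i) (l i)) ->
  ctends (fun n => \sum_(i <- r) u i n) (\sum_(i <- r) l i).
Proof.
move=> h; elim: r => [|i r IH].
  by rewrite big_nil; apply: (ctends_ext (u := fun=> 0)) (ctends_cst 0) => n; rewrite big_nil.
rewrite big_cons; apply: (ctends_ext (u := fun n => u i n + \sum_(j <- r) u j n)) (ctendsD (h i) IH) => n.
by rewrite big_cons.
Qed.

Lemma md_le0 (z : C) : (forall e : R, 0 < e -> md z <= e) -> z = 0.
Proof.
move=> h; apply/eqP; rewrite -md_eq0 eq_le md_ge0 andbT.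
by apply/ler_addgt0Pr => e e0; rewrite add0r h.
Qed.

Lemma eps_small (A e : R) : 0 < e -> exists N : nat, forall n, (N <= n)%N -> A / n%:R < e.
Proof.
move=> e0; exists (Num.truncn (`|A| / e)).+1 => n Nn.
have n0 : 0 < n%:R :> R by rewrite ltr0n; case: n Nn.
rewrite ltr_pdivrMr // mulrC -ltr_pdivrMr //; apply: le_lt_trans (_ : `|A| / e < _).
  by rewrite ler_pM2r ?invr_gt0 // ler_norm.
by apply: lt_le_trans (truncnS_gt _) _; rewrite ler_nat.
Qed.

(** Passing from an n by n square to the next one adds exactly one symmetric partial sum of b, from
    -n to n; hence the Fejer double sums are Cesaro means. *)
Lemma square_sum (b : int -> C) n :
  \sum_(j < n) \sum_(l < n) b (j%:Z - l%:Z) =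
  \sum_(p < n) (\sum_(k < p) (b k%:Z + b (Negz k)) + b p%:Z).
Proof.
elim: n => [|n IH]; first by rewrite !big_ord0.
rewrite big_ord_recr [RHS]big_ord_recr /= -IH.
have -> : \sum_(j < n) \sum_(l < n.+1) b (j%:Z - l%:Z) =
   \sum_(j < n) \sum_(l < n) b (j%:Z - l%:Z) + \sum_(j < n) b (Negz j).
  have E : \sum_(j < n) b (Negz j) = \sum_(j < n) b (Negz (n - j.+1)) by rewrite (reindex_inj rev_ord_inj).
  rewrite E -big_split /=; apply: eq_bigr => j _.
  rewrite big_ord_recr /=; congr (_ + b _); have := ltn_ord j; lia.
have -> : \sum_(l < n.+1) b (n%:Z - l%:Z) = \sum_(k < n) b k%:Z + b n%:Z.
  rewrite (reindex_inj rev_ord_inj) big_ord_recr /=; congr (_ + b _); last lia.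
  by apply: eq_bigr => j _; congr b; have := ltn_ord j; lia.
by rewrite big_split /=; ring.
Qed.

Lemma cesaro (b : int -> C) : zgeo b ->
  ctends (fun n => n%:R^-1 * \sum_(j < n) \sum_(l < n) b (j%:Z - l%:Z)) (zs b).
Proof.
move=> hb; have [K [t [ht h]]] := hb; have [K' [t' [ht' h']]] := zgeo_pair hb.
have /andP[t0 t1] := ht; have /andP[t0' t1'] := ht'.
pose A := 2 * (K' / (1 - t')) / (1 - t') + K / (1 - t).
move=> e e0; have [N hN] := eps_small A e0; exists N.+1 => n Nn.
have n0 : 0 < n%:R :> R by rewrite ltr0n; case: n Nn.
have nC : n%:R != 0 :> C by rewrite pnatr_eq0; case: n Nn n0.
apply: le_lt_trans (hN n (ltnW Nn)); rewrite square_sum.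
have -> : zs b = n%:R^-1 * \sum_(p < n) zs b.
  by rewrite sumr_const card_ord -[zs b *+ n]mulr_natl mulrA mulVf // mul1r.
rewrite -mulrBr -sumrB mdM mdV md_natr mulrC ler_pM2r ?invr_gt0 //.
apply: le_trans (md_sum _ _ _) _.
apply: (@le_trans _ _ (\sum_(p < n) (2 * (K' / (1 - t')) * t' ^+ p + K * t ^+ p))).
  apply: ler_sum => p _; rewrite addrAC; apply: le_trans (mdD _ _) _; apply: lerD; last by case: (h p).
  apply: le_trans (csumP p ht' h') _; rewrite le_eqVlt; apply/orP; left; apply/eqP; ring.
rewrite big_split /= -!mulr_sumr; have K0 : 0 <= K.
  by have [h0 _] := h 0%N; move: h0; rewrite expr0 mulr1; exact/le_trans/md_ge0.
have K0' : 0 <= K' by have := h' 0%N; rewrite expr0 mulr1; exact/le_trans/md_ge0.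
apply: lerD; apply: ler_wpM2l; rewrite ?geo_sum_le //.
by rewrite mulr_ge0 // divr_ge0 // subr_ge0 ltW.
Qed.

(** ** The Fejér kernel *)

Lemma md_1e2pi (x : R) : md (1 - e2pi x%:C) = 2 * `|sin (pi * x)|.
Proof.
apply/eqP; rewrite -(@eqrXn2 _ 2) ?md_ge0 ?mulr_ge0 // md_sqr exprMn real_normK ?num_real //.
Transparent e2pi.
rewrite /e2pi /= mulr0 oppr0 expR0.
Opaque e2pi.
have -> : 2 * pi * x = (pi * x) *+ 2 by ring.
rewrite cos_mulr2n sin_mulr2n; apply/eqP.
have := cos2Dsin2 (pi * x); set c := cos _; set s := sin _ => cs.
have -> : c ^+ 2 = 1 - s ^+ 2 by rewrite -cs addrK.
transitivity (4 * s ^+ 4 + 4 * c ^+ 2 * s ^+ 2); first by ring.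
have -> : c ^+ 2 = 1 - s ^+ 2 by rewrite -cs addrK.
ring.
Qed.

(** |1 - e(x)| = 2 |sin(pi x)| is symmetric under x -> 1 - x. On [0, 1/2] the mean value theorem
    gives sin t >= t cos 1 up to t = 1, and monotonicity of the sine the rest. *)
Lemma md_1e2pi_ge : exists2 k : R, 0 <= k & forall x, 0 <= x <= 1 -> Num.min x (1 - x) <= k * md (1 - e2pi x%:C).
Proof.
have p0 := pi_gt0 R; have p2 := @pi_ge2 R.
have c1 : 0 < cos 1 :> R := cos1_gt0 R.
have s1 : sin 1 >= cos 1 :> R.
  have [c c01 E] := @MVT R sin cos 0 1 ltr01 (fun x _ => is_derive_sin x) (continuous_subspaceT (@continuous_sin R)).
  rewrite -[sin 1]subr0 -sin0 E subr0 mulr1; move: c01; rewrite in_itv /= => /andP[c0 c1'].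
  by apply/ltW; rewrite ltr_cos ?in_itv /= ?ltW //; lra.
have half (x : R) : 0 <= x <= 1 / 2 -> x <= (cos 1)^-1 * md (1 - e2pi x%:C).
  move=> /andP[x0 x1]; rewrite mulrC ler_pdivlMr // md_1e2pi.
  have t0 : 0 <= pi * x by rewrite mulr_ge0 // ltW.
  have tx : 2 * x <= pi * x by rewrite ler_wpM2r.
  have t1 : pi * x <= pi / 2 by apply: ler_wpM2l; [exact: ltW|move: x1; rewrite mul1r].
  suff : pi * x * cos 1 <= 2 * sin (pi * x).
    have := ler_norm (sin (pi * x)); have := ler_wpM2r (ltW c1) tx; nra.
  set t := pi * x in t0 t1 tx *.
  have [tl|tg] := leP t 1.
    have [->|tn] := eqVneq t 0; first by rewrite sin0 mul0r mulr0.
    have tp : 0 < t by rewrite lt_neqAle eq_sym tn.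
    have [c c01 E] := @MVT R sin cos 0 t tp (fun x _ => is_derive_sin x) (continuous_subspaceT (@continuous_sin R)).
    move: E; rewrite sin0 !subr0 => ->; move: c01; rewrite in_itv /= => /andP[c0 c1'].
    have : cos 1 <= cos c by apply/ltW; rewrite ltr_cos ?in_itv /= ?ltW //; lra.
    move=> /(ler_wpM2r t0); nra.
  have : sin 1 <= sin t.
    by apply/ltW; rewrite ltr_sin ?in_itv /=; lra.
  have : t <= 2.
    by apply: le_trans t1 _; case/andP: (@pihalf_02_cos_pihalf R).1.
  have := ltW c1; nra.
exists (cos 1)^-1 => [|x /andP[x0 x1]]; first by rewrite invr_ge0 ltW.
have [xl|xg] := leP x (1 / 2).
  by rewrite ge_min half ?x0.
rewrite ge_min [X in _ || X](le_trans (half (1 - x) _)) ?orbT //; first by lra.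
have -> : md (1 - e2pi (1 - x)%:C) = md (1 - e2pi x%:C) by rewrite !md_1e2pi mulrBr mulr1 sinB sinpi cospi mul0r sub0r mulN1r opprK.
by [].
Qed.

Lemma cderiv_chi (m : int) (c : C) : cderiv (fun x => e2pi (m%:~R * x%:C) * c)
   (fun x => i2pi R * m%:~R * e2pi (m%:~R * x%:C) * c).
Proof.
have h := cderiv_e2pi (cderivM (cderiv_cst (m%:~R : C)) (@cderiv_id R)).
apply: cderiv_ext (cderivM h (cderiv_cst c)) _ => x /=; ring.
Qed.

Lemma ccont_chi (m : int) : ccont (fun x : R => e2pi (m%:~R * x%:C)).
Proof.
have := cderiv_ccont (cderiv_chi m 1).
by have -> : (fun x : R => e2pi (m%:~R * x%:C) * 1) = (fun x => e2pi (m%:~R * x%:C)) by apply: funext => x; rewrite mulr1.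
Qed.

Lemma cint_chi (m : int) : cint (fun x : R => e2pi (m%:~R * x%:C)) = (m == 0)%:R.
Proof.
have [->|m0] := eqVneq m 0.
  rewrite (@eq_cint _ _ (fun=> 1)) ?cint_cst // => x _.
  by rewrite mul0r e2pi0.
have c0 : i2pi R * m%:~R != 0.
  by rewrite mulf_neq0 ?intr_eq0 // -md_eq0 md_i2pi mulf_neq0 // gt_eqF // pi_gt0.
have D : cderiv (fun x => e2pi (m%:~R * x%:C) * (i2pi R * m%:~R)^-1) (fun x : R => e2pi (m%:~R * x%:C)).
  by apply: cderiv_ext (cderiv_chi m _) _ => x; rewrite [_ * e2pi _]mulrC mulfK.
rewrite (cint_deriv D (ccont_chi m)) rmorph1 mulr1 rmorph0 mulr0 e2pi_int e2pi0 subrr //.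
Qed.

Definition dirichlet (n : nat) (x : R) : C := \sum_(j < n) e2pi (j%:Z%:~R * x%:C).

Lemma chi_conj (m : int) (x : R) : conjc (e2pi (m%:~R * x%:C)) = e2pi ((- m)%:~R * x%:C).
Proof.
have -> (k : int) : k%:~R * x%:C = (k%:~R * x)%:C by rewrite rmorphM rmorph_int.
by rewrite conjc_e2pi mulrNz mulNr rmorphM rmorph_int.
Qed.

Lemma dirichlet_sqr n x : (md (dirichlet n x) ^+ 2)%:C = \sum_(j < n) \sum_(l < n) e2pi ((j%:Z - l%:Z)%:~R * x%:C).
Proof.
rewrite -mulcJ /dirichlet mulr_suml; apply: eq_bigr => j _.
rewrite conjc_sum mulr_sumr; apply: eq_bigr => l _.
by rewrite chi_conj -e2piD -mulrDl -rmorphD.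
Qed.

Lemma dirichlet_1e n x : md (1 - e2pi x%:C) * md (dirichlet n x) <= 2.
Proof.
rewrite -mdM.
have -> : (1 - e2pi x%:C) * dirichlet n x = 1 - e2pi (n%:R * x%:C).
  rewrite /dirichlet.
  elim: n => [|n IH]; first by rewrite big_ord0 mulr0 mul0r e2pi0 subrr.
  rewrite big_ord_recr /= mulrDr IH -natr1 !mulrDl !mul1r e2piD -pmulrn; ring.
apply: le_trans (mdB _ _) _.
have -> : n%:R * x%:C = (n%:R * x)%:C by rewrite rmorphM rmorph_nat.
by rewrite md_e2pi_real -[1]/(1%:C) md_real normr1.
Qed.

Lemma fejer_int n : (0 < n)%N -> cint (fun x => (md (dirichlet n x) ^+ 2)%:C) = n%:R.
Proof.
move=> n0; have E : (fun x => (md (dirichlet n x) ^+ 2)%:C) = (fun x => \sum_(j < n) \sum_(l < n) e2pi ((j%:Z - l%:Z)%:~R * x%:C)).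
  by apply: funext => x; rewrite dirichlet_sqr.
rewrite E cint_sum => [|j]; last by apply: ccont_sum => l; exact: ccont_chi.
rewrite (eq_bigr (fun=> 1)) ?sumr_const ?card_ord // => j _.
rewrite cint_sum => [|l]; last exact: ccont_chi.
rewrite (bigD1 j) //= cint_chi subrr eqxx big1 ?addr0 // => l lj; rewrite cint_chi subr_eq0.
by have -> : ((j : nat)%:Z == (l : nat)%:Z) = false by apply/negbTE; rewrite eqz_nat; apply: contraNneq lj => /val_inj ->.
Qed.

(** A quantitative Fejer theorem at 0 without splitting the interval: the Lipschitz bound is
    measured by |1 - e(x)|, which is what multiplies the Dirichlet kernel down to 2. The additive
    error e admits functions that are only almost periodic. *)
Lemma fejer (g : R -> C) (L e : R) n : (0 < n)%N -> ccont g -> 0 <= L -> 0 < e ->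
  (forall x, 0 <= x <= 1 -> md (g x - g 0) <= L * md (1 - e2pi x%:C) + e) ->
  md (n%:R^-1 * (\sum_(j < n) \sum_(l < n) cint (fun x => e2pi ((j%:Z - l%:Z)%:~R * x%:C) * g x)) - g 0)
    <= L * (e + (n%:R * e)^-1) + e.
Proof.
move=> n0 cg L0 e0 h.
have nR : 0 < n%:R :> R by rewrite ltr0n.
have nC : n%:R != 0 :> C by rewrite pnatr_eq0 -lt0n.
pose D := fun x => md (dirichlet n x) ^+ 2.
have cD : ccont (fun x => (D x)%:C).
  have -> : (fun x => (D x)%:C) = (fun x => \sum_(j < n) \sum_(l < n) e2pi ((j%:Z - l%:Z)%:~R * x%:C)).
    by apply: funext => x; rewrite /D dirichlet_sqr.
  by apply: ccont_sum => j; apply: ccont_sum => l; exact: ccont_chi.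
have cDg (f : R -> C) : ccont f -> ccont (fun x => (D x)%:C * f x) by exact: ccontM.
have cg0 : ccont (fun x => g x + - g 0) by apply: ccontD => //; exact: ccont_cst.
have -> : n%:R^-1 * (\sum_(j < n) \sum_(l < n) cint (fun x => e2pi ((j%:Z - l%:Z)%:~R * x%:C) * g x)) - g 0 =
   n%:R^-1 * cint (fun x => (D x)%:C * (g x + - g 0)).
  have -> : \sum_(j < n) \sum_(l < n) cint (fun x => e2pi ((j%:Z - l%:Z)%:~R * x%:C) * g x) = cint (fun x => (D x)%:C * g x).
    have -> : (fun x => (D x)%:C * g x) = (fun x => \sum_(j < n) \sum_(l < n) (e2pi ((j%:Z - l%:Z)%:~R * x%:C) * g x)).
      apply: funext => x; rewrite /D dirichlet_sqr mulr_suml; apply: eq_bigr => j _.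
      by rewrite mulr_suml.
    rewrite cint_sum => [|j].
      by apply: eq_bigr => j _; rewrite cint_sum // => l; apply: ccontM => //; exact: ccont_chi.
    by apply: ccont_sum => l; apply: ccontM => //; exact: ccont_chi.
  have -> : (fun x => (D x)%:C * (g x + - g 0)) = (fun x => (D x)%:C * g x + (- g 0) * (D x)%:C).
    by apply: funext => x; ring.
  rewrite cintD; [|exact: cDg|by apply: ccontM => //; exact: ccont_cst].
  by rewrite cintZ // fejer_int // mulrDr mulrCA mulVf // mulr1.
rewrite mdM mdV md_natr mulrC ler_pdivrMr //.
have cst1 : ccont (fun=> (e^-1)%:C : C) := ccont_cst _.
pose G := fun x => ((L * e + e)%:C * (D x)%:C + (L / e)%:C).
have cG : ccont G by apply: ccontD; [apply: ccontM => //|]; exact: ccont_cst.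
have -> : (L * (e + (n%:R * e)^-1) + e) * n%:R = Re (cint G).
  rewrite /G cintD; [|by apply: ccontM => //; exact: ccont_cst|exact: ccont_cst].
  rewrite cintZ // fejer_int // cint_cst.
  have -> : (n%:R : C) = (n%:R)%:C by rewrite rmorph_nat.
  rewrite -rmorphM -rmorphD /=.
  by field; rewrite !gt_eqF.
apply: md_cint_le => //; first exact: cDg.
move=> x xi; rewrite mdM md_real ger0_norm ?sqr_ge0 // /G -rmorphM -rmorphD /=.
apply: (@le_trans _ _ (D x * (L * md (1 - e2pi x%:C) + e))).
  by apply: ler_wpM2l; [exact: sqr_ge0|exact: h].
rewrite mulrDr [(L * e + e) * _]mulrDl addrAC [e * D x]mulrC; apply: lerD => //.
(* Here d^2 m <= 2d for the kernel d and m = |1 - e(x)|, and 2d <= e d^2 + 1/e; the first term is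
   integrated by [fejer_int]. *)
suff : D x * md (1 - e2pi x%:C) <= e * D x + e^-1.
  move=> hD; have -> : D x * (L * md (1 - e2pi x%:C)) = L * (D x * md (1 - e2pi x%:C)) by ring.
  have -> : L * e * D x + L / e = L * (e * D x + e^-1) by ring.
  exact: ler_wpM2l.
have d1 := dirichlet_1e n x; have d0 := md_ge0 (dirichlet n x).
rewrite /D; set d := md (dirichlet n x) in d1 d0 *; set m := md (1 - _) in d1 *.
have := ler_wpM2l d0 d1; have -> : d ^+ 2 * m = d * (m * d) by ring.
have : 0 <= (e * d - 1) ^+ 2 / e by rewrite divr_ge0 ?sqr_ge0 // ltW.
have -> : (e * d - 1) ^+ 2 / e = e * d ^+ 2 - 2 * d + e^-1 by field; rewrite gt_eqF.
lra.
Qed.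

(** ** Poisson summation for Gaussians *)

Lemma ctends_le_near u (l : C) (M : R) N0 : ctends u l -> (forall n, (N0 <= n)%N -> md (u n) <= M) -> md l <= M.
Proof.
move=> h hM; apply/ler_addgt0Pr => e e0; have [N hN] := h e e0.
have := hN _ (leq_maxl N N0); have := hM _ (leq_maxr N N0).
have := md_triB l (u (maxn N N0)); rewrite mdBC; lra.
Qed.

Lemma zgeo_abs (f : int -> C) (K t : R) : 0 <= t < 1 -> (forall m, md (f m) <= K * t ^+ `|m|%N) -> zgeo f.
Proof.
move=> ht h; exists K, t; split=> // n; split; first exact: h.
apply: le_trans (h _) _; have K0 : 0 <= K by have := h 0; rewrite expr0 mulr1; exact/le_trans/md_ge0.
by apply: ler_wpM2l => //; have /andP[t0 t1] := ht; apply: ler_wiXn2l => //; rewrite ?ltW //; lia.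
Qed.

Lemma gauss_decay_int sigma (W : R) : 0 < Im sigma -> 0 <= W ->
  exists K t : R, [/\ 0 <= K, 0 <= t < 1 & forall (m : int) w, md w <= W ->
    md (gauss sigma (m%:~R + w)) <= K * t ^+ `|m|%N /\ md (dgauss sigma (m%:~R + w)) <= K * t ^+ `|m|%N].
Proof.
move=> s0 W0; have [K [t [K0 t0 t1 h]]] := gauss_decay s0 W0.
have p0 := pi_ge0 R; have S0 := md_ge0 sigma.
pose A := 2 * pi * md sigma * (1 + W).
have A0 : 0 <= A by rewrite /A; apply: mulr_ge0; [apply: mulr_ge0 => //; exact: mulr_ge0|exact: addr_ge0].
have AK0 : 0 <= A * K by exact: mulr_ge0.
have hn (m : int) : `|m%:~R : R| = `|m|%N%:R by rewrite -intr_norm -[`|m|]abszE.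
have le2 n : t ^+ n <= (2 * t) ^+ n by apply: lerXn2r; rewrite ?nnegrE ?mulr_ge0 //; lra.
exists (K + A * K), (2 * t); split=> [||m w wW]; first exact: addr_ge0.
  by rewrite t1 mulr_ge0.
have g := h m%:~R w `|m|%N wW (hn m).
have mC : (m%:~R : R)%:C = m%:~R :> C by rewrite rmorph_int.
rewrite mC in g; set n := `|m|%N in g *.
have tn : 0 <= t ^+ n by rewrite exprn_ge0.
have Ktn : K * t ^+ n <= K * (2 * t) ^+ n by apply: ler_wpM2l.
have T0 : 0 <= (2 * t) ^+ n by rewrite exprn_ge0 // mulr_ge0.
split; first by apply: le_trans g _; rewrite mulrDl; apply: le_trans Ktn _; rewrite lerDl mulr_ge0.
rewrite /dgauss mdM mdM md_i2pi mdM.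
apply: (@le_trans _ _ (A * K * (2 * t) ^+ n)); last by rewrite [leRHS]mulrDl lerDr mulr_ge0.
have zle : md (m%:~R + w) <= (1 + W) * 2 ^+ n.
  apply: le_trans (mdD _ _) _; rewrite -mC md_real hn -/n.
  have n2 : n%:R <= 2 ^+ n :> R by rewrite -natrX ler_nat ltnW // ltn_expl.
  have n1 : 1 <= 2 ^+ n :> R by rewrite exprn_ege1 // ler1n.
  by have := ler_wpM2l W0 n1; rewrite mulrDl; lra.
have -> : A * K * (2 * t) ^+ n = 2 * pi * (md sigma * ((1 + W) * 2 ^+ n)) * (K * t ^+ n).
  by rewrite exprMn /A; ring.
apply: ler_pM; rewrite ?md_ge0 //.
  by apply: mulr_ge0; apply: mulr_ge0 => //; exact: md_ge0.
by apply: ler_wpM2l; [exact: mulr_ge0|apply: ler_wpM2l].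
Qed.

Definition Jint (sigma zeta : C) (N : nat) : C :=
  \sum_(n < 2 * N) cint (fun x => gauss sigma ((x + n%:R - N%:R)%:C + zeta)).

(** The integral of the Gaussian over the real line, cut into unit intervals. *)
Definition gconst (sigma : C) : C := zs (fun m => cint (fun x => gauss sigma (m%:~R + x%:C))).

Lemma node_int (x : R) n N : (x + n%:R - N%:R)%:C = (n%:Z - N%:Z)%:~R + x%:C.
Proof. by rewrite -addrA addrC rmorphD rmorphB !rmorph_nat rmorphB. Qed.

Lemma cderiv_lin (c d : C) : cderiv (fun x => c + x%:C * d) (fun=> d).
Proof.
apply: cderiv_ext (cderivD (cderiv_cst c) (cderivM (@cderiv_id R) (cderiv_cst d))) _ => x.
by rewrite add0r mul1r mulr0 addr0.
Qed.

Lemma ccont_gauss sigma (c d : C) : ccont (fun x => gauss sigma (c + x%:C * d)).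
Proof. exact: cderiv_ccont (cderiv_gauss sigma (cderiv_lin c d)). Qed.

Lemma ccont_gauss1 sigma (c : C) : ccont (fun x => gauss sigma (c + x%:C)).
Proof.
have := ccont_gauss sigma c 1.
by have -> : (fun x => gauss sigma (c + x%:C * 1)) = (fun x => gauss sigma (c + x%:C)) by apply: funext => x; rewrite mulr1.
Qed.

Lemma Jint_tends0 sigma : 0 < Im sigma -> ctends (Jint sigma 0) (gconst sigma).
Proof.
move=> s0; have [K [t [K0 ht h]]] := gauss_decay_int s0 ler01.
apply: (ctends_ext (u := fun N => \sum_(n < 2 * N) (fun m : int => cint (fun x => gauss sigma (m%:~R + x%:C))) (n%:Z - N%:Z))).
  by move=> N; apply: eq_bigr => n _; apply: eq_cint => x _; rewrite node_int addr0.
apply: zs_tends; apply: (zgeo_abs (K := K) ht) => m.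
apply: md_cint_bound => [|x /andP[x0 x1]]; first exact: ccont_gauss1.
have xW : md x%:C <= 1 by rewrite md_real ger0_norm.
by have [] := h m _ xW.
Qed.

(** The line of integration is translated by zeta; the ends of the strip contribute O(t^n). *)
Lemma Jint_tends sigma zeta : 0 < Im sigma -> ctends (Jint sigma zeta) (gconst sigma).
Proof.
move=> s0; apply: ctends_squeeze (Jint_tends0 s0) _ => e e0.
have [K [t [K0 ht h]]] := gauss_decay_int s0 (md_ge0 zeta).
have [N hN] := geo_small (md zeta * K * 2) ht e0; exists N => n /hN; apply: le_lt_trans.
have /andP[t0 _] := ht.
have b0 : 0 <= md zeta * K * 2 * t ^+ n by rewrite !mulr_ge0 ?md_ge0 // exprn_ge0.
apply: (le_trans _ (@homotopy_bound R sigma 1 0 zeta n _ b0 _)).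
  rewrite mdBC le_eqVlt; apply/orP; left; apply/eqP; congr (md (_ - _)); apply: eq_bigr => k _; apply: eq_cint => x _.
    by rewrite mulr0 addr0 !mul1r.
  by rewrite rmorph0 !mul0r !addr0 !mul1r.
move=> s /andP[s0' s1].
have zW : md (s%:C * zeta) <= md zeta.
  by rewrite mdM md_real ger0_norm // -[leRHS]mul1r ler_wpM2r ?md_ge0.
rewrite !mulr0 !addr0 !mul0r !add0r !mul1r !(mdM zeta).
have [h1 _] := h n%:Z _ zW; have [h2 _] := h (- n%:Z) _ zW.
rewrite abszN in h2; rewrite rmorphN !rmorph_nat.
move: h1 h2; rewrite mulrNz -!pmulrn /= => h1 h2.
have := ler_wpM2l (md_ge0 zeta) h1; have := ler_wpM2l (md_ge0 zeta) h2; lra.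
Qed.

Lemma eps_n_geo (K t e : R) : 0 <= t < 1 -> 0 < e -> exists N, forall n, (N <= n)%N -> K * (n%:R * t ^+ n) < e.
Proof. by move=> ht e0; have [N hN] := n_geo_small K ht e0; exists N => n /hN; rewrite mulrA. Qed.

Let ii : C := 0 +i* 1.

(** The substitution z = beta x turns exp of the form sigma into that of i on a rotated line. The
    condition |Im beta| < Re beta keeps the integrand decaying while the line turns from slope 1 to
    beta. *)
Lemma gconst_rot sigma beta : 0 < Im sigma -> ii * beta ^+ 2 = sigma -> `|Im beta| < Re beta ->
  beta * gconst sigma = gconst ii.
Proof.
move=> s0 bs bre; have p0 := pi_gt0 R.
have i0 : 0 < Im ii by rewrite /= ltr01.
apply: (ctends_uniq (ctendsZ beta (Jint_tends0 s0))).
apply: ctends_squeeze (Jint_tends0 i0) _ => e e0.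
pose d := Num.min 1 (Re beta - `|Im beta|).
have d0 : 0 < d by rewrite /d lt_min ltr01 subr_gt0.
pose t := expR (- (pi * d ^+ 2)).
have ht : 0 <= t < 1 by rewrite /t expR_ge0 expR_lt1 oppr_lt0 mulr_gt0 // exprn_gt0.
have [N hN] := eps_n_geo (md (beta - 1) * 2) ht e0; exists N => n /hN; apply: le_lt_trans.
have /andP[t0 t1] := ht.
have b0 : 0 <= md (beta - 1) * 2 * (n%:R * t ^+ n).
  by apply: mulr_ge0; apply: mulr_ge0; rewrite ?md_ge0 // exprn_ge0.
apply: (le_trans _ (@homotopy_bound R ii 1 (beta - 1) 0 n _ b0 _)).
  rewrite mdBC /Jint mulr_sumr le_eqVlt; apply/orP; left; apply/eqP; congr (md (_ - _)); apply: eq_bigr => k _.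
    rewrite -cintZ; last first.
      have -> : (fun x => gauss sigma ((x + k%:R - n%:R)%:C + 0)) = (fun x => gauss sigma ((k%:Z - n%:Z)%:~R + x%:C)).
        by apply: funext => x; rewrite node_int addr0.
      exact: ccont_gauss1.
    apply: eq_cint => x _; have -> : 1 + 1%:C * (beta - 1) = beta by rewrite rmorph1; ring.
    rewrite mulr0 !addr0; congr (_ * _).
    by rewrite /gauss exprMn (mulrA ii) bs.
  by apply: eq_cint => x _; rewrite rmorph0 !mul0r !addr0 !mul1r.
move=> s /andP[s0' s1]; set al := 1 + s%:C * (beta - 1).
(* Re - |Im| is concave, so along the segment from 1 to beta it stays above the smaller of its end
   values. *)
have ar : d <= Re al - `|Im al|.
  have -> : Re al = 1 + s * (Re beta - 1) by rewrite /al; case: (beta) => u v /=; ring.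
  have -> : Im al = s * Im beta by rewrite /al; case: (beta) => u v /=; ring.
  rewrite normrM ger0_norm //.
  have d1 : d <= 1 by rewrite /d ge_min lexx.
  have d2 : d <= Re beta - `|Im beta| by rewrite /d ge_min lexx orbT.
  have := ler_wpM2l s0' d2; have : (1 - s) * d <= (1 - s) * 1 by rewrite ler_wpM2l // subr_ge0.
  lra.
have gb (y : R) : y ^+ 2 = n%:R ^+ 2 -> md (gauss ii (al * y%:C)) <= t ^+ n.
  move=> yn; rewrite md_gauss -expRM_natl ler_expR; apply: (@le_trans _ _ (- (pi * (d ^+ 2 * n%:R ^+ 2)))).
    rewrite lerN2 ler_pM2l // -yn.
    have -> : Im (ii * (al * y%:C) ^+ 2) = (Re al ^+ 2 - Im al ^+ 2) * y ^+ 2.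
      by case: (al) => u v; rewrite /ii /=; ring.
    apply: ler_wpM2r; first exact: sqr_ge0.
    have q0 := normr_ge0 (Im al).
    rewrite -[Im al ^+ 2]real_normK ?num_real //; nra.
  rewrite [leRHS]mulrN lerN2.
  have -> : n%:R * (pi * d ^+ 2) = pi * (d ^+ 2 * n%:R) by ring.
  rewrite ler_pM2l // ler_pM2l ?exprn_gt0 //.
  case: n {hN b0 yn} => [|n]; first by rewrite expr2 mulr0.
  by rewrite expr2 ler_peMl // ler1n.
rewrite !mulr0 !addr0 !(mdM ((beta - 1) * _)) !(mdM (beta - 1)) !md_real normrN normr_nat.
have h1 := gb n%:R (erefl _); have h2 := gb (- n%:R) (sqrrN _).
have n0 : 0 <= md (beta - 1) * n%:R by rewrite mulr_ge0 ?md_ge0.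
have := ler_wpM2l n0 h1; have := ler_wpM2l n0 h2; lra.
Qed.

Lemma bisum_geo (K t : R) (f : int -> R) N : 0 <= K -> 0 <= t < 1 -> (forall m, f m <= K * t ^+ `|m|%N) ->
  \sum_(n < 2 * N) f (n%:Z - N%:Z) <= 2 * K / (1 - t).
Proof.
move=> K0 ht h; have /andP[t0 t1] := ht; rewrite bisum.
apply: (@le_trans _ _ (\sum_(n < N) (2 * K) * t ^+ n)).
  apply: ler_sum => n _; have := h (n : nat)%:Z; have := h (Negz n); rewrite absz_nat /= => h1 h2.
  have : t ^+ n.+1 <= t ^+ n by rewrite ler_wiXn2l // ltW.
  by move=> /(ler_wpM2l K0); lra.
by rewrite -mulr_sumr; apply: ler_wpM2l; [exact: mulr_ge0|exact: geo_sum_le].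
Qed.

Section Summation.
Variables (sigma : C) (a : R).
Hypothesis s0 : 0 < Im sigma.

Let F (N : nat) (x : R) : C := \sum_(n < 2 * N) gauss sigma (((n%:Z - N%:Z)%:~R + a%:C) + x%:C).
Let b (m : int) : C := e2pi (- (m%:~R * a%:C) - m%:~R ^+ 2 / (2 * sigma)).

Let sn0 : sigma != 0. Proof. exact: Im_gt0_neq0. Qed.

Let F_cont N : ccont (F N).
Proof. by apply: ccont_sum => n; exact: ccont_gauss1. Qed.

(** Completing the square moves the frequency m into a shift m/sigma of the line of integration; the
    integer part of the exponent disappears. *)
Lemma gauss_fourier m N : cint (fun x => e2pi (m%:~R * x%:C) * F N x) = b m * Jint sigma (a%:C + m%:~R / sigma) N.
Proof.
rewrite /Jint mulr_sumr.
have -> : (fun x => e2pi (m%:~R * x%:C) * F N x) = (fun x => \sum_(n < 2 * N) (b m * gauss sigma ((x + n%:R - N%:R)%:C + (a%:C + m%:~R / sigma)))).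
  apply: funext => x; rewrite mulr_sumr; apply: eq_bigr => n _.
  rewrite node_int /gauss /b -!e2piD.
  set k := n%:Z - N%:Z.
  have -> : m%:~R * x%:C + sigma * (k%:~R + a%:C + x%:C) ^+ 2 / 2 =
    (- (m%:~R * a%:C) - m%:~R ^+ 2 / (2 * sigma) + sigma * (k%:~R + x%:C + (a%:C + m%:~R / sigma)) ^+ 2 / 2) + (- (m * k))%:~R :> C.
    by rewrite rmorphN rmorphM /=; field; rewrite sn0.
  by rewrite [LHS]e2piD e2pi_int mulr1.
have cc (n : nat) : ccont (fun x => gauss sigma ((x + n%:R - N%:R)%:C + (a%:C + m%:~R / sigma))).
  have -> : (fun x => gauss sigma ((x + n%:R - N%:R)%:C + (a%:C + m%:~R / sigma))) =
    (fun x => gauss sigma (((n%:Z - N%:Z)%:~R + (a%:C + m%:~R / sigma)) + x%:C)).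
    by apply: funext => x; rewrite node_int addrAC.
  exact: ccont_gauss1.
rewrite cint_sum => [|n]; last by apply: ccontM; [exact: ccont_cst|exact: cc].
by apply: eq_bigr => n _; rewrite cintZ.
Qed.

Let W := `|a| + 1.
Let W0 : 0 <= W. Proof. by rewrite addr_ge0. Qed.

Let aW (x : R) : 0 <= x <= 1 -> md (a%:C + x%:C) <= W.
Proof.
move=> /andP[x0 x1]; rewrite -rmorphD md_real; apply: le_trans (ler_normD _ _) _.
by rewrite lerD2l ger0_norm.
Qed.

Let F_lip : exists2 L, 0 <= L & forall N x y, 0 <= x <= 1 -> 0 <= y <= 1 -> md (F N x - F N y) <= L * `|x - y|.
Proof.
have [K [t [K0 ht h]]] := gauss_decay_int s0 W0; have /andP[t0 t1] := ht.
exists (2 * K / (1 - t)) => [|N x y hx hy]; first by rewrite divr_ge0 ?mulr_ge0 // subr_ge0 ltW.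
rewrite /F -sumrB; apply: le_trans (md_sum _ _ _) _.
pose f (m : int) := K * t ^+ `|m|%N * `|x - y|.
apply: (@le_trans _ _ (\sum_(n < 2 * N) f (n%:Z - N%:Z))); last first.
  by rewrite -mulr_suml; apply: ler_wpM2r => //; apply: (@bisum_geo K t (fun m => K * t ^+ `|m|%N)).
apply: ler_sum => n _; rewrite /f; set m := n%:Z - N%:Z.
have -> : gauss sigma (m%:~R + a%:C + x%:C) - gauss sigma (m%:~R + a%:C + y%:C) =
  cint (fun s => (x - y)%:C * dgauss sigma ((m%:~R + a%:C + y%:C) + s%:C * (x - y)%:C)).
  rewrite (cint_deriv (cderiv_gauss sigma (cderiv_lin _ _))).
    by rewrite rmorph0 mul0r addr0 rmorph1 mul1r rmorphB; congr (gauss _ _ - _); ring.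
  apply: ccontM; first exact: ccont_cst.
  apply: ccontM; last exact: ccont_gauss.
  apply: ccontM; first exact: ccont_cst.
  apply: ccontM; first exact: ccont_cst.
  exact: cderiv_ccont (cderiv_lin _ _).
apply: md_cint_bound => [|s /andP[s0' s1]].
  apply: ccontM; first exact: ccont_cst.
  apply: ccontM; last exact: ccont_gauss.
  apply: ccontM; first exact: ccont_cst.
  apply: ccontM; first exact: ccont_cst.
  exact: cderiv_ccont (cderiv_lin _ _).
rewrite mdM md_real mulrC; apply: ler_wpM2r => //.
have -> : m%:~R + a%:C + y%:C + s%:C * (x - y)%:C = m%:~R + (a%:C + (y + s * (x - y))%:C).
  by rewrite !(rmorphD, rmorphM, rmorphN) /=; ring.
have zW : md (a%:C + (y + s * (x - y))%:C) <= W.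
  by apply: aW; have /andP[x0 x1] := hx; have /andP[y0 y1] := hy; apply/andP; split; nra.
by have [] := h m _ zW.
Qed.

Let gz := zs (fun m => gauss sigma (m%:~R + a%:C)).

Let gz_geo : zgeo (fun m => gauss sigma (m%:~R + a%:C)).
Proof.
have [K [t [K0 ht h]]] := gauss_decay_int s0 (normr_ge0 a).
apply: (zgeo_abs (K := K) ht) => m; have aa : md a%:C <= `|a| by rewrite md_real.
by have [] := h m _ aa.
Qed.

Let F_tends : ctends (fun N => F N 0) gz.
Proof.
by apply: ctends_ext (zs_tends gz_geo) => N; apply: eq_bigr => n _; rewrite addr0.
Qed.

(** Shifting x by 1 exchanges only the two extreme terms of the truncated sum. *)
Let F_per e : 0 < e -> exists N, forall n, (N <= n)%N -> md (F n 1 - F n 0) < e.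
Proof.
move=> e0; have [K [t [K0 ht h]]] := gauss_decay_int s0 (normr_ge0 a).
have [N hN] := geo_small (K + K) ht e0; exists N => n /hN; apply: le_lt_trans.
rewrite /F -sumrB.
have -> : \sum_(i < 2 * n) (gauss sigma ((i%:Z - n%:Z)%:~R + a%:C + 1%:C) - gauss sigma ((i%:Z - n%:Z)%:~R + a%:C + 0%:C))
  = gauss sigma (n%:Z%:~R + a%:C) - gauss sigma ((- n%:Z)%:~R + a%:C).
  rewrite -(big_mkord xpredT (fun i => gauss sigma ((i%:Z - n%:Z)%:~R + a%:C + 1%:C) - gauss sigma ((i%:Z - n%:Z)%:~R + a%:C + 0%:C))).
  rewrite (eq_bigr (fun i => gauss sigma ((i.+1%:Z - n%:Z)%:~R + a%:C) - gauss sigma ((i%:Z - n%:Z)%:~R + a%:C))).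
    rewrite (telescope_sumr (fun i => gauss sigma ((i%:Z - n%:Z)%:~R + a%:C))) //.
    have -> : (2 * n)%N%:Z - n%:Z = n%:Z by lia.
    by rewrite sub0r.
  move=> i _; rewrite addr0; congr (gauss _ _ - _).
  have -> : i.+1%:Z - n%:Z = (i%:Z - n%:Z) + 1 by lia.
  by rewrite rmorphD rmorph1; ring.
apply: le_trans (mdB _ _) _; rewrite mulrDl.
have aa : md a%:C <= `|a| by rewrite md_real.
have [h1 _] := h n%:Z _ aa; have [h2 _] := h (- n%:Z) _ aa; rewrite abszN in h2.
exact: lerD.
Qed.

Hypothesis b_geo : zgeo b.

(** For fixed n the Fejer means of the truncated sums converge as N grows, because each Fourier
    coefficient does; the estimate is uniform in N. Then n grows, and [cesaro] identifies the means
    with the dual sum. Near x = 1 the function is compared with its value at 1 and [F_per] returns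
    to 0, whence the minimum of x and 1 - x. *)
Theorem poisson_gauss : gz = gconst sigma * zs b.
Proof.
have [L L0 hL] := F_lip; have [k k0 hk] := md_1e2pi_ge.
have step n e : (0 < n)%N -> 0 < e ->
   md (n%:R^-1 * (\sum_(j < n) \sum_(l < n) b (j%:Z - l%:Z) * gconst sigma) - gz) <= L * k * (e + (n%:R * e)^-1) + e.
  move=> n0 e0; have [N0 hN0] := F_per e0.
  apply: (@ctends_le_near (fun N => n%:R^-1 * (\sum_(j < n) \sum_(l < n) cint (fun x => e2pi ((j%:Z - l%:Z)%:~R * x%:C) * F N x)) - F N 0) _ _ N0).
    have F_tendsN : ctends (fun N => - F N 0) (- gz).
      by rewrite -mulN1r; apply: ctends_ext (ctendsZ (-1) F_tends) => N; rewrite mulN1r.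
    apply: ctendsD F_tendsN; apply: ctendsZ; apply: ctends_sum => j; apply: ctends_sum => l.
    apply: (ctends_ext (u := fun N => b (j%:Z - l%:Z) * Jint sigma (a%:C + (j%:Z - l%:Z)%:~R / sigma) N)).
      by move=> N; rewrite gauss_fourier.
    by apply: ctendsZ; exact: Jint_tends.
  move=> N NN; apply: fejer => //; first exact: mulr_ge0.
  move=> x hx; have /andP[x0 x1] := hx.
  apply: (@le_trans _ _ (L * Num.min x (1 - x) + e)); last first.
    by rewrite lerD2r -mulrA; apply: ler_wpM2l => //; exact: hk.
  have [xl|xg] := leP x (1 - x).
    have := hL N x 0 hx; rewrite lexx ler01 => /(_ isT); rewrite subr0 ger0_norm // => hh.
    by apply: le_trans hh _; rewrite lerDl ltW.
  have -> : F N x - F N 0 = (F N x - F N 1) + (F N 1 - F N 0) by ring.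
  apply: le_trans (mdD _ _) _; apply: lerD; last by apply/ltW/hN0.
  have := hL N x 1 hx; rewrite lexx ler01 => /(_ isT); rewrite distrC ger0_norm ?subr_ge0 //.
apply/eqP; rewrite eq_sym -subr_eq0; apply/eqP; apply: md_le0 => e e0.
pose M := 2 * (L * k) + 1.
have M0 : 0 < M by rewrite /M ltr_wpDl // mulr_ge0 // mulr_ge0.
pose e1 := e / M; have e10 : 0 < e1 by rewrite divr_gt0.
have [N hN] := eps_small (e1^-1) e10.
have C1 := ctendsZ (gconst sigma) (cesaro b_geo).
have C2 : ctends (fun n => gconst sigma * (n%:R^-1 * \sum_(j < n) \sum_(l < n) b (j%:Z - l%:Z)) + - gz) (gconst sigma * zs b + - gz).
  by apply: ctendsD => //; exact: ctends_cst.
apply: (ctends_le_near (N0 := N.+1) C2) => n Nn.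
have n0 : (0 < n)%N by case: n Nn.
have := step n e1 n0 e10.
have -> : n%:R^-1 * (\sum_(j < n) \sum_(l < n) b (j%:Z - l%:Z) * gconst sigma) = gconst sigma * (n%:R^-1 * \sum_(j < n) \sum_(l < n) b (j%:Z - l%:Z)).
  under eq_bigr do rewrite -mulr_suml.
  by rewrite -mulr_suml; ring.
move=> h; apply: le_trans h _.
have := hN n (ltnW Nn); rewrite -invfM mulrC => h1.
have : L * k * (n%:R * e1)^-1 <= L * k * e1 by apply: ler_wpM2l; [exact: mulr_ge0|exact: ltW].
have -> : e = M * e1 by rewrite /e1 mulrC mulfVK // gt_eqF.
rewrite /M; lra.
Qed.

End Summation.

Lemma gauss_zgeo sigma (a : R) : 0 < Im sigma -> zgeo (fun m => gauss sigma (m%:~R + a%:C)).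
Proof.
move=> s0; have [K [t [K0 ht h]]] := gauss_decay_int s0 (normr_ge0 a).
apply: (zgeo_abs (K := K) ht) => m; have aa : md a%:C <= `|a| by rewrite md_real.
by have [] := h m _ aa.
Qed.

Lemma intC (m : int) (a : R) : m%:~R * a%:C = (m%:~R * a)%:C :> C.
Proof. by rewrite rmorphM rmorph_int. Qed.

Lemma gauss_dual_zgeo sigma (a : R) : 0 < Im sigma -> zgeo (fun m => e2pi (- (m%:~R * a%:C)) * gauss (- sigma^-1) m%:~R).
Proof.
move=> s0; apply: zgeo_le (gauss_zgeo 0 (Im_invN_gt0 s0)) _ => m.
by rewrite addr0 mdM intC -rmorphN md_e2pi_real mul1r.
Qed.

Lemma poisson_dual sigma a : 0 < Im sigma ->
  zs (fun m => gauss sigma (m%:~R + a%:C)) = gconst sigma * zs (fun m => e2pi (- (m%:~R * a%:C)) * gauss (- sigma^-1) m%:~R).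
Proof.
move=> s0; have E (m : int) : e2pi (- (m%:~R * a%:C)) * gauss (- sigma^-1) m%:~R =
   e2pi (- (m%:~R * a%:C) - m%:~R ^+ 2 / (2 * sigma)) :> C.
  by rewrite /gauss -e2piD; congr e2pi; field; rewrite Im_gt0_neq0.
rewrite poisson_gauss //; last first.
  have -> : (fun m : int => e2pi (- (m%:~R * a%:C) - m%:~R ^+ 2 / (2 * sigma))) = (fun m : int => e2pi (- (m%:~R * a%:C)) * gauss (- sigma^-1) m%:~R).
    by apply: funext => m; rewrite E.
  exact: gauss_dual_zgeo.
by congr (_ * _); apply: eq_zs => m; rewrite E.
Qed.

(** The form i with shift 0 is self-dual, so Poisson summation reads Z = gconst(i) Z; here Z is
    nonzero because its terms are nonnegative and the one at m = 0 is 1. No Gaussian integral is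
    evaluated. *)
Lemma gconst_i : gconst ii = 1.
Proof.
have i0 : 0 < Im ii by rewrite /= ltr01.
have iV : - ii^-1 = ii.
  have i2 : ii * ii = -1 by apply: complex_eqP; rewrite ?cReM ?cImM /=; ring.
  by apply: (mulfI (Im_gt0_neq0 i0)); rewrite mulrN mulfV ?Im_gt0_neq0 // i2.
have := poisson_dual 0 i0.
have -> : (fun m : int => gauss ii (m%:~R + 0%:C)) = (fun m : int => gauss ii m%:~R).
  by apply: funext => m; rewrite addr0.
have -> : (fun m : int => e2pi (- (m%:~R * 0%:C)) * gauss (- ii^-1) m%:~R) = (fun m : int => gauss ii m%:~R).
  by apply: funext => m; rewrite mulr0 oppr0 e2pi0 mul1r iV.
set Z := zs _ => E.
have : Z != 0.
  apply/eqP => Z0.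
  have zg : zgeo (fun m : int => gauss ii m%:~R).
    by apply: zgeo_le (gauss_zgeo 0 i0) _ => m; rewrite addr0.
  have [N hN] := zs_tends zg ltr01.
  have := hN N.+1 (leqnSn _); rewrite -/Z Z0 subr0 => h.
  have : 1 <= md (\sum_(n < 2 * N.+1) gauss ii (n%:Z - N.+1%:Z)%:~R).
    have gp (m : int) : 0 <= Re (gauss ii m%:~R) /\ (m = 0 -> Re (gauss ii m%:~R) = 1).
      have -> : gauss ii m%:~R = (expR (- (pi * m%:~R ^+ 2)))%:C.
        have -> : m%:~R = (m%:~R)%:C :> C by rewrite rmorph_int.
        rewrite /gauss.
        Transparent e2pi.
        rewrite /e2pi.
        Opaque e2pi.
        have -> : ii * (m%:~R)%:C ^+ 2 / 2 = 0 +i* (m%:~R ^+ 2 / 2).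
          by rewrite -[2]/(2%:R) -(rmorph_nat (real_complex R)) -fmorphV; apply: complex_eqP; rewrite ?cReM ?cImM /=; ring.
        rewrite /= mulr0 cos0 sin0 -[1 +i* 0]/(1 : C) mulr1; congr ((expR _)%:C); by field.
      by split=> [|->]; rewrite /= ?expR_ge0 // expr0n mulr0 oppr0 expR0.
    apply: le_trans (md_Re _); apply: le_trans (ler_norm _); rewrite Re_sum.
    have nl : (N.+1 < 2 * N.+1)%N by lia.
    rewrite (bigD1 (Ordinal nl)) //= subrr (gp 0).2 // lerDl; apply: sumr_ge0 => k _.
    by case: (gp (k%:Z - N.+1%:Z)).
  by move=> /le_lt_trans/(_ h); rewrite ltxx.
by move=> Zn; apply: (mulIf Zn); rewrite mul1r -E.
Qed.

Theorem theta_inversion sigma beta a : 0 < Im sigma -> ii * beta ^+ 2 = sigma -> `|Im beta| < Re beta ->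
  beta * zs (fun m => gauss sigma (m%:~R + a%:C)) =
  zs (fun m => e2pi (- (m%:~R * a%:C)) * gauss (- sigma^-1) m%:~R).
Proof.
by move=> s0 bs bre; rewrite poisson_dual // mulrA (gconst_rot s0 bs bre) gconst_i mul1r.
Qed.

Lemma zs_res (d : nat) (r : nat) (f : int -> C) : (r < d)%N -> zgeo f ->
  zgeo (fun m => f (d%:Z * m + r%:Z)) ->
  zs (fun m => f (d%:Z * m + r%:Z)) = zs (fun m => ((m %% d)%Z == r%:Z)%:R * f m).
Proof.
move=> rd hf hg; apply: zs_uniq => //.
have hf' : zgeo (fun m => ((m %% d)%Z == r%:Z)%:R * f m).
  apply: zgeo_le hf _ => m; rewrite mdM md_natr.
  by case: eqP => _; rewrite ?mul1r // mul0r md_ge0.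
have sub (u : nat -> C) l : ctends u l -> ctends (fun N => u (d * N)%N) l.
  move=> h e /h [N hN]; exists N => n Nn; apply: hN; apply: leq_trans Nn _.
  by rewrite leq_pmull // (leq_trans _ rd).
apply: ctends_ext (sub _ _ (zs_tends hf')) => N.
rewrite -(big_mkord xpredT (fun n => (((n%:Z - (d * N)%N%:Z) %% d)%Z == r%:Z)%:R * f (n%:Z - (d * N)%N%:Z))).
have -> : (2 * (d * N) = 2 * N * d)%N by lia.
rewrite big_nat_mul big_mkord; apply: eq_bigr => k _.
rewrite [(\sum_(_ <= _ < _) _)](_ : _ = \sum_(0 <= j < d) (j == r)%:R * f (d%:Z * (k%:Z - N%:Z) + j%:Z)).
  rewrite big_mkord (bigD1 (Ordinal rd)) //= eqxx mul1r big1 ?addr0 // => j.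
  by rewrite -val_eqE /= => /negbTE ->; rewrite mul0r.
rewrite -{1}[(k * d)%N]add0n big_addn.
have -> : (k.+1 * d - k * d = d)%N by rewrite mulSn addnK.
apply: eq_big_nat => j /andP[_ jd].
have -> : (j + k * d)%N%:Z - (d * N)%N%:Z = d%:Z * (k%:Z - N%:Z) + j%:Z by lia.
by rewrite {1}[d%:Z * _]mulrC modzMDl modz_small ?jd // eqz_nat.
Qed.

End Poisson.

(** * Theta series with characteristics *)

Section Thetas.
Variable R : realType.
Local Notation C := R[i].
Local Notation md := (@md R).
Local Notation PS := (@PS R).
Local Notation Re := complex.Re.
Local Notation Im := complex.Im.
Local Notation wq := (@wq R).
Let ii : C := 0 +i* 1.

Definition tser (c : nat) (chi : int -> C) (tau : C) : C :=
  zs (fun m => chi m * wq tau ^+ (c * `|m| ^ 2)).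

(** Each integer occurs once, as n or as -(n+1); for c > 0 a solution of c m^2 = k has |m| <= k, so
    the finite range is enough. *)
Definition tcoef (c : nat) (chi : int -> C) (k : nat) : C :=
  \sum_(n < k.+1) ((c * n ^ 2 == k)%N%:R * chi n%:Z + (c * n.+1 ^ 2 == k)%N%:R * chi (Negz n)).

Lemma tcoef0 c chi k : (forall m : int, (c * `|m| ^ 2)%N = k -> chi m = 0) -> tcoef c chi k = 0.
Proof.
move=> h; rewrite /tcoef big1 // => n _.
case: eqP => [e|_]; last rewrite mul0r add0r; case: eqP => [e'|_]; rewrite ?mul0r ?mul1r ?addr0 //.
- by rewrite (h (nat_of_ord n)%:Z e) (h (Negz n) e') addr0.
- exact: (h (nat_of_ord n)%:Z e).
- exact: (h (Negz n) e').
Qed.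

Lemma tcoef_sq c chi n : (0 < c)%N -> (0 < n)%N -> tcoef c chi (c * n ^ 2) = chi n%:Z + chi (- n%:Z).
Proof.
move=> c0 n0; case: n n0 => // n _; rewrite /tcoef big_split /=.
have lt1 : (n.+1 < (c * n.+1 ^ 2).+1)%N by rewrite ltnS; nia.
have lt2 : (n < (c * n.+1 ^ 2).+1)%N by rewrite ltnS; nia.
have eqc m : (c * m ^ 2 == c * n.+1 ^ 2)%N = (m == n.+1) by rewrite eqn_pmul2l // eqn_exp2r.
rewrite (bigD1 (Ordinal lt1)) //= eqc eqxx mul1r big1 ?addr0; last first.
  by move=> i; rewrite -val_eqE /= eqc => /negbTE ->; rewrite mul0r.
rewrite (bigD1 (Ordinal lt2)) //= eqc eqxx mul1r big1 ?addr0 -?NegzE //.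
by move=> i; rewrite -val_eqE /= eqc eqSS => /negbTE ->; rewrite mul0r.
Qed.

Lemma tcoef_0 c chi : (0 < c)%N -> tcoef c chi 0 = chi 0.
Proof.
move=> c0; rewrite /tcoef big_ord_recl big_ord0 addr0 muln0 eqxx mul1r.
by rewrite (_ : (c * 1 ^ 2 == 0)%N = false) ?mul0r ?addr0 //; apply/eqP; lia.
Qed.

Lemma ind_sum (M e : nat) (g : nat -> C) : \sum_(k < M) (e == k :> nat)%:R * g k = if (e < M)%N then g e else 0.
Proof.
case: ifP => eM.
  rewrite (bigD1 (Ordinal eM)) //= eqxx mul1r big1 ?addr0 // => k; rewrite -val_eqE /= eq_sym.
  by move/negbTE ->; rewrite mul0r.
rewrite big1 // => k _; case: eqP => [ek|]; last by rewrite mul0r.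
by rewrite ek ltn_ord in eM.
Qed.

Lemma tcoef_widen c chi k M : (0 < c)%N -> (k < M)%N -> tcoef c chi k =
  \sum_(n < M) ((c * n ^ 2 == k)%N%:R * chi n%:Z + (c * n.+1 ^ 2 == k)%N%:R * chi (Negz n)).
Proof.
move=> c0 kM; rewrite /tcoef.
rewrite (big_ord_widen_cond M xpredT (fun n => (c * n ^ 2 == k)%N%:R * chi n%:Z + (c * n.+1 ^ 2 == k)%N%:R * chi (Negz n))) //.
rewrite big_mkcond; apply: eq_bigr => n _ /=; case: ltnP => // nk.
have -> : (c * n ^ 2 == k)%N = false by apply/eqP; nia.
have -> : (c * n.+1 ^ 2 == k)%N = false by apply/eqP; nia.
by rewrite !mul0r addr0.
Qed.

Lemma tser_zgeo c chi tau : (0 < c)%N -> (forall m, md (chi m) <= 1) -> 0 < Im tau ->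
  zgeo (fun m => chi m * wq tau ^+ (c * `|m| ^ 2)).
Proof.
move=> c0 h t0; have w1 := md_wq_lt1 t0.
apply: (@zgeo_abs _ _ 1 (md (wq tau))) => [|m]; first by rewrite md_ge0.
rewrite mdM mdX; apply: ler_pM; rewrite ?md_ge0 ?exprn_ge0 ?md_ge0 //.
by rewrite ler_wiXn2l ?md_ge0 ?(ltW w1) //; nia.
Qed.

Lemma good_lin (a : nat -> C) (K : R) : (forall k, md (a k) <= K * k.+1%:R) -> good a.
Proof.
move=> h r /andP[r0 r1]; exists (K * ((1 - r)^-1 + 1)) => k.
have K0 : 0 <= K by have := h 0%N; rewrite mulr1; exact/le_trans/md_ge0.
apply: (@le_trans _ _ (K * k.+1%:R * r ^+ k)).
  by apply: ler_wpM2r => //; rewrite exprn_ge0 // ltW.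
rewrite -mulrA; apply: ler_wpM2l => //; rewrite -natr1 mulrDl mul1r; apply: lerD.
  by apply: n_geo_bdd; rewrite r1 ltW.
by rewrite exprn_ile1 // ltW.
Qed.

Lemma tser_hasq c chi : (0 < c)%N -> (forall m, md (chi m) <= 1) -> hasq (tser c chi) (tcoef c chi).
Proof.
move=> c0 h.
have gd : good (tcoef c chi).
  apply: (@good_lin _ 2) => k; rewrite /tcoef; apply: le_trans (md_sum _ _ _) _.
  apply: (@le_trans _ _ (\sum_(n < k.+1) 2)); last by rewrite sumr_const card_ord mulr_natr.
  apply: ler_sum => n _; apply: le_trans (mdD _ _) _.
  have b (e : bool) m : md (e%:R * chi m) <= 1.
    by rewrite mdM md_natr; case: e; rewrite ?mul1r ?mul0r.
  by rewrite (_ : 2 = 1 + 1 :> R) //; apply: lerD; exact: b.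
split=> // tau t0; have w1 := md_wq_lt1 t0.
pose f := fun m => chi m * wq tau ^+ (c * `|m| ^ 2).
have zf : zgeo f := tser_zgeo c0 h t0.
have [K [t [ht hK]]] := zf.
apply: (@ctends_uniq _ (fun N => \sum_(k < c * N.+1 ^ 2) tcoef c chi k * wq tau ^+ k)); last first.
  move=> e /(PS_tends gd w1) [N hN]; exists N => n Nn; apply: hN; nia.
have T1 : ctends (fun N => \sum_(n < 2 * N.+1) f (n%:Z - N.+1%:Z)) (zs f) := ctends_shift (zs_tends zf).
apply: ctends_squeeze T1 _ => e e0; have [N hN] := geo_small K ht e0.
exists N => n Nn; apply: le_lt_trans (hN n Nn).
set w := wq tau.
(* Exponents below c (n+1)^2 belong to |m| <= n, whereas the window of the theta sum also contains m
   = -(n+1); this one term is the whole difference. *)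
have -> : \sum_(k < c * n.+1 ^ 2) tcoef c chi k * w ^+ k =
   \sum_(i < n.+1) (f i%:Z + f (Negz i)) - f (Negz n).
  set M := (c * n.+1 ^ 2)%N.
  have nM : (n.+1 <= M)%N by rewrite /M; nia.
  rewrite (eq_bigr (fun k : 'I_M => \sum_(i < M) ((c * i ^ 2 == k)%N%:R * (chi i%:Z * w ^+ k) + (c * i.+1 ^ 2 == k)%N%:R * (chi (Negz i) * w ^+ k)))); last first.
    move=> k _; rewrite (tcoef_widen _ c0 (ltn_ord k)) mulr_suml; apply: eq_bigr => i _.
    by rewrite mulrDl -!mulrA.
  rewrite exchange_big /=.
  under eq_bigr do rewrite big_split (ind_sum _ _ (fun k => chi _ * w ^+ k)) (ind_sum _ _ (fun k => chi (Negz _) * w ^+ k)).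
  rewrite !big_split /= [X in _ = _ + X - _]big_ord_recr /= addrA addrK; congr (_ + _).
    rewrite (big_ord_widen_cond M xpredT (fun i => f i%:Z)) // [RHS]big_mkcond; apply: eq_bigr => i _ /=.
    rewrite /f /= /M ltn_pmul2l // ltn_exp2r //.
  rewrite (big_ord_widen_cond M xpredT (fun i => f (Negz i))) ?(ltnW nM) // [RHS]big_mkcond; apply: eq_bigr => i _ /=.
  by rewrite /f /= /M ltn_pmul2l // ltn_exp2r.
by rewrite bisum opprD addrA subrr add0r opprK; case: (hK n).
Qed.

Lemma T_hasq f (a : nat -> C) (e : nat) : hasq f a -> (forall k, a k != 0 -> k = e %[mod 144]) ->
  forall tau, 0 < Im tau -> f (tau + 1) = e2pi (e%:R / 144%:R) * f tau.
Proof.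
move=> [ga fE] h tau t0.
have t1 : 0 < Im (tau + 1) by rewrite cImD /= addr0.
rewrite !fE //; have w1 := md_wq_lt1 t1; apply: (PS_uniq ga w1).
apply: ctends_ext (ctendsZ _ (PS_tends ga (md_wq_lt1 t0))) => n.
rewrite mulr_sumr; apply: eq_bigr => k _.
have [->|/h ke] := eqVneq (a k) 0; first by rewrite !mul0r mulr0.
rewrite mulrCA; congr (_ * _); rewrite /wq -!e2piX.
have N0 : (144%:R : C) != 0 by rewrite pnatr_eq0.
have -> : k%:R * ((tau + 1) / 144%:R) = k%:R * (tau / 144%:R) + k%:R / 144%:R by rewrite mulrDl mul1r mulrDr.
rewrite (e2piD (k%:R * (tau / 144%:R))) mulrC; congr (_ * _).
have E (j : nat) : e2pi (j%:R / 144%:R) = e2pi ((j %% 144)%:R / 144%:R) :> C.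
  rewrite {1}(divn_eq j 144) natrD mulrDl natrM mulfK // e2piD.
  by rewrite -[(j %/ 144)%:R]/((Posz (j %/ 144))%:~R) e2pi_int mul1r.
by rewrite [LHS]E -ke -E.
Qed.

(** The square root of i/tau in the right half-plane. As i/tau has positive real part, the root
    satisfies |Im| < Re, the condition of [gconst_rot]. *)
Definition jb (tau : C) : C := let s := sqrtc (ii / tau) in if 0 < Re s then s else - s.

Lemma jbP tau : 0 < Im tau -> jb tau ^+ 2 = ii / tau /\ `|Im (jb tau)| < Re (jb tau).
Proof.
move=> t0; have E : jb tau ^+ 2 = ii / tau by rewrite /jb; case: ifP => _; rewrite ?sqrrN sqr_sqrtc.
split=> //; have : 0 < Re (jb tau ^+ 2).
  rewrite E; have := Im_invN_gt0 t0; have -> : ii / tau = - (ii * - tau^-1) by rewrite mulrN opprK.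
  by case: (- tau^-1) => u v /=; rewrite mul0r sub0r opprK mul1r.
have -> : Re (jb tau ^+ 2) = Re (jb tau) ^+ 2 - Im (jb tau) ^+ 2 by case: (jb tau) => u v /=; ring.
rewrite subr_gt0 => h.
have p : 0 < Re (jb tau).
  have n0 : Re (jb tau) != 0.
    by apply: contraTneq h => ->; rewrite expr0n /= -leNgt sqr_ge0.
  move: n0; rewrite /jb; case: ifP => //= s0; rewrite cReN oppr_eq0 oppr_gt0 => n0.
  by rewrite lt_neqAle n0 leNgt s0.
by rewrite -(ger0_norm (ltW p)) -ltr_sqr ?nnegrE // !real_normK ?num_real.
Qed.

Definition ind (d r : nat) (m : int) : C := ((m %% d)%Z == r%:Z)%:R.

Lemma ind_le d r m : md (ind d r m) <= 1.
Proof. by rewrite /ind md_natr; case: eqP. Qed.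

(** With c d = 72 the exponent c m^2/144 is m^2/(2d), so the sum over m congruent to r is a Gaussian
    sum with sigma = -d/tau and shift r/d. The dual sum depends on its index only through its
    residue modulo d. *)
Lemma theta_S c d r tau : (c * d = 72)%N -> (r < d)%N -> 0 < Im tau ->
  (Num.sqrt d%:R)%:C * jb tau * tser c (ind d r) (- tau^-1) =
  \sum_(s < d) e2pi (- (r%:R * (s : nat)%:R / d%:R)) * tser c (ind d s) tau.
Proof.
move=> cd rd t0; have [j2 jr] := jbP t0.
have c0 : (0 < c)%N by case: c cd.
have d0 : (0 < d)%N by case: d cd rd; rewrite ?muln0.
have dC : d%:R != 0 :> C by rewrite pnatr_eq0 -lt0n.
have dR : 0 < d%:R :> R by rewrite ltr0n.
have tn := Im_gt0_neq0 t0.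
have cC : c%:R = 72%:R / d%:R :> C by rewrite -cd natrM mulfK.
pose sigma := d%:R * - tau^-1.
have s0 : 0 < Im sigma.
  rewrite /sigma; have := Im_invN_gt0 t0; have -> : d%:R = d%:R%:C :> C by rewrite rmorph_nat.
  by case: (- tau^-1) => u v /= h; rewrite mul0r addr0 mulr_gt0.
pose beta := (Num.sqrt d%:R)%:C * jb tau.
have sq : (Num.sqrt d%:R)%:C ^+ 2 = d%:R :> C.
  by rewrite -rmorphXn sqr_sqrtr ?ltW // rmorph_nat.
have bs : ii * beta ^+ 2 = sigma.
  have i2 : ii * ii = -1 by apply: complex_eqP; rewrite ?cReM ?cImM /=; ring.
  rewrite /beta exprMn sq j2 /sigma.
  have -> : ii * (d%:R * (ii / tau)) = (ii * ii) * (d%:R / tau) by ring.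
  by rewrite i2; ring.
have bre : `|Im beta| < Re beta.
  rewrite /beta; case: (jb tau) jr => u v /= h; rewrite !mul0r subr0 addr0 normrM ger0_norm ?sqrtr_ge0 //.
  by rewrite ltr_pM2l // sqrtr_gt0.
pose f := fun m : int => wq (- tau^-1) ^+ (c * `|m| ^ 2).
have mC (m : int) : (`|m| ^ 2)%N%:R = m%:~R ^+ 2 :> C.
  by rewrite -rmorphXn /= -[(`|m| ^ 2)%N%:R]/((`|m| ^ 2)%N%:Z%:~R) -abszX gez0_abs ?sqr_ge0.
have fE (m : int) : f m = e2pi (- tau^-1 * m%:~R ^+ 2 / (2 * d%:R)).
  rewrite /f /wq -e2piX natrM mC cC; congr e2pi.
  have n144 : 144%:R = 2 * 72%:R :> C by rewrite -natrM.
  by rewrite n144; field; rewrite ?tn ?dC ?pnatr_eq0.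
have gE (m : int) : f (d%:Z * m + r%:Z) = gauss sigma (m%:~R + (r%:R / d%:R)%:C).
  rewrite fE /gauss /sigma rmorphD rmorphM /= fmorph_div !rmorph_nat; congr e2pi.
  by field; rewrite tn dC.
have zf : zgeo f.
  have h1 (m : int) : md (1 : C) <= 1 by rewrite -[1]/(1%:R) md_natr.
  apply: zgeo_le (tser_zgeo c0 h1 (Im_invN_gt0 t0)) _ => m; by rewrite mul1r.
have zg : zgeo (fun m => f (d%:Z * m + r%:Z)).
  by apply: zgeo_le (gauss_zgeo (r%:R / d%:R) s0) _ => m; rewrite gE.
rewrite /tser -/f.
have -> : zs (fun m => ind d r m * wq (- tau^-1) ^+ (c * `|m| ^ 2)) = zs (fun m => gauss sigma (m%:~R + (r%:R / d%:R)%:C)).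
  by rewrite -(zs_res rd zf zg); apply: eq_zs => m.
rewrite (theta_inversion _ s0 bs bre).
have zh (s : nat) : zgeo (fun m => ind d s m * wq tau ^+ (c * `|m| ^ 2)) := tser_zgeo c0 (ind_le d s) t0.
apply: zs_uniq; first exact: gauss_dual_zgeo.
apply: (ctends_ext (u := fun N => \sum_(s < d) e2pi (- (r%:R * (s : nat)%:R / d%:R)) *
   \sum_(n < 2 * N) (ind d s (n%:Z - N%:Z) * wq tau ^+ (c * `|n%:Z - N%:Z| ^ 2)))); last first.
  by apply: ctends_sum => s; apply: ctendsZ; exact: zs_tends.
move=> N; under eq_bigr do rewrite mulr_sumr; rewrite exchange_big /=; apply: eq_bigr => n _.
set m := n%:Z - N%:Z.
have [s sd ms] : exists2 s, (s < d)%N & (m %% d)%Z = s%:Z.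
  have : 0 <= (m %% d)%Z by rewrite modz_ge0 //; lia.
  have : (m %% d)%Z < d by rewrite ltz_mod //; lia.
  by case: (m %% d)%Z => // s sd _; exists s.
rewrite (bigD1 (Ordinal sd)) //= big1 ?addr0 => [|i]; last first.
  by rewrite -val_eqE /= /ind ms eqz_nat eq_sym => /negbTE ->; rewrite mul0r mulr0.
rewrite /ind ms eqxx mul1r; congr (_ * _).
  have mE : m = (m %/ d)%Z * d + s%:Z by rewrite -ms -divz_eq.
  rewrite {1}mE rmorphD rmorphM /= fmorph_div !rmorph_nat.
  have -> : - (((m %/ d)%Z%:~R * d%:R + s%:R) * (r%:R / d%:R)) = - (r%:R * s%:R / d%:R) + (- ((m %/ d)%Z * r%:Z))%:~R :> C.
    by rewrite rmorphN rmorphM /=; field.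
  by rewrite e2piD e2pi_int mulr1.
rewrite /gauss /wq -e2piX natrM mC cC /sigma; congr e2pi.
have n144 : 144%:R = 2 * 72%:R :> C by rewrite -natrM.
by rewrite n144; field; rewrite ?tn ?dC ?pnatr_eq0.
Qed.

End Thetas.

(** The sum of q^(m^2/12) over m congruent to r modulo 6; [thr] is the sum of q^(m^2/4) over m
    congruent to a modulo 2. *)
HB.lock Definition usr (R : realType) (r : nat) : R[i] -> R[i] := tser 12 (ind R 6 r).
HB.lock Definition thr (R : realType) (a : nat) : R[i] -> R[i] := tser 36 (ind R 2 a).
(** This is the square of the Dedekind eta function. The proof uses only its weight, its order 12 in
    w and that it has no zero; the expression by theta series makes all three accessible. *)
HB.lock Definition eta2 (R : realType) (tau : R[i]) : R[i] :=
  usr 0 tau * usr 1 tau - usr 2 tau * usr 3 tau.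

(** * Orders, residues and nonvanishing of eta^2 *)

Section Forms.
Variable R : realType.
Local Notation C := R[i].
Local Notation md := (@md R).
Local Notation PS := (@PS R).
Local Notation Re := complex.Re.
Local Notation Im := complex.Im.
Local Notation wq := (@wq R).
Local Notation jb := (@jb R).
Local Notation conv := (@conv R).
Local Notation U := (@usr R).
Local Notation TH := (@thr R).
Local Notation E := (@eta2 R).
Let ii : C := 0 +i* 1.

(** Order at least m together with the T-eigenvalue e(e/144), encoded by the residue of the
    exponents. *)
Definition sq (f : C -> C) (m e : nat) := exists a, [/\ hasq f a, vge m a &
  forall k, a k != 0 -> k = e %[mod 144]].

Lemma sq_le f m m' e : (m' <= m)%N -> sq f m e -> sq f m' e.
Proof. by move=> mm [a [h v r]]; exists a; split=> // k km; apply: v; exact: leq_trans mm. Qed.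

Lemma sq_mod f m e e' : e = e' %[mod 144] -> sq f m e -> sq f m e'.
Proof. by move=> ee [a [h v r]]; exists a; split=> // k /r ->. Qed.

Lemma sq_lift f m m' e : (forall k, (m <= k < m')%N -> k <> e %[mod 144]) -> sq f m e -> sq f m' e.
Proof.
move=> h [a [ha v r]]; exists a; split=> // k km'; have [km|mk] := ltnP k m; first exact: v.
by apply/eqP; apply: contraT => /r ke; case: (h k _ ke); rewrite mk km'.
Qed.

Lemma zero_hasq : hasq (fun=> 0 : C) (fun=> 0).
Proof.
have g0 : good (fun=> 0 : C) by apply: (@good_bdd _ _ 0) => k; rewrite md0.
split=> // t t0; apply/esym; apply: (PS_uniq g0 (md_wq_lt1 t0)) => e e0; exists 0%N => n _.
by rewrite big1 ?subrr ?md0 // => i _; rewrite mul0r.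
Qed.

Lemma hasqD (f g : C -> C) a b : hasq f a -> hasq g b -> hasq (fun t => f t + g t) (fun k => a k + b k).
Proof.
move=> [ga fa] [gb fb]; split; first exact: goodD.
by move=> t t0; rewrite fa // fb // PSD // md_wq_lt1.
Qed.

Lemma hasqZ (f : C -> C) a c : hasq f a -> hasq (fun t => c * f t) (fun k => c * a k).
Proof.
move=> [ga fa]; split; first exact: goodZ.
by move=> t t0; rewrite fa // PSZ // md_wq_lt1.
Qed.

Lemma sq0 m e : sq (fun=> 0) m e.
Proof. by exists (fun=> 0); split=> //; [exact: zero_hasq|move=> k; rewrite eqxx]. Qed.

Lemma sqD f g m e : sq f m e -> sq g m e -> sq (fun t => f t + g t) m e.
Proof.
move=> [a [ha va ra]] [b [hb vb rb]]; exists (fun k => a k + b k); split; first exact: hasqD.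
- by move=> k km; rewrite va // vb // addr0.
- move=> k; have [->|/ra //] := eqVneq (a k) 0; rewrite add0r; exact: rb.
Qed.

Lemma sqZ c f m e : sq f m e -> sq (fun t => c * f t) m e.
Proof.
move=> [a [ha va ra]]; exists (fun k => c * a k); split; first exact: hasqZ.
- by move=> k km; rewrite va // mulr0.
- by move=> k; rewrite mulf_eq0 negb_or => /andP[_ /ra].
Qed.

Lemma hasq_ext (f g : C -> C) a : (forall t, 0 < Im t -> f t = g t) -> hasq f a -> hasq g a.
Proof. by move=> h [ga fa]; split=> // t t0; rewrite -h // fa. Qed.

Lemma hasq_sum (I : Type) (r : seq I) (P : pred I) (f : I -> C -> C) (a : I -> nat -> C) :
  (forall i, P i -> hasq (f i) (a i)) ->
  hasq (fun t => \sum_(i <- r | P i) f i t) (fun k => \sum_(i <- r | P i) a i k).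
Proof.
move=> h; elim: r => [|i r IH].
  have -> : (fun t => \sum_(i <- [::] | P i) f i t) = (fun=> 0) by apply: funext => t; rewrite big_nil.
  have -> : (fun k => \sum_(i <- [::] | P i) a i k) = (fun=> 0) by apply: funext => k; rewrite big_nil.
  exact: zero_hasq.
case Pi : (P i).
  have -> : (fun t => \sum_(j <- i :: r | P j) f j t) = (fun t => f i t + \sum_(j <- r | P j) f j t).
    by apply: funext => t; rewrite big_cons Pi.
  have -> : (fun k => \sum_(j <- i :: r | P j) a j k) = (fun k => a i k + \sum_(j <- r | P j) a j k).
    by apply: funext => k; rewrite big_cons Pi.
  by apply: hasqD IH; exact: h.
have -> : (fun t => \sum_(j <- i :: r | P j) f j t) = (fun t => \sum_(j <- r | P j) f j t).
  by apply: funext => t; rewrite big_cons Pi.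
by have -> : (fun k => \sum_(j <- i :: r | P j) a j k) = (fun k => \sum_(j <- r | P j) a j k)
  by apply: funext => k; rewrite big_cons Pi.
Qed.

Lemma sqB f g m e : sq f m e -> sq g m e -> sq (fun t => f t - g t) m e.
Proof.
move=> hf /(sqZ (-1)) hg; have [a [[ga h] v r]] := sqD hf hg; exists a; split=> //; split=> // t t0.
by rewrite -h // mulN1r.
Qed.

Lemma sq_sum (I : Type) (r : seq I) (P : pred I) (f : I -> C -> C) m e : (forall i, P i -> sq (f i) m e) ->
  sq (fun t => \sum_(i <- r | P i) f i t) m e.
Proof.
move=> h; elim: r => [|i r IH].
  have -> : (fun t => \sum_(i <- [::] | P i) f i t) = (fun=> 0) by apply: funext => t; rewrite big_nil.
  exact: sq0.
have -> : (fun t => \sum_(j <- i :: r | P j) f j t) =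
   (fun t => (if P i then f i t else 0) + \sum_(j <- r | P j) f j t).
  by apply: funext => t; rewrite big_cons; case: ifP => _; rewrite ?add0r.
apply: sqD => //; have := h i; case: (P i) => [/(_ isT)|_] //; exact: sq0.
Qed.

Lemma conv_vge a b m n : vge m a -> vge n b -> vge (m + n) (conv a b).
Proof.
move=> va vb k kmn; rewrite /conv big1 // => i _; have [im|mi] := ltnP i m.
  by rewrite va ?mul0r.
by rewrite vb ?mulr0 //; have := ltn_ord i; lia.
Qed.

Lemma conv_res a b e e' (k : nat) : (forall k, a k != 0 -> k = e %[mod 144]) -> (forall k, b k != 0 -> k = e' %[mod 144]) ->
  conv a b k != 0 -> k = (e + e')%N %[mod 144].
Proof.
move=> ra rb; apply: contraNeq => /eqP h; rewrite /conv big1 // => i _.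
apply/eqP; apply: contraT; rewrite mulf_eq0 negb_or => /andP[/ra h1 /rb h2].
case: h; rewrite -(subnKC (_ : i <= k)%N) -1?ltnS // -modnDm h1 h2 modnDm //.
Qed.

Lemma conv_lead a b m n : vge m a -> vge n b -> conv a b (m + n) = a m * b n.
Proof.
move=> va vb; have mlt : (m < (m + n).+1)%N by lia.
rewrite /conv (bigD1 (Ordinal mlt)) //= addKn big1 ?addr0 // => i; rewrite -val_eqE /= => im.
have [lt|ge] := ltnP i m; first by rewrite va ?mul0r.
by rewrite vb ?mulr0 //; have := ltn_ord i; lia.
Qed.

Lemma hasqM f g a b : hasq f a -> hasq g b -> hasq (fun t => f t * g t) (conv a b).
Proof.
move=> [ga fa] [gb fb]; split; first exact: good_conv.
by move=> t t0; rewrite fa // fb // PSM //; exact: md_wq_lt1.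
Qed.

Lemma sqM f g m n e e' : sq f m e -> sq g n e' -> sq (fun t => f t * g t) (m + n) (e + e').
Proof.
move=> [a [ha va ra]] [b [hb vb rb]]; exists (conv a b); split.
- exact: hasqM.
- exact: conv_vge.
- move=> k; exact: conv_res.
Qed.

Lemma sq_ext f g m e : (forall t, 0 < Im t -> f t = g t) -> sq f m e -> sq g m e.
Proof. by move=> h [a [[ga fa] v r]]; exists a; split=> //; split=> // t t0; rewrite -h // fa. Qed.

Lemma sq_T f m e tau : sq f m e -> 0 < Im tau -> f (tau + 1) = e2pi (e%:R / 144%:R) * f tau.
Proof. by move=> [a [h _ r]]; exact: (T_hasq h r). Qed.

Lemma md_e2pi_frac (a b : nat) : md (e2pi (a%:R / b%:R)) = 1.
Proof.
have -> : a%:R / b%:R = (a%:R / b%:R)%:C :> C by rewrite fmorph_div !rmorph_nat.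
exact: md_e2pi_real.
Qed.

Lemma md_sq_T f m e tau : sq f m e -> 0 < Im tau -> md (f (tau + 1)) = md (f tau).
Proof. by move=> h t0; rewrite (sq_T h t0) mdM md_e2pi_frac mul1r. Qed.

(** ** Unitary kernels *)

(** Only preservation of the norm is ever used, so this is taken as the definition; [unitaryP]
    derives it from orthogonality of the columns. *)
Definition unitary (X : finType) (K : X -> X -> C) := forall v : X -> C,
  \sum_x md (\sum_y K x y * v y) ^+ 2 = \sum_y md (v y) ^+ 2.

Lemma unitaryP (X : finType) (K : X -> X -> C) : (forall y z, \sum_x K x y * conjc (K x z) = (y == z)%:R) -> unitary K.
Proof.
move=> h v; apply: (@complexI R); rewrite !rmorph_sum /=.
under eq_bigr do rewrite -mulcJ conjc_sum mulr_suml.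
rewrite exchange_big /=; apply: eq_bigr => y _.
under eq_bigr do rewrite mulr_sumr.
rewrite exchange_big /= (bigD1 y) //= [X in _ + X]big1 ?addr0.
  under eq_bigr do rewrite conjcM mulrACA.
  by rewrite -mulr_suml h eqxx mul1r mulcJ.
move=> z zy; under eq_bigr do rewrite conjcM mulrACA.
by rewrite -mulr_suml h eq_sym (negbTE zy) mul0r.
Qed.

Definition tensorK (X Y : finType) (K : X -> X -> C) (L : Y -> Y -> C) : X * Y -> X * Y -> C :=
  fun p q => K p.1 q.1 * L p.2 q.2.

Lemma unitary_tensor (X Y : finType) (K : X -> X -> C) (L : Y -> Y -> C) :
  unitary K -> unitary L -> unitary (tensorK K L).
Proof.
move=> uK uL v.
pose w x y := \sum_y' L y y' * v (x, y').
transitivity (\sum_x \sum_y md (\sum_x' K x x' * w x' y) ^+ 2).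
  rewrite pair_bigA /=; apply: eq_bigr => -[x y] _ /=; congr (md _ ^+ 2).
  rewrite /w; under [RHS]eq_bigr do rewrite mulr_sumr.
  by rewrite pair_bigA /=; apply: eq_bigr => -[x' y'] _; rewrite /tensorK /= mulrA.
rewrite exchange_big /=; under eq_bigr do rewrite uK.
rewrite exchange_big /=; under eq_bigr do rewrite uL.
by rewrite pair_bigA; apply: eq_bigr => -[x y].
Qed.

(** The S-matrix, without its eighth root of unity, of the cyclic module Z/n with bilinear form k x
    y / n. *)
Definition uk (n k : nat) (x y : 'I_n) : C := e2pi (- ((k * x * y)%N%:R / n%:R)) / (Num.sqrt n%:R)%:C.

Lemma e2pi_frac_neq1 (a n : nat) : ~~ (n %| a)%N -> (0 < n)%N -> e2pi (a%:R / n%:R : C) != 1.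
Proof.
move=> na n0; have nC : n%:R != 0 :> C by rewrite pnatr_eq0 -lt0n.
have -> : e2pi (a%:R / n%:R : C) = e2pi ((a %% n)%:R / n%:R).
  rewrite {1}(divn_eq a n) natrD natrM mulrDl mulfK // e2piD.
  by rewrite -[(a %/ n)%:R]/((Posz (a %/ n))%:~R) e2pi_int mul1r.
have r0 : (0 < a %% n)%N by rewrite lt0n.
have rn : (a %% n < n)%N by rewrite ltn_mod.
rewrite eq_sym -subr_eq0 -md_eq0.
have -> : (a %% n)%:R / n%:R = ((a %% n)%:R / n%:R)%:C :> C by rewrite fmorph_div !rmorph_nat.
rewrite md_1e2pi mulf_neq0 // normr_eq0 gt_eqF // sin_gt0_pi //.
have p0 := pi_gt0 R; have nR : 0 < n%:R :> R by rewrite ltr0n.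
rewrite mulr_gt0 ?divr_gt0 ?ltr0n //= gtr_pMr // ltr_pdivrMr // mul1r ltr_nat //.
Qed.

Lemma root_sum (a n : nat) : (0 < n)%N -> \sum_(x < n) e2pi (a%:R / n%:R : C) ^+ x = if (n %| a)%N then n%:R else 0.
Proof.
move=> n0; have nC : n%:R != 0 :> C by rewrite pnatr_eq0 -lt0n.
case: ifP => na.
  have -> : e2pi (a%:R / n%:R : C) = 1.
    by rewrite -(divnK na) natrM mulfK // -[(a %/ n)%:R]/((Posz (a %/ n))%:~R) e2pi_int.
  by under eq_bigr do rewrite expr1n; rewrite sumr_const card_ord.
have z1 := e2pi_frac_neq1 (negbT na) n0.
have : (e2pi (a%:R / n%:R : C) - 1) * \sum_(x < n) e2pi (a%:R / n%:R) ^+ x = 0.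
  rewrite -subrX1 -e2piX mulrCA mulfV // mulr1 -[a%:R]/((Posz a)%:~R) e2pi_int subrr //.
by move/eqP; rewrite mulf_eq0 subr_eq0 (negbTE z1) => /eqP.
Qed.

Lemma sqrt_natC (n : nat) : (Num.sqrt n%:R)%:C * (Num.sqrt n%:R)%:C = n%:R :> C.
Proof. by rewrite -rmorphM -expr2 sqr_sqrtr // rmorph_nat. Qed.

Lemma uk_orth n k (y z : 'I_n) : coprime n k ->
  \sum_x uk k x y * conjc (uk k x z) = (y == z)%:R.
Proof.
move=> cop; have n0 : (0 < n)%N by case: n y z {cop} => // -[].
have nC : n%:R != 0 :> C by rewrite pnatr_eq0 -lt0n.
have cj : conjc (Num.sqrt n%:R)%:C = (Num.sqrt n%:R)%:C :> C by rewrite /= oppr0.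
have E (x : 'I_n) : uk k x y * conjc (uk k x z) = e2pi ((k * (z + (n - y)))%N%:R / n%:R) ^+ x / n%:R.
  have frC (a : nat) : a%:R / n%:R = (a%:R / n%:R)%:C :> C by rewrite fmorph_div !rmorph_nat.
  rewrite /uk conjcM [conjc (_^-1)](_ : _ = ((Num.sqrt n%:R)%:C)^-1); last first.
    by rewrite -fmorphV /= oppr0.
  rewrite mulrACA -invfM sqrt_natC; congr (_ / _).
  have cf (a : nat) : conjc (e2pi (- (a%:R / n%:R) : C)) = e2pi (a%:R / n%:R).
    have -> : - (a%:R / n%:R) = (- (a%:R / n%:R))%:C :> C by rewrite frC rmorphN.
    by rewrite conjc_e2pi rmorphN opprK frC.
  rewrite cf -e2piX -e2piD.
  have -> : - ((k * x * y)%N%:R / n%:R) + (k * x * z)%N%:R / n%:R = x%:R * ((k * (z + (n - y)))%N%:R / n%:R) + (- (Posz (k * x)))%:~R :> C.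
    by rewrite rmorphN /= !natrM natrD natrB ?(ltnW (ltn_ord y)) //; field.
  by rewrite e2piD e2pi_int mulr1.
under eq_bigr do rewrite E; rewrite -mulr_suml root_sum // Gauss_dvdr //.
have -> : (n %| z + (n - y))%N = (y == z).
  have yn := ltn_ord y; have zn := ltn_ord z; rewrite -val_eqE /=.
  apply/idP/eqP => [/dvdnP[q hq]|->]; last by rewrite subnKC ?dvdnn // ltnW.
  have [q0|q1|q2] : [\/ q = 0%N, q = 1%N | (2 <= q)%N] by case: q {hq} => [|[|q]]; [constructor 1|constructor 2|constructor 3].
  - by move: hq; rewrite q0; lia.
  - by move: hq; rewrite q1; lia.
  - nia.
by case: eqP => _; rewrite ?mulfV // mul0r.
Qed.

Lemma unitary_uk n k : coprime n k -> unitary (@uk n k).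
Proof. by move=> cop; apply: (@unitaryP 'I_n) => y z; exact: uk_orth. Qed.

(** ** Forms whose order is large *)

(** Only the absolute value of the automorphy factor matters for Liouville's theorem. *)
Definition slaw (X : finType) (r : nat) (K : X -> X -> C) (f : X -> C -> C) :=
  exists2 j : C -> C, (forall tau, 0 < Im tau -> md (j tau) ^+ 2 = md tau ^+ r) &
  forall x tau, 0 < Im tau -> f x (- tau^-1) = j tau * \sum_y K x y * f y tau.

Definition normS (X : finType) (r : nat) (f : X -> C -> C) := forall tau, 0 < Im tau ->
  \sum_x md (f x (- tau^-1)) ^+ 2 = md tau ^+ r * \sum_x md (f x tau) ^+ 2.

Definition normT (X : finType) (f : X -> C -> C) := forall tau, 0 < Im tau ->
  \sum_x md (f x (tau + 1)) ^+ 2 = \sum_x md (f x tau) ^+ 2.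

Lemma slaw_norm (X : finType) r K (f : X -> C -> C) : unitary K -> slaw r K f -> normS r f.
Proof.
move=> uK [j j2 h] tau t0; under eq_bigr do rewrite h // mdM exprMn.
by rewrite -mulr_sumr j2 // uK.
Qed.

Lemma sq_normT (X : finType) (f : X -> C -> C) m e : (forall x, sq (f x) (m x) (e x)) -> normT f.
Proof. by move=> h tau t0; apply: eq_bigr => x _; rewrite (md_sq_T (h x)). Qed.

(** ** The theta functions and eta^2 *)

(** For m = q d + r the difference c m^2 - c r^2 is 72 (q^2 d + 2 q r), a multiple of 144 because d
    is even. The smallest |m| in the class is the minimum of r and d - r. *)
Lemma tcoefP c d r : (c * d = 72)%N -> ~~ odd d -> (r < d)%N ->
  [/\ hasq (tser c (@ind R d r)) (tcoef c (ind R d r)), vge (c * minn r (d - r) ^ 2) (tcoef c (ind R d r)) &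
   forall k, tcoef c (ind R d r) k != 0 -> k = (c * r ^ 2)%N %[mod 144]].
Proof.
move=> cd od rd; have c0 : (0 < c)%N by case: c cd.
have key k : @tcoef R c (ind R d r) k != 0 -> exists2 m : int, (c * `|m| ^ 2)%N = k & (m %% d)%Z = r%:Z.
  move=> h; apply: contrapT => no; move: h; rewrite tcoef0 ?eqxx // => m mk.
  by rewrite /ind; case: eqP => // mr; case: no; exists m.
split.
- exact: (tser_hasq c0 (@ind_le R d r)).
- move=> k kl; apply/eqP; apply: contraT => /key [m mk mr]; move: kl; rewrite -mk ltn_pmul2l // ltn_exp2r //.
  have := divz_eq m d; rewrite mr => mE.
  have [q0|[q0|q0]] : (m %/ d)%Z = 0 \/ (1 <= (m %/ d)%Z \/ (m %/ d)%Z <= -1) by lia.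
  + by move: mE; rewrite q0; lia.
  + have : d%:Z <= (m %/ d)%Z * d by nia.
    by lia.
  + have : (m %/ d)%Z * d <= - d%:Z by nia.
    by lia.
- move=> k /key [m <- mr]; have := divz_eq m d; rewrite mr => mE.
  have dE : d = (d./2 * 2)%N by rewrite muln2 -[LHS]odd_double_half (negbTE od).
  set q := (m %/ d)%Z in mE.
  suff : (144%:Z %| c%:Z * m ^+ 2 - c%:Z * r%:Z ^+ 2)%Z.
    rewrite -eqz_mod_dvd => /eqP; have -> : c%:Z * m ^+ 2 = (c * `|m| ^ 2)%N%:Z.
      by rewrite PoszM -abszX gez0_abs // sqr_ge0.
    have -> : c%:Z * r%:Z ^+ 2 = (c * r ^ 2)%N%:Z by rewrite PoszM.
    by rewrite !modz_nat => -[].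
  have cdZ : c%:Z * d%:Z = 72 by rewrite -PoszM cd.
  have -> : c%:Z * m ^+ 2 - c%:Z * r%:Z ^+ 2 = (c%:Z * d%:Z) * (q ^+ 2 * d%:Z + 2 * q * r%:Z) by rewrite mE; ring.
  rewrite cdZ {1}dE PoszM.
  have -> : 72 * (q ^+ 2 * (d./2%:Z * 2) + 2 * q * r%:Z) = 144%:Z * (q ^+ 2 * d./2%:Z + q * r%:Z) by ring.
  exact: dvdz_mulr.
Qed.

Lemma tser_sq c d r : (c * d = 72)%N -> ~~ odd d -> (r < d)%N ->
  sq (tser c (@ind R d r)) (c * minn r (d - r) ^ 2) (c * r ^ 2).
Proof. by move=> cd od rd; exists (tcoef c (ind R d r)); exact: tcoefP. Qed.

Lemma tser_sym c chi chi' : (0 < c)%N -> (forall m, md (chi m) <= 1) -> (forall m, chi' m = chi (- m)) ->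
  forall tau, 0 < Im tau -> @tser R c chi' tau = tser c chi tau.
Proof.
move=> c0 h e tau t0; have h' m : md (chi' m) <= 1 by rewrite e.
rewrite (tser_hasq c0 h).2 // (tser_hasq c0 h').2 //; congr (PS _ _); apply: funext => k.
have [[n ->]|no] := pselect (exists n, k = (c * n ^ 2)%N).
  case: n => [|n]; first by rewrite muln0 !tcoef_0 // e oppr0.
  by rewrite !tcoef_sq // !e opprK addrC.
by rewrite !tcoef0 // => m mk; case: no; exists `|m|%N.
Qed.

Lemma ind_sym d r m : (0 < r < d)%N -> @ind R d (d - r) m = ind R d r (- m).
Proof.
move=> /andP[r0 rd]; rewrite /ind; congr (nat_of_bool _)%:R.
have d0 : (0 < d)%N by case: d rd.
have -> : ((- m) %% d == r%:Z)%Z = ((- m) %% d == r%:Z %% d)%Z by rewrite modz_nat modn_small.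
have -> : (m %% d == (d - r)%N%:Z)%Z = (m %% d == (d - r)%N%:Z %% d)%Z by rewrite modz_nat modn_small //; lia.
rewrite !eqz_mod_dvd; apply/dvdzP/dvdzP => -[q hq]; exists (- q - 1); lia.
Qed.

Lemma U_sym tau : 0 < Im tau -> U 4 tau = U 2 tau /\ U 5 tau = U 1 tau.
Proof.
by rewrite usr.unlock => t0; split; apply: (tser_sym _ (@ind_le R _ _)) => // m; [exact: (@ind_sym 6 2 m)|exact: (@ind_sym 6 1 m)].
Qed.

Lemma jb_neq0 tau : 0 < Im tau -> jb tau != 0.
Proof.
move=> t0; have [_ h] := jbP t0; apply: contraTneq h => ->.
by rewrite /= normr0 ltxx.
Qed.

Lemma md_jb tau : 0 < Im tau -> md (jb tau) ^+ 2 = (md tau)^-1.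
Proof.
move=> t0; have [h _] := jbP t0; rewrite -mdX h mdM mdV.
have -> : md (0 +i* 1) = 1 by apply/eqP; rewrite -sqrp_eq1 ?md_ge0 // md_sqr /= expr0n add0r expr1n.
by rewrite mul1r.
Qed.

Lemma zeta6 : let z := e2pi (- (1 / 6%:R)) : C in z ^+ 3 = -1 /\ z ^+ 2 = z - 1.
Proof.
move=> z; have n6 : (6%:R : C) != 0 by rewrite pnatr_eq0.
pose y := e2pi (1%:R / 6%:R) : C.
have yz : y * z = 1 by rewrite -e2piD addrN e2pi0.
have y6 : y ^+ 6 = 1 by rewrite -e2piX mulrCA mulfV // mulr1 e2pi1.
have y3 : y ^+ 3 != 1.
  by rewrite -e2piX mulrA -natrM e2pi_frac_neq1.
have y2 : y ^+ 2 != 1.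
  by rewrite -e2piX mulrA -natrM e2pi_frac_neq1.
have y3N : y ^+ 3 = -1.
  have : (y ^+ 3 - 1) * (y ^+ 3 + 1) = 0 by rewrite -subr_sqr -exprM y6 expr1n subrr.
  by move/eqP; rewrite mulf_eq0 subr_eq0 (negbTE y3) /= addr_eq0 => /eqP.
have yq : y ^+ 2 - y + 1 = 0.
  have : (y + 1) * (y ^+ 2 - y + 1) = 0.
    by transitivity (y ^+ 3 + 1); [ring|rewrite y3N addrC subrr].
  move/eqP; rewrite mulf_eq0 => /orP[|/eqP //]; rewrite addr_eq0 => /eqP yN.
  by move: y2; rewrite yN sqrrN expr1n eqxx.
have zE : z = - y ^+ 2.
  have y0 : y != 0 by exact: e2pi_neq0.
  by apply: (mulfI y0); rewrite yz mulrN -exprS y3N opprK.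
split; first by rewrite zE exprNn -exprM y6; ring.
rewrite zE sqrrN.
have -> : (y ^+ 2) ^+ 2 = y * y ^+ 3 by rewrite -exprM -exprS.
by rewrite y3N; move/eqP: yq; rewrite -addrA addr_eq0 => /eqP ->; ring.
Qed.

Lemma U_S tau : 0 < Im tau -> let c := (Num.sqrt 6%:R)%:C * jb tau in
  [/\ c * U 0 (- tau^-1) = U 0 tau + 2 * U 1 tau + 2 * U 2 tau + U 3 tau,
      c * U 1 (- tau^-1) = U 0 tau + U 1 tau - U 2 tau - U 3 tau,
      c * U 2 (- tau^-1) = U 0 tau - U 1 tau - U 2 tau + U 3 tau &
      c * U 3 (- tau^-1) = U 0 tau - 2 * U 1 tau + 2 * U 2 tau - U 3 tau].
Proof.
move=> t0 c; have [u4 u5] := U_sym t0; have [z3 z2] := zeta6; set z := e2pi _ in z3 z2.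
have S r : (r < 6)%N -> c * U r (- tau^-1) = U 0 tau + z ^+ r * U 1 tau + (z ^+ r) ^+ 2 * U 2 tau +
   (z ^+ r) ^+ 3 * U 3 tau + (z ^+ r) ^+ 4 * U 2 tau + (z ^+ r) ^+ 5 * U 1 tau.
  move=> r6; have := @theta_S R 12 6 r tau erefl r6 t0; have Ur s t : tser 12 (ind R 6 s) t = U s t by rewrite usr.unlock.
  rewrite Ur /c => ->; under eq_bigr do rewrite Ur.
  transitivity (\sum_(s < 6) (z ^+ r) ^+ s * U s tau); last first.
    by rewrite !big_ord_recr big_ord0 /= u4 u5 expr0 expr1 add0r mul1r.
  apply: eq_bigr => s _; congr (_ * _); rewrite -exprM.
  by rewrite /z -e2piX natrM; congr e2pi; field.
have z4 : z ^+ 4 = - z by rewrite exprS z3; ring.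
have z5 : z ^+ 5 = 1 - z by rewrite exprS z4 mulrN -expr2 z2; ring.
split; rewrite S //.
- by rewrite expr0; ring.
- by rewrite expr1 z5 z4 z3 z2; ring.
- have w2 : (z - 1) ^+ 2 = - z by rewrite -z2 -exprM z4.
  have w3 : (z - 1) ^+ 3 = 1 by rewrite exprS w2 mulrN mulrBl -expr2 z2; ring.
  by rewrite z2 (exprD _ 3 2) (exprD _ 3 1) w3 w2; ring.
- by rewrite z3; ring.
Qed.

(** The substitution of [U_S] multiplies the quadratic form U0 U1 - U2 U3 by 6, which the two
    factors sqrt 6 cancel. *)
Lemma E_S tau : 0 < Im tau -> jb tau ^+ 2 * E (- tau^-1) = E tau.
Proof.
move=> t0; have [h0 h1 h2 h3] := U_S t0.
have s6 := sqrt_natC 6; have n6 : (6%:R : C) != 0 by rewrite pnatr_eq0.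
apply: (mulfI n6); rewrite -{1}s6 eta2.unlock.
set c := (Num.sqrt _)%:C in h0 h1 h2 h3 s6 *; set j := jb tau in h0 h1 h2 h3 *.
transitivity ((c * j * U 0 (- tau^-1)) * (c * j * U 1 (- tau^-1)) - (c * j * U 2 (- tau^-1)) * (c * j * U 3 (- tau^-1))).
  by ring.
by rewrite h0 h1 h2 h3; ring.
Qed.

Lemma tcoef_le2 c d r k : (0 < c)%N -> md (@tcoef R c (ind R d r) k) <= 2.
Proof.
move=> c0; have [[n ->]|no] := pselect (exists n, k = (c * n ^ 2)%N); last first.
  by rewrite tcoef0 ?md0 // => m mk; case: no; exists `|m|%N.
case: n => [|n]; first by rewrite muln0 tcoef_0 //; apply: le_trans (ind_le _ _ _ _) _; lra.
rewrite tcoef_sq //; apply: le_trans (mdD _ _) _.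
by have := ind_le R d r n.+1%:Z; have := ind_le R d r (- n.+1%:Z); lra.
Qed.

Lemma PS_dilate (a : nat -> C) d w : (0 < d)%N -> (forall k, a k != 0 -> (d %| k)%N) -> good a ->
  (forall k, md (a k) <= 2) -> md w < 1 -> PS a w = PS (fun k => a (d * k)%N) (w ^+ d).
Proof.
move=> d0 h ga a2 w1; have gd : good (fun k => a (d * k)%N) by exact: (good_bdd (fun k => a2 _)).
have wd : md (w ^+ d) < 1 by rewrite mdX exprn_ilt1 ?md_ge0 // -lt0n.
apply/esym; apply: PS_uniq => //.
apply: (ctends_ext (u := fun n => \sum_(k < d * n) a k * w ^+ k)); last first.
  move=> e /(PS_tends ga w1) [N hN]; exists N => n Nn; apply: hN; apply: leq_trans Nn _.
  by rewrite leq_pmull.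
move=> n; rewrite -(big_mkord xpredT (fun k => a k * w ^+ k)) mulnC big_nat_mul big_mkord.
apply: eq_bigr => k _; rewrite -{1}[(k * d)%N]add0n big_addn.
have -> : (k.+1 * d - k * d = d)%N by rewrite mulSn addnK.
rewrite big_ltn // add0n [X in _ + X = _]big_nat_cond [X in _ + X = _]big1 ?addr0.
  by rewrite mulnC exprM.
move=> i /andP[/andP[i0 id] _]; have [->|/h] := eqVneq (a (i + k * d)%N) 0; first by rewrite mul0r.
by rewrite addnC dvdn_addr ?dvdn_mull // => /dvdn_leq; lia.
Qed.

(** A series in w^144 with coefficients at most 2 and ratio at most 1/8 differs from its constant
    term by at most 2 (1/8)/(1 - 1/8) = 2/7. *)
Lemma PS_near (a : nat -> C) w : good a -> (forall k, md (a k) <= 2) -> (forall k, a k != 0 -> (144 %| k)%N) ->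
  md w < 1 -> md w ^+ 144 <= 1 / 8 -> md (PS a w - a 0%N) <= 2 / 7.
Proof.
move=> ga a2 h w1 w8; rewrite (PS_dilate (d := 144) _ h ga a2 w1) //.
have gd : good (fun k => a (144 * k)%N) by exact: (good_bdd (fun k => a2 _)).
have q8 : md (w ^+ 144) <= 1 / 8 by rewrite mdX.
have q1 : md (w ^+ 144) < 1 by lra.
have [gs ->] := PS_shift1 gd q1.
rewrite muln0 addrAC subrr add0r mdM.
have : md (PS (fun k => a (144 * k.+1)%N) (w ^+ 144)) <= 2 / (1 - 1 / 8).
  rewrite PS.unlock; apply: csum_le => [|k]; first lra.
  rewrite mdM mdX; apply: ler_pM; rewrite ?md_ge0 ?exprn_ge0 ?md_ge0 //.
  by apply: lerXn2r; rewrite ?nnegrE ?md_ge0.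
move=> h2; apply: (@le_trans _ _ (1 / 8 * (2 / (1 - 1 / 8)))); last by rewrite le_eqVlt; apply/orP; left; apply/eqP; field.
by apply: ler_pM; rewrite ?md_ge0.
Qed.

(** cos(3/2) > 0 by the triple-angle formula and cos(1/2) >= 7/8, so 3/2 lies below pi/2. The bound
    is used to get |q| <= exp(-3) <= 1/8 for Im tau >= 1/2. *)
Lemma pi_ge3 : 3 <= pi :> R.
Proof.
have p2 := @pi_ge2 R; rewrite leNgt; apply/negP => p3.
have s1 : sin (1 / 4) <= 1 / 4 :> R.
  have [c c01 e] := @MVT R sin cos 0 (1 / 4) ltac:(lra) (fun x _ => is_derive_sin x) (continuous_subspaceT (@continuous_sin R)).
  by move: e; rewrite sin0 !subr0 => ->; have := cos_le1 c; lra.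
have s0 : 0 <= sin (1 / 4) :> R by apply: sin_ge0_pi; lra.
have c1 : 7 / 8 <= cos (1 / 2) :> R.
  have -> : 1 / 2 = (1 / 4) *+ 2 :> R by lra.
  rewrite cos_mulr2n cos2sin2.
  have : sin (1 / 4) ^+ 2 <= (1 / 4) ^+ 2 :> R by apply: lerXn2r; rewrite ?nnegrE //; lra.
  by rewrite !expr2; lra.
have c3 : 0 < cos (3 / 2) :> R.
  have -> : 3 / 2 = 1 / 2 + (1 / 2) *+ 2 :> R by lra.
  rewrite cosD cos_mulr2n sin_mulr2n.
  have := sin2cos2 (1 / 2 : R); set c := cos _ in c1 *; set s := sin _ => e.
  have -> : c * (c ^+ 2 *+ 2 - 1) - s * ((c * s) *+ 2) = c * (c ^+ 2 *+ 2 - 1) - (s ^+ 2) * (c *+ 2) by ring.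
  rewrite e; have : (7 / 8) ^+ 2 <= c ^+ 2 by apply: lerXn2r; rewrite ?nnegrE //; lra.
  move=> h; have -> : c * (c ^+ 2 *+ 2 - 1) - (1 - c ^+ 2) * (c *+ 2) = c * (4 * c ^+ 2 - 3) by ring.
  by rewrite mulr_gt0 //; move: h; rewrite !expr2; lra.
have : cos (3 / 2) <= cos (pi / 2) :> R.
  by rewrite leNgt ltr_cos ?in_itv /=; rewrite -?leNgt; lra.
by rewrite cos_pihalf leNgt c3.
Qed.

Lemma wq_small tau : 1 / 2 <= Im tau -> md (wq tau) ^+ 144 <= 1 / 8.
Proof.
move=> t1; rewrite md_wq -expRM_natl.
have -> : 144%:R * - (2 * pi * (Im tau / 144%:R)) = - (2 * pi * Im tau) by field.
have h3 : 3 <= 2 * pi * Im tau by have := pi_ge3; nra.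
rewrite expRN mul1r lef_pV2 ?posrE ?expR_gt0 //.
have : (1 + 3 / 8) ^+ 8 <= expR (3 / 8) ^+ 8 :> R.
  by apply: lerXn2r; rewrite ?nnegrE ?expR_ge0 ?expR_ge1Dx //; lra.
rewrite -expRM_natl; have -> : 8%:R * (3 / 8) = 3 :> R by field.
move=> h; apply: (@le_trans _ _ (expR 3)); last by rewrite ler_expR.
by apply: le_trans h; rewrite !exprS expr0; lra.
Qed.

Lemma U_near r r0 tau : (r < 6)%N -> r0 = minn r (6 - r) -> 1 / 2 <= Im tau ->
  exists2 v, U r tau = wq tau ^+ (12 * r0 ^ 2) * v & md (v - @tcoef R 12 (ind R 6 r) (12 * r0 ^ 2)) <= 2 / 7.
Proof.
move=> r6 rr t1; have t0 : 0 < Im tau by lra.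
have [[ga fa] va ra] := @tcoefP 12 6 r erefl isT r6; rewrite -rr in va.
have w1 := md_wq_lt1 t0.
have [gs sE] := PS_shift ga va.
exists (PS (fun k => tcoef 12 (ind R 6 r) (12 * r0 ^ 2 + k)%N) (wq tau)); first by rewrite usr.unlock fa // sE.
have h := @PS_near _ (wq tau) gs _ _ w1 (wq_small t1); rewrite addn0 in h; apply: h => k.
  exact: tcoef_le2.
move=> /ra hk.
have : (12 * r0 ^ 2 = 12 * r ^ 2 %[mod 144])%N.
  by rewrite rr; case: r r6 {rr va ra gs sE ga fa hk} => [|[|[|[|[|[|]]]]]].
move=> h2; apply/eqP; move: hk; rewrite -h2 -{2}[(12 * r0 ^ 2)%N]addn0 => /eqP.
by rewrite eqn_modDl mod0n => /eqP.
Qed.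

Definition cE := (fun k => conv (tcoef 12 (ind R 6 0)) (tcoef 12 (ind R 6 1)) k +
  -1 * conv (tcoef 12 (ind R 6 2)) (tcoef 12 (ind R 6 3)) k).

Lemma cEP : [/\ hasq E cE, vge 12 cE, cE 12 = 1 & forall k, cE k != 0 -> k = 12 %[mod 144]].
Proof.
have [h0 v0 r0] := @tcoefP 12 6 0 erefl isT isT; have [h1 v1 r1] := @tcoefP 12 6 1 erefl isT isT.
have [h2 v2 r2] := @tcoefP 12 6 2 erefl isT isT; have [h3 v3 r3] := @tcoefP 12 6 3 erefl isT isT.
have [g01 e01] := hasqM h0 h1; have [g23 e23] := hasqM h2 h3.
have v01 := conv_vge v0 v1; have v23 := conv_vge v2 v3.
split.
- split; first by apply: goodD => //; exact: goodZ.
  move=> t t0; rewrite PSD ?PSZ //; [|exact: md_wq_lt1|exact: goodZ|exact: md_wq_lt1].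
  by rewrite -e01 // -e23 // mulN1r eta2.unlock usr.unlock.
- by move=> k k12; rewrite /cE v01 // v23 ?mulr0 ?addr0 //; apply: leq_trans k12 _.
- rewrite /cE v23 // mulr0 addr0 (conv_lead v0 v1) tcoef_0 // (@tcoef_sq R 12 _ 1) //.
  by rewrite /ind /=; ring.
- move=> k; have [z|n1 _] := eqVneq (conv (tcoef 12 (ind R 6 0)) (tcoef 12 (ind R 6 1)) k) 0.
    by rewrite /cE z add0r mulf_eq0 negb_or => /andP[_ /(conv_res r2 r3)].
  exact: (conv_res r0 r1 n1).
Qed.

Lemma E_T tau : 0 < Im tau -> md (E (tau + 1)) = md (E tau).
Proof.
have [h v _ r] := cEP; have hs : sq E 12 12 by exists cE.
exact: md_sq_T hs.
Qed.

(** By S and T it suffices to look at Im tau >= 1/2. There eta^2 is w^12 times v0 v1 - q v2 v3, and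
    the leading terms of the v_i together with [PS_near] give |v0 v1| >= 25/49 against |q v2 v3| <=
    18/49. *)
Lemma E_neq0 tau : 0 < Im tau -> E tau != 0.
Proof.
apply: (half_plane_ind (P := fun t => E t != 0)) => t.
- by move=> t0; rewrite -[E (t + 1) == 0]md_eq0 -[E t == 0]md_eq0 E_T.
- by move=> t0; rewrite -[E (t + 1) == 0]md_eq0 -[E t == 0]md_eq0 E_T.
- by move=> t0; apply: contraNneq; rewrite -(E_S t0) => /eqP; rewrite mulf_eq0 expf_eq0 (negbTE (jb_neq0 t0)) andbF.
move=> t1; have t0 : 0 < Im t by lra.
have [v0 e0 n0] := @U_near 0 0 t isT erefl t1; have [v1 e1 n1] := @U_near 1 1 t isT erefl t1.
have [v2 e2 n2] := @U_near 2 2 t isT erefl t1; have [v3 e3 n3] := @U_near 3 3 t isT erefl t1.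
have ts (r : nat) n : (0 < n)%N -> tcoef 12 (ind R 6 r) (12 * n ^ 2) = ind R 6 r n%:Z + ind R 6 r (- n%:Z).
  by move=> n0'; rewrite tcoef_sq.
have c0 : tcoef 12 (ind R 6 0) (12 * 0 ^ 2) = 1.
  by have -> : (12 * 0 ^ 2 = 0)%N by []; rewrite (@tcoef_0 R 12 (ind R 6 0) isT).
rewrite c0 in n0; rewrite (ts 1%N 1%N isT) in n1; rewrite (ts 2%N 2%N isT) in n2; rewrite (ts 3%N 3%N isT) in n3.
have i1 : ind R 6 1 1%:Z + ind R 6 1 (- 1%:Z) = 1 + 0 by [].
have i2 : ind R 6 2 2%:Z + ind R 6 2 (- 2%:Z) = 1 + 0 by [].
have i3 : ind R 6 3 3%:Z + ind R 6 3 (- 3%:Z) = 1 + 1 by [].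
rewrite i1 in n1; rewrite i2 in n2; rewrite i3 in n3.
have -> : E t = wq t ^+ 12 * (v0 * v1 - wq t ^+ 144 * (v2 * v3)).
  rewrite eta2.unlock e0 e1 e2 e3 expr0 mul1r.
  have -> : (12 * 1 ^ 2 = 12)%N by []. have -> : (12 * 2 ^ 2 = 48)%N by []. have -> : (12 * 3 ^ 2 = 108)%N by [].
  have ew : wq t ^+ 12 * wq t ^+ 144 = wq t ^+ 48 * wq t ^+ 108.
    have e156 : (12 + 144 = 48 + 108)%N by [].
    by rewrite -(exprD (wq t) 12 144) e156 (exprD (wq t) 48 108).
  move: (wq t ^+ 12) (wq t ^+ 144) (wq t ^+ 48) (wq t ^+ 108) ew => a b d f ew.
  transitivity (a * (v0 * v1) - (a * b) * (v2 * v3)); last by ring.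
  by rewrite ew; ring.
have w8 := wq_small t1.
have W8 : md (wq t ^+ 144) <= 1 / 8 by rewrite mdX.
apply: mulf_neq0; first exact: expf_neq0 (wq_neq0 t).
move: (wq t ^+ 144) W8 => W W8 {w8 ts c0 i1 i2 i3 e0 e1 e2 e3}; rewrite -md_gt0; apply: lt_le_trans (md_triB _ _).
rewrite subr_gt0 !mdM.
have tri (a b : C) : md b - md (a - b) <= md a /\ md a <= md b + md (a - b).
  by have := md_triB b a; have := mdD (a - b) b; rewrite subrK mdBC; lra.
have l0 : 5 / 7 <= md v0 by have [h _] := tri v0 1; rewrite -[md 1]/(md 1%:R) md_natr in h; lra.
have l1 : 5 / 7 <= md v1.
  by have [h _] := tri v1 (1 + 0); rewrite addr0 -[md 1]/(md 1%:R) md_natr in h; rewrite addr0 in n1; lra.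
have l2 : md v2 <= 9 / 7.
  by have [_ h] := tri v2 (1 + 0); rewrite addr0 -[md 1]/(md 1%:R) md_natr in h; rewrite addr0 in n2; lra.
have l3 : md v3 <= 16 / 7.
  by have [_ h] := tri v3 (1 + 1); rewrite -[md (1 + 1)]/(md 2%:R) md_natr in h; lra.
apply: (@le_lt_trans _ _ (1 / 8 * (9 / 7 * (16 / 7)))).
  apply: ler_pM; rewrite ?mulr_ge0 ?md_ge0 //.
  by apply: ler_pM; rewrite ?md_ge0.
apply: (@lt_le_trans _ _ (5 / 7 * (5 / 7))).
  have -> : 1 / 8 * (9 / 7 * (16 / 7)) = 18 / 49 :> R by field.
  have -> : 5 / 7 * (5 / 7) = 25 / 49 :> R by field.
  by lra.
by apply: ler_pM; rewrite ?divr_ge0.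
Qed.

Lemma E_pow r : exists dd, [/\ hasq (fun t => E t ^+ r) dd, vge (12 * r) dd & dd (12 * r)%N = 1].
Proof.
elim: r => [|r [dd [h v l]]].
  exists (mono R 0); split=> //; split; first exact: good_mono.
  by move=> t t0; rewrite PS_mono ?md_wq_lt1.
have [hE vE lE _] := cEP; exists (conv cE dd); rewrite mulnS; split.
- by have [g e] := hasqM hE h; split=> // t t0; rewrite -e // exprS.
- exact: conv_vge.
- by rewrite conv_lead // lE l mulr1.
Qed.

Definition sqo (f : C -> C) (m : nat) := exists2 a, hasq f a & vge m a.

Lemma sq_sqo f m e : sq f m e -> sqo f m.
Proof. by move=> [a [h v _]]; exists a. Qed.

Lemma sqoD f g m : sqo f m -> sqo g m -> sqo (fun t => f t + g t) m.
Proof.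
move=> [a [ga fa] va] [b [gb fb] vb]; exists (fun k => a k + b k).
  split; first exact: goodD.
  by move=> t t0; rewrite fa // fb // PSD //; exact: md_wq_lt1.
by move=> k km; rewrite va // vb // addr0.
Qed.

Lemma sqoZ c f m : sqo f m -> sqo (fun t => c * f t) m.
Proof.
move=> [a [ga fa] va]; exists (fun k => c * a k).
  split; first exact: goodZ.
  by move=> t t0; rewrite fa // PSZ //; exact: md_wq_lt1.
by move=> k km; rewrite va // mulr0.
Qed.

Lemma sqo_le f m m' : (m' <= m)%N -> sqo f m -> sqo f m'.
Proof. by move=> mm [a h v]; exists a => // k km; apply: v; exact: leq_trans mm. Qed.

Lemma sqoM f g m n : sqo f m -> sqo g n -> sqo (fun t => f t * g t) (m + n).
Proof. by move=> [a ha va] [b hb vb]; exists (conv a b); [exact: hasqM|exact: conv_vge]. Qed.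

(** Liouville's theorem against E^r, of order 12r, makes the square of each component a constant
    times E^r; the constant is the square of the coefficient at w^(6r), which is 0 when the order is
    larger. Components that reach 6r exactly are not excluded here. *)
Theorem vanish (X : finType) r (f : X -> C -> C) (m : X -> nat) : (forall x, sqo (f x) (m x)) ->
  (forall x, 6 * r <= m x)%N -> normS r f -> normT f ->
  forall x, (6 * r < m x)%N -> forall tau, 0 < Im tau -> f x tau = 0.
Proof.
move=> /(_ _)/cid2 fm mr nS nT x mx tau t0.
pose A x := projT1 (fm x).
have hA y : hasq (f y) (A y) by rewrite /A; case: (fm y).
have vA y : vge (m y) (A y) by rewrite /A; case: (fm y).
have [dd [hd vd ld]] := E_pow r.
have vA' y : vge (6 * r) (A y) by move=> k kr; apply: vA; exact: leq_trans (mr y).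
have rr : (2 * (6 * r) = 12 * r)%N by rewrite mulnA.
rewrite -rr in vd ld.
have l := @liouville R X f A (fun t => E t ^+ r) dd (6 * r) hA hd vA' vd _ _ _ _ x x tau t0.
have /eqP : f x tau * f x tau * dd (2 * (6 * r))%N = A x (6 * r)%N * A x (6 * r)%N * E tau ^+ r.
  apply: l; first by rewrite ld oner_neq0.
  - by move=> t tp; rewrite expf_neq0 // E_neq0.
  - by move=> t tp; rewrite nT // !mdX E_T.
  - move=> t tp; rewrite (nS t tp) -mulrA mulrC -mulrA; congr (_ * _).
    rewrite (mdX (E t)) (mdX (E (- t^-1))) -(E_S tp) mdM mdX md_jb // exprMn -mulrA mulrC -!mulrA mulrCA -exprMn.
    by rewrite -exprMn mulrCA mulfV ?mulr1 // md_eq0 Im_gt0_neq0.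
by rewrite ld mulr1 (vA x) // !mul0r mulf_eq0 orbb => /eqP.
Qed.

End Forms.

(** * Finite quadratic modules and averaging; orders 12 and 24 *)

Section Models.
Variable R : realType.
Local Notation C := R[i].
Local Notation md := (@md R).
Local Notation Re := complex.Re.
Local Notation Im := complex.Im.
Local Notation wq := (@wq R).
Local Notation jb := (@jb R).
Local Notation U := (@usr R).
Local Notation TH := (@thr R).
Local Notation E := (@eta2 R).
Local Notation uk := (@uk R).
Local Notation tensor := (@tensorK R _ _).

Lemma e2pi_mod (a b n : nat) : (0 < n)%N -> a = b %[mod n] -> e2pi (- (a%:R / n%:R) : C) = e2pi (- (b%:R / n%:R)).
Proof.
move=> n0 ab; have nC : n%:R != 0 :> C by rewrite pnatr_eq0 -lt0n.
have red (c : nat) : e2pi (- (c%:R / n%:R) : C) = e2pi (- ((c %% n)%:R / n%:R)).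
  rewrite {1}(divn_eq c n) natrD natrM mulrDl mulfK // opprD e2piD.
  have -> : - (c %/ n)%:R = (- Posz (c %/ n))%:~R :> C by rewrite rmorphN.
  by rewrite e2pi_int mul1r.
by rewrite red ab -red.
Qed.

Lemma uk_mod n k k' (x y x' y' : 'I_n) : (k * x * y = k' * x' * y' %[mod n])%N -> uk k x y = uk k' x' y'.
Proof.
move=> h; have n0 : (0 < n)%N by case: n x {y x' y' h} => // -[].
by rewrite /uk (e2pi_mod n0 h).
Qed.

Lemma uk_0 n k (x y : 'I_n) : (k * x * y = 0 %[mod n])%N -> uk k x y = ((Num.sqrt n%:R)%:C)^-1.
Proof.
move=> h; have n0 : (0 < n)%N by case: n x {y h} => // -[].
by rewrite /uk (e2pi_mod n0 h) mul0r oppr0 e2pi0 mul1r.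
Qed.

Lemma uk_half (k : nat) (x y : 'I_2) : odd k -> uk k x y = (-1) ^+ (x * y) / (Num.sqrt 2%:R)%:C.
Proof.
move=> ok; rewrite /uk; congr (_ / _).
have h1 : e2pi (1%:R / 2%:R) = -1 :> C.
  have n1 := @e2pi_frac_neq1 R 1 2 isT isT.
  have : (e2pi (1%:R / 2%:R) - 1) * (e2pi (1%:R / 2%:R) + 1) = 0 :> C.
    by rewrite -subr_sqr expr1n -e2piX mulrCA mulfV ?pnatr_eq0 // mulr1 e2pi1 subrr.
  by move/eqP; rewrite mulf_eq0 subr_eq0 (negbTE n1) /= addr_eq0 => /eqP.
have -> : - ((k * x * y)%N%:R / 2%:R) = (k * x * y)%N%:R * - (1%:R / 2%:R) :> C by field.
rewrite e2piX e2piN h1 invrN invr1 -mulnA exprM.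
by rewrite -[(-1) ^+ k]signr_odd ok expr1.
Qed.

Lemma uk_opp n k (x y : 'I_n.+1) : uk k (- x) (- y) = uk k x y.
Proof.
apply: uk_mod => /=; rewrite -!mulnA -[LHS]modnMmr modnMm modnMmr.
have xn := ltnW (ltn_ord x); have yn := ltnW (ltn_ord y).
suff : ((n.+1 - x) * (n.+1 - y) = x * y %[mod n.+1])%N by move=> h; rewrite -modnMmr h modnMmr.
apply/eqP; rewrite -(eqn_modDr (n.+1 * (x + y))) ; apply/eqP.
have -> : ((n.+1 - x) * (n.+1 - y) + n.+1 * (x + y) = x * y + n.+1 * n.+1)%N by nia.
by rewrite -modnDmr [X in (_ + X)%N]modnMl addn0 -[in RHS]modnDmr modnMr addn0.
Qed.

(** ** Cusp forms on a finite quadratic module and their symmetrizations *)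

(** The least positive exponent in the class of e: a cusp form has no constant term, so residue 0
    counts as 144. *)
Definition qm (e : nat) := if (e %% 144 == 0)%N then 144%N else (e %% 144)%N.

(** Q is 144 q, and K is the matrix of rho_L(S) up to the factor e(-1/8). *)
Record cform (X : finType) (r : nat) (K : X -> X -> C) (Q : X -> nat) (f : X -> C -> C) : Prop := CForm {
  cf_q : forall x, sq (f x) (qm (Q x)) (Q x);
  cf_s : slaw r K f }.

Definition fqm_isom (X : finType) (K : X -> X -> C) (Q : X -> nat) (s : X -> X) :=
  [/\ injective s, forall x, Q (s x) = Q x %[mod 144] & forall x y, K (s x) (s y) = K x y].

Definition sinv (X : finType) (K : X -> X -> C) (Q : X -> nat) (f : X -> C -> C) :=
  forall s, fqm_isom K Q s -> forall x tau, 0 < Im tau -> f (s x) tau = f x tau.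

Definition xlaw (X : finType) (j : C -> C) (K : X -> X -> C) (f : X -> C -> C) :=
  forall x tau, 0 < Im tau -> f x (- tau^-1) = j tau * \sum_y K x y * f y tau.

Section Average.
Variables (X : finType) (K : X -> X -> C) (Q : X -> nat).

Definition isoms : {set {perm X}} := [set p : {perm X} | `[< fqm_isom K Q p >]].

Lemma isomsP (p : {perm X}) : reflect (fqm_isom K Q p) (p \in isoms).
Proof. by rewrite inE; exact: asboolP. Qed.

Lemma isoms_group : group_set isoms.
Proof.
apply/group_setP; split.
  by apply/isomsP; split=> [|x|x y]; rewrite ?perm1 //; exact: perm_inj.
move=> p q /isomsP[_ p2 p3] /isomsP[_ q2 q3]; apply/isomsP; split.
- exact: perm_inj.
- by move=> x; rewrite permM q2.
- by move=> x y; rewrite !permM q3.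
Qed.

(** A sum and not a mean; the number of isometries reappears as a factor in [lambda_avg] and
    [petersson_avg]. *)
Definition avg (f : X -> C -> C) x t := \sum_(p in isoms) f (p x) t.

Lemma avg_xlaw j f : xlaw j K f -> xlaw j K (avg f).
Proof.
move=> fs x tau t0; rewrite /avg; under eq_bigr do rewrite fs //.
rewrite -mulr_sumr; congr (_ * _); under [RHS]eq_bigr do rewrite mulr_sumr.
rewrite [RHS]exchange_big /=; apply: eq_bigr => p /isomsP[_ _ p3].
by rewrite (reindex_inj (@perm_inj _ p)); apply: eq_bigr => y _; rewrite p3.
Qed.

Lemma avg_sq f : (forall x, sq (f x) (qm (Q x)) (Q x)) -> forall x, sq (avg f x) (qm (Q x)) (Q x).
Proof.
move=> fq x; apply: sq_sum => p /isomsP[_ p2 _].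
have := fq (p x); have -> : qm (Q (p x)) = qm (Q x) by rewrite /qm p2.
by apply: sq_mod; rewrite p2.
Qed.

Lemma avg_cform r f : cform r K Q f -> cform r K Q (avg f).
Proof. by move=> [fq [j j2 fs]]; split; [exact: avg_sq|exists j => //; exact: avg_xlaw]. Qed.

Lemma avg_sinv f : sinv K Q (avg f).
Proof.
move=> s hs x tau t0; rewrite /avg; have [si s2 s3] := hs.
pose ps := perm si; have psG : ps \in Group isoms_group.
  by apply/isomsP; split=> [|y|y z]; rewrite ?permE //; exact: perm_inj.
rewrite [RHS](reindex_inj (mulgI ps)) /=; apply: eq_big => [p|p _].
  by have := groupMl p psG; rewrite /= => ->.
by rewrite permM permE.
Qed.

End Average.

(** Evaluate the S-law of the vanishing component at -1/tau, also a point where it vanishes; the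
    automorphy factor is nonzero, so a linear relation among the other components remains. *)
Lemma slaw_zero (X : finType) r K (f : X -> C -> C) x : slaw r K f ->
  (forall tau, 0 < Im tau -> f x tau = 0) -> forall tau, 0 < Im tau -> \sum_y K x y * f y tau = 0.
Proof.
move=> [j j2 h] z tau t0; have := h x tau t0; rewrite z ?Im_invN_gt0 // => /esym/eqP.
rewrite mulf_eq0 => /orP[|/eqP //]; rewrite -md_eq0 => /eqP j0.
have := j2 tau t0; rewrite j0 expr0n /= => /eqP; rewrite eq_sym expf_eq0 md_eq0.
by rewrite (negbTE (Im_gt0_neq0 t0)) andbF.
Qed.

Lemma cform_vanish (X : finType) r K Q (f : X -> C -> C) : unitary K -> cform r K Q f ->
  (forall x, 6 * r <= qm (Q x))%N -> forall x, (6 * r < qm (Q x))%N -> forall tau, 0 < Im tau -> f x tau = 0.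
Proof.
move=> uK [fq fs] h; apply: (@vanish _ _ r) => // [x||].
- exact: sq_sqo (fq x).
- exact: slaw_norm fs.
- exact: sq_normT fq.
Qed.

(** Applied with [P] the classes whose order equals the bound: they form one orbit, the others
    already vanish, and the relation comes from the zero class, whose row in the S-matrix is
    constant. *)
Lemma sum_orbit (X : finType) (g : X -> C) (P : pred X) x1 : P x1 -> (forall x, ~~ P x -> g x = 0) ->
  (forall x, P x -> g x = g x1) -> \sum_x g x = 0 -> forall x, g x = 0.
Proof.
move=> P1 nP hP s0; suff g1 : g x1 = 0 by move=> x; case: (boolP (P x)) => [/hP ->|/nP].
move: s0; rewrite (bigID P) /= [X in _ + X]big1 // addr0 (eq_bigr _ hP) sumr_const => /eqP.
by rewrite mulrn_eq0 (cardD1 x1) unfold_in P1 => /eqP.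
Qed.

Lemma I2P (P : 'I_2 -> Prop) : P ord0 -> P (inord 1) -> forall x, P x.
Proof.
move=> p0 p1 [[|[|//]] i]; [have -> : Ordinal i = ord0 by exact: val_inj|have -> : Ordinal i = inord 1 by apply: val_inj; rewrite /= inordK]; by [].
Qed.

Lemma I3P (P : 'I_3 -> Prop) : P ord0 -> P (inord 1) -> P (inord 2) -> forall x, P x.
Proof.
move=> p0 p1 p2 [[|[|[|//]]] i]; [have -> : Ordinal i = ord0 by exact: val_inj|have -> : Ordinal i = inord 1 by apply: val_inj; rewrite /= inordK|
 have -> : Ordinal i = inord 2 by apply: val_inj; rewrite /= inordK]; by [].
Qed.

Lemma I4P (P : 'I_4 -> Prop) : P ord0 -> P (inord 1) -> P (inord 2) -> P (inord 3) -> forall x, P x.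
Proof.
move=> p0 p1 p2 p3 [[|[|[|[|//]]]] i]; [have -> : Ordinal i = ord0 by exact: val_inj|have -> : Ordinal i = inord 1 by apply: val_inj; rewrite /= inordK|
 have -> : Ordinal i = inord 2 by apply: val_inj; rewrite /= inordK|have -> : Ordinal i = inord 3 by apply: val_inj; rewrite /= inordK]; by [].
Qed.

Lemma sumI2 (V : nmodType) (F : 'I_2 -> V) : \sum_x F x = F ord0 + F (inord 1).
Proof. by rewrite !big_ord_recr big_ord0 /= add0r; congr (F _ + F _); apply: val_inj; rewrite /= ?inordK. Qed.

Lemma sumI3 (V : nmodType) (F : 'I_3 -> V) : \sum_x F x = F ord0 + F (inord 1) + F (inord 2).
Proof. by rewrite !big_ord_recr big_ord0 /= add0r; congr (F _ + F _ + F _); apply: val_inj; rewrite /= ?inordK. Qed.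

Lemma sumI4 (V : nmodType) (F : 'I_4 -> V) : \sum_x F x = F ord0 + F (inord 1) + F (inord 2) + F (inord 3).
Proof. by rewrite !big_ord_recr big_ord0 /= add0r; congr (F _ + F _ + F _ + F _); apply: val_inj; rewrite /= ?inordK. Qed.

Lemma opp_inord n k : (0 < k <= n)%N -> - (inord k : 'I_n.+1) = inord (n.+1 - k).
Proof. by move=> /andP[k0 kn]; apply: val_inj; rewrite /= !inordK ?modn_small //; lia. Qed.

Lemma sqr_opp_mod c n (x : 'I_n.+1) : (144 %| c * n.+1 ^ 2)%N -> (144 %| 2 * c * n.+1)%N ->
  (c * (- x : 'I_n.+1) ^ 2 = c * x ^ 2 %[mod 144])%N.
Proof.
move=> h1 h2; have [x0|x0] := posnP x.
  have -> : x = 0 by apply: val_inj.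
  by rewrite oppr0.
have xn := ltn_ord x.
have -> : ((- x : 'I_n.+1) = n.+1 - x :> nat)%N by rewrite /= modn_small //; lia.
apply/eqP; rewrite -(eqn_modDr (2 * c * n.+1 * x)); apply/eqP.
have -> : (c * (n.+1 - x) ^ 2 + 2 * c * n.+1 * x = c * n.+1 ^ 2 + c * x ^ 2)%N.
  move: (nat_of_ord x) xn => m mn.
  have [z ->] : exists z, n.+1 = (m + z)%N by exists (n.+1 - m)%N; lia.
  by rewrite addKn; ring.
by rewrite -modnDml (eqP h1) add0n -[in RHS]modnDmr -(modnMml (2 * c * n.+1)) (eqP h2) mul0n mod0n addn0.
Qed.

(** ** Discriminant 12 *)

Definition K12 := tensor (@uk 4 7) (@uk 3 2).
Definition Q12 (p : 'I_4 * 'I_3) := (126 * p.1 ^ 2 + 48 * p.2 ^ 2)%N.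

Lemma unitary_K12 : unitary K12.
Proof. by apply: unitary_tensor; apply: unitary_uk. Qed.

Lemma isom12_1 : fqm_isom K12 Q12 (fun p => (- p.1, p.2)).
Proof.
split=> [[a y] [b z] h|[a y]|[a y] [b z]].
    by have := congr1 fst h; have := congr1 snd h => /= -> /oppr_inj ->.
  by rewrite /Q12 /= -modnDml sqr_opp_mod // modnDml.
rewrite /K12 /tensorK /=; congr (_ * _); exact: uk_opp.
Qed.

Lemma isom12_2 : fqm_isom K12 Q12 (fun p => (p.1, - p.2)).
Proof.
split=> [[a y] [b z] h|[a y]|[a y] [b z]].
    by have := congr1 fst h; have := congr1 snd h => /= /oppr_inj -> ->.
  by rewrite /Q12 /= -modnDmr sqr_opp_mod // modnDmr.
rewrite /K12 /tensorK /=; congr (_ * _); exact: uk_opp.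
Qed.

(** The bound is 30. It is attained only at the classes with a odd and y nonzero, where 126 + 48 is
    30 modulo 144; these are exchanged by the sign changes. *)
Lemma no_form12 f : cform 5 K12 Q12 f ->
  (forall a y tau, 0 < Im tau -> f (- a, y) tau = f (a, y) tau) ->
  (forall a y tau, 0 < Im tau -> f (a, - y) tau = f (a, y) tau) -> forall x tau, 0 < Im tau -> f x tau = 0.
Proof.
move=> hf j1 j2 x tau t0.
have i1 a y : f (- a, y) tau = f (a, y) tau by exact: j1.
have i2 a y : f (a, - y) tau = f (a, y) tau by exact: j2.
have q30 z : (30 <= qm (Q12 z))%N.
  by case: z; apply: I4P; apply: I3P; rewrite /Q12 /= ?inordK.
have z0 : forall z, (30 < qm (Q12 z))%N -> forall t, 0 < Im t -> f z t = 0 := cform_vanish unitary_K12 hf q30.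
have S := slaw_zero (cf_s hf) (z0 (ord0, ord0) isT) t0.
apply: (@sum_orbit _ (fun z => f z tau) (fun z => qm (Q12 z) == 30%N) (inord 1, inord 1)).
- by rewrite /Q12 /= !inordK.
- by move=> z zn; apply: z0 => //; rewrite ltn_neqAle eq_sym zn q30.
- have e3 : inord 3 = - inord 1 :> 'I_4 by rewrite opp_inord.
  have e2 : inord 2 = - inord 1 :> 'I_3 by rewrite opp_inord.
  by case; apply: I4P; apply: I3P; rewrite /Q12 /= ?inordK // => _; rewrite ?e3 ?e2 ?i1 ?i2.
- have c0 : ((Num.sqrt 4%:R)%:C : C)^-1 * ((Num.sqrt 3%:R)%:C)^-1 != 0.
    by rewrite mulf_neq0 // invr_eq0 -md_eq0 md_real normr_eq0 sqrtr_eq0 -ltNge ltr0n.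
  apply: (mulfI c0); rewrite mulr0 -[RHS]S mulr_sumr; apply: eq_bigr => z _.
  by rewrite /K12 /tensorK /= !uk_0 // muln0 mul0n.
Qed.

(** ** Contraction with theta functions *)

(** As for [cform], but without vanishing at the cusp, as theta functions require. *)
Record wform (X : finType) (r : nat) (K : X -> X -> C) (Q : X -> nat) (f : X -> C -> C) : Prop := WForm {
  wf_q : forall x, sq (f x) 0 (Q x);
  wf_s : slaw r K f }.

Lemma sq_qm (f : C -> C) m e : (0 < m)%N -> sq f m e -> sq f (qm e) e.
Proof.
move=> m0; apply: sq_lift => k /andP[mk]; rewrite /qm; case: eqP => e0 kl; rewrite ?e0 modn_small; lia.
Qed.

Lemma qm_gt0 e : (0 < qm e)%N.
Proof. by rewrite /qm; case: eqP; lia. Qed.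

Lemma sum_pair (V : nmodType) (X Y : finType) (F : X * Y -> V) : \sum_p F p = \sum_x \sum_y F (x, y).
Proof. by rewrite pair_bigA; apply: eq_bigr => -[]. Qed.

(** The sum over z pairs two dual S-matrices, so the common summand Z drops out and the remaining
    summand of g takes its place, while the weights add. *)
Lemma slaw_contract (A X Z : finType) r s (KA : A -> A -> C) (KZ KZ' : Z -> Z -> C) (KX : X -> X -> C) f g :
  slaw r (@tensorK R _ _ KA KZ) f -> slaw s (@tensorK R _ _ KX KZ') g ->
  (forall z z', \sum_w KZ w z * KZ' w z' = (z == z')%:R) ->
  slaw (r + s) (@tensorK R _ _ KA KX) (fun p t => \sum_z f (p.1, z) t * g (p.2, z) t).
Proof.
move=> [j j2 hf] [k k2 hg] dual; exists (fun t => j t * k t) => [tau t0|[a x] tau t0 /=].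
  by rewrite mdM exprMn j2 // k2 // exprD.
under eq_bigr do rewrite hf // hg // mulrACA.
rewrite -mulr_sumr; congr (_ * _); rewrite sum_pair /=.
transitivity (\sum_a' \sum_x' KA a a' * KX x x' * (\sum_z1 \sum_z2 (\sum_z KZ z z1 * KZ' z z2) * (f (a', z1) tau * g (x', z2) tau))).
  under eq_bigr do rewrite sum_pair mulr_suml.
  rewrite exchange_big /=; apply: eq_bigr => a' _.
  under eq_bigr do rewrite sum_pair mulr_sumr.
  rewrite exchange_big /=; apply: eq_bigr => x' _.
  transitivity (\sum_z \sum_z1 \sum_z2 KA a a' * KX x x' * (KZ z z1 * KZ' z z2 * (f (a', z1) tau * g (x', z2) tau))).
    apply: eq_bigr => z _; rewrite mulr_suml; apply: eq_bigr => z1 _; rewrite mulr_sumr; apply: eq_bigr => z2 _.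
    by rewrite /tensorK /=; ring.
  rewrite exchange_big mulr_sumr; apply: eq_bigr => z1 _.
  rewrite exchange_big mulr_sumr; apply: eq_bigr => z2 _.
  by rewrite -mulr_sumr -mulr_suml.
apply: eq_bigr => a' _; apply: eq_bigr => x' _; rewrite /tensorK /=; congr (_ * _).
apply: eq_bigr => z _; rewrite (bigD1 z) //= dual eqxx mul1r big1 ?addr0 // => z' zz.
by rewrite dual eq_sym (negbTE zz) mul0r.
Qed.

Lemma cform_contract (A X Z : finType) r s (KA : A -> A -> C) (KZ KZ' : Z -> Z -> C) (KX : X -> X -> C) Q Q' QF f g :
  cform r (@tensorK R _ _ KA KZ) Q f -> wform s (@tensorK R _ _ KX KZ') Q' g ->
  (forall z z', \sum_w KZ w z * KZ' w z' = (z == z')%:R) ->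
  (forall a x z, Q (a, z) + Q' (x, z) = QF (a, x) %[mod 144])%N ->
  cform (r + s) (@tensorK R _ _ KA KX) QF (fun p t => \sum_z f (p.1, z) t * g (p.2, z) t).
Proof.
move=> [fq fs] [gq gs] dual QE; split; last exact: (slaw_contract fs gs dual).
move=> [a x] /=; apply: sq_sum => z _; apply: (sq_qm (m := 1)) => //.
apply: sq_mod (QE a x z) _; apply: sq_le (sqM (fq (a, z)) (gq (x, z))).
by rewrite addn0 qm_gt0.
Qed.

Lemma conj_uk n k k' (x y : 'I_n) : (n %| k + k')%N -> conjc (uk k x y) = uk k' x y.
Proof.
move=> /dvdnP[q kk]; have n0 : (0 < n)%N by case: n x {y kk} => // -[].
have nC : n%:R != 0 :> C by rewrite pnatr_eq0 -lt0n.
rewrite /uk conjcM -fmorphV /= oppr0; congr (_ * _).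
have -> : - ((k * x * y)%N%:R / n%:R) = (- ((k * x * y)%N%:R / n%:R))%:C :> C by rewrite rmorphN fmorph_div !rmorph_nat.
rewrite conjc_e2pi -rmorphN opprK fmorph_div !rmorph_nat.
have -> : (k * x * y)%N%:R / n%:R = - ((k' * x * y)%N%:R / n%:R) + (Posz (q * x * y))%:~R :> C.
  have : (k * x * y + k' * x * y = q * x * y * n)%N by rewrite -!mulnDl kk; ring.
  move=> h; have := congr1 (fun m : nat => m%:R / n%:R : C) h.
  rewrite /= natrD mulrDl [(_ * n)%N%:R]natrM mulfK // => e.
  by rewrite -[(Posz _)%:~R]/((q * x * y)%N%:R) -e; ring.
by rewrite e2piD e2pi_int mulr1.
Qed.

Lemma uk_dual n k k' (z z' : 'I_n) : coprime n k -> (n %| k + k')%N -> \sum_w uk k w z * uk k' w z' = (z == z')%:R.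
Proof. by move=> cop kk; rewrite -(@uk_orth R n k z z' cop); apply: eq_bigr => w _; rewrite (conj_uk _ _ kk). Qed.

(** The Chinese remainder theorem, r = 3x + 2y: modulo 1 one has r^2/12 = 3x^2/4 + y^2/3, because
    the cross term is integral. *)
Definition uu (p : 'I_2 * 'I_3) : C -> C := U ((3 * p.1 + 2 * p.2) %% 6).

Lemma uu_law : xlaw (fun t => (jb t)^-1) (tensor (@uk 2 3) (@uk 3 2)) uu.
Proof.
move=> [x y] tau t0.
have s6 : (Num.sqrt 6%:R)%:C != 0 :> C by rewrite -md_eq0 md_real normr_eq0 sqrtr_eq0 -ltNge ltr0n.
apply: (mulfI (mulf_neq0 s6 (jb_neq0 t0))); set r := ((3 * x + 2 * y) %% 6)%N.
have r6 : (r < 6)%N by rewrite ltn_mod.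
have := @theta_S R 12 6 r tau erefl r6 t0.
have Ur s t : tser 12 (ind R 6 s) t = U s t by rewrite usr.unlock.
rewrite Ur /uu /= => ->; under eq_bigr do rewrite Ur.
rewrite mulrA mulfK ?jb_neq0 // mulr_sumr.
pose H (s : nat) := e2pi (- ((r * s)%N%:R / 6%:R)) * U s tau.
transitivity (\sum_p H ((3 * (p : 'I_2 * 'I_3).1 + 2 * p.2) %% 6)%N).
  rewrite sum_pair sumI2 !sumI3 /= ?inordK // !big_ord_recr big_ord0 /= /H.
  rewrite -!natrM [(_ + 2 * 1)%N]/= ; ring.
apply: eq_bigr => -[x' y'] _; rewrite /H mulrA; congr (_ * _).
rewrite /tensorK /uk /= mulrACA -invfM -rmorphM -sqrtrM ?ler0n // -natrM [RHS]mulrC mulfVK //.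
rewrite -e2piD -opprD.
have -> : (3 * x * x')%N%:R / 2%:R + (2 * y * y')%N%:R / 3%:R = (9 * x * x' + 4 * y * y')%N%:R / 6%:R :> C.
  by rewrite natrD !natrM; field.
apply: e2pi_mod => //; rewrite modnMm.
have -> : ((3 * x + 2 * y) * (3 * x' + 2 * y') = 9 * x * x' + 4 * y * y' + (x * y' + x' * y) * 6)%N by ring.
by rewrite -modnDmr modnMl addn0.
Qed.

Lemma uu_form : wform 1 (tensor (@uk 2 3) (@uk 3 2)) (fun p => 108 * p.1 ^ 2 + 48 * p.2 ^ 2)%N uu.
Proof.
split=> [[x y]|].
  have r6 : ((3 * x + 2 * y) %% 6 < 6)%N by rewrite ltn_mod.
  have := @tser_sq R 12 6 _ erefl isT r6; rewrite /uu usr.unlock /= => /(sq_le (leq0n _)); apply: sq_mod.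
  by case: x {r6} => [[|[|//]] ?]; case: y => [[|[|[|//]]] ?].
exists (fun t => (jb t)^-1) => [tau t0|].
  by rewrite mdV exprVn md_jb // invrK expr1.
exact: uu_law.
Qed.

(** ** Discriminant 24 *)

Definition KA24 := tensor (tensor (@uk 2 1) (@uk 2 1)) (@uk 2 1).
Definition QA24 (p : 'I_2 * 'I_2 * 'I_2) := (36 * (p.1.1 ^ 2 + p.1.2 ^ 2 + p.2 ^ 2))%N.
Definition K24 := tensor KA24 (@uk 3 4).
Definition Q24 (p : 'I_2 * 'I_2 * 'I_2 * 'I_3) := (QA24 p.1 + 96 * p.2 ^ 2)%N.

Lemma isom24_1 : fqm_isom K24 Q24 (fun p => (p.1.1.2, p.1.1.1, p.1.2, p.2)).
Proof.
split=> [[[[a b] c] y] [[[a' b'] c'] y'] [-> -> -> ->] //|[[[a b] c] y]|[[[a b] c] y] [[[a' b'] c'] y']].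
  by rewrite /Q24 /QA24 /= (addnC (b ^ 2)%N).
by rewrite /K24 /KA24 /tensorK /= [uk 1 b b' * _]mulrC.
Qed.

Lemma isom24_2 : fqm_isom K24 Q24 (fun p => (p.1.1.1, p.1.2, p.1.1.2, p.2)).
Proof.
split=> [[[[a b] c] y] [[[a' b'] c'] y'] [-> -> -> ->] //|[[[a b] c] y]|[[[a b] c] y] [[[a' b'] c'] y']].
  by rewrite /Q24 /QA24 /= (addnAC (a ^ 2)%N).
by rewrite /K24 /KA24 /tensorK /= [uk 1 a a' * _ * _]mulrAC.
Qed.

Lemma isom24_3 : fqm_isom K24 Q24 (fun p => (p.1, - p.2)).
Proof.
split=> [[a y] [b z] h|[a y]|[a y] [b z]].
    by have := congr1 fst h; have := congr1 snd h => /= /oppr_inj -> ->.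
  by rewrite /Q24 /= -modnDmr sqr_opp_mod // modnDmr.
rewrite /K24 /tensorK /=; congr (_ * _); exact: uk_opp.
Qed.

(** Classes with two of the first three coordinates and the last one nonzero have order 24, below
    the bound 30. Contraction with [uu] trades Z/3 for Z/2 and leads to weight 3 with bound 36, and
    on the new module all exponents are multiples of 36. *)
Lemma no_form24 f : cform 5 K24 Q24 f -> sinv K24 Q24 f -> forall x tau, 0 < Im tau -> f x tau = 0.
Proof.
move=> hf si.
have i1 a b c y t : 0 < Im t -> f (b, a, c, y) t = f (a, b, c, y) t by move=> t0; exact: (si _ isom24_1 (a, b, c, y) t t0).
have i2 a b c y t : 0 < Im t -> f (a, c, b, y) t = f (a, b, c, y) t by move=> t0; exact: (si _ isom24_2 (a, b, c, y) t t0).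
have i3 a y t : 0 < Im t -> f (a, - y) t = f (a, y) t by move=> t0; exact: (si _ isom24_3 (a, y) t t0).
pose QF (p : 'I_2 * 'I_2 * 'I_2 * 'I_2) := (QA24 p.1 + 108 * p.2 ^ 2)%N.
pose F (p : 'I_2 * 'I_2 * 'I_2 * 'I_2) t := \sum_z f (p.1, z) t * uu (p.2, z) t.
have hF : cform (5 + 1) (tensor KA24 (@uk 2 3)) QF F.
  apply: (cform_contract hf uu_form); first by move=> z z'; apply: uk_dual.
  move=> a x z; rewrite /Q24 /QF /=.
  have -> : (QA24 a + 96 * z ^ 2 + (108 * x ^ 2 + 48 * z ^ 2) = (QA24 a + 108 * x ^ 2) + (z ^ 2) * 144)%N by ring.
  by rewrite -modnDmr modnMl addn0.
have uF : unitary (tensor KA24 (@uk 2 3)).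
  by apply: unitary_tensor; [apply: unitary_tensor; first apply: unitary_tensor|]; apply: unitary_uk.
have q36 p : (6 * (5 + 1) <= qm (QF p))%N.
  case: p => [[[a b] c] x]; elim/I2P: a; elim/I2P: b; elim/I2P: c; elim/I2P: x; by rewrite /QF /QA24 /= ?inordK.
have Fz : forall p, (6 * (5 + 1) < qm (QF p))%N -> forall t, 0 < Im t -> F p t = 0 := cform_vanish uF hF q36.
have F1 a b c x t : 0 < Im t -> F (b, a, c, x) t = F (a, b, c, x) t.
  by move=> t0; apply: eq_bigr => z _; rewrite /= i1.
have F2 a b c x t : 0 < Im t -> F (a, c, b, x) t = F (a, b, c, x) t.
  by move=> t0; apply: eq_bigr => z _; rewrite /= i2.
have F0 p t : 0 < Im t -> F p t = 0.
  move=> t0; set o := inord 1 : 'I_2; set z := ord0 : 'I_2.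
  have z0 q : (6 * (5 + 1) < qm (QF q))%N -> F q t = 0 by move=> h; exact: Fz.
  have e000 : F (z, z, z, z) t = 0 by apply: z0; rewrite /QF /QA24 /= ?inordK.
  have e001 : F (z, z, z, o) t = 0 by apply: z0; rewrite /QF /QA24 /= ?inordK.
  have e011 : F (z, z, o, o) t = 0 by apply: z0; rewrite /QF /QA24 /= ?inordK.
  have e110 : F (z, o, o, z) t = 0 by apply: z0; rewrite /QF /QA24 /= ?inordK.
  have e1110 : F (o, o, o, z) t = 0 by apply: z0; rewrite /QF /QA24 /= ?inordK.
  have e1111 : F (o, o, o, o) t = 0 by apply: z0; rewrite /QF /QA24 /= ?inordK.
  have r x : F (z, o, z, x) t = F (z, z, o, x) t by rewrite F2.
  have r' x : F (o, z, z, x) t = F (z, z, o, x) t by rewrite F1 // r.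
  have s x : F (o, z, o, x) t = F (z, o, o, x) t by rewrite F1.
  have s' x : F (o, o, z, x) t = F (z, o, o, x) t by rewrite F2 // s.
  (* Two orbits lie exactly on the bound: one nonzero coordinate with x = 0, and two with x = 1. The
     relations at (0,0,0,0) and (0,0,0,1) yield the sum and the difference of their values. *)
  have S0 := slaw_zero (cf_s hF) (Fz (z, z, z, z) _) t0.
  have S1 := slaw_zero (cf_s hF) (Fz (z, z, z, o) _) t0.
  have c0 : (Num.sqrt 2%:R)%:C != 0 :> C by rewrite -md_eq0 md_real normr_eq0 sqrtr_eq0 -ltNge ltr0n.
  have c3 : 3%:R * ((Num.sqrt 2%:R)%:C^-1 ^+ 4) != 0 :> C.
    by rewrite mulf_neq0 ?pnatr_eq0 ?expf_neq0 ?invr_eq0.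
  have {S0} : F (z, z, o, z) t + F (z, o, o, o) t = 0.
    have := S0; rewrite /QF /QA24 /= ?inordK // => /(_ isT).
    rewrite !sum_pair !sumI2 /tensorK /KA24 /tensorK /= !uk_half // !inordK // !muln0 !mul0n ?muln1 ?expr0 -/o -/z.
    rewrite e000 e001 e011 e110 e1110 e1111 !r !r' !s !s' e110 e011 !mulr0 !mul1r => h.
    have : 3%:R * ((Num.sqrt 2%:R)%:C^-1 ^+ 4) * (F (z, z, o, z) t + F (z, o, o, o) t) = 0 by rewrite -[RHS]h; ring.
    by move=> h'; apply: (mulfI c3); rewrite mulr0.
  have {S1} : F (z, z, o, z) t - F (z, o, o, o) t = 0.
    have := S1; rewrite /QF /QA24 /= ?inordK // => /(_ isT).
    rewrite !sum_pair !sumI2 /tensorK /KA24 /tensorK /= !uk_half // !inordK // !muln0 !mul0n ?muln1 ?expr0 ?expr1 -/o -/z.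
    rewrite e000 e001 e011 e110 e1110 e1111 !r !r' !s !s' e110 e011 !mulr0 !mul1r => h.
    have : 3%:R * ((Num.sqrt 2%:R)%:C^-1 ^+ 4) * (F (z, z, o, z) t - F (z, o, o, o) t) = 0 by rewrite -[RHS]h; ring.
    by move=> h'; apply: (mulfI c3); rewrite mulr0.
  move=> h2 h1.
  have k1 : F (z, z, o, z) t = 0.
    have : 2%:R * F (z, z, o, z) t = 0 by rewrite -[RHS]addr0 -{1}h1 -h2; ring.
    by move/eqP; rewrite mulf_eq0 pnatr_eq0 => /eqP.
  have k2 : F (z, o, o, o) t = 0 by move: h1; rewrite k1 add0r.
  case: p => [[[a b] c] x]; elim/I2P: a; elim/I2P: b; elim/I2P: c; elim/I2P: x; rewrite -/o -/z ?r ?r' ?s ?s' //.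
move=> [a y] tau t0.
have e2 : inord 2 = - inord 1 :> 'I_3 by rewrite opp_inord.
(* The two values of x give a linear system for f(a,0) and 2 f(a,1) with determinant U0 U1 - U2 U3 =
   eta^2, which has no zero. *)
have eq1 : f (a, ord0) tau * U 0 tau + 2 * f (a, inord 1) tau * U 2 tau = 0.
  rewrite -(F0 (a, ord0) tau t0) /F sumI3 /= e2 i3 // -e2 /uu /= !inordK // [(_ %% 6)%N]/=.
  by have [-> _] := U_sym t0; ring.
have eq2 : f (a, ord0) tau * U 3 tau + 2 * f (a, inord 1) tau * U 1 tau = 0.
  rewrite -(F0 (a, inord 1) tau t0) /F sumI3 /= e2 i3 // -e2 /uu /= !inordK //.
  by have [_ h5] := U_sym t0; rewrite [((3 * 1 + 2 * 1) %% 6)%N]/= [((3 * 1 + 2 * 2) %% 6)%N]/= h5; ring.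
have En := E_neq0 t0.
have f0 : f (a, ord0) tau = 0.
  apply: (mulIf En); rewrite mul0r eta2.unlock.
  have -> : f (a, ord0) tau * (U 0 tau * U 1 tau - U 2 tau * U 3 tau) =
    (f (a, ord0) tau * U 0 tau + 2 * f (a, inord 1) tau * U 2 tau) * U 1 tau - (f (a, ord0) tau * U 3 tau + 2 * f (a, inord 1) tau * U 1 tau) * U 2 tau by ring.
  by rewrite eq1 eq2 !mul0r subrr.
have f1 : f (a, inord 1) tau = 0.
  have n2 : (2 : C) != 0 by rewrite pnatr_eq0.
  apply: (mulfI n2); apply: (mulIf En); rewrite mulr0 mul0r eta2.unlock.
  have -> : 2 * f (a, inord 1) tau * (U 0 tau * U 1 tau - U 2 tau * U 3 tau) =
    (f (a, ord0) tau * U 3 tau + 2 * f (a, inord 1) tau * U 1 tau) * U 0 tau - (f (a, ord0) tau * U 0 tau + 2 * f (a, inord 1) tau * U 2 tau) * U 3 tau by ring.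
  by rewrite eq1 eq2 !mul0r subrr.
by elim/I3P: y; rewrite ?e2 ?i3.
Qed.

End Models.

(** * Products of components: modules of order 36 and 108 *)

Section Models.
Variable R : realType.
Local Notation C := R[i].
Local Notation md := (@md R).
Local Notation Re := complex.Re.
Local Notation Im := complex.Im.
Local Notation wq := (@wq R).
Local Notation jb := (@jb R).
Local Notation U := (@usr R).
Local Notation TH := (@thr R).
Local Notation E := (@eta2 R).
Local Notation uk := (@uk R).
Local Notation tensor := (@tensorK R _ _).

Lemma hasq0 (f : C -> C) a : hasq f a -> (forall t, 0 < Im t -> f t = 0) -> forall k, a k = 0.
Proof.
(* Multiplication by w makes the series vanish at w = 0 as well, a point that [wq] does not
   reach. *)
move=> [ga fa] z k; pose c := conv (mono R 1) a.
have gc : good c by apply: good_conv => //; exact: good_mono.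
have c0 : forall i, c i = 0.
  apply: (PS_coef0 gc ltr01) => w w1 _; rewrite PSM //; last exact: good_mono.
  rewrite PS_mono // expr1; have [->|wn] := eqVneq w 0; first by rewrite mul0r.
  by have [t t0 <-] := wq_surj wn w1; rewrite -fa // z // mulr0.
have := c0 (1 + k)%N; rewrite /c /conv (bigD1 (inord 1)) //= /mono inordK // eqxx mul1r addKn big1 ?addr0 // => i.
by rewrite -val_eqE /= inordK // => /negbTE ->; rewrite mul0r.
Qed.

Definition hzero (f : C -> C) := forall t, 0 < Im t -> f t = 0.

(** The first nonzero coefficients multiply to a nonzero coefficient, so there are no zero divisors.
    This extracts vanishing factors from vanishing products of components. *)
Lemma sqo_integral (f g : C -> C) m n : sqo f m -> sqo g n -> hzero (fun t => f t * g t) -> hzero f \/ hzero g.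
Proof.
move=> [a ha _] [b hb _] z.
have h0 := hasq0 (hasqM ha hb) z.
have [fz|fn] := pselect (hzero f); [by left|right].
have [gz|gn] := pselect (hzero g); first by [].
have ex (u : C -> C) c : hasq u c -> ~ hzero u -> exists k, c k != 0.
  move=> [gc uc] un; apply: contrapT => no; apply: un => t t0; rewrite uc //.
  have -> : c = (fun=> 0) by apply: funext => k; apply/eqP; apply: contrapT => /negP ck; apply: no; exists k.
  apply: PS_uniq (md_wq_lt1 t0) _; first by apply: (@good_bdd _ _ 0) => k; rewrite md0.
  by apply: (ctends_ext (u := fun=> 0)) (ctends_cst 0) => k; rewrite big1 // => i _; rewrite mul0r.
have ka := ex_minnP (ex f a ha fn); have kb := ex_minnP (ex g b hb gn).
case: ka => p ap pm; case: kb => q bq qmin.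
have va : vge p a by move=> k kp; apply/eqP; apply: contraTT kp => /pm; rewrite -leqNgt.
have vb : vge q b by move=> k kq; apply/eqP; apply: contraTT kq => /qmin; rewrite -leqNgt.
have := h0 (p + q)%N; rewrite (conv_lead va vb) => /eqP; rewrite mulf_eq0.
by rewrite (negbTE ap) (negbTE bq).
Qed.

Definition nrm (X : finType) (f : X -> C -> C) t := \sum_x md (f x t) ^+ 2.

(** Taking all products of components makes the sums of squares multiply, so transformation rules
    known only for the norms of the factors still give one for the product. *)
Lemma nrm_pair (X Y : finType) (f : X -> C -> C) (g : Y -> C -> C) t :
  nrm (fun p t => f p.1 t * g p.2 t) t = nrm f t * nrm g t.
Proof.
rewrite /nrm mulr_suml; under [RHS]eq_bigr do rewrite mulr_sumr.
by rewrite pair_bigA; apply: eq_bigr => -[x y] _ /=; rewrite mdM exprMn.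
Qed.

Lemma nrm0 (X : finType) (f : X -> C -> C) t : nrm f t = 0 <-> forall x, f x t = 0.
Proof.
split=> [h x|h]; last by rewrite /nrm big1 // => x _; rewrite h md0 expr0n.
apply/eqP; rewrite -md_eq0 -sqrf_eq0; move: h => /eqP.
by rewrite psumr_eq0 => [/allP/(_ x)|y _]; [rewrite mem_index_enum => /(_ isT)|exact: sqr_ge0].
Qed.

Lemma mdN1V tau : 0 < Im tau -> md (- tau^-1) = (md tau)^-1.
Proof. by move=> _; rewrite mdN mdV. Qed.

Lemma invNK (tau : C) : - (- tau^-1)^-1 = tau.
Proof. by rewrite invrN opprK invrK. Qed.

Lemma half4 : e2pi (- (2%:R / 4%:R)) = -1 :> C.
Proof.
have := @uk_half R 1 (inord 1) (inord 1) isT.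
have c0 : (Num.sqrt 2%:R)%:C^-1 != 0 :> C by rewrite invr_eq0 -md_eq0 md_real normr_eq0 sqrtr_eq0 -ltNge ltr0n.
rewrite /uk !inordK // => /(mulIf c0); rewrite muln1 mul1n expr1 => <-.
by congr e2pi; field.
Qed.

Lemma sqrt4C : (Num.sqrt 4%:R)%:C = 2 :> C.
Proof.
have -> : 4%:R = 2 ^+ 2 :> R by rewrite -natrX.
by rewrite sqrtr_sqr ger0_norm // (rmorph_nat (real_complex R)).
Qed.

(** ** Discriminant 36 *)

Definition KK := tensor (@uk 3 2) (@uk 3 2).
Definition K36 := tensor (@uk 4 5) KK.
Definition Q36 (p : 'I_4 * ('I_3 * 'I_3)) := (90 * p.1 ^ 2 + 48 * (p.2.1 ^ 2 + p.2.2 ^ 2))%N.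

Lemma isom36_1 : fqm_isom K36 Q36 (fun p => (- p.1, p.2)).
Proof.
split=> [[a y] [b z] h|[a y]|[a y] [b z]].
    by have := congr1 fst h; have := congr1 snd h => /= -> /oppr_inj ->.
  by rewrite /Q36 /= -modnDml sqr_opp_mod // modnDml.
rewrite /K36 /tensorK /=; congr (_ * _); exact: uk_opp.
Qed.

Lemma isom36_2 : fqm_isom K36 Q36 (fun p => (p.1, (- p.2.1, p.2.2))).
Proof.
split=> [[a [y y']] [b [z z']] h|[a [y y']]|[a [y y']] [b [z z']]].
    have h1 := congr1 fst h; have h2 := congr1 snd h; have h3 := congr1 fst h2; have h4 := congr1 snd h2.
    by move: h1 h3 h4 => /= -> /oppr_inj -> ->.
  rewrite /Q36; change (90 * a ^ 2 + 48 * ((- y : 'I_3) ^ 2 + y' ^ 2) = 90 * a ^ 2 + 48 * (y ^ 2 + y' ^ 2) %[mod 144])%N.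
  rewrite !mulnDr -[LHS]modnDmr -[RHS]modnDmr -[in LHS](modnDml (48 * (- y : 'I_3) ^ 2)).
  by rewrite sqr_opp_mod // modnDml.
by rewrite /K36 /KK /tensorK /=; congr (_ * (_ * _)); exact: uk_opp.
Qed.

Lemma isom36_3 : fqm_isom K36 Q36 (fun p => (p.1, (p.2.2, p.2.1))).
Proof.
split=> [[a [y y']] [b [z z']] [-> -> ->] //|[a [y y']]|[a [y y']] [b [z z']]].
  by rewrite /Q36 /= (addnC (y ^ 2)%N).
by rewrite /K36 /KK /tensorK /= [uk 2 y z * _]mulrC.
Qed.

Lemma unitary_KK : unitary KK.
Proof. by apply: unitary_tensor; apply: unitary_uk. Qed.

(** The class (2,1,1) has order 24, below the bound 30. For invariant f the combinations f_0 + f_2,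
    f_0 - f_2 and f_1 are permuted up to constants: S fixes the first and exchanges the other two, T
    exchanges the first two in absolute value, since their exponents at a = 0 and a = 2 differ by
    half a period. *)
Lemma no_form36 f : cform 5 K36 Q36 f -> sinv K36 Q36 f -> forall x, hzero (f x).
Proof.
move=> hf si.
have i1 a y t : 0 < Im t -> f (- a, y) t = f (a, y) t by move=> t0; exact: (si _ isom36_1 (a, y) t t0).
have i2 a y z t : 0 < Im t -> f (a, (- y, z)) t = f (a, (y, z)) t by move=> t0; exact: (si _ isom36_2 (a, (y, z)) t t0).
have i3 a y z t : 0 < Im t -> f (a, (z, y)) t = f (a, (y, z)) t by move=> t0; exact: (si _ isom36_3 (a, (y, z)) t t0).
have [j j2 fs] := cf_s hf; have fq := cf_q hf.
set o1 := inord 1 : 'I_4; set o2 := inord 2 : 'I_4; set o0 := ord0 : 'I_4.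
have e3 : inord 3 = - o1 :> 'I_4 by rewrite opp_inord.
pose f3 y t := f (o0, y) t + f (o2, y) t.
pose f4 y t := f (o0, y) t - f (o2, y) t.
pose f1 y t := f (o1, y) t.
have k0 (a : 'I_4) : uk 5 o0 a = 2^-1.
  by rewrite uk_0 ?sqrt4C // muln0 mul0n.
have k2 (a : 'I_4) : uk 5 o2 a = (-1) ^+ a / 2.
  rewrite /uk sqrt4C; congr (_ / _); rewrite inordK //.
  have -> : - ((5 * 2 * a)%N%:R / 4%:R) = a%:R * - (2%:R / 4%:R) + (- (Posz (2 * a)))%:~R :> C.
    by rewrite rmorphN /= !natrM; field.
  by rewrite e2piD e2pi_int mulr1 e2piX half4.
have S a y t : 0 < Im t -> f (a, y) (- t^-1) = j t * \sum_z KK y z * (\sum_b uk 5 a b * f (b, z) t).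
  move=> t0; rewrite fs // sum_pair exchange_big /=; congr (_ * _); apply: eq_bigr => z _.
  by rewrite mulr_sumr; apply: eq_bigr => b _; rewrite /K36 /tensorK /=; ring.
have S3 y t : 0 < Im t -> f3 y (- t^-1) = j t * \sum_z KK y z * f3 z t.
  move=> t0; rewrite /f3 !S // -mulrDr -big_split /=; congr (_ * _); apply: eq_bigr => z _.
  rewrite -mulrDr; congr (_ * _); rewrite !sumI4 !k0 !k2 !inordK // e3 i1 //.
  by rewrite -/o1 -/o2 -/o0 expr0 expr1; field.
have S4 y t : 0 < Im t -> f4 y (- t^-1) = j t * 2 * \sum_z KK y z * f1 z t.
  move=> t0; rewrite /f4 !S // -mulrBr -mulrA -sumrB mulr_sumr; congr (_ * _); apply: eq_bigr => z _.
  rewrite -mulrBr mulrCA; congr (_ * _); rewrite !sumI4 !k0 !k2 !inordK // e3 i1 //.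
  by rewrite -/o1 -/o2 -/o0 /f1 expr0 expr1; field.
have T y t : 0 < Im t -> md (f3 y (t + 1)) = md (f4 y t) /\ md (f4 y (t + 1)) = md (f3 y t).
  move=> t0; have h0 := sq_T (fq (o0, y)) t0; have h2 := sq_T (fq (o2, y)) t0.
  have em : e2pi ((Q36 (o2, y))%:R / 144%:R) = - e2pi ((Q36 (o0, y))%:R / 144%:R) :> C.
    have -> : (Q36 (o2, y))%:R / 144%:R = (Q36 (o0, y))%:R / 144%:R + (- (2%:R / 4%:R) + (Posz 3)%:~R) :> C.
      by rewrite /Q36 /= inordK // !natrD -pmulrn; field.
    by rewrite e2piD [e2pi (_ + 3%:~R)]e2piD e2pi_int half4; ring.
  have mz : md (e2pi ((Q36 (o0, y))%:R / 144%:R)) = 1 by exact: md_e2pi_frac.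
  rewrite /f3 /f4 h0 h2 em; move: (e2pi _) mz => z mz; set A := f _ t; set B := f _ t.
  have -> : z * A + - z * B = z * (A - B) by ring.
  have -> : z * A - - z * B = z * (A + B) by ring.
  by rewrite !mdM mz !mul1r.
have N3 t : 0 < Im t -> nrm f3 (- t^-1) = md t ^+ 5 * nrm f3 t.
  move=> t0; rewrite /nrm; under eq_bigr do rewrite S3 // mdM exprMn.
  by rewrite -mulr_sumr j2 // unitary_KK.
have N4 t : 0 < Im t -> nrm f4 (- t^-1) = md t ^+ 5 * (4 * nrm f1 t).
  move=> t0; rewrite /nrm; under eq_bigr do rewrite S4 // mdM exprMn.
  rewrite -mulr_sumr mdM exprMn j2 // unitary_KK -mulrA; congr (_ * (_ * _)).
  by rewrite md_natr -natrX.
have N1 t : 0 < Im t -> nrm f1 (- t^-1) = md t ^+ 5 * (nrm f4 t / 4).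
  move=> t0; have := N4 _ (Im_invN_gt0 t0); rewrite invNK mdN1V // => ->.
  have m0 : md t != 0 by rewrite md_eq0 Im_gt0_neq0.
  by rewrite exprVn; field; rewrite m0.
(* Weight 15/2 has bound 90, and the smallest orders of the three factors add up to 24 + 24 + 42 =
   90. *)
pose G (p : ('I_3 * 'I_3) * ('I_3 * 'I_3) * ('I_3 * 'I_3)) t := f3 p.1.1 t * f4 p.1.2 t * f1 p.2 t.
have NG t : nrm G t = nrm f3 t * nrm f4 t * nrm f1 t.
  by rewrite -(nrm_pair f3 f4) -(nrm_pair (fun p t => f3 p.1 t * f4 p.2 t) f1).
pose m3 y := minn (qm (Q36 (o0, y))) (qm (Q36 (o2, y))).
pose m1 y := qm (Q36 (o1, y)).
have q3 y : sqo (f3 y) (m3 y) /\ sqo (f4 y) (m3 y).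
  have h0 := sqo_le (geq_minl _ (qm (Q36 (o2, y)))) (sq_sqo (fq (o0, y))).
  have h2 := sqo_le (geq_minr (qm (Q36 (o0, y))) _) (sq_sqo (fq (o2, y))).
  split; first exact: sqoD.
  have := sqoD h0 (sqoZ (-1) h2).
  by have -> : (fun t => f (o0, y) t + -1 * f (o2, y) t) = f4 y by apply: funext => t; rewrite mulN1r.
have q1 y : sqo (f1 y) (m1 y) by exact: sq_sqo (fq (o1, y)).
have b3 y : (24 <= m3 y)%N.
  by case: y; apply: I3P; apply: I3P; rewrite /m3 /Q36 /= ?inordK.
have b1 y : (42 <= m1 y)%N.
  by case: y; apply: I3P; apply: I3P; rewrite /m1 /Q36 /= ?inordK.
have vG p : (90 < m3 p.1.1 + m3 p.1.2 + m1 p.2)%N -> hzero (G p).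
  apply: (@vanish _ _ 15 G (fun p => (m3 p.1.1 + m3 p.1.2 + m1 p.2)%N)).
  - by move=> q; apply: sqoM => //; apply: sqoM; have [] := q3 q.1.1; have [] := q3 q.1.2.
  - by move=> q; have := b3 q.1.1; have := b3 q.1.2; have := b1 q.2; lia.
  - move=> t t0; rewrite -/(nrm G _) -/(nrm G _) !NG N3 // N4 // N1 //; by field.
  - move=> t t0; rewrite -/(nrm G _) -/(nrm G _) !NG [nrm f3 t * _]mulrC.
    congr (_ * _ * _); apply: eq_bigr => y _; have [a b] := T y _ t0; rewrite ?a ?b //.
    by rewrite /f1 (md_sq_T (fq (o1, y)) t0).
have fin : (forall y, hzero (f1 y)) -> forall x, hzero (f x).
  move=> z1 x t t0.
  have n4 s : 0 < Im s -> nrm f4 s = 0.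
    move=> s0; have := N4 _ (Im_invN_gt0 s0); rewrite invNK => ->.
    by rewrite (nrm0 f1 _).2 ?mulr0 // => y; apply: z1; exact: Im_invN_gt0.
  have z4 y s : 0 < Im s -> f4 y s = 0 by move=> /n4/nrm0.
  have z3 y s : 0 < Im s -> f3 y s = 0.
    move=> s0; have s1 : 0 < Im (s + 1) by rewrite cImD /= addr0.
    by apply/eqP; rewrite -md_eq0; have [_ <-] := T y _ s0; rewrite z4 // md0.
  have z0 y : f (o0, y) t = 0.
    have n2 : (2 : C) != 0 by rewrite pnatr_eq0.
    apply: (mulfI n2); rewrite mulr0 -[RHS](addr0 0) -{1}(z3 y t t0) -(z4 y t t0) /f3 /f4; ring.
  have z1' y : f (o1, y) t = 0 := z1 y t t0.
  have z2 y : f (o2, y) t = 0 by have := z3 y t t0; rewrite /f3 z0 add0r.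
  by case: x => a y; elim/I4P: a; rewrite -/o0 -/o1 -/o2 ?e3 ?i1 ?z0 ?z1' ?z2.
have [z1|nz1] := pselect (forall y, hzero (f1 y)); first exact: fin z1.
apply: fin => y t t0; exfalso; apply: nz1 => {y t t0}.
have [z4|nz4] := pselect (forall y, hzero (f4 y)).
  move=> y t t0; move: (N4 _ t0); rewrite (nrm0 f4 _).2; last by move=> w; apply: z4; exact: Im_invN_gt0.
  move/esym/eqP; rewrite mulf_eq0 expf_eq0 md_eq0 (negbTE (Im_gt0_neq0 t0)) andbF /= mulf_eq0 pnatr_eq0 /= => /eqP.
  by move/nrm0.
have [y4 hy4] : exists y, ~ hzero (f4 y) by apply: contrapT => no; apply: nz4 => y; apply: contrapT => h; apply: no; exists y.
have nz3 : ~ (forall y, hzero (f3 y)).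
  move=> z3; apply: hy4 => t t0; have s1 : 0 < Im (t + 1) by rewrite cImD /= addr0.
  by apply/eqP; rewrite -md_eq0; have [<- _] := T y4 _ t0; rewrite z3 // md0.
have [y3 hy3] : exists y, ~ hzero (f3 y) by apply: contrapT => no; apply: nz3 => y; apply: contrapT => h; apply: no; exists y.
(* A nonzero component of f3, of order at least 24, is fixed; 66 is what remains of 90. *)
have key y y' : (66 < m3 y + m1 y')%N -> hzero (f4 y) \/ hzero (f1 y').
  move=> h; have hz : hzero (G (y3, y, y')) by apply: vG => /=; have := b3 y3; lia.
  have [q31 _] := q3 y3; have [_ q4] := q3 y.
  by have [|] := sqo_integral (sqoM q31 q4) (q1 y') hz; [move=> /(sqo_integral q31 q4) [/hy3|]; [|left]|right].
have z1 y : (42 < m1 y)%N -> hzero (f1 y).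
  by move=> h; have [|/hy4|] := key y4 y => //; have := b3 y4; lia.
(* At y = 0 the order of f4 is 72, beyond the bound with any component of f1. So either every f1
   vanishes at once, or f4 vanishes at y = 0 and S turns this into the relation that the f1 sum to
   0. *)
have [|nn] := pselect (hzero (f4 (ord0, ord0))); last first.
  move=> y; have [|/nn|] := key (ord0, ord0) y => //; have := b1 y.
  by have -> : m3 (ord0, ord0) = 72%N; [rewrite /m3 /Q36 /= inordK|lia].
move=> z00; move=> y t t0.
have sum0 : \sum_y f1 y t = 0.
  have := S4 (ord0, ord0) _ t0; rewrite z00 ?Im_invN_gt0 // => /esym/eqP.
  have jn : j t != 0.
    by rewrite -md_eq0 -sqrf_eq0 j2 // expf_neq0 // md_eq0 Im_gt0_neq0.
  rewrite !mulf_eq0 (negbTE jn) pnatr_eq0 /= => /eqP h.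
  have c3 : (Num.sqrt 3%:R)%:C^-1 * (Num.sqrt 3%:R)%:C^-1 != 0 :> C.
    by rewrite mulf_neq0 // invr_eq0 -md_eq0 md_real normr_eq0 sqrtr_eq0 -ltNge ltr0n.
  apply: (mulfI c3); rewrite mulr0 -[RHS]h mulr_sumr; apply: eq_bigr => z _.
  by rewrite /KK /tensorK /= !uk_0 // muln0 mul0n.
apply: (@sum_orbit _ _ (fun y => f1 y t) (fun y => m1 y == 42%N) (inord 1, inord 1)) => //.
- by rewrite /m1 /Q36 /= !inordK.
- by move=> z zn; apply: z1 => //; rewrite ltn_neqAle eq_sym zn b1.
- have e2 : inord 2 = - inord 1 :> 'I_3 by rewrite opp_inord.
  case; apply: I3P; apply: I3P; rewrite /m1 /Q36 /= ?inordK // => _; rewrite /f1 ?e2.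
  + by rewrite i3 // i2 // i3.
  + by rewrite i2.
  + by rewrite i2 // i3 // i2 // i3.
Qed.

(** ** Discriminant 108 *)

Definition K108 := tensor (@uk 4 7) (tensor (@uk 9 2) (@uk 3 2)).
Definition Q108 (p : 'I_4 * ('I_9 * 'I_3)) := (126 * p.1 ^ 2 + (16 * p.2.1 ^ 2 + 48 * p.2.2 ^ 2))%N.

(** An isometry of order 3 that mixes the two 3-primary summands. It carries the classes with x
    prime to 3 and y = 1 to classes with y = 0, which sign changes cannot do. *)
Definition rot (p : 'I_4 * ('I_9 * 'I_3)) : 'I_4 * ('I_9 * 'I_3) :=
  (p.1, (inZp (4 * p.2.1 + 3 * p.2.2), inZp (p.2.2 + 2 * p.2.1))).

Lemma rotK p : rot (rot (rot p)) = p.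
Proof.
case: p => a [x y]; rewrite /rot /=; congr (_, (_, _)); apply: val_inj.
  by case: x => [[|[|[|[|[|[|[|[|[|//]]]]]]]]] ?]; case: y => [[|[|[|//]]] ?].
by case: x => [[|[|[|[|[|[|[|[|[|//]]]]]]]]] ?]; case: y => [[|[|[|//]]] ?].
Qed.

Lemma isom108_1 : fqm_isom K108 Q108 (fun p => (- p.1, p.2)).
Proof.
split=> [[a y] [b z] h|[a y]|[a y] [b z]].
    by have := congr1 fst h; have := congr1 snd h => /= -> /oppr_inj ->.
  by rewrite /Q108 /= -modnDml sqr_opp_mod // modnDml.
rewrite /K108 /tensorK /=; congr (_ * _); exact: uk_opp.
Qed.

Lemma isom108_2 : fqm_isom K108 Q108 (fun p => (p.1, (- p.2.1, p.2.2))).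
Proof.
split=> [[a [y y']] [b [z z']] h|[a [y y']]|[a [y y']] [b [z z']]].
    have h1 := congr1 fst h; have h2 := congr1 snd h; have h3 := congr1 fst h2; have h4 := congr1 snd h2.
    by move: h1 h3 h4 => /= -> /oppr_inj -> ->.
  rewrite /Q108 /= -[LHS]modnDmr -[RHS]modnDmr -[in LHS](modnDml (16 * (- y : 'I_9) ^ 2)).
  by rewrite sqr_opp_mod // modnDml.
by rewrite /K108 /tensorK /=; congr (_ * (_ * _)); exact: uk_opp.
Qed.

Lemma isom108_3 : fqm_isom K108 Q108 (fun p => (p.1, (p.2.1, - p.2.2))).
Proof.
split=> [[a [y y']] [b [z z']] h|[a [y y']]|[a [y y']] [b [z z']]].
    have h1 := congr1 fst h; have h2 := congr1 snd h; have h3 := congr1 fst h2; have h4 := congr1 snd h2.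
    by move: h1 h3 h4 => /= -> -> /oppr_inj ->.
  rewrite /Q108 /= -[LHS]modnDmr -[RHS]modnDmr; congr ((_ + _) %% _)%N.
  by rewrite -modnDmr sqr_opp_mod // modnDmr.
by rewrite /K108 /tensorK /=; congr (_ * (_ * _)); exact: uk_opp.
Qed.

Lemma isom108_rot : fqm_isom K108 Q108 rot.
Proof.
split; first exact: (can_inj (g := rot \o rot) rotK).
  move=> [a [x y]]; rewrite /Q108 /rot /= -[LHS]modnDmr -[RHS]modnDmr; congr ((_ + _) %% _)%N.
  set A := (4 * x + 3 * y)%N; set B := (y + 2 * x)%N.
  have sA : (16 * (A %% 9) ^ 2 = 16 * A ^ 2 %[mod 144])%N.
    rewrite [in RHS](divn_eq A 9); move: (A %/ 9)%N (A %% 9)%N => q s.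
    have -> : (16 * (q * 9 + s) ^ 2 = 16 * s ^ 2 + (9 * q ^ 2 + 2 * q * s) * 144)%N by ring.
    by rewrite -[RHS]modnDmr modnMl addn0.
  have sB : (48 * (B %% 3) ^ 2 = 48 * B ^ 2 %[mod 144])%N.
    rewrite [in RHS](divn_eq B 3); move: (B %/ 3)%N (B %% 3)%N => q s.
    have -> : (48 * (q * 3 + s) ^ 2 = 48 * s ^ 2 + (3 * q ^ 2 + 2 * q * s) * 144)%N by ring.
    by rewrite -[RHS]modnDmr modnMl addn0.
  rewrite -modnDm sA sB modnDm /A /B.
  have -> : (16 * (4 * x + 3 * y) ^ 2 + 48 * (y + 2 * x) ^ 2 = (16 * x ^ 2 + 48 * y ^ 2) + (3 * x ^ 2 + 4 * x * y + y ^ 2) * 144)%N by ring.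
  by rewrite -modnDmr modnMl addn0.
move=> [a [x y]] [b [z w]]; rewrite /K108 /rot /tensorK /=; congr (_ * _).
have key (x1 z1 : 'I_9) (y1 w1 : 'I_3) : uk 2 x1 z1 * uk 2 y1 w1 = e2pi (- ((2 * x1 * z1 + 6 * y1 * w1)%N%:R / 9%:R)) * ((Num.sqrt 9%:R)%:C^-1 / (Num.sqrt 3%:R)%:C).
  rewrite /uk mulrACA -e2piD -opprD; congr (e2pi (- _) * _).
  by rewrite natrD !natrM; field.
rewrite !key; congr (_ * _); apply: e2pi_mod => //=.
have m9 (A B : nat) : (2 * (A %% 9) * (B %% 9) = 2 * A * B %[mod 9])%N.
  by rewrite -!mulnA -[LHS]modnMmr modnMm modnMmr.
have m3 (A B : nat) : (6 * (A %% 3) * (B %% 3) = 6 * A * B %[mod 9])%N.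
  rewrite [in RHS](divn_eq A 3) [in RHS](divn_eq B 3); move: (A %/ 3)%N (A %% 3)%N (B %/ 3)%N (B %% 3)%N => q s q' s'.
  have -> : (6 * (q * 3 + s) * (q' * 3 + s') = 6 * s * s' + (6 * q * q' + 2 * q * s' + 2 * s * q') * 9)%N by ring.
  by rewrite -[RHS]modnDmr modnMl addn0.
rewrite -modnDm m9 m3 modnDm.
have -> : (2 * (4 * x + 3 * y) * (4 * z + 3 * w) + 6 * (y + 2 * x) * (w + 2 * z) =
  (2 * x * z + 6 * y * w) + (6 * x * z + 4 * (x * w + z * y) + 2 * y * w) * 9)%N by ring.
by rewrite -modnDmr modnMl addn0.
Qed.

Lemma sumI9 (F : 'I_9 -> C) : \sum_x F x = F ord0 + F (inord 1) + F (inord 2) + F (inord 3) + F (inord 4) +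
  F (inord 5) + F (inord 6) + F (inord 7) + F (inord 8).
Proof.
rewrite !big_ord_recr big_ord0 /= add0r.
by congr (F _ + F _ + F _ + F _ + F _ + F _ + F _ + F _ + F _); apply: val_inj; rewrite /= ?inordK.
Qed.

(** The subgroup {0, 3, 6} of Z/9 is isotropic and equal to its orthogonal complement. Summing over
    it maps forms on the module of order 108 to forms on that of order 12. *)
Lemma uk9_arrow (x : 'I_9) : uk 2 ord0 x + uk 2 (inord 3) x + uk 2 (inord 6) x = (3 %| x)%N%:R.
Proof.
have s9 : (Num.sqrt 9%:R)%:C = 3%:R :> C.
  have -> : 9%:R = 3%:R ^+ 2 :> R by rewrite -natrX.
  by rewrite sqrtr_sqr ger0_norm ?ler0n // rmorph_nat.
have s3 := sqrt_natC R 3.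
have c3 : (Num.sqrt 3%:R)%:C != 0 :> C by rewrite -md_eq0 md_real normr_eq0 sqrtr_eq0 -ltNge ltr0n.
have xm : (x %% 3 < 3)%N by rewrite ltn_mod.
have U k : (k < 3)%N -> uk 2 (inord (3 * k) : 'I_9) x = uk 2 (inord k) (Ordinal xm) / (Num.sqrt 3%:R)%:C.
  move=> k3; rewrite /uk s9 -mulrA -invfM s3 !inordK //; last lia.
  congr (_ / _); rewrite -(@e2pi_mod R (2 * k * x) (2 * k * (x %% 3)) 3) //; last by rewrite modnMmr.
  by congr e2pi; rewrite !natrM; field.
have := @uk_orth R 3 2 (Ordinal xm) ord0 isT.
rewrite sumI3 (_ : (3 %| x)%N = (Ordinal xm == ord0)) // => <-.
have u0 : uk 2 (ord0 : 'I_9) x = uk 2 (ord0 : 'I_3) (Ordinal xm) / (Num.sqrt 3%:R)%:C.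
  have := U 0%N isT; have -> : inord (3 * 0) = ord0 :> 'I_9 by apply: val_inj; rewrite /= inordK.
  by have -> : inord 0 = ord0 :> 'I_3 by apply: val_inj; rewrite /= inordK.
rewrite u0 (U 1%N isT) (U 2%N isT).
have cj k : conjc (uk 2 k (ord0 : 'I_3)) = ((Num.sqrt 3%:R)%:C)^-1 :> C.
  by rewrite uk_0 ?muln0 // -fmorphV /= oppr0.
by rewrite !cj.
Qed.

(** The four norms are permuted like the points of the projective line over the field with three
    elements. The action of S on the last two is not given but follows from the relation between S
    and T, in the form -1/s = 1 - 1/(t+1) for s = -1/t - 1. *)
Lemma cusp_norms (Nn N0 N1 N2 : C -> R) (k : R) : k != 0 ->
  (forall t, 0 < Im t -> [/\ Nn (t + 1) = Nn t, N0 (t + 1) = N2 t, N1 (t + 1) = N0 t & N2 (t + 1) = N1 t]) ->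
  (forall t, 0 < Im t -> Nn (- t^-1) = md t ^+ 5 * (k * N0 t)) ->
  forall t, 0 < Im t -> [/\ N0 (- t^-1) = md t ^+ 5 * (Nn t / k), N1 (- t^-1) = md t ^+ 5 * N2 t & N2 (- t^-1) = md t ^+ 5 * N1 t].
Proof.
move=> k0 T Sn.
have m0 t : 0 < Im t -> md t != 0 by move=> t0; rewrite md_eq0 Im_gt0_neq0.
have S0 t : 0 < Im t -> N0 (- t^-1) = md t ^+ 5 * (Nn t / k).
  move=> t0; have := Sn _ (Im_invN_gt0 t0); rewrite invNK mdN1V // exprVn => ->.
  by field; rewrite ?k0 ?m0.
have S1 t : 0 < Im t -> N1 (- t^-1) = md t ^+ 5 * N2 t.
  move=> t0; have t1 : 0 < Im (t + 1) by rewrite cImD /= addr0.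
  have tn := Im_gt0_neq0 t0; have t1n := Im_gt0_neq0 t1.
  pose s := - t^-1 - 1.
  have s0 : 0 < Im s by have -> : Im s = Im (- t^-1); [rewrite /s; case: (- t^-1) => u v /=; rewrite oppr0 addr0|exact: Im_invN_gt0].
  have sE : - s^-1 = - (t + 1)^-1 + 1.
    have -> : s = - ((t + 1) / t) by rewrite /s; field.
    by field; rewrite tn t1n.
  have [_ _ e1 _] := T s s0; rewrite /s subrK in e1; rewrite e1 -/s.
  have := S0 _ (Im_invN_gt0 s0); rewrite invNK mdN1V // => ->; rewrite sE.
  have [-> _ _ _] := T _ (Im_invN_gt0 t1); rewrite Sn //; have [_ -> _ _] := T t t0.
  have -> : md s = md (t + 1) / md t.
    by have -> : s = - ((t + 1) / t) by [rewrite /s; field]; rewrite mdN mdM mdV.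
  by rewrite !exprVn expr_div_n; field; rewrite ?k0 ?m0.
move=> t t0; split; [exact: S0|exact: S1|].
have := S1 _ (Im_invN_gt0 t0); rewrite invNK mdN1V // exprVn => ->.
by field; rewrite ?m0.
Qed.

(** Orders as small as 16 occur. Descent to the module of order 12 and the isometry [rot] reduce an
    invariant form to the components at x = 0, 1, 4, 7 with y = 0; S and T then permute the norms of
    four combinations of these. *)
Lemma no_form108 f : cform 5 K108 Q108 f -> sinv K108 Q108 f -> forall x, hzero (f x).
Proof.
move=> hf si.
have i1 a p t : 0 < Im t -> f (- a, p) t = f (a, p) t by move=> t0; exact: (si _ isom108_1 (a, p) t t0).
have i2 a x y t : 0 < Im t -> f (a, (- x, y)) t = f (a, (x, y)) t by move=> t0; exact: (si _ isom108_2 (a, (x, y)) t t0).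
have i3 a x y t : 0 < Im t -> f (a, (x, - y)) t = f (a, (x, y)) t by move=> t0; exact: (si _ isom108_3 (a, (x, y)) t t0).
have i4 a (x : 'I_9) (y : 'I_3) t : 0 < Im t -> f (a, (inZp (4 * x + 3 * y), inZp (y + 2 * x))) t = f (a, (x, y)) t.
  by move=> t0; exact: (si _ isom108_rot (a, (x, y)) t t0).
have [j j2 fs] := cf_s hf; have fq := cf_q hf.
(* The sum over the isotropic subgroup, zero by [no_form12]. *)
pose g (p : 'I_4 * 'I_3) t := f (p.1, (ord0, p.2)) t + f (p.1, (inord 3, p.2)) t + f (p.1, (inord 6, p.2)) t.
have hg : cform 5 (@K12 R) Q12 g.
  split.
    move=> [a y]; have q x : (3 %| x)%N -> (x < 9)%N -> sq (f (a, (inord x, y))) (qm (Q12 (a, y))) (Q12 (a, y)).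
      move=> /dvdnP[k ->] k9; have := fq (a, (inord (k * 3), y)).
      have e : Q108 (a, (inord (k * 3), y)) = Q12 (a, y) %[mod 144].
        rewrite /Q108 /Q12 /= inordK //.
        have -> : (126 * a ^ 2 + (16 * (k * 3) ^ 2 + 48 * y ^ 2) = (126 * a ^ 2 + 48 * y ^ 2) + k ^ 2 * 144)%N by ring.
        by rewrite -modnDmr modnMl addn0.
      by rewrite {1}/qm e; exact: sq_mod.
    have e0 : inord 0 = ord0 :> 'I_9 by apply: val_inj; rewrite /= inordK.
    by apply: sqD; [apply: sqD|]; rewrite -?e0; exact: q.
  exists j => // [[a y]] t t0; rewrite /g /= !fs // -!mulrDr -!big_split /=; congr (_ * _).
  rewrite !sum_pair; apply: eq_bigr => b _; rewrite sum_pair exchange_big /=; apply: eq_bigr => z _.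
  rewrite /K108 /K12 /tensorK /=.
  transitivity (uk 7 a b * uk 2 y z * \sum_x (uk 2 ord0 x + uk 2 (inord 3) x + uk 2 (inord 6) x) * f (b, (x, z)) t).
    by rewrite mulr_sumr; apply: eq_bigr => x _; ring.
  by congr (_ * _); rewrite sumI9 !uk9_arrow !inordK //= !mul1r !mul0r !addr0.
have g0 : forall p t, 0 < Im t -> g p t = 0.
  apply: no_form12 => // a y t t0; first by rewrite /g /= !i1.
  by rewrite /g /= !i3.
have n9 k l : (0 < k < 9)%N -> l = (9 - k)%N -> inord l = - inord k :> 'I_9 by move=> kk ->; rewrite opp_inord.
have n3 : inord 2 = - inord 1 :> 'I_3 by rewrite opp_inord.
have n4 : inord 3 = - inord 1 :> 'I_4 by rewrite opp_inord.
pose fn a t := f (a, (ord0, ord0)) t.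
pose g1 a t := f (a, (inord 1, ord0)) t.
pose g4 a t := f (a, (inord 4, ord0)) t.
pose g7 a t := f (a, (inord 7, ord0)) t.
have rt a k l k' l' t : 0 < Im t -> (k < 9)%N -> (l < 3)%N -> (k' = (4 * k + 3 * l) %% 9)%N -> (l' = (l + 2 * k) %% 3)%N ->
   f (a, (inord k', inord l')) t = f (a, (inord k, inord l)) t.
  move=> t0 k9 l3 e1 e2; rewrite -(i4 a (inord k) (inord l) t t0); congr (f (_, (_, _)) _).
    by apply: val_inj; rewrite /= !inordK // e1 ltn_mod.
  by apply: val_inj; rewrite /= !inordK // e2 ltn_mod.
have o3 : inord 0 = ord0 :> 'I_3 by apply: val_inj; rewrite /= inordK.
have o9 : inord 0 = ord0 :> 'I_9 by apply: val_inj; rewrite /= inordK.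
have v01 a t : 0 < Im t -> f (a, (ord0, inord 1)) t = 0 /\ f (a, (inord 3, inord 1)) t = 0.
  move=> t0; have := g0 (a, inord 1) t t0; rewrite /g /=.
  have e3 := @rt a 0%N 1%N 3%N 1%N t t0 isT isT erefl erefl.
  have e6 := @rt a 3%N 1%N 6%N 1%N t t0 isT isT erefl erefl.
  rewrite e6 e3 o9 => h; have n30 : (3%:R : C) != 0 by rewrite pnatr_eq0.
  suff -> : f (a, (ord0, inord 1)) t = 0 by [].
  by apply: (mulfI n30); rewrite mulr0 -[RHS]h; ring.
have v30 a t : 0 < Im t -> f (a, (inord 3, ord0)) t = - (fn a t / 2).
  move=> t0; have := g0 (a, ord0) t t0; rewrite /g /= (n9 3%N 6%N) // i2 //.
  rewrite -/(fn a t) => h; have n20 : (2 : C) != 0 by rewrite pnatr_eq0.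
  apply: (mulfI n20); rewrite mulrN mulrCA mulfV // mulr1; apply/eqP; rewrite -addr_eq0; apply/eqP.
  by rewrite -[RHS]h; ring.
have r41 a t : 0 < Im t -> f (a, (inord 4, inord 1)) t = g1 a t.
  move=> t0; have := @rt a 4%N 1%N 1%N 0%N t t0 isT isT erefl erefl.
  by rewrite o3 => <-.
have r71 a t : 0 < Im t -> f (a, (inord 7, inord 1)) t = g4 a t.
  move=> t0; have := @rt a 7%N 1%N 4%N 0%N t t0 isT isT erefl erefl.
  by rewrite o3 => <-.
have r11 a t : 0 < Im t -> f (a, (inord 1, inord 1)) t = g7 a t.
  move=> t0; have := @rt a 1%N 1%N 7%N 0%N t t0 isT isT erefl erefl.
  by rewrite o3 => <-.
(* In the row of x = y = 0 the kernel is constant in x and y. The nine classes with x divisible by 3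
   cancel, and the other eighteen form three orbits of six, whence the factor 6. *)
have Sn a t : 0 < Im t -> fn a (- t^-1) = j t * (6%:R * ((Num.sqrt 9%:R)%:C^-1 * (Num.sqrt 3%:R)%:C^-1)) * \sum_b uk 7 a b * (g1 b t + g4 b t + g7 b t).
  move=> t0; rewrite /fn fs // sum_pair -mulrA; congr (_ * _); rewrite mulr_sumr; apply: eq_bigr => b _.
  have -> : \sum_y K108 (a, (ord0, ord0)) (b, y) * f (b, y) t = uk 7 a b * ((Num.sqrt 9%:R)%:C^-1 * (Num.sqrt 3%:R)%:C^-1) * \sum_y f (b, y) t.
    rewrite mulr_sumr; apply: eq_bigr => -[x y] _; rewrite /K108 /tensorK /=.
    by rewrite (@uk_0 R 9 2 ord0 x) ?muln0 // (@uk_0 R 3 2 ord0 y) ?muln0.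
  have -> : \sum_y f (b, y) t = 6%:R * (g1 b t + g4 b t + g7 b t); last by ring.
  rewrite sum_pair sumI9 !sumI3 n3 !i3 //.
  rewrite (n9 1%N 8%N) // (n9 4%N 5%N) // (n9 7%N 2%N) // (n9 3%N 6%N) // !i2 //.
  have [-> ->] := v01 b t t0; rewrite v30 // r41 // r71 // r11 // -/(fn b t) -/(g1 b t) -/(g4 b t) -/(g7 b t).
  by field.
pose w := e2pi (1%:R / 3%:R) : C.
have w3 : w ^+ 3 = 1 by rewrite /w -e2piX mulrCA mulfV ?pnatr_eq0 // mulr1 e2pi1.
have w2 : w ^+ 2 = - 1 - w.
  have : (w - 1) * (w ^+ 2 + w + 1) = 0 by transitivity (w ^+ 3 - 1); [ring|rewrite w3 subrr].
  have wn : w != 1 by exact: e2pi_frac_neq1.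
  move/eqP; rewrite mulf_eq0 subr_eq0 (negbTE wn) /= => /eqP h.
  by apply/eqP; rewrite -subr_eq0 -[X in _ == X]h; apply/eqP; ring.
(* The exponents at x = 1, 4, 7 are 16, 112 and 64 modulo 144 and differ by multiples of 48, so T
   multiplies by cube roots of unity and rotates the three discrete Fourier transforms. *)
pose G0 a t := g1 a t + g4 a t + g7 a t.
pose G1 a t := g1 a t + w * g4 a t + w ^+ 2 * g7 a t.
pose G2 a t := g1 a t + w ^+ 2 * g4 a t + w * g7 a t.
have TG a t : 0 < Im t -> [/\ md (G0 a (t + 1)) = md (G2 a t), md (G1 a (t + 1)) = md (G0 a t) & md (G2 a (t + 1)) = md (G1 a t)].
  move=> t0; set z := e2pi ((126 * a ^ 2 + 16)%N%:R / 144%:R : C).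
  have mz : md z = 1 by exact: md_e2pi_frac.
  have Tf x q : Q108 (a, (x, ord0)) = q -> f (a, (x, ord0)) (t + 1) = e2pi (q%:R / 144%:R) * f (a, (x, ord0)) t.
    by move=> <-; exact: sq_T (fq _) t0.
  have h1 : g1 a (t + 1) = z * g1 a t by apply: Tf; rewrite /Q108 /= inordK.
  have wk (k m : nat) : (k * 3 = m)%N -> e2pi ((126 * a ^ 2 + 16 + m * 16)%N%:R / 144%:R : C) = z * w ^+ k.
    move=> <-; rewrite /z /w -e2piX -e2piD; congr e2pi.
    by rewrite natrD mulrDl; congr (_ + _); rewrite !natrM; field.
  have h4 : g4 a (t + 1) = z * w ^+ 5 * g4 a t.
    rewrite -(wk 5%N 15%N) //; apply: Tf.
    by rewrite /Q108 /= inordK //; lia.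
  have h7 : g7 a (t + 1) = z * w ^+ 16 * g7 a t.
    rewrite -(wk 16%N 48%N) //; apply: Tf.
    by rewrite /Q108 /= inordK //; lia.
  have w5 : w ^+ 5 = w ^+ 2 by rewrite (exprD w 3 2) w3 mul1r.
  have w16 : w ^+ 16 = w by rewrite (exprD w 15 1) (exprM w 3 5) w3 expr1n mul1r.
  have w4 : w * w ^+ 2 = 1 by rewrite -exprS.
  rewrite w5 in h4; rewrite w16 in h7; split.
  - have -> : G0 a (t + 1) = z * G2 a t by rewrite /G0 /G2 h1 h4 h7; ring.
    by rewrite mdM mz mul1r.
  - have -> : G1 a (t + 1) = z * (g1 a t + (w * w ^+ 2) * g4 a t + (w * w ^+ 2) * g7 a t) by rewrite /G1 h1 h4 h7; ring.
    by rewrite w4 !mul1r mdM mz mul1r.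
  - have -> : G2 a (t + 1) = z * (g1 a t + (w * (w * w ^+ 2)) * g4 a t + w ^+ 2 * g7 a t) by rewrite /G2 h1 h4 h7; ring.
    by rewrite w4 mulr1 mdM mz mul1r.
set c6 := 6%:R * _ in Sn.
have c6n : c6 != 0.
  by rewrite /c6 !mulf_neq0 ?pnatr_eq0 // invr_eq0 -md_eq0 md_real normr_eq0 sqrtr_eq0 -ltNge ltr0n.
pose k := md c6 ^+ 2; have kn : k != 0 by rewrite /k expf_neq0 // md_eq0.
have u4 : unitary (@uk 4 7) by exact: unitary_uk.
have Nn t : 0 < Im t -> nrm fn (- t^-1) = md t ^+ 5 * (k * nrm G0 t).
  move=> t0; rewrite /nrm; under eq_bigr do rewrite Sn // mdM exprMn.
  by rewrite -mulr_sumr mdM exprMn j2 // u4 -mulrA.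
have NT t : 0 < Im t -> [/\ nrm fn (t + 1) = nrm fn t, nrm G0 (t + 1) = nrm G2 t, nrm G1 (t + 1) = nrm G0 t & nrm G2 (t + 1) = nrm G1 t].
  move=> t0; split; apply: eq_bigr => a _; have [e0 e1 e2] := TG a t t0; rewrite ?e0 ?e1 ?e2 //.
  by rewrite /fn (md_sq_T (fq (a, (ord0, ord0))) t0).
have NS := cusp_norms kn NT Nn.
pose mn a := qm (Q108 (a, (ord0, ord0))).
pose mg a := minn (qm (Q108 (a, (inord 1, ord0)))) (minn (qm (Q108 (a, (inord 4, ord0)))) (qm (Q108 (a, (inord 7, ord0))))).
have qn a : sqo (fn a) (mn a) by exact: sq_sqo (fq (a, (ord0, ord0))).
have qg (u v : C) a : sqo (fun t => g1 a t + u * g4 a t + v * g7 a t) (mg a).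
  apply: sqoD; [apply: sqoD|]; [|apply: sqoZ|apply: sqoZ].
  - by apply: sqo_le (sq_sqo (fq (a, (inord 1, ord0)))); rewrite geq_minl.
  - by apply: sqo_le (sq_sqo (fq (a, (inord 4, ord0)))); rewrite /mg !geq_min leqnn orbT.
  - by apply: sqo_le (sq_sqo (fq (a, (inord 7, ord0)))); rewrite /mg !geq_min leqnn !orbT.
have qG0 a : sqo (G0 a) (mg a).
  by have := qg 1 1 a; have -> : (fun t => g1 a t + 1 * g4 a t + 1 * g7 a t) = G0 a by apply: funext => t; rewrite !mul1r.
have bn a : (72 <= mn a)%N by elim/I4P: a; rewrite /mn /Q108 /= ?inordK.
have bg a : (16 <= mg a)%N by elim/I4P: a; rewrite /mg /Q108 /= ?inordK.
(* Weight 10 has bound 120, and the smallest orders add up to 16 + 16 + 16 + 72 = 120. *)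
pose H (p : 'I_4 * 'I_4 * ('I_4 * 'I_4)) t := G0 p.1.1 t * G1 p.1.2 t * (G2 p.2.1 t * fn p.2.2 t).
have NH t : nrm H t = nrm G0 t * nrm G1 t * (nrm G2 t * nrm fn t).
  rewrite -(nrm_pair G0 G1) -(nrm_pair G2 fn).
  by rewrite -(nrm_pair (fun p t => G0 p.1 t * G1 p.2 t) (fun p t => G2 p.1 t * fn p.2 t)).
have vH p : (120 < mg p.1.1 + mg p.1.2 + (mg p.2.1 + mn p.2.2))%N -> hzero (H p).
  apply: (@vanish _ _ 20 H (fun p => (mg p.1.1 + mg p.1.2 + (mg p.2.1 + mn p.2.2))%N)).
  - by move=> q; apply: sqoM; apply: sqoM; [exact: qG0|exact: qg|exact: qg|exact: qn].
  - by move=> q; have := bg q.1.1; have := bg q.1.2; have := bg q.2.1; have := bn q.2.2; lia.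
  - move=> t t0; rewrite -/(nrm H _) -/(nrm H _) !NH; have [-> -> ->] := NS t t0; rewrite Nn //; by field.
  - move=> t t0; rewrite -/(nrm H _) -/(nrm H _) !NH; have [-> -> -> ->] := NT t t0; ring.
have fin : (forall a, hzero (G0 a)) -> forall x, hzero (f x).
  move=> z0 x t t0.
  have t1 (s : C) : 0 < Im s -> 0 < Im (s + 1) by rewrite cImD /= addr0.
  have a0 s : 0 < Im s -> nrm G0 s = 0 by move=> s0; apply/nrm0 => a; exact: z0.
  have a2 s : 0 < Im s -> nrm G2 s = 0 by move=> s0; have [_ <- _ _] := NT s s0; exact: a0 (t1 _ s0).
  have a1 s : 0 < Im s -> nrm G1 s = 0 by move=> s0; have [_ _ _ <-] := NT s s0; exact: a2 (t1 _ s0).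
  have an : nrm fn t = 0.
    by have := Nn _ (Im_invN_gt0 t0); rewrite invNK => ->; rewrite a0 ?mulr0 // Im_invN_gt0.
  have zn a : fn a t = 0 by move/nrm0: an.
  have e0 a : G0 a t = 0 by exact: z0.
  have e1 a : G1 a t = 0 by move: (a1 t t0) => /nrm0.
  have e2 a : G2 a t = 0 by move: (a2 t t0) => /nrm0.
  have n30 : (3%:R : C) != 0 by rewrite pnatr_eq0.
  have s0 : 1 + w + w ^+ 2 = 0 by rewrite w2; ring.
  have y1 a : g1 a t = 0.
    apply: (mulfI n30); rewrite mulr0; transitivity (G0 a t + G1 a t + G2 a t - (1 + w + w ^+ 2) * (g4 a t + g7 a t)).
      by rewrite /G0 /G1 /G2; ring.
    by rewrite e0 e1 e2 s0; ring.
  have y4 a : g4 a t = 0.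
    have := e1 a; rewrite /G1 y1 add0r; have := e0 a; rewrite /G0 y1 add0r => /eqP; rewrite addrC addr_eq0 => /eqP -> h.
    have : (w - w ^+ 2) * g4 a t = 0 by rewrite -[RHS]h; ring.
    move/eqP; rewrite mulf_eq0 => /orP[|/eqP //]; rewrite expr2 -{1}[w]mulr1 -mulrBr mulf_eq0 (negbTE (e2pi_neq0 _)) /=.
    by rewrite subr_eq0 eq_sym (negbTE (@e2pi_frac_neq1 R 1 3 isT isT)).
  have y7 a : g7 a t = 0 by have := e0 a; rewrite /G0 y1 y4 !add0r.
  have key a y : f (a, (ord0, y)) t = 0 /\ forall i, (i < 9)%N -> f (a, (inord i, y)) t = 0.
    have [x0 x3] := v01 a t t0; have x30 : f (a, (inord 3, ord0)) t = 0 by rewrite v30 // zn mul0r oppr0.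
    have h0 : f (a, (ord0, y)) t = 0 by elim/I3P: y; rewrite ?n3 ?i3 //; exact: zn.
    split=> // i i9; case: i i9 => [|[|[|[|[|[|[|[|[|//]]]]]]]]] _; rewrite ?o9 //.
    + by elim/I3P: y {h0}; rewrite ?n3 ?i3 // ?r11 //; solve [exact: y1|exact: y4|exact: y7].
    + by rewrite (n9 7%N 2%N) // i2 //; elim/I3P: y {h0}; rewrite ?n3 ?i3 // ?r71 //; solve [exact: y1|exact: y4|exact: y7].
    + by elim/I3P: y {h0}; rewrite ?n3 ?i3.
    + by elim/I3P: y {h0}; rewrite ?n3 ?i3 // ?r41 //; solve [exact: y1|exact: y4|exact: y7].
    + by rewrite (n9 4%N 5%N) // i2 //; elim/I3P: y {h0}; rewrite ?n3 ?i3 // ?r41 //; solve [exact: y1|exact: y4|exact: y7].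
    + by rewrite (n9 3%N 6%N) // i2 //; elim/I3P: y {h0}; rewrite ?n3 ?i3.
    + by elim/I3P: y {h0}; rewrite ?n3 ?i3 // ?r71 //; solve [exact: y1|exact: y4|exact: y7].
    + by rewrite (n9 1%N 8%N) // i2 //; elim/I3P: y {h0}; rewrite ?n3 ?i3 // ?r11 //; solve [exact: y1|exact: y4|exact: y7].
  by case: x => a [x y]; rewrite -(inord_val x); have [_ ->] := key a y.
have [z0|nz0] := pselect (forall a, hzero (G0 a)); first exact: fin z0.
apply: fin => a t t0; exfalso; apply: nz0 => {a t t0}.
have ex (u : 'I_4 -> C -> C) : ~ (forall a, hzero (u a)) -> exists a, ~ hzero (u a).
  by move=> h; apply: contrapT => no; apply: h => a; apply: contrapT => h; apply: no; exists a.
have t1 (s : C) : 0 < Im s -> 0 < Im (s + 1) by rewrite cImD /= addr0.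
have [z2|/ex [a2 h2]] := pselect (forall a, hzero (G2 a)).
  move=> a t t0; have [_ _ e _] := NT _ t0; apply: (nrm0 G0 t).1; rewrite -e; apply/nrm0 => b.
  have [_ _ _ e'] := NT _ (t1 _ t0).
  have : nrm G1 (t + 1) = 0 by rewrite -e'; apply/nrm0 => d; apply: z2; exact: t1 (t1 _ t0).
  by move/nrm0.
have [z1|/ex [a1 h1]] := pselect (forall a, hzero (G1 a)).
  by move=> a t t0; have [_ _ e _] := NT _ t0; apply: (nrm0 G0 t).1; rewrite -e; apply/nrm0 => b; apply: z1; exact: t1.
have [zn|/ex [an hn]] := pselect (forall a, hzero (fn a)).
  move=> a t t0; apply: (nrm0 G0 t).1; have := Nn _ t0.
  rewrite (nrm0 fn _).2 => [/esym/eqP|b]; last by apply: zn; exact: Im_invN_gt0.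
  by rewrite mulf_eq0 expf_eq0 md_eq0 (negbTE (Im_gt0_neq0 t0)) andbF /= mulf_eq0 (negbTE kn) /= => /eqP.
have key b d : (88 < mg b + mn d)%N -> hzero (G0 b) \/ hzero (fn d).
  move=> h; have hz : hzero (H (b, a1, (a2, d))).
    by apply: vH => /=; have := bg a1; have := bg a2; lia.
  have [/(sqo_integral (qG0 b) (qg _ _ a1)) [|/h1 //]|/(sqo_integral (qg _ _ a2) (qn d)) [/h2 //|]] :=
    sqo_integral (sqoM (qG0 b) (qg _ _ a1)) (sqoM (qg _ _ a2) (qn d)) hz; by [left|right].
(* The minimum 16 is attained only at b = 0; any other b exceeds the bound against the nonvanishing
   component [an]. *)
have zG b : b != ord0 -> hzero (G0 b).
  move=> b0; have hb : (16 < mg b)%N by elim/I4P: b b0 => //; rewrite /mg /Q108 /= ?inordK.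
  by have [|//|/hn //] := key b an; have := bn an; lia.
(* The component of [fn] at 0 has order 144, also beyond the bound. If it vanishes, S gives the
   relation that the G0 sum to 0, and only the one at b = 0 is left. *)
have [|nn] := pselect (hzero (fn ord0)); last first.
  move=> b; have [|//|/nn //] := key b ord0.
  by have := bg b; have -> : mn ord0 = 144%N by []; lia.
move=> zn0 b t t0; have [b0|/zG h] := eqVneq b ord0; last exact: h.
have := Sn ord0 t t0; rewrite zn0 ?Im_invN_gt0 // => /esym/eqP.
have jn : j t != 0 by rewrite -md_eq0 -sqrf_eq0 j2 // expf_neq0 // md_eq0 Im_gt0_neq0.
rewrite mulf_eq0 (negbTE (mulf_neq0 jn c6n)) /= (bigD1 ord0) //= big1 ?addr0 => [|d d0]; last first.
  by have := zG d d0 t t0; rewrite /G0 => ->; rewrite mulr0.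
rewrite uk_0 // mulf_eq0 invr_eq0 -md_eq0 md_real normr_eq0 sqrtr_eq0 leNgt ltr0n /= b0 => /eqP.
by [].
Qed.

End Models.

(** * Leading coefficients, theta quotients and the module of order 72 *)

Section Models.
Variable R : realType.
Local Notation C := R[i].
Local Notation md := (@md R).
Local Notation Re := complex.Re.
Local Notation Im := complex.Im.
Local Notation wq := (@wq R).
Local Notation jb := (@jb R).
Local Notation U := (@usr R).
Local Notation TH := (@thr R).
Local Notation E := (@eta2 R).
Local Notation uk := (@uk R).
Local Notation tensor := (@tensorK R _ _).
Local Notation uu := (@uu R).
Local Notation KK := (@KK R).
Local Notation conv := (@conv R).

Lemma hasq_uniq (f : C -> C) a b : hasq f a -> hasq f b -> a =1 b.
Proof.
move=> [ga fa] [gb fb] k; apply/eqP; rewrite -subr_eq0; apply/eqP.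
have h : hasq (fun=> 0) (fun k => a k + -1 * b k).
  split; first by apply: goodD => //; exact: goodZ.
  move=> t t0; rewrite PSD ?PSZ //; [|exact: md_wq_lt1|exact: goodZ|exact: md_wq_lt1].
  by rewrite -fa // -fb // mulN1r subrr.
by have := hasq0 h (fun _ _ => erefl) k; rewrite mulN1r.
Qed.

(** f = l w^m + O(w^(m+1)), where l may vanish. *)
Definition lead (f : C -> C) (m : nat) (l : C) := exists2 a, hasq f a & vge m a /\ a m = l.

Lemma lead_ext f g m l : (forall t, 0 < Im t -> f t = g t) -> lead f m l -> lead g m l.
Proof. by move=> h [a [ga fa] v]; exists a => //; split=> // t t0; rewrite -h // fa. Qed.

Lemma leadM f g m n l l' : lead f m l -> lead g n l' -> lead (fun t => f t * g t) (m + n) (l * l').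
Proof.
move=> [a ha [va <-]] [b hb [vb <-]]; exists (conv a b); first exact: hasqM.
by split; [exact: conv_vge|exact: conv_lead].
Qed.

Lemma leadX f m l k : lead f m l -> lead (fun t => f t ^+ k) (m * k) (l ^+ k).
Proof.
move=> h; elim: k => [|k IH].
  rewrite muln0 expr0; exists (mono R 0); last by rewrite /mono eqxx.
  by split=> [|t t0]; [exact: good_mono|rewrite PS_mono ?expr0 ?md_wq_lt1].
by rewrite mulnS exprS; apply: lead_ext (leadM h IH) => t t0; rewrite exprS.
Qed.

Lemma leadD f g m l l' : lead f m l -> lead g m l' -> lead (fun t => f t + g t) m (l + l').
Proof.
move=> [a [ga fa] [va <-]] [b [gb fb] [vb <-]]; exists (fun k => a k + b k).
  split; first exact: goodD.
  by move=> t t0; rewrite PSD ?md_wq_lt1 // fa // fb.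
by split=> // k km; rewrite va // vb // addr0.
Qed.

Lemma leadZ c f m l : lead f m l -> lead (fun t => c * f t) m (c * l).
Proof.
move=> [a [ga fa] [va <-]]; exists (fun k => c * a k).
  split; first exact: goodZ.
  by move=> t t0; rewrite PSZ ?md_wq_lt1 // fa.
by split=> // k km; rewrite va // mulr0.
Qed.

Lemma lead_at f m l k : lead f m l -> (k <= m)%N -> lead f k (if m == k then l else 0).
Proof.
move=> [a ha [va al]] km; exists a => //; split; first by move=> i ik; apply: va; exact: leq_trans km.
by case: eqP => [<- //|/eqP mk]; apply: va; rewrite ltn_neqAle eq_sym mk.
Qed.

Lemma lead_coef f m l a : lead f m l -> hasq f a -> a m = l.
Proof. by move=> [b hb [_ <-]] ha; exact: hasq_uniq ha hb m. Qed.

(** ** Nonvanishing of the theta constants *)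

Lemma e2pi_half : e2pi (- (1%:R * 1%:R / 2%:R)) = -1 :> C.
Proof. by rewrite -[RHS]half4; congr e2pi; field. Qed.

Lemma TH_S t : 0 < Im t -> let c := (Num.sqrt 2%:R)%:C * jb t in
  c * TH 0 (- t^-1) = TH 0 t + TH 1 t /\ c * TH 1 (- t^-1) = TH 0 t - TH 1 t.
Proof.
move=> t0; have Tr s u : tser 36 (ind R 2 s) u = TH s u by rewrite thr.unlock.
have := @theta_S R 36 2 0 t erefl isT t0; have := @theta_S R 36 2 1 t erefl isT t0.
rewrite !Tr /= => -> ->; rewrite !big_ord_recr !big_ord0 /= !Tr !mul0r !mulr0 ?mul0r !oppr0 !e2pi0 !mul1r !add0r.
have e : e2pi (- 2^-1) = -1 :> C by rewrite -e2pi_half; congr e2pi; field.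
by rewrite e mulN1r.
Qed.

Lemma sqrt2_neq0 : (Num.sqrt 2%:R)%:C != 0 :> C.
Proof. by rewrite -md_eq0 md_real normr_eq0 sqrtr_eq0 -ltNge ltr0n. Qed.

Definition th (a : 'I_2) : C -> C := TH a.

Lemma th_law : xlaw (fun t => (jb t)^-1) (@uk 2 1) th.
Proof.
move=> a t t0; have [h0 h1] := TH_S t0.
have cn := mulf_neq0 sqrt2_neq0 (jb_neq0 t0).
apply: (mulfI cn); rewrite sumI2 /th !uk_half //.
have -> : (Num.sqrt 2%:R)%:C * jb t * ((jb t)^-1 * ((-1) ^+ (a * (ord0 : 'I_2)) / (Num.sqrt 2%:R)%:C * TH (ord0 : 'I_2) t +
   (-1) ^+ (a * (inord 1 : 'I_2)) / (Num.sqrt 2%:R)%:C * TH (inord 1 : 'I_2) t)) =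
   (-1) ^+ (a * (ord0 : 'I_2)) * TH (ord0 : 'I_2) t + (-1) ^+ (a * (inord 1 : 'I_2)) * TH (inord 1 : 'I_2) t.
  by field; rewrite (jb_neq0 t0) sqrt2_neq0.
rewrite inordK // muln0 muln1 expr0 mul1r.
elim/I2P: a; rewrite /= ?inordK //.
  by rewrite h0 expr0 mul1r.
by rewrite h1 expr1 mulN1r.
Qed.

Lemma TH_lead : lead (TH 0) 0 1 /\ lead (TH 1) 36 2.
Proof.
rewrite thr.unlock; split.
  have [h v _] := @tcoefP R 36 2 0 erefl isT isT; exists (tcoef 36 (ind R 2 0)) => //; split=> //.
  by rewrite tcoef_0.
have [h v _] := @tcoefP R 36 2 1 erefl isT isT; exists (tcoef 36 (ind R 2 1)) => //; split=> //.
by rewrite (@tcoef_sq R 36 _ 1) // /ind /= -natrD.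
Qed.

Lemma TH_sq (a : 'I_2) : sq (TH a) 0 (36 * a ^ 2).
Proof. by have := @tser_sq R 36 2 a erefl isT (ltn_ord a); rewrite thr.unlock => /(sq_le (leq0n _)). Qed.

Lemma md_E_S t : 0 < Im t -> md (E (- t^-1)) = md t * md (E t).
Proof.
move=> t0; rewrite -(E_S t0) mdM mdX md_jb // mulrA mulfV ?mul1r // md_eq0; exact: Im_gt0_neq0.
Qed.

(** The product TH_0 TH_1 (TH_0^4 - TH_1^4) is 2 eta^6: it has weight 3 and exactly the critical
    order 36, so Liouville's theorem makes its square 4 E^6, which has no zero. The factors inherit
    this. *)
Lemma TH_neq0 t : 0 < Im t -> TH 0 t != 0 /\ TH 1 t != 0.
Proof.
pose P (_ : 'I_1) t := TH 0 t * TH 1 t * (TH 0 t ^+ 4 - TH 1 t ^+ 4).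
have [l0 l1] := TH_lead.
have lP i : lead (P i) 36 2.
  have l4 := lead_at (leadZ (-1) (leadX 4 l1)) (leq0n _).
  have := leadM (leadM l0 l1) (leadD (leadX 4 l0) l4); rewrite expr1n addr0 mulr1 mul1r.
  by apply: lead_ext => s s0; rewrite mulN1r.
have [dd [hd vd ld]] := E_pow R 6.
have hA i : exists2 a, hasq (P i) a & vge 36 a /\ a 36%N = 2 := lP i.
have [A0 hA0 [vA0 lA0]] := hA ord0.
have PA i : hasq (P i) A0 by exact: hA0.
have TS (s : C) : 0 < Im s -> md (P ord0 (s + 1)) = md (P ord0 s).
  move=> s0; rewrite /P !mdM.
  have e0 : TH 0 (s + 1) = TH 0 s.
    have := sq_T (TH_sq ord0) s0; have -> : (36 * (ord0 : 'I_2) ^ 2)%N%:R = 0 :> C by [].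
    by rewrite mul0r e2pi0 mul1r.
  have := sq_T (TH_sq (inord 1)) s0; have := md_sq_T (TH_sq (inord 1)) s0.
  rewrite inordK // => -> e1; rewrite e0; congr (_ * md (_ - _)).
  rewrite e1 exprMn -e2piX; have -> : 4%:R * (36%:R / 144%:R) = 1%:~R :> C by field.
  by rewrite e2pi_int mul1r.
have SS (s : C) : 0 < Im s -> md (P ord0 (- s^-1)) = md s ^+ 3 * md (P ord0 s).
  move=> s0; have [e0 e1] := TH_S s0; have sn := Im_gt0_neq0 s0.
  have k : jb s ^+ 6 * P ord0 (- s^-1) = P ord0 s.
    have n8 : (8%:R : C) != 0 by rewrite pnatr_eq0.
    have s2 := sqrt_natC R 2; apply: (mulfI n8); rewrite /P.
    move: e0 e1 s2; set c := (Num.sqrt _)%:C; set a := TH 0 (- s^-1); set b := TH 1 (- s^-1) => e0 e1 s2.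
    transitivity ((c * jb s * a) * (c * jb s * b) * ((c * jb s * a) ^+ 4 - (c * jb s * b) ^+ 4)); last by rewrite e0 e1; ring.
    have -> : 8%:R = (c * c) ^+ 3 :> C by rewrite s2; ring.
    by ring.
  rewrite -k mdM mdX (exprM _ 2 3) md_jb // mulrA -exprMn mulfV ?expr1n ?mul1r // md_eq0 //.
move=> t0; have := @liouville R _ P (fun=> A0) (fun t => E t ^+ 6) dd 36 PA hd (fun=> vA0) vd _ _ _ _ ord0 ord0 t t0.
rewrite ld mulr1 lA0 => h.
have {h} : P ord0 t * P ord0 t != 0.
  rewrite h ?mulf_neq0 ?pnatr_eq0 ?expf_neq0 ?oner_neq0 ?E_neq0 //.
  - by move=> s s0; rewrite expf_neq0 // E_neq0.
  - by move=> s s0; rewrite !big_ord_recl !big_ord0 !addr0 TS // !mdX E_T.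
  - move=> s s0; rewrite !big_ord_recl !big_ord0 !addr0 SS // !mdX md_E_S //; ring.
by rewrite /P !mulf_eq0 !negb_or => /andP[/andP[/andP[-> ->]]].
Qed.

(** The two theta constants span a unitary representation, so [thn] has the transformation behaviour
    of a squared absolute value in weight 1/2. *)
Definition thn t := md (TH 0 t) ^+ 2 + md (TH 1 t) ^+ 2.

Lemma nrm_th t : nrm th t = thn t.
Proof. by rewrite /nrm sumI2 /th /= inordK. Qed.

Lemma slaw_th : slaw 1 (@uk 2 1) th.
Proof.
exists (fun t => (jb t)^-1); last exact: th_law.
by move=> t t0; rewrite mdV exprVn md_jb // invrK expr1.
Qed.

Lemma thn_S t : 0 < Im t -> thn (- t^-1) = md t * thn t.
Proof.
move=> t0; rewrite -!nrm_th; have u : unitary (@uk 2 1) by exact: unitary_uk.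
by rewrite /nrm (slaw_norm u slaw_th t0) expr1.
Qed.

Lemma thn_T t : 0 < Im t -> thn (t + 1) = thn t.
Proof. by move=> t0; rewrite -!nrm_th; exact: (sq_normT TH_sq). Qed.

Lemma thn_gt0 t : 0 < Im t -> 0 < thn t.
Proof. by move=> /TH_neq0[h _]; rewrite ltr_wpDr ?sqr_ge0 // exprn_gt0 // md_gt0. Qed.

(** Liouville's theorem applied to the quotients g_y / TH_0^n, of weight k/2. *)
Lemma theta_liouville (Y : finType) (g : Y -> C -> C) (N : C -> R) n k (m : Y -> nat) :
  (forall y, sqo (g y) (m y)) -> (forall y, 6 * k <= m y)%N ->
  (forall t, 0 < Im t -> N t * md (TH 0 t) ^+ (2 * n) = nrm g t * thn t ^+ n) ->
  (forall t, 0 < Im t -> N (- t^-1) = md t ^+ (n + k) * N t) -> (forall t, 0 < Im t -> N (t + 1) = N t) ->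
  forall y, (6 * k < m y)%N -> hzero (g y).
Proof.
move=> /(_ _)/cid2 gm mk NE NS NT y my t t0.
pose A y := projT1 (gm y).
have hA z : hasq (g z) (A z) by rewrite /A; case: (gm z).
have vA z : vge (m z) (A z) by rewrite /A; case: (gm z).
have vA' z : vge (6 * k) (A z) by move=> i ik; apply: vA; exact: leq_trans (mk z).
pose D t := TH 0 t ^+ (2 * n) * E t ^+ k.
have [dd hd [vd ld]] : lead D (2 * (6 * k)) 1.
  have [de [he ve le]] := E_pow R k; have [l0 _] := TH_lead.
  have lE : lead (fun t => E t ^+ k) (12 * k) 1 by exists de.
  by have := leadM (leadX (2 * n) l0) lE; rewrite mul0n add0n expr1n mulr1 mulnA.
have S1 (s : C) : 0 < Im s -> 0 < Im (s + 1) by rewrite cImD /= addr0.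
have l := @liouville R Y g A D dd (6 * k) hA hd vA' vd _ _ _ _ y y t t0.
suff /eqP : g y t * g y t * dd (2 * (6 * k))%N = A y (6 * k)%N * A y (6 * k)%N * D t.
  by rewrite ld mulr1 (vA y) // !mul0r mulf_eq0 orbb => /eqP.
apply: l; first by rewrite ld oner_neq0.
- by move=> s s0; rewrite mulf_neq0 // expf_neq0 ?E_neq0 //; have [] := TH_neq0 s0.
- move=> s s0; have h1 := NE _ (S1 s s0); have h0 := NE _ s0.
  move: h1; rewrite NT // thn_T // (_ : md (TH 0 (s + 1)) = md (TH 0 s)); last exact: (md_sq_T (TH_sq ord0)).
  rewrite h0 => /(mulIf (expf_neq0 n (lt0r_neq0 (thn_gt0 s0)))) e; rewrite -/(nrm g s) -/(nrm g (s + 1)) -e; congr (_ * _).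
  rewrite /D !mdM !mdX E_T // (_ : md (TH 0 (s + 1)) = md (TH 0 s)) //; exact: (md_sq_T (TH_sq ord0)).
- move=> s s0; have h1 := NE _ (Im_invN_gt0 s0); have h0 := NE _ s0.
  have nn := expf_neq0 n (lt0r_neq0 (thn_gt0 s0)).
  have mn : md s ^+ n != 0 by rewrite expf_neq0 // md_eq0 Im_gt0_neq0.
  apply: (mulIf (mulf_neq0 mn nn)); rewrite -/(nrm g s) -/(nrm g (- s^-1)) /D !mdM !mdX md_E_S // !exprMn.
  rewrite thn_S // exprMn NS // exprD in h1.
  set a := md (TH 0 s) ^+ _ in h0 *; set b := md (TH 0 (- s^-1)) ^+ _ in h1 *.
  transitivity (nrm g (- s^-1) * (md s ^+ n * thn s ^+ n) * (a * md (E s) ^+ k)); first by ring.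
  rewrite -h1; transitivity (N s * a * md s ^+ n * md s ^+ k * b * md (E s) ^+ k); first by ring.
  by rewrite h0; ring.
Qed.

Lemma slaw_contract1 (A Z : finType) r s (KA : A -> A -> C) (KZ KZ' : Z -> Z -> C) f g :
  slaw r (@tensorK R _ _ KA KZ) f -> slaw s KZ' g ->
  (forall z z', \sum_w KZ w z * KZ' w z' = (z == z')%:R) ->
  slaw (r + s) KA (fun a t => \sum_z f (a, z) t * g z t).
Proof.
move=> [j j2 hf] [k k2 hg] dual; exists (fun t => j t * k t) => [tau t0|a tau t0 /=].
  by rewrite mdM exprMn j2 // k2 // exprD.
under eq_bigr do rewrite hf // hg // mulrACA.
rewrite -mulr_sumr; congr (_ * _).
transitivity (\sum_a' KA a a' * (\sum_z1 \sum_z2 (\sum_z KZ z z1 * KZ' z z2) * (f (a', z1) tau * g z2 tau))).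
  under eq_bigr do rewrite sum_pair mulr_suml.
  rewrite exchange_big /=; apply: eq_bigr => a' _.
  transitivity (\sum_z \sum_z1 \sum_z2 KA a a' * (KZ z z1 * KZ' z z2 * (f (a', z1) tau * g z2 tau))).
    apply: eq_bigr => z _; rewrite mulr_suml; apply: eq_bigr => z1 _; rewrite mulr_sumr; apply: eq_bigr => z2 _.
    by rewrite /tensorK /=; ring.
  rewrite exchange_big mulr_sumr; apply: eq_bigr => z1 _.
  rewrite exchange_big mulr_sumr; apply: eq_bigr => z2 _.
  by rewrite -mulr_sumr -mulr_suml.
apply: eq_bigr => a' _; congr (_ * _).
apply: eq_bigr => z _; rewrite (bigD1 z) //= dual eqxx mul1r big1 ?addr0 // => z' zz.
by rewrite dual eq_sym (negbTE zz) mul0r.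
Qed.

Lemma sq_gap (f : C -> C) m m' e : (m' <= 144)%N -> ~~ (m <= e %% 144 < m')%N -> sq f m e -> sq f m' e.
Proof.
move=> m1 h; apply: sq_lift => k /andP[mk km] ke; case/negP: h; rewrite -ke modn_small ?mk //.
exact: leq_trans m1.
Qed.

(** ** Discriminant 72 *)

Definition KA72 := tensor (tensor KK (@uk 2 3)) (@uk 2 3).
Definition K72 := tensor KA72 (@uk 2 3).
Definition Q72 (p : 'I_3 * 'I_3 * 'I_2 * 'I_2 * 'I_2) :=
  (48 * (p.1.1.1.1 ^ 2 + p.1.1.1.2 ^ 2) + 108 * p.1.1.2 ^ 2 + 108 * p.1.2 ^ 2 + 108 * p.2 ^ 2)%N.

Lemma isom72_ab : fqm_isom K72 Q72 (fun p => (p.1.1.1, p.1.2, p.1.1.2, p.2)).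
Proof.
split=> [[[[y a] b] c] [[[y' a'] b'] c'] [-> -> -> ->] //|[[[y a] b] c]|[[[y a] b] c] [[[y' a'] b'] c']].
  by rewrite /Q72 /= (addnAC _ (108 * b ^ 2)%N).
by rewrite /K72 /KA72 /tensorK /= [KK y y' * _ * _]mulrAC.
Qed.

Lemma isom72_bc : fqm_isom K72 Q72 (fun p => (p.1.1.1, p.1.1.2, p.2, p.1.2)).
Proof.
split=> [[[[y a] b] c] [[[y' a'] b'] c'] [-> -> -> ->] //|[[[y a] b] c]|[[[y a] b] c] [[[y' a'] b'] c']].
  by rewrite /Q72 /= (addnAC _ (108 * c ^ 2)%N).
by rewrite /K72 /KA72 /tensorK /= [KK y y' * _ * _ * _]mulrAC.
Qed.

Lemma isom72_y : fqm_isom K72 Q72 (fun p => (p.1.1.1.2, p.1.1.1.1, p.1.1.2, p.1.2, p.2)).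
Proof.
split=> [[[[[y z] a] b] c] [[[[y' z'] a'] b'] c'] [-> -> -> -> ->] //|[[[[y z] a] b] c]|[[[[y z] a] b] c] [[[[y' z'] a'] b'] c']].
  by rewrite /Q72 /= (addnC (z ^ 2)%N).
by rewrite /K72 /KA72 /KK /tensorK /= [uk 2 z z' * _]mulrC.
Qed.

Lemma isom72_opp : fqm_isom K72 Q72 (fun p => (- p.1.1.1.1, p.1.1.1.2, p.1.1.2, p.1.2, p.2)).
Proof.
split=> [[[[[y z] a] b] c] [[[[y' z'] a'] b'] c'] h|[[[[y z] a] b] c]|[[[[y z] a] b] c] [[[[y' z'] a'] b'] c']].
- have /= -> := congr1 (fun p => p.2) h; have /= -> := congr1 (fun p => p.1.2) h; have /= -> := congr1 (fun p => p.1.1.2) h.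
  by have /= -> := congr1 (fun p => p.1.1.1.2) h; have /= /oppr_inj -> := congr1 (fun p => p.1.1.1.1) h.
- change (48 * ((- y : 'I_3) ^ 2 + z ^ 2) + 108 * a ^ 2 + 108 * b ^ 2 + 108 * c ^ 2 = 48 * (y ^ 2 + z ^ 2) + 108 * a ^ 2 + 108 * b ^ 2 + 108 * c ^ 2 %[mod 144])%N.
  apply/eqP; rewrite !eqn_modDr !mulnDr eqn_modDr; apply/eqP; exact: sqr_opp_mod.
- by rewrite /K72 /KA72 /KK /tensorK /= uk_opp.
Qed.

Lemma unitary_KA72 : unitary KA72.
Proof. by apply: unitary_tensor; [apply: unitary_tensor; first exact: unitary_KK|]; apply: unitary_uk. Qed.

Lemma slaw_row0 (X : finType) r (K : X -> X -> C) f x t : slaw r K f -> hzero (f x) -> 0 < Im t -> \sum_y K x y * f y t = 0.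
Proof. by move=> h z t0; exact: slaw_zero h z t t0. Qed.

(** The hypothesis of order 13 removes the only exponent, 12, at which an invariant form can
    survive. Two contractions with theta vanish by their order. Each vanishing contraction says that
    components with coordinate 0 are -TH_1/TH_0 times those with coordinate 1, so the norm of the
    vector reduces to the components with all coordinates 1, and these are compared with a power of
    TH_0 times one of eta. *)
Lemma no_form72 f : slaw 5 K72 f -> (forall x, sq (f x) 13 (Q72 x)) -> sinv K72 Q72 f -> forall x, hzero (f x).
Proof.
move=> fs fq si; set o := inord 1 : 'I_2; set z := ord0 : 'I_2.
have iab y a b c t : 0 < Im t -> f (y, b, a, c) t = f (y, a, b, c) t by move=> t0; exact: (si _ isom72_ab (y, a, b, c) t t0).
have ibc y a b c t : 0 < Im t -> f (y, a, c, b) t = f (y, a, b, c) t by move=> t0; exact: (si _ isom72_bc (y, a, b, c) t t0).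
have iy y y' a b c t : 0 < Im t -> f (y', y, a, b, c) t = f (y, y', a, b, c) t by move=> t0; exact: (si _ isom72_y (y, y', a, b, c) t t0).
have io y y' a b c t : 0 < Im t -> f (- y, y', a, b, c) t = f (y, y', a, b, c) t by move=> t0; exact: (si _ isom72_opp (y, y', a, b, c) t t0).
have dual (u v : 'I_2) : \sum_w uk 3 w u * uk 1 w v = (u == v)%:R by exact: uk_dual.
pose g (p : 'I_3 * 'I_3 * 'I_2 * 'I_2) t := \sum_c f (p, c) t * th c t.
pose F (p : 'I_3 * 'I_3 * 'I_2) t := \sum_b g (p, b) t * th b t.
have gs : slaw 6 KA72 g by exact: (slaw_contract1 fs slaw_th dual).
have Fs : slaw 7 (tensor KK (@uk 2 3)) F by exact: (slaw_contract1 gs slaw_th dual).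
pose Qg (p : 'I_3 * 'I_3 * 'I_2 * 'I_2) := (48 * (p.1.1.1 ^ 2 + p.1.1.2 ^ 2) + 108 * p.1.2 ^ 2 + 108 * p.2 ^ 2)%N.
pose QF (p : 'I_3 * 'I_3 * 'I_2) := (48 * (p.1.1 ^ 2 + p.1.2 ^ 2) + 108 * p.2 ^ 2)%N.
have h144 (A : nat) (c : 'I_2) : (A + 108 * c ^ 2 + 36 * c ^ 2 = A %[mod 144])%N.
  by rewrite -addnA -mulnDl -modnDmr modnMr addn0.
have gq p : sq (g p) 13 (Qg p).
  apply: sq_sum => c _; apply: sq_mod (h144 _ c) _; have := sqM (fq (p, c)) (TH_sq c).
  by rewrite addn0.
have Fq p : sq (F p) 13 (QF p).
  apply: sq_sum => c _; apply: sq_mod (h144 _ c) _; have := sqM (gq (p, c)) (TH_sq c).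
  by rewrite addn0.
(* Weight 7/2 has bound 42. The exponents of [QF] are 12, 48, 60, 96, 108 and 0 modulo 144; without
   12 all orders are at least 43. *)
have F0 p : hzero (F p).
  apply: (@vanish R _ 7 F (fun=> 43%N)) => //; last 1 first.
  - exact: sq_normT Fq.
  - move=> q; apply: (@sq_sqo _ _ _ (QF q)); apply: sq_gap (Fq q) => //.
    by case: q => [[y y'] a]; elim/I3P: y; elim/I3P: y'; elim/I2P: a; rewrite /QF /= ?inordK.
  - apply: slaw_norm Fs; apply: unitary_tensor; [exact: unitary_KK|exact: unitary_uk].
have gab y a b t : 0 < Im t -> g (y, b, a) t = g (y, a, b) t.
  by move=> t0; apply: eq_bigr => c _; rewrite iab.
have md0N (u v : C) : u + v = 0 -> md u = md v by move/eqP; rewrite addr_eq0 => /eqP ->; rewrite mdN.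
have Fe y a t : 0 < Im t -> g (y, a, z) t * TH 0 t + g (y, a, o) t * TH 1 t = 0.
  by move=> t0; have := F0 (y, a) t t0; rewrite /F sumI2 /th -/o -/z inordK.
have rel (u v : C) t : u * TH 0 t + v * TH 1 t = 0 -> md u ^+ 2 * md (TH 0 t) ^+ 2 = md v ^+ 2 * md (TH 1 t) ^+ 2.
  by move/md0N; rewrite !mdM -!exprMn => ->.
pose mg (y : 'I_3 * 'I_3) := if (y.1 != ord0) && (y.2 != ord0) then 24%N else 25%N.
(* Weight 3 is n/2 + k/2 with n = 2 and k = 4, so the bound is 24, met only when both coordinates
   modulo 3 are nonzero. *)
have g11 y : (24 < mg y)%N -> hzero (g (y, o, o)).
  apply: (@theta_liouville _ (fun y => g (y, o, o)) (nrm g) 2 4 mg) => [w|w|t t0|t t0|t t0].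
  - apply: (@sq_sqo _ _ _ (Qg (w, o, o))); apply: sq_gap (gq _); first by rewrite /mg; case: ifP.
    by case: w => [w w']; elim/I3P: w; elim/I3P: w'; rewrite /mg /Qg /o /= -?val_eqE /= ?inordK.
  - by rewrite /mg; case: ifP.
  - rewrite /nrm !sum_pair [LHS]mulr_suml [RHS]mulr_suml; apply: eq_bigr => w1 _; rewrite [LHS]mulr_suml [RHS]mulr_suml.
    apply: eq_bigr => w2 _; set w := (w1, w2); rewrite !sumI2 -/o -/z.
    have := rel _ _ _ (Fe w z t t0); have := rel _ _ _ (Fe w o t t0); rewrite (gab w z o) // /thn (exprM _ 2 2).
    move: (md (g (w, z, z) t) ^+ 2) (md (g (w, z, o) t) ^+ 2) (md (g (w, o, o) t) ^+ 2) (md (TH 0 t) ^+ 2) (md (TH 1 t) ^+ 2) => p q r A B h1 h2.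
    transitivity ((p * A) * A + 2 * (q * A) * A + r * A ^+ 2); first by ring.
    rewrite h2 h1; transitivity ((q * A) * B + 2 * (r * B) * A + r * A ^+ 2); first by ring.
    by rewrite h1; ring.
  - exact: (slaw_norm unitary_KA72 gs).
  - exact: (sq_normT gq).
have gz p : hzero (g p).
  move=> t t0; have [n0 n1] := TH_neq0 t0.
  have S := slaw_row0 gs (g11 (ord0, ord0) isT) t0.
  have e2 : inord 2 = - inord 1 :> 'I_3 by rewrite opp_inord.
  (* Eliminating the coordinates 0 turns the relation at the zero class into (TH_0 + TH_1)^2 times
     this sum; TH_0 + TH_1 is a multiple of TH_0 at -1/t and hence nonzero. *)
  have s0 : \sum_y g (y, o, o) t = 0.
    have c0 : (Num.sqrt 3%:R)%:C^-1 * (Num.sqrt 3%:R)%:C^-1 * ((Num.sqrt 2%:R)%:C^-1 ^+ 2) * (TH 0 t + TH 1 t) ^+ 2 != 0 :> C.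
      have c3 : (Num.sqrt 3%:R)%:C^-1 != 0 :> C by rewrite invr_eq0 -md_eq0 md_real normr_eq0 sqrtr_eq0 -ltNge ltr0n.
      have c2 : (Num.sqrt 2%:R)%:C^-1 != 0 :> C by rewrite invr_eq0 sqrt2_neq0.
      have d0 : TH 0 t + TH 1 t != 0.
        have [<- _] := TH_S t0; rewrite !mulf_neq0 ?sqrt2_neq0 ?jb_neq0 //.
        by have [] := TH_neq0 (Im_invN_gt0 t0).
      by rewrite mulf_neq0 ?(mulf_neq0 (mulf_neq0 c3 c3)) ?expf_neq0.
    apply: (mulfI c0); rewrite mulr0 -[RHS](mulr0 (TH 0 t ^+ 2)) -[in RHS]S.
    rewrite !sum_pair [LHS]mulr_sumr [RHS]mulr_sumr; apply: eq_bigr => y1 _; rewrite [LHS]mulr_sumr [RHS]mulr_sumr.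
    apply: eq_bigr => y2 _; set y := (y1, y2); rewrite !sumI2 -/o -/z /KA72 /KK /tensorK /= !uk_half // !(@uk_0 R 3) ?muln0 //.
    rewrite /o !inordK // -/o muln1 expr0 expr1 (gab y z o) //.
    have := Fe y z t t0; have := Fe y o t t0; rewrite (gab y z o) //.
    move: (g (y, z, z) t) (g (y, z, o) t) (g (y, o, o) t) (TH 0 t) (TH 1 t) ((Num.sqrt 3%:R)%:C^-1) ((Num.sqrt 2%:R)%:C^-1) => A B D u v c d /eqP; rewrite addr_eq0 => /eqP h1 /eqP; rewrite addr_eq0 => /eqP h2.
    transitivity (c * c * d ^+ 2 * ((A * u) * u - 2 * (B * u) * u + D * u ^+ 2)); last by ring.
    rewrite h2 h1; transitivity (c * c * d ^+ 2 * (- (B * u) * v + 2 * D * v * u + D * u ^+ 2)); last by ring.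
    by rewrite h1; ring.
  have gy y y' : g (y', y, o, o) t = g (y, y', o, o) t by apply: eq_bigr => c _; rewrite iy.
  have go y y' : g (- y, y', o, o) t = g (y, y', o, o) t by apply: eq_bigr => c _; rewrite io.
  have goo y : g (y, o, o) t = 0.
    apply: (@sum_orbit _ _ (fun y => g (y, o, o) t) (fun y => mg y == 24%N) (inord 1, inord 1)) => //.
    - by rewrite /mg /= -val_eqE /= inordK.
    - by move=> w wn; apply: g11 => //; move: wn; rewrite /mg; case: ifP.
    - case; apply: I3P; apply: I3P; rewrite /mg /= -?val_eqE /= ?inordK // => _; rewrite ?e2 //;
        by [rewrite go|rewrite gy go gy|rewrite go gy go gy].
  have goz y : g (y, o, z) t = 0.
    by apply: (mulIf n0); rewrite mul0r; have := Fe y o t t0; rewrite goo mul0r addr0.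
  have gzo y : g (y, z, o) t = 0 by rewrite gab.
  have gzz y : g (y, z, z) t = 0.
    by apply: (mulIf n0); rewrite mul0r; have := Fe y z t t0; rewrite gzo mul0r addr0.
  by case: p => [[y a] b]; elim/I2P: a; elim/I2P: b.
have fe y a b t : 0 < Im t -> f (y, a, b, z) t * TH 0 t + f (y, a, b, o) t * TH 1 t = 0.
  by move=> t0; have := gz (y, a, b) t t0; rewrite /g sumI2 /th -/o -/z inordK.
(* Weight 5/2 is n/2 + k/2 with n = 3 and k = 2; the bound 12 is below the order 13. *)
have f111 y : hzero (f (y, o, o, o)).
  apply: (@theta_liouville _ (fun y => f (y, o, o, o)) (nrm f) 3 2 (fun=> 13%N)) => // [w|t t0|t t0|t t0].
  - exact: (sq_sqo (fq _)).
  - rewrite /nrm !sum_pair [LHS]mulr_suml [RHS]mulr_suml; apply: eq_bigr => w1 _; rewrite [LHS]mulr_suml [RHS]mulr_suml.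
    apply: eq_bigr => w2 _; set w := (w1, w2); rewrite !sumI2 -/o -/z.
    have := rel _ _ _ (fe w z z t t0); have := rel _ _ _ (fe w o z t t0); have := rel _ _ _ (fe w o o t t0).
    have e1 : f (w, z, o, o) t = f (w, o, o, z) t by rewrite -(iab w z o o) // ibc.
    have e2 : f (w, o, z, o) t = f (w, o, o, z) t by rewrite ibc.
    have e3 : f (w, z, o, z) t = f (w, z, z, o) t by rewrite ibc.
    have e4 : f (w, o, z, z) t = f (w, z, z, o) t by rewrite iab // ibc.
    rewrite e1 e2 e3 e4 /thn (exprM _ 2 3).
    move: (md (f (w, z, z, z) t) ^+ 2) (md (f (w, z, z, o) t) ^+ 2) (md (f (w, o, o, z) t) ^+ 2) (md (f (w, o, o, o) t) ^+ 2) (md (TH 0 t) ^+ 2) (md (TH 1 t) ^+ 2) => p q r v A B h3 h2 h1.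
    transitivity ((p * A) * A ^+ 2 + 3 * (q * A) * A ^+ 2 + 3 * (r * A) * A ^+ 2 + v * A ^+ 3); first by ring.
    rewrite h1 h2; transitivity ((q * A) * B * A + 3 * (r * A) * B * A + 3 * (r * A) * A ^+ 2 + v * A ^+ 3); first by ring.
    rewrite h2 h3; transitivity ((r * A) * B ^+ 2 + 3 * v * B ^+ 2 * A + 3 * v * B * A ^+ 2 + v * A ^+ 3); first by ring.
    by rewrite h3; ring.
  - have uK : unitary K72 by apply: unitary_tensor; [exact: unitary_KA72|exact: unitary_uk].
    exact: (slaw_norm uK fs t0).
  - exact: (sq_normT fq).
move=> [[[y a] b] c] t t0; have [n0 n1] := TH_neq0 t0.
have down a' b' : f (y, a', b', o) t = 0 -> f (y, a', b', z) t = 0.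
  by move=> h; apply: (mulIf n0); rewrite mul0r; have := fe y a' b' t t0; rewrite h mul0r addr0.
have e1 := f111 y t t0; have e2 := down o o e1.
have e3 : f (y, o, z, o) t = 0 by rewrite ibc.
have e4 : f (y, z, o, o) t = 0 by rewrite iab.
have e5 := down o z e3; have e6 : f (y, z, o, z) t = 0 by rewrite iab.
have e7 : f (y, z, z, o) t = 0 by rewrite ibc.
have e8 := down z z e7.
by elim/I2P: a; elim/I2P: b; elim/I2P: c.
Qed.

(** ** The form Xi *)

Lemma xlaw_tensor (X Y : finType) j k K L (f : X -> C -> C) (g : Y -> C -> C) : xlaw j K f -> xlaw k L g ->
  xlaw (fun t => j t * k t) (@tensorK R _ _ K L) (fun p t => f p.1 t * g p.2 t).
Proof.
move=> h h' [x y] tau t0 /=; rewrite h // h' // mulrACA mulr_suml; congr (_ * _).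
rewrite sum_pair; apply: eq_bigr => i _; rewrite mulr_sumr; apply: eq_bigr => i' _.
by rewrite /tensorK /=; ring.
Qed.

Lemma xlaw_reindex (X Y : finType) j (K : X -> X -> C) (L : Y -> Y -> C) (phi : X -> Y) f : injective phi -> (#|Y| <= #|X|)%N ->
  (forall x x', L (phi x) (phi x') = K x x') -> xlaw j L f -> xlaw j K (fun x => f (phi x)).
Proof.
move=> pi pc LK h x t t0; rewrite h //; congr (_ * _).
rewrite (reindex phi) /=; last exact/onW_bij/inj_card_bij.
by apply: eq_bigr => y _; rewrite LK.
Qed.

Lemma xlawD (X : finType) j (K : X -> X -> C) f g : xlaw j K f -> xlaw j K g -> xlaw j K (fun x t => f x t + g x t).
Proof.
move=> hf hg x t t0; rewrite hf // hg // -mulrDr -big_split /=; congr (_ * _).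
by apply: eq_bigr => y _; rewrite mulrDr.
Qed.

(** The dual of a two-dimensional representation is the representation twisted by its determinant.
    The pair (TH_1, -TH_0) passes in this way from the form a^2/4 to 3c^2/4, at the price of a sign
    under S and a shift of the exponents by 36. *)
Definition sv (c : 'I_2) t := if c == ord0 then TH 1 t else - TH 0 t.

Lemma sv_law : xlaw (fun t => - (jb t)^-1) (@uk 2 3) sv.
Proof.
move=> c t t0; have [h0 h1] := TH_S t0.
have cn := mulf_neq0 sqrt2_neq0 (jb_neq0 t0); apply: (mulfI cn).
rewrite sumI2 !uk_half // {2 3}/sv eqxx -val_eqE /= inordK //= muln0 muln1 expr0.
have -> : (Num.sqrt 2%:R)%:C * jb t * (- (jb t)^-1 * (1 / (Num.sqrt 2%:R)%:C * TH 1 t + (-1) ^+ c / (Num.sqrt 2%:R)%:C * - TH 0 t)) =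
   - TH 1 t + (-1) ^+ c * TH 0 t :> C.
  by field; rewrite (jb_neq0 t0) sqrt2_neq0.
elim/I2P: c; rewrite /sv -val_eqE /= ?inordK //= ?expr0 ?expr1; first by rewrite h1; ring.
by rewrite mulrN h0; ring.
Qed.

(** Weight 1 + 1/2 + 1/2 + 1/2 = 5/2. The exponents are those of the module of order 72 shifted by
    12 + 36 = 48, a cube root of unity under T. *)
Definition base (q : ('I_2 * 'I_3) * (('I_2 * 'I_3) * 'I_2)) t := E t * (uu q.1 t * (uu q.2.1 t * sv q.2.2 t)).

Definition jx t := - ((jb t) ^+ 5)^-1.

Lemma base_law : xlaw jx (tensor (tensor (@uk 2 3) (@uk 3 2)) (tensor (tensor (@uk 2 3) (@uk 3 2)) (@uk 2 3))) base.
Proof.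
have h := xlaw_tensor (@uu_law R) (xlaw_tensor (@uu_law R) sv_law).
move=> q t t0; have := h q t t0; rewrite /base => ->.
have -> : E (- t^-1) = (jb t ^+ 2)^-1 * E t by rewrite -(E_S t0) mulKf // expf_neq0 // jb_neq0.
rewrite !mulr_sumr; apply: eq_bigr => p _; rewrite /jx /=; field; exact: jb_neq0.
Qed.

Notation X72 := ('I_3 * 'I_3 * 'I_2 * 'I_2 * 'I_2)%type.

(** The three coordinates modulo 2 play different roles in [base], two in [uu] and one in [sv]; the
    six permutations restore the symmetry. *)
Definition pX (x : X72) t :=
  let y := x.1.1.1.1 in let z := x.1.1.1.2 in let a := x.1.1.2 in let b := x.1.2 in let c := x.2 in
  base ((a, y), ((b, z), c)) t + base ((b, y), ((a, z), c)) t + base ((a, y), ((c, z), b)) t +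
  base ((c, y), ((a, z), b)) t + base ((b, y), ((c, z), a)) t + base ((c, y), ((b, z), a)) t.

Lemma pX_law : xlaw jx K72 pX.
Proof.
have card : (#|{: ('I_2 * 'I_3) * (('I_2 * 'I_3) * 'I_2)}| <= #|{: X72}|)%N by rewrite !card_prod !card_ord.
have key (s : 'I_2 * 'I_2 * 'I_2 -> 'I_2 * 'I_2 * 'I_2) : injective s ->
    (forall p q, uk 3 (s p).1.1 (s q).1.1 * uk 3 (s p).1.2 (s q).1.2 * uk 3 (s p).2 (s q).2 =
       uk 3 p.1.1 q.1.1 * uk 3 p.1.2 q.1.2 * uk 3 p.2 q.2) ->
    xlaw jx K72 (fun x => let p := s (x.1.1.2, x.1.2, x.2) in base ((p.1.1, x.1.1.1.1), ((p.1.2, x.1.1.1.2), p.2))).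
  move=> sI sK; pose phi (x : X72) := let p := s (x.1.1.2, x.1.2, x.2) in ((p.1.1, x.1.1.1.1), ((p.1.2, x.1.1.1.2), p.2)).
  apply: (xlaw_reindex (phi := phi) _ card _ base_law).
    move=> [[[[y z] a] b] c] [[[[y' z'] a'] b'] c']; rewrite /phi /=.
    move: (sI (a, b, c) (a', b', c')); case: (s _) => [[u v] w]; case: (s _) => [[u' v'] w'] /= h [h1 -> h2 -> h3].
    by have [-> -> ->] : (a, b, c) = (a', b', c') by apply: h; rewrite h1 h2 h3.
  move=> [[[[y z] a] b] c] [[[[y' z'] a'] b'] c']; rewrite /phi /K72 /KA72 /KK /tensorK /=.
  have := sK (a, b, c) (a', b', c'); rewrite /= => e.
  transitivity (uk 2 y y' * uk 2 z z' * (uk 3 a a' * uk 3 b b' * uk 3 c c')); last by ring.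
  by rewrite -e; ring.
rewrite /pX; do 5?apply: xlawD.
- apply: (key id) => //.
- by apply: (key (fun p => (p.1.2, p.1.1, p.2))) => [[[a b] c] [[a' b'] c'] [-> -> ->] //|p q /=]; ring.
- by apply: (key (fun p => (p.1.1, p.2, p.1.2))) => [[[a b] c] [[a' b'] c'] [-> -> ->] //|p q /=]; ring.
- by apply: (key (fun p => (p.2, p.1.1, p.1.2))) => [[[a b] c] [[a' b'] c'] [-> -> ->] //|p q /=]; ring.
- by apply: (key (fun p => (p.1.2, p.2, p.1.1))) => [[[a b] c] [[a' b'] c'] [-> -> ->] //|p q /=]; ring.
- by apply: (key (fun p => (p.2, p.1.2, p.1.1))) => [[[a b] c] [[a' b'] c'] [-> -> ->] //|p q /=]; ring.
Qed.

Definition wt (y : 'I_3 * 'I_3) : nat := (y.1 != ord0) + (y.2 != ord0).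

(** On functions of the number of nonzero coordinates the S-matrix of (Z/3)^2 acts by a three by
    three matrix; there are 1, 4 and 4 classes of weight 0, 1 and 2. *)
Lemma KK_wt (v : nat -> C) y : \sum_z KK y z * v (wt z) =
  (if wt y is 0 then v 0%N + 4%:R * v 1%N + 4%:R * v 2%N
   else if wt y is 1 then v 0%N + v 1%N - 2%:R * v 2%N else v 0%N - 2%:R * v 1%N + v 2%N) / 3%:R.
Proof.
pose w := e2pi (1%:R / 3%:R) : C.
have w3 : w ^+ 3 = 1 by rewrite /w -e2piX mulrCA mulfV ?pnatr_eq0 // mulr1 e2pi1.
have w2 : w ^+ 2 = - 1 - w.
  have : (w - 1) * (w ^+ 2 + w + 1) = 0 by transitivity (w ^+ 3 - 1); [ring|rewrite w3 subrr].
  have wn : w != 1 by exact: e2pi_frac_neq1.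
  move/eqP; rewrite mulf_eq0 subr_eq0 (negbTE wn) /= => /eqP h.
  by apply/eqP; rewrite -subr_eq0 -[X in _ == X]h; apply/eqP; ring.
pose s := ((Num.sqrt 3%:R)%:C)^-1 : C.
have s3 : s * s = 3%:R^-1 by rewrite -invfM sqrt_natC.
have u (k l : 'I_3) : uk 2 k l = w ^+ (k * l) * s.
  rewrite /uk -/s; congr (_ * _); rewrite /w -e2piX.
  have -> : - ((2 * k * l)%N%:R / 3%:R) = (k * l)%N%:R * (1%:R / 3%:R) + (- (Posz (k * l)))%:~R :> C.
    by rewrite rmorphN /= !natrM; field.
  by rewrite e2piD e2pi_int mulr1.
have e2 : w ^+ 2 = - 1 - w := w2.
have e4 : w ^+ 4 = w by rewrite (exprD w 3 1) w3 mul1r.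
rewrite -s3 sum_pair !sumI3 /KK /tensorK /= !u /wt /= -!val_eqE /= !inordK //=.
by case: y => y z; elim/I3P: y; elim/I3P: z; rewrite /= -?val_eqE /= ?inordK //= ?mul0n ?muln0 ?mul1n ?muln1 ?expr0 ?expr1 ?e4 ?e2; ring.
Qed.

Definition rep (k : nat) : 'I_3 * 'I_3 := if k is 0 then (ord0, ord0) else if k is 1 then (ord0, inord 1) else (inord 1, inord 1).

Definition pt k (a b c : 'I_2) t := pX (rep k, a, b, c) t.

Lemma uu2 a t : 0 < Im t -> uu (a, inord 2) t = uu (a, inord 1) t.
Proof. by move=> t0; have [e1 e2] := U_sym t0; elim/I2P: a; rewrite /uu /= ?inordK. Qed.

Lemma pX_wt y a b c t : 0 < Im t -> pX (y, a, b, c) t = pt (wt y) a b c t.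
Proof.
move=> t0; case: y => y z; elim/I3P: y; elim/I3P: z; rewrite /wt /= -?val_eqE /= ?inordK //= /pt /pX /rep /base /= ?uu2 //; ring.
Qed.

(** The map (p0, p1, p2) -> (4 p2, p0, -2 p1) commutes with the matrix of [KK_wt] and moves the
    weight k to k + 1 modulo 3. Since the exponent of weight k is 48k modulo 144, this undoes the
    shift by 48 in [pX]. *)
Definition Xi72 (x : X72) t :=
  let: (y, a, b, c) := x in
  if wt y is 0 then 4%:R * pt 2 a b c t else if wt y is 1 then pt 0 a b c t else - 2%:R * pt 1 a b c t.

Lemma Xi_law : xlaw jx K72 Xi72.
Proof.
have sum4 (G : X72 -> C) : \sum_x G x = \sum_a \sum_b \sum_c \sum_y G (y, a, b, c).
  rewrite (sum_pair (X := ('I_3 * 'I_3 * 'I_2 * 'I_2)%type)) exchange_big /=.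
  under eq_bigr do rewrite (sum_pair (X := ('I_3 * 'I_3 * 'I_2)%type)) exchange_big /=.
  under eq_bigr do under eq_bigr do rewrite (sum_pair (X := ('I_3 * 'I_3)%type)) exchange_big /=.
  rewrite exchange_big /=; under eq_bigr do rewrite exchange_big /=.
  rewrite exchange_big /=; under eq_bigr do under eq_bigr do rewrite exchange_big /=.
  done.
have row (v : nat -> 'I_2 -> 'I_2 -> 'I_2 -> C) y a b c (G : X72 -> C) : (forall y a b c, G (y, a, b, c) = v (wt y) a b c) ->
    \sum_x K72 (y, a, b, c) x * G x = \sum_a' \sum_b' \sum_c' uk 3 a a' * uk 3 b b' * uk 3 c c' * (\sum_z KK y z * v (wt z) a' b' c').
  move=> Gv; rewrite sum4; apply: eq_bigr => a' _; apply: eq_bigr => b' _; apply: eq_bigr => c' _.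
  rewrite mulr_sumr; apply: eq_bigr => z _; rewrite Gv /K72 /KA72 /tensorK /=; ring.
move=> [[[y a] b] c] t t0; have s0 := Im_invN_gt0 t0.
pose v k a b c := if k is 0 then 4%:R * pt 2 a b c t else if k is 1 then pt 0 a b c t else - 2%:R * pt 1 a b c t.
rewrite (row v) //.
have S k : pt k a b c (- t^-1) = jx t * \sum_a' \sum_b' \sum_c' uk 3 a a' * uk 3 b b' * uk 3 c c' * (\sum_z KK (rep k) z * pt (wt z) a' b' c' t).
  rewrite /pt pX_law //; congr (_ * _).
  by apply: (row (fun k a b c => pt k a b c t)) => y' a' b' c'; exact: pX_wt.
have w0 : wt (rep 0) = 0%N by rewrite /wt /=.
have w1 : wt (rep 1) = 1%N by rewrite /wt /= -!val_eqE /= inordK.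
have w2 : wt (rep 2) = 2%N by rewrite /wt /= -!val_eqE /= inordK.
have tri k : (k < 3)%N -> k = 0%N \/ k = 1%N \/ k = 2%N by lia.
have wy : (wt y < 3)%N by rewrite /wt; case: eqP; case: eqP.
have fin m k : (forall a' b' c', \sum_z KK y z * v (wt z) a' b' c' = m * \sum_z KK (rep k) z * pt (wt z) a' b' c' t) ->
    m * pt k a b c (- t^-1) = jx t * \sum_a' \sum_b' \sum_c' uk 3 a a' * uk 3 b b' * uk 3 c c' * (\sum_z KK y z * v (wt z) a' b' c').
  move=> h; rewrite S mulrCA mulr_sumr; congr (_ * _); apply: eq_bigr => a' _; rewrite mulr_sumr; apply: eq_bigr => b' _.
  by rewrite mulr_sumr; apply: eq_bigr => c' _; rewrite h mulrCA.
rewrite /Xi72; have [e|[e|e]] := tri _ wy; rewrite e; [|rewrite -[LHS]mul1r|]; apply: fin => a' b' c';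
  rewrite (KK_wt (fun k => v k a' b' c')) (KK_wt (fun k => pt k a' b' c' t)) e ?w0 ?w1 ?w2 /v /=; by field.
Qed.

Lemma sv_sq c : sq (sv c) 0 (36 + 108 * c ^ 2).
Proof.
elim/I2P: c; rewrite /sv -val_eqE /= ?inordK //=.
  by have := TH_sq (inord 1); rewrite inordK.
apply: (@sq_ext _ (fun t => -1 * TH 0 t)); first by move=> t _; rewrite mulN1r.
by apply: sq_mod (sqZ (-1) (TH_sq ord0)).
Qed.

Lemma E_sq : sq E 12 12.
Proof. by have [h v _ r] := cEP R; exists (cE R). Qed.

Lemma pX_sq (x : X72) : sq (pX x) 12 (48 + Q72 x).
Proof.
case: x => [[[[y z] a] b] c]; have uq := wf_q (@uu_form R).
have h p q r : sq (fun t => E t * (uu p t * (uu q t * sv r t))) 12 (48 + (48 * (p.2 ^ 2 + q.2 ^ 2) + 108 * p.1 ^ 2 + 108 * q.1 ^ 2 + 108 * r ^ 2)).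
  have := sqM E_sq (sqM (uq p) (sqM (uq q) (sv_sq r))); rewrite !addn0; apply: sq_mod.
  by congr (_ %% _)%N; ring.
rewrite /pX /base /=; do 5?apply: sqD.
- by apply: sq_mod (h _ _ _); congr (_ %% _)%N; rewrite /Q72 /=; ring.
- by apply: sq_mod (h _ _ _); congr (_ %% _)%N; rewrite /Q72 /=; ring.
- by apply: sq_mod (h _ _ _); congr (_ %% _)%N; rewrite /Q72 /=; ring.
- by apply: sq_mod (h _ _ _); congr (_ %% _)%N; rewrite /Q72 /=; ring.
- by apply: sq_mod (h _ _ _); congr (_ %% _)%N; rewrite /Q72 /=; ring.
- by apply: sq_mod (h _ _ _); congr (_ %% _)%N; rewrite /Q72 /=; ring.
Qed.

Lemma Xi_sq x : sq (Xi72 x) (qm (Q72 x)) (Q72 x).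
Proof.
case: x => [[[y a] b] c]; apply: (sq_qm (m := 12)) => //.
have key m k : (48 + 48 * ((rep k).1 ^ 2 + (rep k).2 ^ 2) = 48 * (y.1 ^ 2 + y.2 ^ 2) %[mod 144])%N ->
    sq (fun t => m * pt k a b c t) 12 (Q72 (y, a, b, c)).
  move=> h; apply: sqZ; apply: sq_mod (pX_sq (rep k, a, b, c)); rewrite /Q72 /=.
  move: h; set P := (48 * ((rep k).1 ^ 2 + _))%N; set Q := (48 * (y.1 ^ 2 + _))%N.
  move: P Q (108 * a ^ 2)%N (108 * b ^ 2)%N (108 * c ^ 2)%N => P Q A B D h.
  have -> : (48 + (P + A + B + D) = 48 + P + (A + B + D))%N by ring.
  have -> : (Q + A + B + D = Q + (A + B + D))%N by ring.
  by rewrite -modnDml h modnDml.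
rewrite /Xi72; case: y key => y z key.
have key1 : (48 + 48 * ((rep 0).1 ^ 2 + (rep 0).2 ^ 2) = 48 * (y ^ 2 + z ^ 2) %[mod 144])%N -> sq (fun t => pt 0 a b c t) 12 (Q72 (y, z, a, b, c)).
  by move=> /(key 1 0%N) /=; apply: sq_ext => t _; rewrite mul1r.
by elim/I3P: y key key1; elim/I3P: z => key key1; rewrite /wt /= -?val_eqE /= ?inordK //=; (apply: key || apply: key1); rewrite /= ?inordK.
Qed.

Lemma sv_lead c : lead (sv c) (if c == ord0 then 36 else 0) (if c == ord0 then 2 else -1).
Proof.
have [l0 l1] := TH_lead; rewrite /sv; case: eqP => _ //.
by have := leadZ (-1) l0; rewrite mulr1; apply: lead_ext => t _; rewrite mulN1r.
Qed.

Definition uo (p : 'I_2 * 'I_3) : nat := if p.2 == ord0 then (if p.1 == ord0 then 0 else 108) else (if p.1 == ord0 then 48 else 12).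
Definition ul (p : 'I_2 * 'I_3) : C := if (p.2 == ord0) && (p.1 != ord0) then 2 else 1.

Lemma uu_lead p : lead (uu p) (uo p) (ul p).
Proof.
have H r : (r < 6)%N -> lead (U r) (12 * minn r (6 - r) ^ 2) (tcoef 12 (ind R 6 r) (12 * minn r (6 - r) ^ 2)).
  by move=> r6; have [h v _] := @tcoefP R 12 6 r erefl isT r6; rewrite usr.unlock; exists (tcoef 12 (ind R 6 r)).
have ts (r : nat) n : (0 < n)%N -> tcoef 12 (ind R 6 r) (12 * n ^ 2) = ind R 6 r n%:Z + ind R 6 r (- n%:Z).
  by move=> n0'; rewrite tcoef_sq.
have h0 := H 0%N isT; have h1 := H 1%N isT; have h2 := H 2%N isT; have h3 := H 3%N isT; have h4 := H 4%N isT; have h5 := H 5%N isT.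
have e0 : tcoef 12 (ind R 6 0) (12 * minn 0 (6 - 0) ^ 2) = 1.
  by have -> : (12 * minn 0 (6 - 0) ^ 2 = 0)%N by []; rewrite tcoef_0.
have e1 : tcoef 12 (ind R 6 1) (12 * minn 1 (6 - 1) ^ 2) = 1 by rewrite (ts 1%N 1%N) // /ind /= addr0.
have e2 : tcoef 12 (ind R 6 2) (12 * minn 2 (6 - 2) ^ 2) = 1 by rewrite (ts 2%N 2%N) // /ind /= addr0.
have e3 : tcoef 12 (ind R 6 3) (12 * minn 3 (6 - 3) ^ 2) = 2 by rewrite (ts 3%N 3%N) // /ind /= -natrD.
have e4 : tcoef 12 (ind R 6 4) (12 * minn 4 (6 - 4) ^ 2) = 1 by rewrite (ts 4%N 2%N) // /ind /= add0r.
have e5 : tcoef 12 (ind R 6 5) (12 * minn 5 (6 - 5) ^ 2) = 1 by rewrite (ts 5%N 1%N) // /ind /= add0r.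
rewrite e0 in h0; rewrite e1 in h1; rewrite e2 in h2; rewrite e3 in h3; rewrite e4 in h4; rewrite e5 in h5.
by case: p => a y; elim/I2P: a; elim/I3P: y; rewrite /uo /ul /uu /= -?val_eqE /= ?inordK.
Qed.

Definition bo (p q : 'I_2 * 'I_3) (c : 'I_2) : nat := 12 + (uo p + (uo q + (if c == ord0 then 36 else 0))).
Definition bl (p q : 'I_2 * 'I_3) (c : 'I_2) : C := ul p * (ul q * (if c == ord0 then 2 else -1)).

Lemma base_lead p q c k : (k <= bo p q c)%N -> lead (base (p, (q, c))) k (if bo p q c == k then bl p q c else 0).
Proof.
apply: lead_at; have [hE vE lE _] := cEP R; have lE' : lead E 12 1 by exists (cE R).
by have := leadM lE' (leadM (uu_lead p) (leadM (uu_lead q) (sv_lead c))); rewrite mul1r.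
Qed.

(** All six terms of [pX] start at w^k or later, so that its coefficient at w^k is the sum of the
    terms [bk]. *)
Definition po k y z a b c := [&& k <= bo (a, y) (b, z) c, k <= bo (b, y) (a, z) c, k <= bo (a, y) (c, z) b,
  k <= bo (c, y) (a, z) b, k <= bo (b, y) (c, z) a & k <= bo (c, y) (b, z) a]%N.
Definition bk k p q c : C := if bo p q c == k then bl p q c else 0.

Lemma pX_lead k y z a b c : po k y z a b c -> lead (pX (y, z, a, b, c)) k
  (bk k (a, y) (b, z) c + bk k (b, y) (a, z) c + bk k (a, y) (c, z) b +
   bk k (c, y) (a, z) b + bk k (b, y) (c, z) a + bk k (c, y) (b, z) a).
Proof.
move=> /and5P[h1 h2 h3 h4 /andP[h5 h6]]; rewrite /pX /=.
do 5?apply: leadD; exact: base_lead.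
Qed.

(** In the classes of residue 12, 24 and 72 the coefficient sought is the one at the least exponent,
    so leading terms of the theta factors decide it. What remains is a finite check over the weights
    and the coordinates modulo 2. *)
Lemma Xi_lead (x : X72) : [/\ Q72 x = 12 %[mod 144] -> lead (Xi72 x) 12 (- 2%:R),
  Q72 x = 24 %[mod 144] -> lead (Xi72 x) 24 4%:R & Q72 x = 72 %[mod 144] -> lead (Xi72 x) 72 0].
Proof.
case: x => [[[y a] b] c].
have key m k e l : po e (rep k).1 (rep k).2 a b c -> m * (bk e (a, (rep k).1) (b, (rep k).2) c + bk e (b, (rep k).1) (a, (rep k).2) c + bk e (a, (rep k).1) (c, (rep k).2) b +
   bk e (c, (rep k).1) (a, (rep k).2) b + bk e (b, (rep k).1) (c, (rep k).2) a + bk e (c, (rep k).1) (b, (rep k).2) a) = l -> lead (fun t => m * pt k a b c t) e l.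
  move=> h <-; apply: leadZ; rewrite /pt; move: h; case: (rep k) => u v; exact: pX_lead.
have key1 e l : po e ord0 ord0 a b c -> (bk e (a, ord0) (b, ord0) c + bk e (b, ord0) (a, ord0) c + bk e (a, ord0) (c, ord0) b +
   bk e (c, ord0) (a, ord0) b + bk e (b, ord0) (c, ord0) a + bk e (c, ord0) (b, ord0) a) = l -> lead (fun t => pt 0 a b c t) e l.
  by move=> h <-; exact: pX_lead.
rewrite /Xi72; case: y => y z.
have Qe k : (48 * (y ^ 2 + z ^ 2) = k %[mod 144])%N -> (Q72 (y, z, a, b, c) = k + 108 * a ^ 2 + 108 * b ^ 2 + 108 * c ^ 2 %[mod 144])%N.
  move=> h; change (48 * (y ^ 2 + z ^ 2) + 108 * a ^ 2 + 108 * b ^ 2 + 108 * c ^ 2 = k + 108 * a ^ 2 + 108 * b ^ 2 + 108 * c ^ 2 %[mod 144])%N.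
  by apply/eqP; rewrite !eqn_modDr h.
have [w0|[w1|w2]] : wt (y, z) = 0%N \/ wt (y, z) = 1%N \/ wt (y, z) = 2%N by rewrite /wt; case: eqP; case: eqP; auto.
- have -> : (y, z) = (ord0, ord0) by move: w0; rewrite /wt /=; case: eqP => // ->; case: eqP => // ->.
  rewrite {Qe} /wt /= /Q72 /=; elim/I2P: a key key1; elim/I2P: b; elim/I2P: c => key key1; rewrite ?inordK //; split=> // _; apply: key;
   rewrite /po /bk /bl /bo /uo /ul /= -?val_eqE /= ?inordK //=; ring.
- have q : (48 * (y ^ 2 + z ^ 2) = 48 %[mod 144])%N.
    by move: w1; rewrite {Qe} /wt /=; elim/I3P: y; elim/I3P: z; rewrite /= -?val_eqE /= ?inordK.
  rewrite w1 (Qe _ q) => {Qe}.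
  elim/I2P: a key key1; elim/I2P: b; elim/I2P: c => key key1; rewrite ?inordK //; split=> // _; apply: key1;
   rewrite /po /bk /bl /bo /uo /ul /= -?val_eqE /= ?inordK //=; ring.
- have q : (48 * (y ^ 2 + z ^ 2) = 96 %[mod 144])%N.
    by move: w2; rewrite {Qe} /wt /=; elim/I3P: y; elim/I3P: z; rewrite /= -?val_eqE /= ?inordK.
  rewrite w2 (Qe _ q) => {Qe}.
  elim/I2P: a key key1; elim/I2P: b; elim/I2P: c => key key1; rewrite ?inordK //; split=> // _; apply: key;
   rewrite /po /bk /bl /bo /uo /ul /= -?val_eqE /= ?inordK //=; ring.
Qed.

End Models.

(** * Discriminant forms as explicit finite quadratic modules *)

Section Lattice.
Variables (G : 'M[int]_3) (H : 'M[int]_3).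
Hypothesis GH : G = H + H^T.
Local Notation Gq := (map_mx intr G : 'M[rat]_3).

Definition imx m n (A : 'M[rat]_(m, n)) := forall i j, A i j \is a Num.int.

Lemma imxD m n (A B : 'M[rat]_(m, n)) : imx A -> imx B -> imx (A + B).
Proof. by move=> a b i j; rewrite mxE rpredD. Qed.

Lemma imxN m n (A : 'M[rat]_(m, n)) : imx A -> imx (- A).
Proof. by move=> a i j; rewrite mxE rpredN. Qed.

Lemma imxM m n p (A : 'M[rat]_(m, n)) (B : 'M[rat]_(n, p)) : imx A -> imx B -> imx (A *m B).
Proof. by move=> a b i j; rewrite mxE rpred_sum // => k _; rewrite rpredM. Qed.

Lemma imxT m n (A : 'M[rat]_(m, n)) : imx A -> imx A^T.
Proof. by move=> a i j; rewrite mxE. Qed.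

Lemma imx_map m n (A : 'M[int]_(m, n)) : imx (map_mx intr A).
Proof. by move=> i j; rewrite mxE intr_int. Qed.

Lemma imx_sum m n (I : finType) (A : I -> 'M[rat]_(m, n)) : (forall i, imx (A i)) -> imx (\sum_i A i).
Proof. by move=> a i j; rewrite summxE; apply: rpred_sum => l _; exact: a. Qed.

Lemma imx_lift m n (A : 'M[rat]_(m, n)) : imx A -> exists B : 'M[int]_(m, n), A = map_mx intr B.
Proof.
move=> a; exists (\matrix_(i, j) Num.floor (A i j)); apply/matrixP => i j; rewrite !mxE.
by rewrite floorK.
Qed.

Lemma GqT : Gq^T = Gq.
Proof. by apply/matrixP => i j; rewrite !mxE GH !mxE addrC. Qed.

Lemma in_dualP u : reflect (imx (Gq *m u)) (in_dual G u).
Proof.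
apply: (iffP forallP) => h i; last exact: h.
by move=> j; rewrite (ord1 j).
Qed.

Lemma bform_int u v : in_dual G u -> imx v -> bform G u v \is a Num.int.
Proof.
move=> /in_dualP hu hv; rewrite /bform; have -> : u^T *m Gq = (Gq *m u)^T by rewrite trmx_mul GqT.
by apply: imxM => //; exact: imxT.
Qed.

Lemma bformDl u u' v : bform G (u + u') v = bform G u v + bform G u' v.
Proof. by rewrite /bform linearD /= !mulmxDl mxE. Qed.

Lemma bformDr u v v' : bform G u (v + v') = bform G u v + bform G u v'.
Proof. by rewrite /bform mulmxDr mxE. Qed.

Lemma tr11 (A : 'M[rat]_1) : A 0 0 = A^T 0 0.
Proof. by rewrite mxE. Qed.

Lemma bformC u v : bform G u v = bform G v u.
Proof.
by rewrite /bform [LHS]tr11 !trmx_mul trmxK GqT mulmxA.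
Qed.

(** G = H + H^T makes z^T G z twice z^T H z; the half of an even Gram matrix is integral. *)
Lemma bform_even z : imx z -> bform G z z / 2 \is a Num.int.
Proof.
move=> hz; have -> : bform G z z / 2 = (z^T *m map_mx intr H *m z) 0 0.
  rewrite /bform GH map_mxD mulmxDr mulmxDl mxE.
  have -> : (z^T *m map_mx intr H^T *m z) 0 0 = (z^T *m map_mx intr H *m z) 0 0 :> rat.
    rewrite [LHS]tr11 !trmx_mul trmxK mulmxA (_ : (map_mx intr H^T)^T = map_mx intr H) //.
    by apply/matrixP => i j; rewrite !mxE.
  by field.
by apply: imxM => //; apply: imxM; [exact: imxT|exact: imx_map].
Qed.

Lemma bform_cong u v u' v' : in_dual G v -> in_dual G u' -> imx (u - u') -> imx (v - v') ->
  bform G u v - bform G u' v' \is a Num.int.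
Proof.
move=> dv du' hu hv; rewrite -{1}(subrK u' u) bformDl -addrA rpredD //.
  by rewrite bformC bform_int.
by rewrite -{1}(subrK v' v) bformDr addrK bform_int.
Qed.

Lemma qform_cong u u' : in_dual G u' -> imx (u - u') -> bform G u u / 2 - bform G u' u' / 2 \is a Num.int.
Proof.
move=> du hu; have -> : bform G u u / 2 - bform G u' u' / 2 = bform G (u - u') (u - u') / 2 + bform G u' (u - u').
  have := subrK u' u; move: (u - u') => d <-.
  by rewrite !bformDl !bformDr (bformC d u'); field.
by rewrite rpredD // ?bform_even // bform_int.
Qed.

Lemma disc_rep_dual (g : disc G) : in_dual G (disc_rep g).
Proof. by case: g. Qed.

End Lattice.

Section Transfer.
Variables (R : realType) (G H : 'M[int]_3) (X : finType) (k : nat).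
Variables (K : X -> X -> R[i]) (Q : X -> nat) (co : X -> 'I_k -> nat) (n qc : 'I_k -> nat).
Variables (r w : 'I_k -> 'cV[int]_3) (M : 'I_k -> 'I_3 -> int) (Z : 'M[int]_3).
Local Notation Gq := (map_mx intr G : 'M[rat]_3).
Hypothesis GH : G = H + H^T.
Hypothesis dG : \det G != 0.
Hypothesis n_gt0 : forall i, (0 < n i)%N.
Hypothesis hrw : forall i, G *m r i = (n i)%:Z *: w i.
Hypothesis hq : forall i, exists z : int, 72 * ((r i)^T *m w i) 0 0 = (n i)%:Z * (qc i)%:Z + 144 * (n i)%:Z * z.
Hypothesis hb : forall i j, i != j -> exists z : int, ((r i)^T *m w j) 0 0 = (n i)%:Z * z.
Hypothesis hM : forall j, \sum_i M i j *: w i + G *m col j Z = delta_mx j 0.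
Hypothesis hQ : forall x, Q x = (\sum_i qc i * co x i ^ 2)%N.
Hypothesis hK : forall x y, K x y = e2pi (- ((\sum_i qc i * co x i * co y i)%N%:R / 72%:R)) / (Num.sqrt #|X|%:R)%:C.
Hypothesis uK : unitary K.
Hypothesis hco : forall c : 'I_k -> int, exists x, forall i, exists z, c i = (co x i)%:Z + (n i)%:Z * z.

(** Generators r_i/n_i of the dual lattice modulo L. The hypotheses say that G g_i = w_i is
    integral, that q(g_i) is qc_i/144 modulo 1, and that distinct generators are orthogonal modulo
    1. *)
Let g i : 'cV[rat]_3 := (n i)%:R^-1 *: map_mx intr (r i).
Let nQ i : (n i)%:R != 0 :> rat. Proof. by rewrite pnatr_eq0 -lt0n. Qed.

Let Gg i : Gq *m g i = map_mx intr (w i).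
Proof.
by rewrite -scalemxAr -map_mxM hrw map_mxZ scalerA /= mulVf ?scale1r.
Qed.

Let U x : 'cV[rat]_3 := \sum_i (co x i)%:R *: g i.

Let GU x : Gq *m U x = \sum_i (co x i)%:R *: map_mx intr (w i).
Proof. by rewrite mulmx_sumr; apply: eq_bigr => i _; rewrite -scalemxAr Gg. Qed.

Let U_dual x : in_dual G (U x).
Proof.
apply/in_dualP; rewrite GU; apply: imx_sum => i a b; rewrite !mxE rpredM ?natr_int ?intr_int //.
Qed.

Let bg i j : bform G (g i) (g j) = (((r i)^T *m w j) 0 0)%:~R / (n i)%:R.
Proof.
rewrite /bform -mulmxA Gg /g linearZ /= -scalemxAl mxE mulrC; congr (_ * _).
by rewrite map_trmx -map_mxM mxE.
Qed.

Let bg_off i j : i != j -> bform G (g i) (g j) \is a Num.int.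
Proof. by move=> /hb [z e]; rewrite bg e intrM mulrAC -[_%:~R]/(_%:R) divff // ?mul1r ?intr_int. Qed.

Let bg_diag i : bform G (g i) (g i) / 2 - (qc i)%:R / 144%:R \is a Num.int.
Proof.
have [z e] := hq i; suff -> : bform G (g i) (g i) / 2 - (qc i)%:R / 144%:R = z%:~R by rewrite intr_int.
rewrite bg; have := congr1 (fun z : int => z%:~R : rat) e; rewrite !rmorphD !rmorphM /= => {}e.
have n144 : (144%:R : rat) != 0 by [].
apply: (mulfI n144); apply: (mulfI (nQ i)).
transitivity (72%:~R * (((r i)^T *m w i) 0 0)%:~R - (n i)%:R * (qc i)%:R : rat); first by field; exact: nQ.
by rewrite e -!pmulrn; ring.
Qed.

Let bformZ a b u v : bform G (a *: u) (b *: v) = a * b * bform G u v.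
Proof.
rewrite /bform (_ : (a *: u)^T = a *: u^T); last by apply/matrixP => i j; rewrite !mxE.
by rewrite -scalemxAr -!scalemxAl !mxE; ring.
Qed.

Let bform_sum (I : finType) (u : I -> 'cV[rat]_3) v : bform G (\sum_i u i) v = \sum_i bform G (u i) v.
Proof. by rewrite /bform raddf_sum /= !mulmx_suml summxE. Qed.

Let bU x y : bform G (U x) (U y) - (\sum_i qc i * co x i * co y i)%N%:R / 72%:R \is a Num.int.
Proof.
rewrite bform_sum natr_sum mulr_suml -sumrB rpred_sum // => i _.
rewrite (bformC GH) bform_sum (bigD1 i) //= addrAC rpredD //; last first.
  by rewrite rpred_sum // => j ji; rewrite bformZ rpredM ?rpredM ?natr_int ?bg_off.
rewrite bformZ !natrM.
have -> : (co y i)%:R * (co x i)%:R * bform G (g i) (g i) - (qc i)%:R * (co x i)%:R * (co y i)%:R / 72%:R =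
   2 * (co y i)%:R * (co x i)%:R * (bform G (g i) (g i) / 2 - (qc i)%:R / 144%:R) by field.
by rewrite rpredM ?bg_diag // !rpredM ?natr_int.
Qed.

Let qU x : bform G (U x) (U x) / 2 - (Q x)%:R / 144%:R \is a Num.int.
Proof.
rewrite hQ natr_sum; suff : forall s : seq 'I_k, uniq s ->
  bform G (\sum_(i <- s) (co x i)%:R *: g i) (\sum_(i <- s) (co x i)%:R *: g i) / 2 -
  (\sum_(i <- s) (qc i * co x i ^ 2)%N%:R) / 144%:R \is a Num.int.
  by apply; exact: index_enum_uniq.
elim=> [|i s IH] /=.
  by rewrite !big_nil /bform mulmx0 mxE !mul0r subrr rpred0.
move=> /andP[ni us]; rewrite !big_cons bformDl !bformDr; move: (IH us).
set T := \sum_(j <- s) _ *: _; set A := \sum_(j <- s) _ => hT.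
have bT : bform G ((co x i)%:R *: g i) T \is a Num.int.
  rewrite /T; elim: s ni {T A us IH hT} => [|j s IH]; first by rewrite big_nil /bform mulmx0 mxE rpred0.
  rewrite inE negb_or => /andP[ij ni]; rewrite big_cons bformDr rpredD ?IH //.
  by rewrite bformZ !rpredM ?natr_int ?bg_off.
rewrite (bformC GH T) bformZ.
have -> : ((co x i)%:R * (co x i)%:R * bform G (g i) (g i) + bform G ((co x i)%:R *: g i) T + (bform G ((co x i)%:R *: g i) T + bform G T T)) / 2 -
   ((qc i * co x i ^ 2)%N%:R + A) / 144%:R = (bform G T T / 2 - A / 144%:R) + bform G ((co x i)%:R *: g i) T +
     (co x i)%:R ^+ 2 * (bform G (g i) (g i) / 2 - (qc i)%:R / 144%:R) by rewrite natrM natrX; field.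
by apply: rpredD; [exact: rpredD|apply: rpredM; [apply: rpredX; exact: natr_int|exact: bg_diag]].
Qed.

Let psi x : disc G := projT1 (cid (disc_repP dG (U_dual x))).

Let psiP x : imx (U x - disc_rep (psi x)).
Proof. by move=> i j; rewrite (ord1 j) /psi; case: cid => h /= [p _]; exact: p. Qed.

Let psi_eq x (h : disc G) : imx (U x - disc_rep h) -> psi x = h.
Proof. by move=> hx; rewrite /psi; case: cid => h' /= [_ p]; apply: p => i; exact: hx. Qed.

(** M and Z write the dual basis in terms of the g_i modulo Z^3. A dual vector thus has integral
    coordinates with respect to the g_i, and reducing them modulo n_i changes it by an element of
    L. *)
Let surj (h : disc G) : exists x, psi x = h.
Proof.
have [v Ev] := imx_lift (elimT (in_dualP G _) (disc_rep_dual h)).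
have GZ j : Gq *m (\sum_i (M i j)%:~R *: g i + map_mx intr (col j Z)) = delta_mx j 0.
  rewrite mulmxDr mulmx_sumr -map_mxM; have := congr1 (map_mx (intr : int -> rat)) (hM j).
  rewrite map_mxD map_delta_mx /= => <-; congr (_ + _).
  rewrite raddf_sum /=; apply: eq_bigr => i _; by rewrite -scalemxAr Gg map_mxZ.
have Gu : Gq \in unitmx.
  by rewrite unitmxE det_map_mx unitfE intr_eq0.
have hE : disc_rep h = \sum_j (v j 0)%:~R *: (\sum_i (M i j)%:~R *: g i + map_mx intr (col j Z)).
  apply: (can_inj (mulKmx Gu)); rewrite Ev mulmx_sumr.
  under eq_bigr do rewrite -scalemxAr GZ.
  by apply/colP => i; rewrite summxE (bigD1 i) //= !mxE !eqxx mulr1 big1 ?addr0 // => j ji; rewrite !mxE eq_sym (negbTE ji) mulr0.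
have [x hx] := hco (fun i => \sum_j v j 0 * M i j).
exists x; apply: psi_eq.
have {hx} /(_ _)/cid hx := hx; pose z i := projT1 (hx i).
have zE i : \sum_j v j 0 * M i j = (co x i)%:Z + (n i)%:Z * z i by rewrite /z; case: (hx i).
have -> : disc_rep h = U x + (\sum_i (z i)%:~R *: map_mx intr (r i) + \sum_j (v j 0)%:~R *: map_mx intr (col j Z)).
  rewrite hE addrA -big_split /=; under eq_bigr do rewrite scalerDr scaler_sumr.
  rewrite big_split /= exchange_big /=; congr (_ + _); apply: eq_bigr => i _.
  have -> : \sum_j (v j 0)%:~R *: ((M i j)%:~R *: g i) = (\sum_j v j 0 * M i j)%:~R *: g i.
    by rewrite rmorph_sum scaler_suml; apply: eq_bigr => j _; rewrite scalerA rmorphM.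
  rewrite zE rmorphD rmorphM /= scalerDl; congr (_ + _).
  by rewrite /g scalerA mulrAC -[(Posz (n i))%:~R]/((n i)%:R) mulfV ?mul1r.
rewrite opprD addrA subrr add0r; apply: imxN; apply: imxD; apply: imx_sum => i a b; rewrite !mxE rpredM ?intr_int //.
Qed.

Let ker x y : e2pi_rat R (- bform G (disc_rep (psi x)) (disc_rep (psi y))) =
  e2pi (- ((\sum_i qc i * co x i * co y i)%N%:R / 72%:R)).
Proof.
set m := (\sum_i _)%N.
have : bform G (disc_rep (psi x)) (disc_rep (psi y)) - m%:R / 72%:R \is a Num.int.
  have := rpredB (bU x y) (bform_cong GH (U_dual y) (disc_rep_dual (psi x)) (psiP x) (psiP y)).
  rewrite -/m; set a := bform G (U x) _; set b := bform G (disc_rep _) _.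
  by move: a b (m%:R / 72%:R : rat) => a b c; have -> : a - c - (a - b) = b - c by ring.
move=> /intrP [z e]; rewrite /e2pi_rat.
have -> : - bform G (disc_rep (psi x)) (disc_rep (psi y)) = - (m%:R / 72%:R) + (- z)%:~R.
  by rewrite mulrNz -e; move: (bform _ _ _) (m%:R / 72%:R : rat) => a b; ring.
rewrite rmorphD rmorphN fmorph_div !rmorph_nat rmorph_int rmorphD rmorphN fmorph_div !rmorph_nat rmorph_int.
by rewrite e2piD e2pi_int mulr1.
Qed.

(** If two elements had the same class, the corresponding columns of K would agree, although a
    unitary kernel preserves the norm of the difference of two basis vectors. Thus the order of L'/L
    need not be computed. *)
Let psi_inj : injective psi.
Proof.
move=> x x' e; apply/eqP; apply: contraT => xx.
have row y : K y x = K y x' by rewrite !hK -!ker e.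
have := uK (fun y => (y == x)%:R - (y == x')%:R).
rewrite big1 => [|y _].
  move/esym/eqP; rewrite psumr_eq0 => [/allP/(_ x)|? _]; last exact: sqr_ge0.
  by rewrite mem_index_enum => /(_ isT); rewrite eqxx (negbTE xx) subr0 -[md _]/(md 1%:R) md_natr expr1n oner_eq0.
have s z : \sum_y0 K y y0 * (y0 == z)%:R = K y z.
  by rewrite (bigD1 z) //= eqxx mulr1 big1 ?addr0 // => i /negbTE ->; rewrite mulr0.
under eq_bigr do rewrite mulrBr.
by rewrite sumrB !s row subrr md0 expr0n.
Qed.

Lemma transfer : exists psi : X -> disc G, [/\ bijective psi,
  forall x, qval (psi x) - (Q x)%:R / 144%:R \is a Num.int &
  forall x y, e2pi_rat R (- bform G (disc_rep (psi y)) (disc_rep (psi x))) / (Num.sqrt #|disc G|%:R)%:C = K x y].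
Proof.
have bij : bijective psi.
  apply: inj_card_bij => //; have /(_ _)/cid sj := surj.
  apply: (leq_card (fun h => projT1 (sj h))) => h h' e.
  by rewrite -(projT2 (sj h)) -(projT2 (sj h')) e.
exists psi; split=> // [x|x y].
  have := rpredB (qU x) (qform_cong GH (disc_rep_dual (psi x)) (psiP x)).
  rewrite /qval; move: (bform _ _ _ / 2) (bform _ _ _ / 2) (_%:R / _) => a b c.
  by have -> : b - c - (b - a) = a - c by ring.
by rewrite ker hK (bij_eq_card bij); under eq_bigr do rewrite mulnAC.
Qed.

End Transfer.

(** * Certificates for the eleven lattices *)

Section Coordinates.
Variable R : realType.
Local Notation C := R[i].

(** Coordinates on a finite quadratic module that is an orthogonal sum of k cyclic ones, of orders
    n_i, on which 144 q = sum_i qc_i x_i^2. *)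
Record fqm_coords (X : finType) (K : X -> X -> C) (Q : X -> nat) (k : nat) (co : X -> 'I_k -> nat) (n qc : 'I_k -> nat) : Prop := FqmCoords {
  fc_n : forall i, (0 < n i)%N;
  fc_Q : forall x, Q x = (\sum_i qc i * co x i ^ 2)%N;
  fc_K : forall x y, K x y = e2pi (- ((\sum_i qc i * co x i * co y i)%N%:R / 72%:R)) / (Num.sqrt #|X|%:R)%:C;
  fc_unitary : unitary K;
  fc_surj : forall c : 'I_k -> int, exists x, forall i, exists z, c i = (co x i)%:Z + (n i)%:Z * z }.

Definition fqm_model (G : 'M[int]_3) (X : finType) (K : X -> X -> C) (Q : X -> nat) := exists psi : X -> disc G, [/\ bijective psi,
  forall x, qval (psi x) - (Q x)%:R / 144%:R \is a Num.int &
  forall x y, e2pi_rat R (- bform G (disc_rep (psi y)) (disc_rep (psi x))) / (Num.sqrt #|disc G|%:R)%:C = K x y].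

Definition mxz (A : seq (seq int)) : 'M[int]_3 := \matrix_(i, j) (nth [::] A i)`_j.
Definition colz (v : seq int) : 'cV[int]_3 := \col_i v`_i.

Lemma gram_model (a b c x y z : int) (X : finType) (K : X -> X -> C) (Q : X -> nat) (k : nat) co n qc :
  @fqm_coords X K Q k co n qc -> forall r w M Z : seq (seq int),
  let ri i := colz (nth [::] r i) in let wi i := colz (nth [::] w i) in
  let G := gram (2 * a) (2 * b) (2 * c) x y z in
  \det G != 0 ->
  (forall i : 'I_k, G *m ri i = (n i)%:Z *: wi i) ->
  (forall i : 'I_k, (144 * (n i)%:Z %| 72 * ((ri i)^T *m wi i) ord0 ord0 - (n i)%:Z * (qc i)%:Z)%Z) ->
  (forall i j : 'I_k, i != j -> ((n i)%:Z %| ((ri i)^T *m wi j) ord0 ord0)%Z) ->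
  (forall j : 'I_3, \sum_(i < k) (nth [::] M i)`_j *: wi i + G *m col j (mxz Z) = delta_mx j 0) ->
  fqm_model G K Q.
Proof.
move=> [n0 hQ hK uK hco] r w M Z ri wi G dG hrw hq hb hM.
pose H := mxz [:: [:: a; x; y]; [:: 0; b; z]; [:: 0; 0; c]].
have GH : G = H + H^T.
  by apply/matrixP; apply: ord3P; apply: ord3P; rewrite !mxE /= ?addr0 ?add0r ?mulr2n ?mulrDl ?mul1r //; ring.
apply: (transfer (H := H) (co := co) (n := n) (qc := qc) (r := fun i : 'I_k => ri i) (w := fun i : 'I_k => wi i) (M := fun (i : 'I_k) (j : 'I_3) => (nth [::] M i)`_j) (Z := mxz Z)) => //.
- by move=> i; have /dvdzP[q e] := hq i; exists q; rewrite [_ * q]mulrC -e addrC subrK.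
- by move=> i j /hb/dvdzP[q e]; exists q; rewrite e mulrC.
Qed.

Definition dot3 (u v : seq int) : int := u`_0 * v`_0 + u`_1 * v`_1 + u`_2 * v`_2.

(** The vectors r_i / n_i represent generators of L'/L: w_i = G (r_i / n_i) is integral, and M, Z
    certify that the w_i generate Z^3 modulo G Z^3. *)
Definition lattice_cert (a b c x y z : int) (k : nat) (n qc : seq nat) (r w M Z : seq (seq int)) : bool :=
  let G := [:: [:: 2 * a; x; y]; [:: x; 2 * b; z]; [:: y; z; 2 * c]] in
  let s := iota 0 k in let t := iota 0 3 in
  let ni i : int := nth 0%N n i in let ri i := nth [::] r i in let wi i := nth [::] w i in
  [&& 2 * a * (2 * b) * (2 * c) + 2 * x * y * z - 2 * a * z ^+ 2 - 2 * b * y ^+ 2 - 2 * c * x ^+ 2 != 0,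
    all (fun i => all (fun j => dot3 (nth [::] G j) (ri i) == ni i * (wi i)`_j) t) s,
    all (fun i => (144 * ni i %| 72 * dot3 (ri i) (wi i) - ni i * (nth 0%N qc i)%:Z)%Z) s,
    all (fun i => all (fun j => (i == j) || (ni i %| dot3 (ri i) (wi j))%Z) s) s &
    all (fun j => all (fun l => foldr (fun i u => (nth [::] M i)`_j * (wi i)`_l + u) 0 s +
      dot3 (nth [::] G l) [:: (nth [::] Z 0)`_j; (nth [::] Z 1)`_j; (nth [::] Z 2)`_j] == (l == j)%:R) t) t].

Lemma lattice_cert_model (a b c x y z : int) (X : finType) (K : X -> X -> C) (Q : X -> nat) (k : nat) co (n qc : seq nat) :
  @fqm_coords X K Q k co (fun i => nth 0%N n i) (fun i => nth 0%N qc i) -> forall r w M Z : seq (seq int),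
  lattice_cert a b c x y z k n qc r w M Z -> fqm_model (gram (2 * a) (2 * b) (2 * c) x y z) K Q.
Proof.
move=> hc r w M Z /and5P [dG h1 h2 h3 h4].
have s_in (i : 'I_k) : (i : nat) \in iota 0 k by rewrite mem_iota ltn_ord.
have t_in (j : 'I_3) : (j : nat) \in iota 0 3 by rewrite mem_iota ltn_ord.
have dotE u v : ((colz u)^T *m colz v) ord0 ord0 = dot3 u v.
  by rewrite !mxE !big_ord_recl big_ord0 !mxE addr0 addrA.
have GE (j : 'I_3) (v : 'cV[int]_3) : (gram (2 * a) (2 * b) (2 * c) x y z *m v) j 0 =
   dot3 (nth [::] [:: [:: 2 * a; x; y]; [:: x; 2 * b; z]; [:: y; z; 2 * c]] j) [:: v ord0 0; v (lift ord0 ord0) 0; v ord_max 0].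
  rewrite !mxE !big_ord_recl big_ord0 !mxE addr0 addrA (_ : lift ord0 (lift ord0 ord0) = ord_max) //; exact: val_inj.
apply: (@gram_model a b c x y z X K Q k co _ _ hc r w M Z).
- by rewrite det_gram; move: dG; congr (_ != 0); ring.
- move=> i; apply/colP => j; rewrite GE !mxE; have /allP/(_ _ (t_in j))/eqP <- := allP h1 _ (s_in i).
  by [].
- by move=> i; rewrite dotE; exact: (allP h2 _ (s_in i)).
- move=> i j ij; rewrite dotE; have /allP/(_ _ (s_in j)) := allP h3 _ (s_in i).
  by rewrite (_ : (i == j :> nat) = (i == j)) // (negbTE ij).
- move=> j; apply/colP => l; have /allP/(_ _ (t_in l))/eqP := allP h4 _ (t_in j).
  move=> e; transitivity ((l == j :> nat)%:R : int); last by rewrite mxE eqxx andbT.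
  rewrite -e mxE GE summxE !mxE; congr (_ + _).
  transitivity (\sum_(i <- iota 0 k) (nth [::] M i)`_j * (nth [::] w i)`_l).
    by rewrite -[in RHS](subn0 k) -/(index_iota 0 k) big_mkord; apply: eq_bigr => i _; rewrite !mxE.
  by elim: (iota 0 k) => [|i s IH]; rewrite ?big_nil // big_cons IH.
Qed.

Lemma res_ord n (c : int) : exists (x : 'I_n.+1) z, c = x%:Z + n.+1%:Z * z.
Proof.
have h : (`|(c %% n.+1%:Z)%Z| < n.+1)%N by rewrite -ltz_nat gez0_abs ?modz_ge0 ?ltz_mod.
exists (Ordinal h), (c %/ n.+1%:Z)%Z => /=; rewrite gez0_abs ?modz_ge0 //.
by rewrite {1}(divz_eq c n.+1%:Z) addrC mulrC.
Qed.

Lemma sqrt_card2 (a b : nat) : (Num.sqrt (a * b)%N%:R)%:C^-1 = (Num.sqrt a%:R)%:C^-1 * (Num.sqrt b%:R)%:C^-1 :> C.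
Proof. by rewrite natrM sqrtrM ?ler0n // rmorphM invfM. Qed.

Definition co12 (p : 'I_4 * 'I_3) (i : 'I_2) : nat := nth 0%N [:: p.1 : nat; p.2 : nat] i.
Definition co24 (p : 'I_2 * 'I_2 * 'I_2 * 'I_3) (i : 'I_4) : nat := nth 0%N [:: p.1.1.1 : nat; p.1.1.2 : nat; p.1.2 : nat; p.2 : nat] i.
Definition co36 (p : 'I_4 * ('I_3 * 'I_3)) (i : 'I_3) : nat := nth 0%N [:: p.1 : nat; p.2.1 : nat; p.2.2 : nat] i.
Definition co108 (p : 'I_4 * ('I_9 * 'I_3)) (i : 'I_3) : nat := nth 0%N [:: p.1 : nat; p.2.1 : nat; p.2.2 : nat] i.
Definition co72 (p : 'I_3 * 'I_3 * 'I_2 * 'I_2 * 'I_2) (i : 'I_5) : nat :=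
  nth 0%N [:: p.1.1.1.1 : nat; p.1.1.1.2 : nat; p.1.1.2 : nat; p.1.2 : nat; p.2 : nat] i.

Lemma coords12 : fqm_coords (@K12 R) Q12 co12 (fun i : 'I_2 => nth 0%N [:: 4; 3] i) (fun i : 'I_2 => nth 0%N [:: 126; 48] i).
Proof.
split.
- by case=> [[|[|//]] ?].
- by move=> [a y]; rewrite !big_ord_recl big_ord0 /co12 /Q12 /= addn0.
- move=> [a y] [b z]; rewrite card_prod !card_ord !big_ord_recl big_ord0 /co12 /= sqrt_card2 addn0.
  have -> : - ((126 * a * b + 48 * y * z)%N%:R / 72%:R) = - ((7 * a * b)%N%:R / 4%:R) + - ((2 * y * z)%N%:R / 3%:R) :> C.
    by rewrite natrD !natrM; field.
  by rewrite e2piD /K12 /tensorK /uk /=; ring.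
- exact: unitary_K12.
- move=> c; have [a [u ea]] := @res_ord 3 (c ord0); have [y [v ey]] := @res_ord 2 (c (@Ordinal 2 1 isT)).
  exists (a, y) => -[[|[|//]] h].
  + by exists u; rewrite (_ : Ordinal h = ord0) //; exact: val_inj.
  + by exists v; rewrite (_ : Ordinal h = @Ordinal 2 1 isT) //; exact: val_inj.
Qed.

Lemma coords24 : fqm_coords (@K24 R) Q24 co24 (fun i : 'I_4 => nth 0%N [:: 2; 2; 2; 3] i) (fun i : 'I_4 => nth 0%N [:: 36; 36; 36; 96] i).
Proof.
split.
- by case=> [[|[|[|[|//]]]] ?].
- by move=> [[[a b] c] y]; rewrite !big_ord_recl big_ord0 /co24 /Q24 /QA24 /= addn0; ring.
- move=> [[[a b] c] y] [[[a' b'] c'] y']; rewrite !card_prod !card_ord !big_ord_recl big_ord0 /co24 /= !sqrt_card2 addn0.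
  have -> : - ((36 * a * a' + (36 * b * b' + (36 * c * c' + 96 * y * y')))%N%:R / 72%:R) =
     - ((1 * a * a')%N%:R / 2%:R) + - ((1 * b * b')%N%:R / 2%:R) + - ((1 * c * c')%N%:R / 2%:R) + - ((4 * y * y')%N%:R / 3%:R) :> C.
    by rewrite !natrD !natrM; field.
  by rewrite !e2piD /K24 /KA24 /tensorK /uk /=; ring.
- by apply: unitary_tensor; [apply: unitary_tensor; first apply: unitary_tensor|]; apply: unitary_uk.
- move=> e; have [a [u ea]] := @res_ord 1 (e ord0); have [b [v eb]] := @res_ord 1 (e (@Ordinal 4 1 isT)).
  have [c [u' ec]] := @res_ord 1 (e (@Ordinal 4 2 isT)); have [y [v' ey]] := @res_ord 2 (e (@Ordinal 4 3 isT)).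
  exists (a, b, c, y) => -[[|[|[|[|//]]]] h].
  + by exists u; rewrite (_ : Ordinal h = ord0) //; exact: val_inj.
  + by exists v; rewrite (_ : Ordinal h = @Ordinal 4 1 isT) //; exact: val_inj.
  + by exists u'; rewrite (_ : Ordinal h = @Ordinal 4 2 isT) //; exact: val_inj.
  + by exists v'; rewrite (_ : Ordinal h = @Ordinal 4 3 isT) //; exact: val_inj.
Qed.

Lemma coords36 : fqm_coords (@K36 R) Q36 co36 (fun i : 'I_3 => nth 0%N [:: 4; 3; 3] i) (fun i : 'I_3 => nth 0%N [:: 90; 48; 48] i).
Proof.
split.
- by case=> [[|[|[|//]]] ?].
- by move=> [a [y z]]; rewrite !big_ord_recl big_ord0 /co36 /Q36 /= addn0; ring.
- move=> [a [y z]] [a' [y' z']]; rewrite !card_prod !card_ord !big_ord_recl big_ord0 /co36 /= !sqrt_card2 addn0.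
  have -> : - ((90 * a * a' + (48 * y * y' + 48 * z * z'))%N%:R / 72%:R) =
     - ((5 * a * a')%N%:R / 4%:R) + - ((2 * y * y')%N%:R / 3%:R) + - ((2 * z * z')%N%:R / 3%:R) :> C.
    by rewrite !natrD !natrM; field.
  by rewrite !e2piD /K36 /KK /tensorK /uk /=; ring.
- by apply: unitary_tensor; [exact: unitary_uk|exact: unitary_KK].
- move=> e; have [a [u ea]] := @res_ord 3 (e ord0); have [b [v eb]] := @res_ord 2 (e (@Ordinal 3 1 isT)).
  have [c [u' ec]] := @res_ord 2 (e (@Ordinal 3 2 isT)).
  exists (a, (b, c)) => -[[|[|[|//]]] h].
  + by exists u; rewrite (_ : Ordinal h = ord0) //; exact: val_inj.
  + by exists v; rewrite (_ : Ordinal h = @Ordinal 3 1 isT) //; exact: val_inj.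
  + by exists u'; rewrite (_ : Ordinal h = @Ordinal 3 2 isT) //; exact: val_inj.
Qed.

Lemma coords108 : fqm_coords (@K108 R) Q108 co108 (fun i : 'I_3 => nth 0%N [:: 4; 9; 3] i) (fun i : 'I_3 => nth 0%N [:: 126; 16; 48] i).
Proof.
split.
- by case=> [[|[|[|//]]] ?].
- by move=> [a [y z]]; rewrite !big_ord_recl big_ord0 /co108 /Q108 /= addn0; ring.
- move=> [a [y z]] [a' [y' z']]; rewrite !card_prod !card_ord !big_ord_recl big_ord0 /co108 /= !sqrt_card2 addn0.
  have -> : - ((126 * a * a' + (16 * y * y' + 48 * z * z'))%N%:R / 72%:R) =
     - ((7 * a * a')%N%:R / 4%:R) + - ((2 * y * y')%N%:R / 9%:R) + - ((2 * z * z')%N%:R / 3%:R) :> C.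
    by rewrite !natrD !natrM; field.
  by rewrite !e2piD /K108 /tensorK /uk /=; ring.
- by apply: unitary_tensor; [exact: unitary_uk|apply: unitary_tensor; apply: unitary_uk].
- move=> e; have [a [u ea]] := @res_ord 3 (e ord0); have [b [v eb]] := @res_ord 8 (e (@Ordinal 3 1 isT)).
  have [c [u' ec]] := @res_ord 2 (e (@Ordinal 3 2 isT)).
  exists (a, (b, c)) => -[[|[|[|//]]] h].
  + by exists u; rewrite (_ : Ordinal h = ord0) //; exact: val_inj.
  + by exists v; rewrite (_ : Ordinal h = @Ordinal 3 1 isT) //; exact: val_inj.
  + by exists u'; rewrite (_ : Ordinal h = @Ordinal 3 2 isT) //; exact: val_inj.
Qed.

Lemma coords72 : fqm_coords (@K72 R) Q72 co72 (fun i : 'I_5 => nth 0%N [:: 3; 3; 2; 2; 2] i) (fun i : 'I_5 => nth 0%N [:: 48; 48; 108; 108; 108] i).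
Proof.
split.
- by case=> [[|[|[|[|[|//]]]]] ?].
- move=> [[[[y z] a] b] c]; rewrite !big_ord_recl big_ord0 /co72 /Q72 [RHS]/=.
  by change (48 * (y ^ 2 + z ^ 2) + 108 * a ^ 2 + 108 * b ^ 2 + 108 * c ^ 2 = 48 * y ^ 2 + (48 * z ^ 2 + (108 * a ^ 2 + (108 * b ^ 2 + (108 * c ^ 2 + 0)))))%N; ring.
- move=> [[[[y z] a] b] c] [[[[y' z'] a'] b'] c']; rewrite !card_prod !card_ord !big_ord_recl big_ord0 /co72 /= !sqrt_card2 addn0.
  have -> : - ((48 * y * y' + (48 * z * z' + (108 * a * a' + (108 * b * b' + 108 * c * c'))))%N%:R / 72%:R) =
     - ((2 * y * y')%N%:R / 3%:R) + - ((2 * z * z')%N%:R / 3%:R) + - ((3 * a * a')%N%:R / 2%:R) + - ((3 * b * b')%N%:R / 2%:R) + - ((3 * c * c')%N%:R / 2%:R) :> C.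
    by rewrite !natrD !natrM; field.
  by rewrite !e2piD /K72 /KA72 /KK /tensorK /uk /=; ring.
- by apply: unitary_tensor; [exact: unitary_KA72|exact: unitary_uk].
- move=> e; have [y [v ey]] := @res_ord 2 (e ord0); have [z [v' ez]] := @res_ord 2 (e (@Ordinal 5 1 isT)).
  have [a [u ea]] := @res_ord 1 (e (@Ordinal 5 2 isT)); have [b [u' eb]] := @res_ord 1 (e (@Ordinal 5 3 isT)); have [c [u2 ec]] := @res_ord 1 (e (@Ordinal 5 4 isT)).
  exists (y, z, a, b, c) => -[[|[|[|[|[|//]]]]] h].
  + by exists v; rewrite (_ : Ordinal h = ord0) //; exact: val_inj.
  + by exists v'; rewrite (_ : Ordinal h = @Ordinal 5 1 isT) //; exact: val_inj.
  + by exists u; rewrite (_ : Ordinal h = @Ordinal 5 2 isT) //; exact: val_inj.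
  + by exists u'; rewrite (_ : Ordinal h = @Ordinal 5 3 isT) //; exact: val_inj.
  + by exists u2; rewrite (_ : Ordinal h = @Ordinal 5 4 isT) //; exact: val_inj.
Qed.

Lemma model_2_4_2_2_1_2 : fqm_model (gram 2 4 2 (-2) (-1) (-2)) (@K12 R) Q12.
Proof.
by apply: (@lattice_cert_model 1 2 1 (-2) (-1) (-2) _ _ _ _ _ _ _ coords12
  [:: [:: 2; 1; 2]; [:: 2; 0; 1]]
  [:: [:: 0; (-1); 0]; [:: 1; (-2); 0]]
  [:: [:: 2; 3; 2]; [:: 1; 0; 2]]
  [:: [:: (-2); (-2); (-3)]; [:: (-1); (-1); (-1)]; [:: (-2); (-2); (-2)]]); vm_compute.
Qed.

Lemma model_2_4_4_2_2_2 : fqm_model (gram 2 4 4 (-2) (-2) (-2)) (@K24 R) Q24.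
Proof.
by apply: (@lattice_cert_model 1 2 2 (-2) (-2) (-2) _ _ _ _ _ _ _ coords24
  [:: [:: 1; 0; 0]; [:: 1; 1; 0]; [:: 1; 0; 1]; [:: 0; 2; 1]]
  [:: [:: 1; (-1); (-1)]; [:: 0; 1; (-2)]; [:: 0; (-2); 1]; [:: (-2); 2; 0]]
  [:: [:: 1; 0; 0]; [:: 1; 1; 0]; [:: 1; 0; 1]; [:: 0; 2; 1]]
  [:: [:: (-2); (-1); (-1)]; [:: (-1); (-2); (-1)]; [:: (-1); (-1); (-1)]]); vm_compute.
Qed.

Lemma model_2_6_4_3_2_0 : fqm_model (gram 2 6 4 (-3) (-2) 0) (@K12 R) Q12.
Proof.
by apply: (@lattice_cert_model 1 3 2 (-3) (-2) 0 _ _ _ _ _ _ _ coords12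
  [:: [:: 0; 2; 1]; [:: 0; 1; 0]]
  [:: [:: (-2); 3; 1]; [:: (-1); 2; 0]]
  [:: [:: 0; 2; 3]; [:: 0; 2; 0]]
  [:: [:: (-2); (-1); (-1)]; [:: (-1); (-2); (-2)]; [:: (-1); (-1); (-1)]]); vm_compute.
Qed.

Lemma model_4_12_2_6_2_0 : fqm_model (gram 4 12 2 (-6) (-2) 0) (@K24 R) Q24.
Proof.
by apply: (@lattice_cert_model 2 6 1 (-6) (-2) 0 _ _ _ _ _ _ _ coords24
  [:: [:: 0; 0; 1]; [:: 1; 0; 1]; [:: 1; 1; 1]; [:: 0; 1; 0]]
  [:: [:: (-1); 0; 1]; [:: 1; (-3); 0]; [:: (-2); 3; 0]; [:: (-2); 4; 0]]
  [:: [:: 0; 0; 1]; [:: 1; 0; 1]; [:: 1; 1; 1]; [:: 0; 1; 0]]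
  [:: [:: (-2); (-1); (-2)]; [:: (-1); (-1); (-1)]; [:: (-2); (-1); (-2)]]); vm_compute.
Qed.

Lemma model_2_6_12_3_0_6 : fqm_model (gram 2 6 12 (-3) 0 (-6)) (@K36 R) Q36.
Proof.
by apply: (@lattice_cert_model 1 3 6 (-3) 0 (-6) _ _ _ _ _ _ _ coords36
  [:: [:: 2; 0; 1]; [:: 0; 1; 0]; [:: 0; 1; 1]]
  [:: [:: 1; (-3); 3]; [:: (-1); 2; (-2)]; [:: (-1); 0; 2]]
  [:: [:: 2; 0; 1]; [:: 0; 2; 0]; [:: 0; 2; 2]]
  [:: [:: (-2); (-1); (-1)]; [:: (-1); (-2); (-1)]; [:: (-1); (-1); (-1)]]); vm_compute.
Qed.

Lemma model_4_12_6_6_0_6 : fqm_model (gram 4 12 6 (-6) 0 (-6)) (@K72 R) Q72.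
Proof.
by apply: (@lattice_cert_model 2 6 3 (-6) 0 (-6) _ _ _ _ _ _ _ coords72
  [:: [:: 0; 0; 1]; [:: 0; 1; 1]; [:: 0; 0; 1]; [:: 0; 1; 1]; [:: 1; 1; 1]]
  [:: [:: 0; (-2); 2]; [:: (-2); 2; 0]; [:: 0; (-3); 3]; [:: (-3); 3; 0]; [:: (-1); 0; 0]]
  [:: [:: 0; 0; 2]; [:: 0; 2; 2]; [:: 0; 0; 1]; [:: 0; 1; 1]; [:: 1; 1; 1]]
  [:: [:: (-1); (-1); (-1)]; [:: (-1); (-2); (-2)]; [:: (-1); (-2); (-3)]]); vm_compute.
Qed.

Lemma model_2_6_2_3_0_3 : fqm_model (gram 2 6 2 (-3) 0 (-3)) (@K12 R) Q12.
Proof.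
by apply: (@lattice_cert_model 1 3 1 (-3) 0 (-3) _ _ _ _ _ _ _ coords12
  [:: [:: 1; 2; 3]; [:: 0; 1; 0]]
  [:: [:: (-1); 0; 0]; [:: (-1); 2; (-1)]]
  [:: [:: 3; 2; 1]; [:: 0; 2; 0]]
  [:: [:: (-1); (-1); (-1)]; [:: (-2); (-2); (-1)]; [:: (-3); (-2); (-1)]]); vm_compute.
Qed.

Lemma model_2_6_6_3_3_0 : fqm_model (gram 2 6 6 (-3) (-3) 0) (@K36 R) Q36.
Proof.
by apply: (@lattice_cert_model 1 3 3 (-3) (-3) 0 _ _ _ _ _ _ _ coords36
  [:: [:: 2; 1; 3]; [:: 0; 1; 0]; [:: 0; 0; 1]]
  [:: [:: (-2); 0; 3]; [:: (-1); 2; 0]; [:: (-1); 0; 2]]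
  [:: [:: 2; 1; 3]; [:: 0; 2; 0]; [:: 0; 0; 2]]
  [:: [:: (-2); (-1); (-2)]; [:: (-1); (-1); (-1)]; [:: (-2); (-1); (-3)]]); vm_compute.
Qed.

Lemma model_6_18_2_9_3_0 : fqm_model (gram 6 18 2 (-9) (-3) 0) (@K108 R) Q108.
Proof.
by apply: (@lattice_cert_model 3 9 1 (-9) (-3) 0 _ _ _ _ _ _ _ coords108
  [:: [:: 2; 1; 1]; [:: 0; 1; 0]; [:: 2; 1; 0]]
  [:: [:: 0; 0; (-1)]; [:: (-1); 2; 0]; [:: 1; 0; (-2)]]
  [:: [:: 2; 3; 3]; [:: 0; 5; 0]; [:: 1; 2; 0]]
  [:: [:: (-2); (-3); (-2)]; [:: (-1); (-2); (-1)]; [:: (-1); (-1); (-1)]]); vm_compute.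
Qed.

Lemma model_2_6_2_3_1_3 : fqm_model (gram 2 6 2 (-3) (-1) (-3)) (@K36 R) Q36.
Proof.
by apply: (@lattice_cert_model 1 3 1 (-3) (-1) (-3) _ _ _ _ _ _ _ coords36
  [:: [:: 1; 3; 1]; [:: 0; 1; 0]; [:: 1; 0; 2]]
  [:: [:: (-2); 3; (-2)]; [:: (-1); 2; (-1)]; [:: 0; (-3); 1]]
  [:: [:: 1; 3; 1]; [:: 0; 2; 0]; [:: 2; 0; 1]]
  [:: [:: (-1); (-1); (-1)]; [:: (-1); (-3); (-1)]; [:: (-2); (-1); (-1)]]); vm_compute.
Qed.

Lemma model_2_6_6_3_3_3 : fqm_model (gram 2 6 6 (-3) (-3) (-3)) (@K108 R) Q108.
Proof.
by apply: (@lattice_cert_model 1 3 3 (-3) (-3) (-3) _ _ _ _ _ _ _ coords108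
  [:: [:: 1; 1; 1]; [:: 0; 2; 1]; [:: 0; 0; 1]]
  [:: [:: (-1); 0; 0]; [:: (-1); 1; 0]; [:: (-1); (-1); 2]]
  [:: [:: 3; 3; 3]; [:: 0; 1; 5]; [:: 0; 0; 2]]
  [:: [:: (-1); (-1); (-1)]; [:: (-1); (-1); (-2)]; [:: (-1); (-1); (-2)]]); vm_compute.
Qed.

Definition no_form (X : finType) (K : X -> X -> C) (Q : X -> nat) :=
  forall f, cform 5 K Q f -> sinv K Q f -> forall x, hzero (f x).

Lemma K12_no_form : no_form (@K12 R) Q12.
Proof.
move=> f hf si x t t0; apply: (no_form12 hf) => // a y s s0.
  exact: (si _ (isom12_1 R) (a, y) s s0).
exact: (si _ (isom12_2 R) (a, y) s s0).
Qed.

(** The ten lattices have only four discriminant forms up to isomorphism, of orders 12, 24, 36 and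
    108. *)
Lemma compact_model G : G \in compact_grams -> G <> gram 4 12 6 (-6) 0 (-6) ->
  exists (X : finType) (K : X -> X -> C) Q, no_form K Q /\ fqm_model G K Q.
Proof.
have n24 : no_form (@K24 R) Q24 by move=> f hf si x t; exact: no_form24.
have n36 : no_form (@K36 R) Q36 by exact: no_form36.
have n108 : no_form (@K108 R) Q108 by exact: no_form108.
have n12 := K12_no_form.
rewrite /compact_grams /chain_1213 !(mem_cat, inE).
move=> /orP[/orP[]|/orP[/or4P[]|/orP[|/orP[|/orP[|/orP[]]]]]] /eqP -> // _;
  try (by do 3!eexists; split; [exact: n12|exact: model_2_4_2_2_1_2]).
- by do 3!eexists; split; [exact: n24|exact: model_2_4_4_2_2_2].
- by do 3!eexists; split; [exact: n12|exact: model_2_6_4_3_2_0].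
- by do 3!eexists; split; [exact: n24|exact: model_4_12_2_6_2_0].
- by do 3!eexists; split; [exact: n36|exact: model_2_6_12_3_0_6].
- by do 3!eexists; split; [exact: n12|exact: model_2_6_2_3_0_3].
- by do 3!eexists; split; [exact: n36|exact: model_2_6_6_3_3_0].
- by do 3!eexists; split; [exact: n108|exact: model_6_18_2_9_3_0].
- by do 3!eexists; split; [exact: n36|exact: model_2_6_2_3_1_3].
- by do 3!eexists; split; [exact: n108|exact: model_2_6_6_3_3_3].
Qed.

End Coordinates.

(** * Cusp forms for the Weil representation as power series in w *)

Section CuspForms.
Variable R : realType.
Local Notation C := R[i].
Local Notation md := (@md R).
Local Notation PS := (@PS R).
Local Notation Re := complex.Re.
Local Notation Im := complex.Im.
Local Notation wq := (@wq R).
Local Notation jb := (@jb R).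

Lemma gt0_realC (e : C) : 0 < e -> e = (Re e)%:C /\ 0 < Re e.
Proof.
case: e => a b; rewrite ltcE /= => /andP[/eqP h a0]; split=> //.
by apply: complex_eqP => //=; rewrite h.
Qed.

Lemma cvg_ctends (u : nat -> C) (l : C) : ((u : nat -> C^o) @ \oo --> (l : C^o)) <-> ctends u l.
Proof.
split=> [/cvgrPdist_lt h e e0|h].
  have e0' : 0 < e%:C by rewrite ltcR.
  have [N _ hN] := h _ e0'; exists N => n Nn.
  by have := hN n Nn; rewrite /= normC_md ltcR mdBC.
apply/cvgrPdist_lt => e e0.
have [eE e1] := gt0_realC e0.
have [N hN] := h _ e1; exists N => // n Nn; rewrite eE normC_md ltcR mdBC; exact: hN.
Qed.

(** (m + 143 - N0)/144, rounded down, counts the j < m in the residue class of N0. *)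
Lemma arith_sum (a : nat -> C) N0 w m : (N0 < 144)%N -> (forall k, a k != 0 -> (k %% 144)%N = N0) ->
  \sum_(j < m) a j * w ^+ j = \sum_(k < (m + 143 - N0) %/ 144) a (N0 + 144 * k)%N * w ^+ (N0 + 144 * k).
Proof.
move=> N1 ha; elim: m => [|m IH].
  by rewrite big_ord0 divn_small ?big_ord0 //; lia.
rewrite big_ord_recr /= IH; have [mN|mN] := eqVneq (m %% 144)%N N0.
  have -> : ((m.+1 + 143 - N0) %/ 144 = ((m + 143 - N0) %/ 144).+1)%N by lia.
  rewrite big_ord_recr /=; have -> : (N0 + 144 * ((m + 143 - N0) %/ 144) = m)%N by lia.
  by [].
have -> : ((m.+1 + 143 - N0) %/ 144 = (m + 143 - N0) %/ 144)%N by lia.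
have [->|/ha e] := eqVneq (a m) 0; first by rewrite mul0r addr0.
by rewrite e eqxx in mN.
Qed.

Lemma frac_lt1 (F : realFieldType) (m n : nat) : (m < n)%N -> m%:R / n%:R < 1 :> F.
Proof.
move=> mn; have n0 : 0 < n%:R :> F by rewrite ltr0n; case: n mn.
by rewrite ltr_pdivrMr // mul1r ltr_nat.
Qed.

Lemma floor_frac (q : rat) (e : nat) : q - e%:R / 144%:R \is a Num.int ->
  q - (Num.floor q)%:~R = (e %% 144)%N%:R / 144%:R.
Proof.
move=> /intrP [z qz].
have qE : q = (e %% 144)%N%:R / 144%:R + (z + (e %/ 144)%N%:Z)%:~R.
  rewrite rmorphD /= -qz -[(Posz _)%:~R]/((e %/ 144)%N%:R : rat).
  have := congr1 (fun m : nat => m%:R : rat) (divn_eq e 144); rewrite natrD natrM => ->; by field.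
have r1 : (e %% 144 < 144)%N by rewrite ltn_mod.
suff -> : Num.floor q = z + (e %/ 144)%N%:Z by rewrite {1}qE addrK.
apply/eqP; rewrite eq_sym; rewrite -[_ == _]/(_ == _); apply/eqP/esym; apply: floor_def.
rewrite qE; apply/andP; split; first by rewrite lerDr divr_ge0.
have f1 : (e %% 144)%N%:R / 144%:R < 1 :> rat by exact: frac_lt1.
rewrite [ltRHS]intrD mulr1z; move: f1; move: ((e %% 144)%N%:R / 144%:R : rat) ((z + _)%:~R : rat) => u v uv; lra.
Qed.

Section OneLattice.
Variables (G : 'M[int]_3) (ee : disc G -> nat).
Hypothesis eeP : forall g, qval g - (ee g)%:R / 144%:R \is a Num.int.
Let N0 g := (ee g %% 144)%N.
Let N0_lt g : (N0 g < 144)%N. Proof. exact: ltn_mod. Qed.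

Let nk g (k : nat) : qval g - (Num.floor (qval g))%:~R + k%:R = (N0 g + 144 * k)%N%:R / 144%:R.
Proof. by rewrite (floor_frac (eeP g)) natrD natrM; field. Qed.

Lemma qval_cong g (k : nat) : (k%:R / 144%:R - qval g \is a Num.int) = (k %% 144 == ee g %% 144)%N.
Proof.
apply/idP/eqP => h.
  have := rpredD h (eeP g); rewrite addrA subrK => /intrP [z e].
  have : k%:Z = (ee g)%:Z + 144 * z.
    apply/eqP; rewrite -(eqr_int rat) rmorphD rmorphM /= -e -!pmulrn; apply/eqP; by field.
  move=> kz; apply/eqP; rewrite -eqz_nat -!modz_nat kz; apply/eqP.
  by rewrite -modzDmr modzMr addr0.
have -> : k%:R / 144%:R - qval g = - (qval g - (ee g)%:R / 144%:R) + ((k %/ 144)%N%:Z - (ee g %/ 144)%N%:Z)%:~R.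
  rewrite rmorphB /= -!pmulrn.
  have := congr1 (fun m : nat => m%:R : rat) (divn_eq (ee g) 144); rewrite natrD natrM => {1}->.
  have := congr1 (fun m : nat => m%:R : rat) (divn_eq k 144); rewrite natrD natrM => {1}->.
  by rewrite h; field.
by rewrite rpredD ?rpredN ?intr_int.
Qed.

Let wterm (k : nat) (tau : C) : e2pi ((ratr (k%:R / 144%:R) : R)%:C * tau) = wq tau ^+ k.
Proof.
rewrite /wq -e2piX; congr e2pi.
have -> : ratr (k%:R / 144%:R) = k%:R / 144%:R :> R by rewrite fmorph_div !rmorph_nat.
have -> : (k%:R / 144%:R : R)%:C = k%:R / 144%:R :> C by rewrite fmorph_div !rmorph_nat.
by ring.
Qed.

Definition qcoef (c : disc G -> rat -> C) g (j : nat) : C :=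
  if (j %% 144 == ee g %% 144)%N then c g (j%:R / 144%:R) else 0.

(** Every w with 0 < |w| < 1 is some [wq tau], so the expansion converges on the whole disc and its
    coefficients satisfy [good]. Order at least 1 is the positivity of the exponents in the support
    condition. *)
Lemma expansion_hasq (h : C -> group_space R G) c g : q_expansion h c ->
  hasq (fun t => h t g) (qcoef c g) /\ vge 1 (qcoef c g).
Proof.
move=> [supp lim]; set a := qcoef c g.
have res k : a k != 0 -> (k %% 144)%N = N0 g by rewrite /a /qcoef; case: ifP => [/eqP -> //|_]; rewrite eqxx.
have aN k : a (N0 g + 144 * k)%N = c g ((N0 g + 144 * k)%N%:R / 144%:R).
  by rewrite /a /qcoef mulnC addnC modnMDl modn_mod eqxx.
have S tau : 0 < Im tau -> ctends (fun n => \sum_(k < n) a k * wq tau ^+ k) (h tau g).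
  move=> t0 e e0; have /cvg_ctends/(_ e e0) [N hN] := lim g tau t0.
  exists (144 * N.+1)%N => n nN; rewrite (arith_sum _ _ (N0_lt g) res).
  have hn : (N <= (n + 143 - N0 g) %/ 144)%N by have := N0_lt g; lia.
  have := hN _ hn; rewrite seriesEord /=.
  by under eq_bigr do rewrite nk wterm -aN.
have ga : good a.
  apply: good_from_tends => w w1; have [->|wn] := eqVneq w 0; last first.
    by have [tau t0 <-] := wq_surj wn w1; exists (h tau g); exact: S.
  exists (a 0%N) => e e0; exists 1%N => -[//|n] _; rewrite big_ord_recl expr0 mulr1 big1 ?addr0 ?subrr ?md0 // => i _.
  by rewrite expr0n mulr0.
split; first by split=> // tau t0; apply/esym; apply: (PS_uniq ga (md_wq_lt1 t0)); exact: S.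
case=> // _; rewrite /a /qcoef; case: eqP => // _; apply/eqP; apply: contraT => /supp [].
by rewrite mul0r ltxx.
Qed.

(** Coefficients are indexed by rational numbers in the definition of a q-expansion; those outside
    (1/144) N receive 0. *)
Definition coef_at (a : nat -> C) (n : rat) : C :=
  if n * 144%:R == (Num.truncn (n * 144%:R))%:R then a (Num.truncn (n * 144%:R)) else 0.

Lemma coef_atE a (k : nat) : coef_at a (k%:R / 144%:R) = a k.
Proof. by rewrite /coef_at mulfVK // natrK eqxx. Qed.

Lemma hasq_expansion (h : C -> group_space R G) (a : disc G -> nat -> C) :
  (forall g, hasq (fun t => h t g) (a g)) -> (forall g, a g 0%N = 0) ->
  (forall g k, a g k != 0 -> (k = ee g %[mod 144])%N) -> q_expansion h (fun g => coef_at (a g)).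
Proof.
move=> ha a0 res; split=> [g n|g tau t0].
  rewrite /coef_at; case: ifP => [/eqP e|_]; last by rewrite eqxx.
  set k := Num.truncn _ in e *; move=> ak.
  have nE : n = k%:R / 144%:R by rewrite -e mulfK.
  have k0 : (0 < k)%N by rewrite lt0n; apply: contraNneq ak => ->; rewrite a0.
  by rewrite nE qval_cong (res g k ak) eqxx divr_gt0 ?ltr0n.
apply/cvg_ctends => e e0; have [ga hE] := ha g.
have := PS_tends ga (md_wq_lt1 t0); rewrite -hE // => /(_ e e0) [N hN].
exists N => n nN; have := hN (144 * n)%N; rewrite (arith_sum _ _ (N0_lt g) (res g)).
have -> : ((144 * n + 143 - N0 g) %/ 144 = n)%N by have := N0_lt g; lia.
rewrite seriesEord /=; under [in X in _ -> X]eq_bigr do rewrite nk wterm coef_atE.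
by apply; lia.
Qed.

(** The coefficient is selected by a choice among expansions, so it is determined only because
    expansions are unique: on the support by uniqueness of power series, elsewhere because both
    coefficients are 0. *)
Lemma fourier_coefE (h : C -> group_space R G) c g n : q_expansion h c -> fourier_coef h g n = c g n.
Proof.
move=> hc; rewrite /fourier_coef; case: xgetP => [a _ /= [c' hc' <-]|/(_ (c g n))]; last by case; exists c.
have [|ni] := boolP ((0 < n) && (n - qval g \is a Num.int)); last first.
  have z (d : disc G -> rat -> C) : q_expansion h d -> d g n = 0.
    by move=> [s _]; apply/eqP; apply: contraNT ni => /s [-> ->].
  by rewrite (z c) // (z c').
move=> /andP[n0 ni].
have [k nE] : exists k : nat, n = k%:R / 144%:R.
  have := rpredD ni (eeP g); rewrite addrA subrK => /intrP [z e].
  have nz : n = ((ee g)%:Z + 144 * z)%:~R / 144%:R.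
    by rewrite rmorphD rmorphM /= -e -!pmulrn; field.
  have : 0 < (ee g)%:Z + 144 * z by rewrite -(ltr0z rat); move: n0; rewrite nz pmulr_lgt0 // invr_gt0.
  by move: nz; case: (_ + _) => // k -> _; exists k.
have kr : (k %% 144 == ee g %% 144)%N by rewrite -qval_cong -nE.
have [h1 _] := expansion_hasq g hc; have [h2 _] := expansion_hasq g hc'.
by have := hasq_uniq h2 h1 k; rewrite /qcoef kr -nE.
Qed.

Lemma cusp_coef (h : C -> group_space R G) (a : disc G -> nat -> C) : (exists c, q_expansion h c) ->
  (forall g, hasq (fun t => h t g) (a g)) -> forall g (k : nat), fourier_coef h g (k%:R / 144%:R) =
     if (k %% 144 == ee g %% 144)%N then a g k else 0.
Proof.
move=> [c hc] ha g k; rewrite (fourier_coefE _ _ hc); have [h1 _] := expansion_hasq g hc.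
have := hasq_uniq h1 (ha g) k; rewrite /qcoef; case: ifP => // kr ak.
apply/eqP; apply: contraFT kr => /hc.1 [_]; rewrite qval_cong; exact: id.
Qed.

End OneLattice.

(** Synthetic division gives the difference quotient in w exactly, and the Taylor bounds for [e2pi]
    treat the change of variable; the derivative is L. *)
Lemma hasq_derivable (f : C -> C) a (tau : C) : hasq f a -> 0 < Im tau ->
  derivable (fun z : C^o => f z : C^o) tau 1.
Proof.
move=> [ga fa] t0; set w0 := wq tau; have w01 : md w0 < 1 := md_wq_lt1 t0.
have gb := good_synth ga w01.
pose i144 := i2pi R / 144%:R; pose L := PS (synth a w0) w0 * (w0 * i144).
have pr := pi_gt0 R.
have key : forall e : R, 0 < e -> exists2 d : R, 0 < d & forall z : C, z != 0 -> md z < d ->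
    md (z^-1 * (f (z + tau) - f tau) - L) < e.
  move=> e e0.
  pose B := md (PS (synth a w0) w0) + 1; have B0 : 0 < B by have := md_ge0 (PS (synth a w0) w0); rewrite /B; lra.
  pose A := md w0; have A0 : 0 <= A := md_ge0 _.
  pose Kc : R := (2 * pi) ^+ 2 * expR (2 * pi).
  have K0 : 0 <= Kc by rewrite mulr_ge0 ?sqr_ge0 ?expR_ge0.
  pose e1 := e / (2 * (A * md i144 + 1)).
  have m0 := md_ge0 i144.
  have D0 : 0 < A * md i144 + 1 by rewrite ltr_wpDl ?ltr01 // mulr_ge0.
  have e10 : 0 < e1 by rewrite divr_gt0 // mulr_gt0.
  have [d1 d10 h1] := PS_cont gb w01 (e := Num.min e1 1) ltac:(by rewrite lt_min e10 ltr01).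
  pose N : R := A * (2 * pi * expR (2 * pi)) + 1.
  have N0 : 0 < N by rewrite ltr_wpDl ?ltr01 // !mulr_ge0 ?expR_ge0 // ltW.
  pose P : R := 2 * (B * A * Kc + 1).
  have P0 : 0 < P by rewrite mulr_gt0 // ltr_wpDl ?ltr01 // !mulr_ge0 // ltW.
  exists (Num.min (Num.min 1 (Im tau)) (Num.min (d1 / N) (e / P))).
    by rewrite !lt_min ltr01 t0 !divr_gt0.
  move=> z zn; rewrite !lt_min => /andP[/andP[z1 zt] /andP[zd ze]].
  have zt0 : 0 < Im (z + tau) by rewrite cImD; have := md_Im z; have := ler_norm (- Im z); rewrite normrN; lra.
  have zm : 0 < md z by rewrite md_gt0.
  set w := wq (z + tau); have w1 : md w < 1 := md_wq_lt1 zt0.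
  have wE : w - w0 = w0 * (e2pi (z / 144%:R) - 1).
    by rewrite /w /wq mulrDl e2piD /w0 /wq; ring.
  have V : md (z / 144%:R) <= md z.
    have -> : z / 144%:R = (144%:R^-1)%:C * z by rewrite mulrC fmorphV rmorph_nat.
    by rewrite mdM md_real ger0_norm ?invr_ge0 ?ler0n // ler_piMl ?md_ge0 // invf_le1 ?ltr0n // ler1n.
  have x1 : expR (2 * pi * md z) <= expR (2 * pi) by rewrite ler_expR; nra.
  have q1 : md (e2pi (z / 144%:R) - 1) <= 2 * pi * md z * expR (2 * pi).
    by apply: le_trans (e2pi_bound1 V) _; rewrite ler_wpM2l // !mulr_ge0 ?ltW.
  have q2 : md (e2pi (z / 144%:R) - 1 - i144 * z) <= Kc * md z ^+ 2.
    have -> : i144 * z = i2pi R * (z / 144%:R) by rewrite /i144; ring.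
    apply: le_trans (e2pi_bound2 V) _.
    have -> : Kc * md z ^+ 2 = (2 * pi * md z) ^+ 2 * expR (2 * pi) by rewrite /Kc; ring.
    by rewrite ler_wpM2l ?sqr_ge0.
  have wd : md (w - w0) < d1.
    rewrite wE mdM; apply: (@le_lt_trans _ _ (md z * N)); last by rewrite -ltr_pdivlMr.
    have : A * md (e2pi (z / 144%:R) - 1) <= A * (2 * pi * md z * expR (2 * pi)) by rewrite ler_wpM2l.
    rewrite -/A /N; nra.
  have [_ c1] := h1 w wd; pose S := PS (synth a w0) w; pose S0 := PS (synth a w0) w0; rewrite -/S -/S0 in c1.
  have SB : md S <= B by have := md_triB S S0; move: c1; rewrite lt_min /B -/S0 => /andP[_]; lra.
  have Se : md (S - S0) < e1 by move: c1; rewrite lt_min => /andP[].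
  have -> : z^-1 * (f (z + tau) - f tau) - L = (S - S0) * (w0 * i144) + S * w0 * (z^-1 * (e2pi (z / 144%:R) - 1 - i144 * z)).
    rewrite fa // fa // -/w -/w0 synthP // -/S wE /L -/S0; field; exact: zn.
  apply: le_lt_trans (mdD _ _) _.
  have b1 : md ((S - S0) * (w0 * i144)) <= e1 * (A * md i144).
    by rewrite (mdM (S - S0)) (mdM w0); apply: ler_wpM2r (ltW Se); rewrite mulr_ge0 ?md_ge0.
  have b2 : md (S * w0 * (z^-1 * (e2pi (z / 144%:R) - 1 - i144 * z))) <= B * A * (Kc * md z).
    rewrite (mdM (S * w0)) (mdM S) (mdM z^-1) mdV; apply: ler_pM; rewrite ?mulr_ge0 ?md_ge0 ?invr_ge0 ?md_ge0 //.
      by apply: ler_pM; rewrite ?md_ge0.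
    by rewrite ler_pdivrMl // mulrCA -expr2.
  have b3 : e1 * (A * md i144) < e / 2.
    have -> : e1 * (A * md i144) = e1 * (A * md i144 + 1) - e1 by ring.
    have -> : e1 * (A * md i144 + 1) = e / 2 by rewrite /e1; field; rewrite gt_eqF.
    by rewrite ltrBlDr ltrDl.
  have b4 : B * A * (Kc * md z) <= e / 2.
    by move: ze; rewrite ltr_pdivlMr // /P; have := zm; lra.
  rewrite [ltRHS]splitr; exact: le_lt_trans (lerD b1 b2) (ltr_leD b3 b4).
apply/cvg_ex; exists (L : C^o); apply/cvgrPdist_lt => e e0.
have [eE e1] := gt0_realC e0.
have [d d0 hd] := key _ e1.
near=> z; rewrite eE normC_md ltcR mdBC.
have zn : z != 0 by near: z; exact: nbhs_dnbhs_neq.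
rewrite /= scaler1; apply: hd => //.
have : `|z : C| < d%:C by near: z; apply: dnbhs0_lt; rewrite ltcR.
by rewrite normC_md ltcR.
Unshelve. all: by end_near. Qed.

(** ** Cusp forms for rho_L as vector-valued functions on a model of the discriminant form *)

Definition jw (tau : C) : C := e2pi_rat R (- (1 / 8)) * sqrtc tau ^+ 5.

Lemma md_e2pi_rat q : md (e2pi_rat R q) = 1.
Proof. exact: md_e2pi_real. Qed.

Lemma md_jw tau : md (jw tau) ^+ 2 = md tau ^+ 5.
Proof.
rewrite /jw mdM md_e2pi_rat mul1r mdX -exprM mulnC exprM; congr (_ ^+ _).
by rewrite -mdX sqr_sqrtc.
Qed.

Lemma e2pi_rat_cong (q : rat) (e : nat) : q - e%:R / 144%:R \is a Num.int -> e2pi_rat R q = e2pi (e%:R / 144%:R).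
Proof.
move=> /intrP [z qz]; rewrite /e2pi_rat; have -> : q = e%:R / 144%:R + z%:~R by rewrite -qz addrC subrK.
by rewrite rmorphD fmorph_div !rmorph_nat rmorph_int rmorphD fmorph_div !rmorph_nat rmorph_int e2piD e2pi_int mulr1.
Qed.

Section OneModel.
Variables (G : 'M[int]_3) (X : finType) (K : X -> X -> C) (Q : X -> nat) (psi : X -> disc G).
Hypothesis psi_bij : bijective psi.
Hypothesis psi_q : forall x, qval (psi x) - (Q x)%:R / 144%:R \is a Num.int.
Hypothesis psi_K : forall x y, e2pi_rat R (- bform G (disc_rep (psi y)) (disc_rep (psi x))) / (Num.sqrt #|disc G|%:R)%:C = K x y.

Let phi_ex : exists phi : disc G -> X, cancel psi phi /\ cancel phi psi.
Proof. by case: psi_bij => f; exists f. Qed.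
Let phi : disc G -> X := projT1 (cid phi_ex).
Let psiK : cancel psi phi. Proof. by rewrite /phi; case: cid => f []. Qed.
Let phiK : cancel phi psi. Proof. by rewrite /phi; case: cid => f []. Qed.

Definition pull (h : C -> group_space R G) (x : X) (t : C) := h t (psi x).

Let ee g := Q (phi g).
Let eeP g : qval g - (ee g)%:R / 144%:R \is a Num.int.
Proof. by rewrite /ee -{1}(phiK g) psi_q. Qed.

Lemma weilS_pull (v : group_space R G) x : weilS v (psi x) = e2pi_rat R (- (1 / 8)) * \sum_y K x y * v (psi y).
Proof.
rewrite /weilS ffunE -mulrA; congr (_ * _); rewrite mulr_sumr (reindex psi) /=; last exact: onW_bij.
by apply: eq_bigr => y _; rewrite -psi_K mulrA [_^-1 * _]mulrC.
Qed.

Lemma cusp_pull h : cusp_form h -> (forall x, sq (pull h x) (qm (Q x)) (Q x)) /\ xlaw jw K (pull h).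
Proof.
move=> [_ _ _ hS [c hc]]; split=> [x|x t t0].
  apply: (sq_qm (m := 1)) => //; have [h1 v1] := expansion_hasq eeP (psi x) hc.
  exists (qcoef ee c (psi x)); split=> // k; rewrite /qcoef /ee psiK; case: ifP => [/eqP -> //|_]; by rewrite eqxx.
by rewrite /pull hS // ffunE weilS_pull /jw; ring.
Qed.

Lemma pull_expansion h (a : X -> nat -> C) : (forall x, hasq (pull h x) (a x)) -> (forall x, a x 0%N = 0) ->
  (forall x k, a x k != 0 -> k = Q x %[mod 144]) -> exists c, q_expansion h c.
Proof.
move=> ha a0 ra; exists (fun g => coef_at (a (phi g))); apply: (hasq_expansion eeP) => [g|g|g k].
- by have := ha (phi g); rewrite /pull phiK.
- exact: a0.
- exact: ra.
Qed.

(** Holomorphy and the expansion come from the power series and the T-law from the residues of the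
    exponents, so only the S-law remains as a genuine condition. *)
Lemma pull_cusp h : (forall tau : C, Im tau <= 0 -> h tau = [ffun=> 0]) ->
  (forall x, sq (pull h x) (qm (Q x)) (Q x)) -> xlaw jw K (pull h) -> cusp_form h.
Proof.
move=> off hq hS; have /(_ _)/cid ha := hq; pose a x := projT1 (ha x).
have [h1 h2 h3] : [/\ forall x, hasq (pull h x) (a x), forall x, vge (qm (Q x)) (a x) & forall x k, a x k != 0 -> k = Q x %[mod 144]].
  by split=> x; rewrite /a; case: (ha x) => b [].
split=> //.
- move=> g tau t0; have := h1 (phi g); rewrite /pull phiK => hh; exact: (hasq_derivable hh t0).
- move=> tau t0; apply/ffunP => g; rewrite ffunE -{1 2 3}(phiK g) (e2pi_rat_cong (psi_q _)).
  exact: (sq_T (hq (phi g)) t0).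
- move=> tau t0; apply/ffunP => g; rewrite ffunE -(phiK g) weilS_pull.
  by have := hS (phi g) tau t0; rewrite /pull /jw => ->; ring.
- apply: (pull_expansion h1) => // x; apply: h2; exact: qm_gt0.
Qed.

Definition push (f : X -> C -> C) (t : C) : group_space R G := [ffun g => if 0 < Im t then f (phi g) t else 0].

Lemma pull_push f x t : 0 < Im t -> pull (push f) x t = f x t.
Proof. by move=> t0; rewrite /pull /push ffunE psiK t0. Qed.

Lemma push_cusp f : (forall x, sq (f x) (qm (Q x)) (Q x)) -> xlaw jw K f -> cusp_form (push f).
Proof.
move=> fq fs; apply: pull_cusp.
- by move=> t t0; apply/ffunP => g; rewrite !ffunE ltNge t0.
- by move=> x; apply: sq_ext (fq x) => t t0; rewrite pull_push.
- move=> x t t0; rewrite pull_push ?Im_invN_gt0 // fs //; congr (_ * _); apply: eq_bigr => y _.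
  by rewrite pull_push.
Qed.

Lemma pull_fourier h (a : X -> nat -> C) : (forall x, hasq (pull h x) (a x)) -> (exists c, q_expansion h c) ->
  forall x (k : nat), fourier_coef h (psi x) (k%:R / 144%:R) = if (k == Q x %[mod 144])%N then a x k else 0.
Proof.
move=> ha hc x k; have := @cusp_coef _ ee eeP h (fun g => a (phi g)) hc _ (psi x) k.
rewrite /ee psiK; apply=> g; by have := ha (phi g); rewrite /pull phiK.
Qed.

Lemma cusp_ext h h' : cusp_form h -> cusp_form h' -> (forall x t, 0 < Im t -> pull h x t = pull h' x t) -> h = h'.
Proof.
move=> hc hc' e; apply: funext => t; have [t0|t0] := ltP 0 (Im t); last by rewrite (cf_off hc) // (cf_off hc').
by apply/ffunP => g; rewrite -(phiK g); exact: e.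
Qed.

Lemma sum_psi (V : nmodType) (F : disc G -> V) (P : pred (disc G)) : \sum_(g | P g) F g = \sum_(x | P (psi x)) F (psi x).
Proof. by rewrite (reindex psi) //=; exact: onW_bij. Qed.

Lemma qval_psi x (k : nat) : (qval (psi x) - k%:R / 144%:R \is a Num.int) = (k == Q x %[mod 144])%N.
Proof.
have := @qval_cong _ ee eeP (psi x) k; rewrite /ee psiK => <-.
by rewrite -rpredN opprB.
Qed.

End OneModel.

End CuspForms.

(** * Convergence and definiteness of the Petersson product *)

Section Petersson.
Variable R : realType.
Local Notation C := R[i].
Local Notation md := (@md R).
Local Notation PS := (@PS R).
Local Notation Re := complex.Re.
Local Notation Im := complex.Im.
Local Notation wq := (@wq R).
Local Notation leb := (@lebesgue_measure R).
Local Notation mu := (leb \x leb)%E.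
Local Notation FD := (@fundamental_domain R).
Local Notation RR := (measurableTypeR R * measurableTypeR R)%type.

Definition cmeas (D : set RR) (f : RR -> C) :=
  measurable_fun D (fun z => Re (f z) : measurableTypeR R) /\ measurable_fun D (fun z => Im (f z) : measurableTypeR R).

Lemma cmeasD D f g : cmeas D f -> cmeas D g -> cmeas D (fun z => f z + g z).
Proof.
move=> [f1 f2] [g1 g2]; split.
  by under eq_fun do rewrite cReD; exact: measurable_funD.
by under eq_fun do rewrite cImD; exact: measurable_funD.
Qed.

Lemma cmeasM D f g : cmeas D f -> cmeas D g -> cmeas D (fun z => f z * g z).
Proof.
move=> [f1 f2] [g1 g2]; split.
  by under eq_fun do rewrite cReM; apply: measurable_funB; exact: measurable_funM.
by under eq_fun do rewrite cImM; apply: measurable_funD; exact: measurable_funM.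
Qed.

Lemma cmeas_cst D c : cmeas D (fun=> c).
Proof. by split; exact: measurable_cst. Qed.

Lemma cmeas_sum (I : Type) (r : seq I) D (f : I -> RR -> C) : (forall i, cmeas D (f i)) -> cmeas D (fun z => \sum_(i <- r) f i z).
Proof.
move=> h; elim: r => [|i r IH].
  by have -> : (fun z => \sum_(i <- [::]) f i z) = (fun=> 0) by apply: funext => z; rewrite big_nil.
have -> : (fun z => \sum_(j <- i :: r) f j z) = (fun z => f i z + \sum_(j <- r) f j z) by apply: funext => z; rewrite big_cons.
exact: cmeasD.
Qed.

Lemma cmeasX D f n : cmeas D f -> cmeas D (fun z => f z ^+ n).
Proof.
move=> h; elim: n => [|n IH]; first by under eq_fun do rewrite expr0; exact: cmeas_cst.
by under eq_fun do rewrite exprS; exact: cmeasM.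
Qed.

Lemma cmeas_conj D f : cmeas D f -> cmeas D (fun z => conjc (f z)).
Proof.
move=> [f1 f2]; split.
  by have -> : (fun z => Re (conjc (f z))) = (fun z => Re (f z)) by apply: funext => z; case: (f z).
have -> : (fun z => Im (conjc (f z))) = (fun z => - Im (f z)) by apply: funext => z; case: (f z).
exact: measurableT_comp.
Qed.

Lemma cmeas_lim D (u : nat -> RR -> C) f : (forall n, cmeas D (u n)) -> (forall z, D z -> ctends (fun n => u n z) (f z)) -> cmeas D f.
Proof.
move=> hu h.
have key (p : C -> R) : (forall x y, p (x - y) = p x - p y) -> (forall x, `|p x| <= md x) -> forall z, D z -> (fun n => p (u n z)) @ \oo --> p (f z).
  move=> pB pm z Dz; apply/cvgrPdist_lt => e e0; have [N hN] := h z Dz e e0; exists N => // n Nn.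
  by rewrite distrC -pB; apply: le_lt_trans (pm _) _; exact: hN.
split.
  apply: (measurable_fun_cvg (h := fun n z => Re (u n z))) => [n|]; first by have [] := hu n.
  by apply: key => [x y|x]; [rewrite cReD cReN|exact: md_Re].
apply: (measurable_fun_cvg (h := fun n z => Im (u n z))) => [n|]; first by have [] := hu n.
by apply: key => [x y|x]; [rewrite cImD cImN|exact: md_Im].
Qed.

Transparent e2pi.
Lemma cmeas_wq D : measurable D -> cmeas D (fun z => wq (z.1 +i* z.2)).
Proof.
move=> mD.
have E z : wq (z.1 +i* z.2) = (expR (- (2 * pi / 144%:R) * z.2))%:C * (cos ((2 * pi / 144%:R) * z.1) +i* sin ((2 * pi / 144%:R) * z.1)).
  rewrite /wq /e2pi Re_divn Im_divn /=; congr ((expR _)%:C * (cos _ +i* sin _)); by field.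
pose W (z : RR) : C := (expR (- (2 * pi / 144%:R) * z.2))%:C * (cos ((2 * pi / 144%:R) * z.1) +i* sin ((2 * pi / 144%:R) * z.1)).
have -> : (fun z : RR => wq (z.1 +i* z.2)) = W by apply: funext => z; exact: E.
have lin (c : R) (p : RR -> measurableTypeR R) : measurable_fun setT p -> measurable_fun D (fun z => c * p z).
  by move=> mp; apply: measurable_funTS; apply: measurable_funM => //; exact: measurable_cst.
apply: cmeasM; split => /=.
- by apply: measurableT_comp (lin _ _ measurable_snd); exact: measurable_expR.
- exact: measurable_cst.
- by apply: measurableT_comp (lin _ _ measurable_fst); exact: continuous_measurable_fun (@continuous_cos R).
- by apply: measurableT_comp (lin _ _ measurable_fst); exact: continuous_measurable_fun (@continuous_sin R).
Qed.
Opaque e2pi.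

Lemma meas_bool (b : RR -> bool) : measurable_fun setT b -> measurable [set z | b z].
Proof.
move=> mb; have h := mb measurableT [set true]; rewrite setTI in h; have {h} : measurable (b @^-1` [set true]) by exact: h.
by congr measurable; apply/seteqP; split => z /=.
Qed.

Lemma measurable_FD : measurable (FD : set RR).
Proof.
have m1 := @measurable_fst _ _ (measurableTypeR R) (measurableTypeR R).
have m2 := @measurable_snd _ _ (measurableTypeR R) (measurableTypeR R).
have -> : (FD : set RR) = [set z : RR | 0 < z.2] `&` ([set z : RR | `|z.1| <= 1 / 2] `&` [set z : RR | 1 <= z.1 * z.1 + z.2 * z.2]).
  by apply/seteqP; split => z /=; rewrite -!expr2; [case|move=> [? [? ?]]].
apply: measurableI; [|apply: measurableI]; apply: meas_bool.
- by apply: measurable_fun_ltr => //; exact: measurable_cst.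
- by apply: measurable_fun_ler; [exact: measurableT_comp|exact: measurable_cst].
- by apply: measurable_fun_ler; [exact: measurable_cst|apply: measurable_funD; exact: measurable_funM].
Qed.

Lemma FD_half z : FD z -> [/\ 0 < z.2, 1 / 2 <= z.2 & `|z.1| <= 1 / 2].
Proof.
move=> [z2 z1 zz]; split=> //; rewrite leNgt; apply/negP => h.
have : z.1 ^+ 2 <= (1 / 2) ^+ 2 by rewrite -real_normK ?num_real // lerXn2r ?nnegrE ?normr_ge0 //; lra.
have : z.2 ^+ 2 <= (1 / 2) ^+ 2 by rewrite lerXn2r ?nnegrE //; lra.
move: zz; rewrite !expr2; lra.
Qed.

Lemma cmeas_hasq f a : hasq f a -> cmeas FD (fun z => f (z.1 +i* z.2)).
Proof.
move=> [ga fa]; apply: (cmeas_lim (u := fun n z => \sum_(k < n) a k * wq (z.1 +i* z.2) ^+ k)) => [n|z zF].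
  by apply: cmeas_sum => k; apply: cmeasM; [exact: cmeas_cst|apply: cmeasX; apply: cmeas_wq; exact: measurable_FD].
have [z2 _ _] := FD_half zF; rewrite fa //; exact: PS_tends ga (@md_wq_lt1 _ (z.1 +i* z.2) z2).
Qed.

Lemma sqo_bound f : sqo f 1 -> exists2 M : R, 0 <= M & forall t, 1 / 2 <= Im t -> md (f t) <= M * md (wq t).
Proof.
move=> [a [ga fa] va]; have [gs sE] := PS_shift ga va.
pose rho := expR (- (2 * pi * (1 / 2 / 144%:R))) : R.
have p0 := pi_gt0 R.
have r01 : 0 <= rho < 1 by rewrite expR_ge0 expR_lt1 oppr_lt0 !mulr_gt0.
have [M M0 hM] := PS_bdd gs r01; exists M => [|t t1]; first exact: ltW.
have t0 : 0 < Im t by lra.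
rewrite fa // sE ?md_wq_lt1 // expr1 mdM mulrC ler_wpM2r ?md_ge0 //; apply: hM.
rewrite md_wq /rho ler_expR lerN2; apply: ler_wpM2l; first by rewrite mulr_ge0 // ltW.
by rewrite ler_pM2r // invr_gt0.
Qed.

Definition ystrip : R := 2 * pi / 144%:R.

Lemma ystrip_gt0 : 0 < ystrip.
Proof. by rewrite /ystrip divr_gt0 ?mulr_gt0 ?pi_gt0. Qed.

(** A dominating function that is a product: an indicator in x and the density of an exponential law
    in y, whose integral is known. Its rate is that of the decay of |w|. *)
Definition pbound (z : RR) : R := \1_(`[- (1 / 2), 1 / 2] : set R) z.1 * exponential_pdf ystrip z.2.

Lemma pbound_integrable K : 0 <= K -> mu.-integrable FD (fun z => (K * pbound z)%:E).
Proof.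
move=> K0; apply: (@integrableS _ _ _ _ setT) => //; first exact: measurable_FD.
have s0 := ystrip_gt0.
have mp : measurable_fun setT (fun z : RR => (K * pbound z)%:E).
  apply/measurable_EFinP; apply: measurable_funM; first exact: measurable_cst.
  apply: measurable_funM.
    by apply: measurableT_comp measurable_fst; apply: measurable_indic; exact: measurable_itv.
  by apply: measurableT_comp measurable_snd; exact: measurable_exponential_pdf.
have p0 (z : RR) : 0 <= K * pbound z.
  by rewrite !mulr_ge0 // ?exponential_pdf_ge0 // ltW.
apply/integrableP; split=> //.
under eq_integral do rewrite gee0_abs ?lee_fin //.
rewrite fubini_tonelli1 //.
have inner x : fubini_F leb (fun z : RR => (K * pbound z)%:E) x = (K * \1_(`[- (1 / 2), 1 / 2] : set R) x)%:E.
  rewrite /fubini_F /pbound /=.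
  under eq_integral do rewrite mulrA EFinM.
  rewrite ge0_integralZl_EFin //= ?mulr_ge0 //.
  - by rewrite integral_exponential_pdf // mule1.
  - by move=> y _; rewrite lee_fin exponential_pdf_ge0 // ltW.
  - by apply/measurable_EFinP; exact: measurable_exponential_pdf.
under eq_integral do rewrite inner EFinM.
rewrite ge0_integralZl_EFin //=.
- rewrite integral_indic //= setIT lebesgue_measure_itv /= lte_fin; case: ifP => _; by rewrite -?EFinB ?EFinM ?ltry.
- by apply/measurable_EFinP; apply: measurable_indic; exact: measurable_itv.
Qed.

Definition pint (G : 'M[int]_3) (f h : C -> group_space R G) (z : RR) : C :=
  (\sum_g f (z.1 +i* z.2) g * conjc (h (z.1 +i* z.2) g)) * (z.2 `^ (5 / 2) / z.2 ^+ 2)%:C.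

Lemma peterssonE G (f h : C -> group_space R G) : petersson f h =
  (\int[mu]_(z in FD) Re (pint f h z)) +i* (\int[mu]_(z in FD) Im (pint f h z)).
Proof. by []. Qed.

Lemma hasq_neq0_near f a (t0 : C) : hasq f a -> 0 < Im t0 -> f t0 != 0 ->
  exists2 d : R, 0 < d & forall t, md (t - t0) < d -> f t != 0.
Proof.
move=> fa i0 f0; have /derivable1_diffP/differentiable_continuous fc := hasq_derivable fa i0.
have /cvgrPdist_lt h := fc; have e0 : 0 < `|f t0| by rewrite normr_gt0.
have /nbhs_ballP [e /= e1 he] := h _ e0; have [eE e2] := gt0_realC e1.
exists (Re e) => // t tt; have : `|f t0 - f t| < `|f t0|.
  by apply: he; rewrite /ball /= eE normC_md ltcR mdBC.
by apply: contraTneq => ->; rewrite subr0 ltxx.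
Qed.

(** Quasi-periodicity extends the vanishing to all of Im > 1, that is to a punctured disc around w =
    0; order at least 1 supplies the centre, and all coefficients vanish. *)
Lemma sq_zero_above (f : C -> C) e : sq f 1 e ->
  (forall t, 1 < Im t -> - (1 / 2) <= Re t -> Re t < 1 / 2 -> f t = 0) -> hzero f.
Proof.
move=> hf z; have [a [ha va _]] := hf.
have z1 t : 1 < Im t -> f t = 0.
  move=> t1; have t0 : 0 < Im t by lra.
  have [|u [iu r1 r2] <-] := strip_shift (P := fun t => f t = 0) _ t0; last by apply: z; rewrite ?iu.
  move=> s s0; rewrite (sq_T hf s0); split=> [/eqP|->]; last by rewrite mulr0.
  by rewrite mulf_eq0 -md_eq0 md_e2pi_frac oner_eq0 => /eqP.
have d0 : 0 < expR (- (2 * pi / 144%:R)) :> R by exact: expR_gt0.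
have [ga fa] := ha; have a0 := PS_coef0 ga d0; move=> t t0.
rewrite fa //; have {}a0 : a = fun=> 0.
  apply: funext; apply: a0 => w w1 wd; have [->|wn] := eqVneq w 0; first by rewrite PS0 va.
  have [u u0 uw] := wq_surj wn w1; rewrite -uw -fa // z1 //.
  move: wd; rewrite -uw md_wq ltr_expR ltrN2 mulrA ltr_pM2r ?invr_gt0 ?ltr0n // ltr_pMr //.
  by rewrite mulr_gt0 ?pi_gt0.
by rewrite a0 -(zero_hasq R).2.
Qed.

Section Regular.
Variable G : 'M[int]_3.
Definition hreg (h : C -> group_space R G) := forall g, exists e, sq (fun t => h t g) 1 e.

Lemma cmeas_pint f h : hreg f -> hreg h -> cmeas FD (pint f h).
Proof.
move=> hf hh; apply: cmeasM.
  apply: cmeas_sum => g; have [_ [a [ha _ _]]] := hf g; have [_ [b [hb _ _]]] := hh g.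
  by apply: cmeasM; [exact: cmeas_hasq ha|apply: cmeas_conj; exact: cmeas_hasq hb].
split=> /=; last exact: measurable_cst.
apply: (eq_measurable_fun (fun z : RR => z.2 `^ (1 / 2))).
  move=> z; rewrite inE => /FD_half[z0 _ _].
  rewrite -powR_mulrn ?(ltW z0) //; apply: (mulIf (x := z.2 `^ 2)); first by rewrite gt_eqF // powR_gt0.
  by rewrite mulfVK ?gt_eqF ?powR_gt0 // -powRD ?gt_eqF ?implybT //; congr (_ `^ _); field.
by apply: measurable_funTS; exact: (measurableT_comp (measurable_powR _) measurable_snd).
Qed.

(** The product of two cusp forms decays like |w|^2, that is like exp(-2 ystrip y). One of the two
    factors is spent on the power of y, the other is left for [pbound]. *)
Lemma pow_bound (y : R) : 1 / 2 <= y -> 0 <= y `^ (5 / 2) / y ^+ 2 /\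
  y `^ (5 / 2) / y ^+ 2 <= 4 * (3 / ystrip) ^+ 3 * expR (ystrip * y).
Proof.
move=> y1; have s0 := ystrip_gt0; have y0 : 0 < y by lra.
split; first by rewrite divr_ge0 ?powR_ge0 ?exprn_ge0 // ltW.
have h1 : y `^ (5 / 2) <= (1 + y) ^+ 3.
  apply: (@le_trans _ _ ((1 + y) `^ (5 / 2))).
    by rewrite ge0_ler_powR ?nnegrE //; lra.
  by rewrite -powR_mulrn ?ler_powR; lra.
have s1 : ystrip <= 3 by have := @pihalf_lt2 R; rewrite /ystrip; lra.
have h2 : 1 + y <= 3 / ystrip * expR (ystrip * y / 3).
  rewrite mulrAC ler_pdivlMr //; have := @expR_ge1Dx R (ystrip * y / 3).
  nra.
have h3 : (1 + y) ^+ 3 <= (3 / ystrip) ^+ 3 * expR (ystrip * y).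
  have -> : expR (ystrip * y) = expR (ystrip * y / 3) ^+ 3 by rewrite -expRM_natl; congr expR; field.
  have k0 : 0 <= 3 / ystrip * expR (ystrip * y / 3) by rewrite !mulr_ge0 ?invr_ge0 ?expR_ge0 // ltW.
  by rewrite -exprMn lerXn2r ?nnegrE //; lra.
rewrite ler_pdivrMr ?exprn_gt0 //; apply: le_trans h1 _; apply: le_trans h3 _.
have a0 : 0 <= (3 / ystrip) ^+ 3 * expR (ystrip * y) by rewrite mulr_ge0 ?expR_ge0 // exprn_ge0 // divr_ge0 // ltW.
have : 1 / 4 <= y ^+ 2 by rewrite expr2; nra.
have -> : 4 * (3 / ystrip) ^+ 3 * expR (ystrip * y) * y ^+ 2 = (3 / ystrip) ^+ 3 * expR (ystrip * y) * (4 * y ^+ 2) by ring.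
move=> y2; rewrite ler_peMr //; lra.
Qed.

Lemma pint_bound f h : hreg f -> hreg h -> exists2 K : R, 0 <= K & forall z, FD z -> md (pint f h z) <= K * pbound z.
Proof.
move=> hf hh; have s0 := ystrip_gt0.
have bnd k : hreg k -> forall g, exists2 M : R, 0 <= M & forall t, 1 / 2 <= Im t -> md (k t g) <= M * md (wq t).
  by move=> hk g; have [e he] := hk g; exact: sqo_bound (sq_sqo he).
have /(_ _)/cid2 bf := bnd f hf; have /(_ _)/cid2 bh := bnd h hh.
pose Mf g := projT1 (bf g); pose Mh g := projT1 (bh g).
have Mf0 g : 0 <= Mf g by rewrite /Mf; case: (bf g).
have Mh0 g : 0 <= Mh g by rewrite /Mh; case: (bh g).
pose S := \sum_g Mf g * Mh g; have S0 : 0 <= S by apply: sumr_ge0 => g _; rewrite mulr_ge0.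
pose A := 4 * (3 / ystrip) ^+ 3.
have A0 : 0 <= A by rewrite mulr_ge0 // exprn_ge0 // divr_ge0 // ltW.
exists (S * A / ystrip) => [|z zF]; first by rewrite !mulr_ge0 ?invr_ge0 // ltW.
have [z0 z2 z1] := FD_half zF.
rewrite /pbound exponential_pdfE ?(ltW z0) // indicE mem_set ?mul1r; last first.
  by have : z.1 \in `[- 2^-1, 2^-1] by rewrite in_itv /= -ler_norml -[2^-1]div1r.
have -> : S * A / ystrip * (ystrip * expR (- ystrip * z.2)) = S * A * expR (- ystrip * z.2).
  by field; rewrite gt_eqF.
have [p0 p1] := pow_bound z2.
rewrite /pint mdM md_real ger0_norm //.
have b1 : md (\sum_g f (z.1 +i* z.2) g * conjc (h (z.1 +i* z.2) g)) <= S * md (wq (z.1 +i* z.2)) ^+ 2.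
  apply: le_trans (md_sum _ _ _) _; rewrite mulr_suml; apply: ler_sum => g _.
  rewrite mdM md_conj; have -> : Mf g * Mh g * md (wq (z.1 +i* z.2)) ^+ 2 = (Mf g * md (wq (z.1 +i* z.2))) * (Mh g * md (wq (z.1 +i* z.2))) by ring.
  by apply: ler_pM; rewrite ?md_ge0 // /Mf /Mh; [case: (bf g) => M /= _|case: (bh g) => M /= _]; apply.
apply: le_trans (ler_pM (md_ge0 _) p0 b1 p1) _; rewrite -/A.
have -> : md (wq (z.1 +i* z.2)) ^+ 2 = expR (- ystrip * z.2) * expR (- ystrip * z.2).
  by rewrite md_wq /= expr2; congr (expR _ * expR _); rewrite /ystrip; field.
have e1 : expR (- ystrip * z.2) * expR (ystrip * z.2) = 1 by rewrite -expRD mulNr addNr expR0.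
rewrite le_eqVlt; apply/orP; left; apply/eqP.
transitivity (S * A * expR (- ystrip * z.2) * (expR (- ystrip * z.2) * expR (ystrip * z.2))); first by ring.
by rewrite e1 mulr1.
Qed.

Lemma pint_integrable f h : hreg f -> hreg h ->
  mu.-integrable FD (EFin \o (fun z => Re (pint f h z))) /\ mu.-integrable FD (EFin \o (fun z => Im (pint f h z))).
Proof.
move=> hf hh; have [K K0 hK] := pint_bound hf hh; have [m1 m2] := cmeas_pint hf hh.
have pb z : FD z -> 0 <= K * pbound z by move=> /hK; apply: le_trans; exact: md_ge0.
have key (p : C -> R) : (forall x, `|p x| <= md x) -> measurable_fun FD (fun z : RR => p (pint f h z) : measurableTypeR R) ->
    mu.-integrable FD (EFin \o (fun z => p (pint f h z))).
  move=> pm mp; apply: (le_integrable _ _ _ (pbound_integrable K0)); first exact: measurable_FD.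
    exact/measurable_EFinP.
  move=> z zF /=; rewrite lee_fin (ger0_norm (pb z zF)).
  exact: le_trans (pm _) (hK z zF).
split; apply: key => //; [exact: md_Re|exact: md_Im].
Qed.

Lemma pint_diag (h : C -> group_space R G) z : pint h h z = ((\sum_g md (h (z.1 +i* z.2) g) ^+ 2) * (z.2 `^ (5 / 2) / z.2 ^+ 2))%:C.
Proof. rewrite /pint; under eq_bigr do rewrite mulcJ.
by rewrite -(rmorph_sum (real_complex R)) -rmorphM. Qed.

Lemma pint_diag_ge0 (h : C -> group_space R G) z : 0 <= Re (pint h h z).
Proof.
by rewrite pint_diag /= mulr_ge0 ?divr_ge0 ?powR_ge0 ?exprn_even_ge0 // sumr_ge0 // => g _; rewrite exprn_ge0 ?md_ge0.
Qed.

Lemma petersson_diag (h : C -> group_space R G) : exists2 N : R, petersson h h = N%:C & 0 <= N.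
Proof.
exists (\int[mu]_(z in FD) Re (pint h h z)); last by apply: Rintegral_ge0 => z _; exact: pint_diag_ge0.
rewrite peterssonE; apply: complex_eqP => //=.
have -> : (fun z : RR => Im (pint h h z)) = (fun=> 0) by apply: funext => z; rewrite pint_diag.
by rewrite /Rintegral integral0.
Qed.

(** A vanishing integral of a nonnegative function makes it zero almost everywhere. If h is nonzero
    at a point above height 1, continuity makes the integrand positive on a small square, whose
    measure is positive. *)
Lemma petersson_definite h : hreg h -> petersson h h = 0 -> forall g, hzero (fun t => h t g).
Proof.
move=> hh h0 g0; have [e he] := hh g0; apply: (sq_zero_above he) => t t1 tl tr; apply/eqP; apply: contraT => hn.
have [a [ha _ _]] := he; have t0 : 0 < Im t by lra.
have [d d0 hd] := hasq_neq0_near ha t0 hn.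
have [i1 _] := pint_integrable hh hh; have [m1 _] := cmeas_pint hh hh.
have I0 : (\int[mu]_(z in FD) (Re (pint h h z))%:E = 0)%E.
  have : \int[mu]_(z in FD) Re (pint h h z) = 0 by move: h0; rewrite peterssonE => -[].
  by rewrite /Rintegral => e0; rewrite -(fineK (integrable_fin_num measurable_FD i1)) e0.
have [N [mN N0 hN]] : ae_eq mu FD (EFin \o (fun z => Re (pint h h z))) (cst 0%E).
  apply/(ae_eq_integral_abs _ measurable_FD); first exact/measurable_EFinP.
  by rewrite -[RHS]I0; apply: eq_integral => z _ /=; rewrite ger0_norm // pint_diag_ge0.
(* The square extends upwards and to the right of t; the second bound keeps it inside |x| <= 1/2,
   and the half-open strip makes it positive. *)
pose r := Num.min (d / 2) (1 / 2 - Re t).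
have r0 : 0 < r by rewrite /r lt_min; apply/andP; split; lra.
have [rd rt] : r <= d / 2 /\ r <= 1 / 2 - Re t by rewrite /r !ge_min !lexx orbT.
pose A : set (measurableTypeR R) := `[Re t, Re t + r]%classic.
pose B : set (measurableTypeR R) := `[Im t, Im t + r]%classic.
have mA : measurable A by exact: measurable_itv.
have mB : measurable B by exact: measurable_itv.
have sub : A `*` B `<=` N.
  move=> z [/=]; rewrite /A /B /=; move=> zA zB; apply: hN => /=; move: zA zB.
  rewrite !in_itv /= => /andP[x1 x2] /andP[y1 y2].
  have zF : FD z.
    split; [exact: lt_le_trans t0 y1|by rewrite ler_norml (le_trans tl x1) (le_trans x2) // -lerBrDl|].
    by rewrite ler_wpDl ?sqr_ge0 // exprn_ege1 // (le_trans (ltW t1)).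
  move=> /(_ zF) [/eqP]; apply/negP; rewrite gt_eqF // pint_diag /=.
  have z0 : 0 < z.2 by lra.
  apply: mulr_gt0; last by rewrite divr_gt0 ?powR_gt0 ?exprn_gt0.
  rewrite (bigD1 g0) //=; apply: ltr_wpDr; first by apply: sumr_ge0 => g _; rewrite exprn_ge0 ?md_ge0.
  rewrite exprn_gt0 // md_gt0; apply: hd.
  have : md (z.1 +i* z.2 - t) ^+ 2 < d ^+ 2.
    rewrite md_sqr cReD cReN cImD cImN /= !expr2; nra.
  by rewrite ltr_pXn2r ?nnegrE ?md_ge0 // ltW.
have AB0 : (leb A * leb B = 0)%E.
  apply: etrans (esym (product_measure1E leb leb mA mB)) _.
  exact: subset_measure0 (measurableX mA mB) mN sub N0.
have leb_itv x : leb (`[x, x + r]%classic : set R) = r%:E.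
  by rewrite lebesgue_measure_itv /= lte_fin ltrDl r0 -EFinB addrC addKr.
by move: AB0; rewrite !leb_itv -EFinM => -[/eqP]; rewrite mulf_eq0 orbb gt_eqF.
Qed.

Lemma petersson_subr f h h' : hreg f -> hreg h -> hreg h' ->
  petersson f (fun t => h t - h' t) = petersson f h - petersson f h'.
Proof.
move=> hf hh hh'; have [i1 i2] := pint_integrable hf hh; have [j1 j2] := pint_integrable hf hh'.
have E z : pint f (fun t => h t - h' t) z = pint f h z - pint f h' z.
  rewrite /pint -mulrBl -sumrB; congr (_ * _); apply: eq_bigr => g _; by rewrite !ffunE rmorphB mulrBr.
rewrite !peterssonE; apply: complex_eqP.
  rewrite /= -RintegralB //; last exact: measurable_FD.
  by congr (Rintegral _ _ _); apply: funext => z; rewrite E cReD cReN.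
rewrite /= -RintegralB //; last exact: measurable_FD.
by congr (Rintegral _ _ _); apply: funext => z; rewrite E cImD cImN.
Qed.

(** Only the integrands are compared, so h and f need not themselves be known to be regular or to
    satisfy a pointwise identity. *)
Lemma petersson_scale c (f h f' h' : C -> group_space R G) : hreg f' -> hreg h' ->
  (forall z, FD z -> pint f h z = c * pint f' h' z) -> petersson f h = c * petersson f' h'.
Proof.
move=> hf hh E; have [i1 i2] := pint_integrable hf hh; have mF := measurable_FD.
rewrite !peterssonE; apply: complex_eqP.
  rewrite cReM /= -!RintegralZl // -RintegralB //; try exact: (integrableZl mF _ i1); try exact: (integrableZl mF _ i2).
  by apply: eq_Rintegral => z; rewrite inE => zF; rewrite E // cReM.
rewrite cImM /= -!RintegralZl // -RintegralD //; try exact: (integrableZl mF _ i1); try exact: (integrableZl mF _ i2).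
by apply: eq_Rintegral => z; rewrite inE => zF; rewrite E // cImM.
Qed.

End Regular.

End Petersson.

(** * Shadows, the invariant form on the module of order 72, and its menu *)

Section Shadows.
Variable R : realType.
Local Notation C := R[i].
Local Notation md := (@md R).
Local Notation PS := (@PS R).
Local Notation Re := complex.Re.
Local Notation Im := complex.Im.
Local Notation wq := (@wq R).
Local Notation jb := (@jb R).
Local Notation jw := (@jw R).
Local Notation zero_form G := ((fun=> [ffun=> 0]) : C -> group_space R G).

Lemma card_isoms_neq0 (X : finType) (K : X -> X -> C) (Q : X -> nat) : #|isoms K Q|%:R != 0 :> C.
Proof. by rewrite pnatr_eq0 -lt0n; apply/card_gt0P; exists 1%g; exact: (group1 (Group (isoms_group K Q))). Qed.

Lemma menu_ge0 G m : menu G m -> 0 <= m.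
Proof.
move=> [v [_ n0 _] ->]; apply: divr_ge0; first by rewrite ler0z ltW.
by rewrite mulr_ge0 // sqr_ge0.
Qed.

Section OneModel.
Variables (G : 'M[int]_3) (X : finType) (K : X -> X -> C) (Q : X -> nat) (psi : X -> disc G).
Hypothesis psi_bij : bijective psi.
Hypothesis psi_q : forall x, qval (psi x) - (Q x)%:R / 144%:R \is a Num.int.
Hypothesis psi_K : forall x y, e2pi_rat R (- bform G (disc_rep (psi y)) (disc_rep (psi x))) / (Num.sqrt #|disc G|%:R)%:C = K x y.
Local Notation pull := (pull psi).
Implicit Types h Xi : C -> group_space R G.

Let psi_pull h := cusp_pull psi_bij psi_q psi_K (h := h).

Lemma cusp_hreg h : cusp_form h -> hreg h.
Proof.
have [f psiK fK] := psi_bij; move=> hc g; have [hq _] := psi_pull hc; exists (Q (f g)).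
by have := hq (f g); rewrite /pull fK; apply: sq_le; exact: qm_gt0.
Qed.

Lemma cusp_form0 : cusp_form (zero_form G).
Proof.
apply: (pull_cusp psi_bij psi_q psi_K) => // [x|x t t0].
  by apply: (sq_ext _ (sq0 _ _ _)) => t _; rewrite /pull ffunE.
by rewrite /pull ffunE big1 ?mulr0 // => y _; rewrite ffunE mulr0.
Qed.

Lemma cusp_formB h h' : cusp_form h -> cusp_form h' -> cusp_form (fun t => h t - h' t).
Proof.
move=> hc hc'; have [h1 h2] := psi_pull hc; have [h3 h4] := psi_pull hc'.
apply: (pull_cusp psi_bij psi_q psi_K) => [t t0|x|x t t0].
- by rewrite (cf_off hc) // (cf_off hc') //; apply/ffunP => g; rewrite !ffunE subr0.
- by apply: (sq_ext _ (sqB (h1 x) (h3 x))) => t _; rewrite /pull !ffunE.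
- have := h2 x t t0; have := h4 x t t0; rewrite /pull !ffunE => -> ->.
  by rewrite -mulrBr -sumrB; congr (_ * _); apply: eq_bigr => y _; rewrite !ffunE mulrBr.
Qed.

Lemma cusp_formZ c h : cusp_form h -> cusp_form (fun t => [ffun g => c * h t g]).
Proof.
move=> hc; have [h1 h2] := psi_pull hc.
apply: (pull_cusp psi_bij psi_q psi_K) => [t t0|x|x t t0].
- by rewrite (cf_off hc) //; apply/ffunP => g; rewrite !ffunE mulr0.
- by apply: (sq_ext _ (sqZ c (h1 x))) => t _; rewrite /pull !ffunE.
- have := h2 x t t0; rewrite /pull !ffunE => ->; rewrite mulrCA; congr (_ * _).
  by rewrite mulr_sumr; apply: eq_bigr => y _; rewrite ffunE mulrCA.
Qed.

Lemma petersson0 h : cusp_form h -> petersson h (zero_form G) = 0.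
Proof.
move=> hc; rewrite -[RHS](mul0r (petersson h h)); apply: petersson_scale => [||z _]; try exact: cusp_hreg.
by rewrite /pint big1 ?mul0r // => g _; rewrite ffunE rmorph0 mulr0.
Qed.

(** The difference D is a cusp form with the same product against both shadows, namely lambda(D), so
    it is orthogonal to itself. *)
Lemma shadow_unique Xi Xi' : @is_shadow R G Xi -> is_shadow Xi' -> Xi = Xi'.
Proof.
move=> [c1 s1] [c2 s2]; have cD := cusp_formB c1 c2.
have D0 : petersson (fun t => Xi t - Xi' t) (fun t => Xi t - Xi' t) = 0.
  by rewrite petersson_subr -?s1 -?s2 ?subrr //; exact: cusp_hreg.
have z := petersson_definite (cusp_hreg cD) D0.
apply: (cusp_ext psi_bij c1 c2) => x t t0; have /eqP := z (psi x) t t0.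
by rewrite !ffunE subr_eq0 => /eqP.
Qed.

Lemma shadow_zero : (forall h, cusp_form h -> lambda h = 0) -> unique (@is_shadow R G) (zero_form G).
Proof.
move=> l0; have s0 : is_shadow (zero_form G).
  by split=> [|h hc]; [exact: cusp_form0|rewrite l0 // petersson0].
by split=> // Xi sXi; exact: shadow_unique.
Qed.

Definition menu_sum (h : C -> group_space R G) (m : rat) := \sum_(g : disc G | qval g - m \is a Num.int) fourier_coef h g m.

Lemma lambdaE h : lambda h = \sum_(m \in menu G) menu_sum h m.
Proof. by []. Qed.

Lemma menu_sum_coef h (a : X -> nat -> C) : cusp_form h -> (forall x, hasq (pull h x) (a x)) ->
  forall k : nat, menu_sum h (k%:R / 144%:R) = \sum_(x | k == Q x %[mod 144]) a x k.
Proof.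
move=> hc ha k; rewrite /menu_sum (sum_psi psi_bij); apply: eq_big => [x|x].
  by rewrite (qval_psi psi_bij psi_q).
rewrite (qval_psi psi_bij psi_q) => xk.
by rewrite (pull_fourier psi_bij psi_q ha (cf_cusp hc)) xk.
Qed.

(** A menu value contributes only if it is congruent to some q; being nonnegative, it is then k/144
    with k a natural number. *)
Lemma menu_sum_supp h m : menu_sum h m != 0 -> 0 <= m -> exists2 k : nat, m = k%:R / 144%:R & exists x, k = Q x %[mod 144].
Proof.
move=> s0 m0; have [x xm] : exists x, qval (psi x) - m \is a Num.int.
  apply/existsP; apply: contraNT s0; rewrite negb_exists => /forallP hn.
  by rewrite /menu_sum (sum_psi psi_bij) big_pred0 // => x; exact: negbTE (hn x).
have [/intrP [u e1] /intrP [v e2]] := (psi_q x, xm); pose z := u - v.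
have : m = ((Q x)%:Z + 144 * z)%:~R / 144%:R.
  by rewrite rmorphD rmorphM rmorphB /= -e1 -e2 -!pmulrn; field.
move=> mE; have : 0 <= (Q x)%:Z + 144 * z.
  by rewrite -(ler0z rat); move: m0; rewrite mE pmulr_lge0 // invr_gt0.
case kE: (_ + _) mE => [k|//] mE _; exists k; first by rewrite mE.
by exists x; apply/eqP; rewrite -eqz_nat -!modz_nat -kE -modzDmr modzMr addr0.
Qed.

Lemma cusp_coefs h : cusp_form h -> exists a, forall x, hasq (pull h x) (a x).
Proof.
by move=> hc; have [hq _] := psi_pull hc; have /(_ _)/cid ha := hq; exists (fun x => projT1 (ha x)) => x; case: (ha x) => b [].
Qed.

(** Each sum in lambda runs over all classes of given norm, a set stable under isometries, so
    reindexing shows that every term of the average contributes lambda(h). *)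
Lemma lambda_avg c h h' : cusp_form h -> cusp_form h' ->
  (forall x t, 0 < Im t -> avg K Q (pull h) x t = c * pull h' x t) ->
  #|isoms K Q|%:R * lambda h = c * lambda h'.
Proof.
move=> hc hc' e; rewrite !lambdaE !mulr_fsumr; apply: eq_fsbigr => m; rewrite inE => /menu_ge0 m0.
have [a ha] := cusp_coefs hc; have [a' ha'] := cusp_coefs hc'.
have key k : #|isoms K Q|%:R * menu_sum h (k%:R / 144%:R) = c * menu_sum h' (k%:R / 144%:R).
  rewrite (menu_sum_coef hc ha) (menu_sum_coef hc' ha') [RHS]mulr_sumr.
  have cE x : c * a' x k = \sum_(p in isoms K Q) a (p x) k.
    have h1 := hasqZ c (ha' x); have h2 := hasq_sum (index_enum {perm X}) (P := fun p => p \in isoms K Q) (fun p _ => ha (p x)).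
    by apply: (hasq_uniq h1 (hasq_ext _ h2)) => t t0; rewrite -e.
  under [RHS]eq_bigr do rewrite cE.
  rewrite [RHS]exchange_big /= -sum1_card natr_sum mulr_suml; apply: eq_bigr => p /isomsP[_ p2 _].
  rewrite mul1r (reindex_inj (@perm_inj _ p)); apply: eq_bigl => x; by rewrite p2.
have [[k -> _]|h1] := pselect (exists2 k : nat, m = k%:R / 144%:R & exists x, k = Q x %[mod 144]); first exact: key.
have z u : menu_sum u m = 0 by apply/eqP; apply: contraT => /menu_sum_supp /(_ m0).
by rewrite !z !mulr0.
Qed.

(** Against an invariant form every isometric translate of h has the same pointwise product, by
    reindexing the sum over classes. *)
Lemma petersson_avg c h h' : cusp_form h -> cusp_form h' -> sinv K Q (pull h') ->
  (forall x t, 0 < Im t -> avg K Q (pull h) x t = c * pull h' x t) ->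
  #|isoms K Q|%:R * petersson h h' = c * petersson h' h'.
Proof.
move=> hc hc' si e; have P0 := card_isoms_neq0 K Q.
apply: (mulfI (x := #|isoms K Q|%:R^-1)); first by rewrite invr_eq0.
rewrite mulKf // mulrA; apply: petersson_scale; try (exact: cusp_hreg hc); try exact: cusp_hreg hc'.
move=> z /FD_half [z0 _ _]; rewrite /pint mulrA; congr (_ * _).
apply: (mulfI P0); rewrite !mulrA mulfV // mul1r !(sum_psi psi_bij) [RHS]mulr_sumr.
have -> : \sum_x c * (h' (z.1 +i* z.2) (psi x) * conjc (h' (z.1 +i* z.2) (psi x))) =
   \sum_x avg K Q (pull h) x (z.1 +i* z.2) * conjc (h' (z.1 +i* z.2) (psi x)).
  by apply: eq_bigr => x _; rewrite e //= mulrA.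
rewrite /avg; under [RHS]eq_bigr do rewrite mulr_suml.
rewrite [RHS]exchange_big /= -sum1_card natr_sum mulr_suml; apply: eq_bigr => p /isomsP pi.
rewrite mul1r (reindex_inj (@perm_inj _ p)); apply: eq_bigr => x _; congr (_ * conjc _).
exact: (si _ pi x (z.1 +i* z.2) z0).
Qed.

Lemma shadow_no_form : no_form K Q -> unique (@is_shadow R G) (zero_form G).
Proof.
move=> nf; apply: shadow_zero => h hc; have [hq hl] := psi_pull hc.
have cf : cform 5 K Q (pull h) by split=> //; exists jw => // t t0; exact: md_jw.
have z := nf _ (avg_cform cf) (avg_sinv _).
have P0 := card_isoms_neq0 K Q.
apply: (mulfI P0); rewrite (lambda_avg (c := 0) hc hc) ?mul0r ?mulr0 // => x t t0.
by rewrite mul0r z.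
Qed.

End OneModel.

Transparent e2pi.
Lemma eighth_root : exists z : C, [/\ z = e2pi_rat R (1 / 8), z ^+ 2 = 0 +i* 1, 0 < Re z & 0 < Im z].
Proof.
exists (e2pi_rat R (1 / 8)); have p0 := pi_gt0 R.
have E : (2 * pi * ratr (1 / 8) : R) = pi / 2 / 2 by rewrite fmorph_div rmorph1 rmorph_nat; field.
have -> : e2pi_rat R (1 / 8) = cos (pi / 2 / 2) +i* sin (pi / 2 / 2).
  by rewrite /e2pi_rat /e2pi [complex.Re _]/= [complex.Im _]/= mulr0 oppr0 expR0 [X in X * _](_ : _ = 1) // mul1r E.
have c0 : 0 < cos (pi / 2 / 2) :> R by apply: cos_gt0_pihalf; lra.
have s0 : 0 < sin (pi / 2 / 2) :> R by apply: sin_gt0_pi; lra.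
split=> //; have a := cosD (pi / 2 / 2) (pi / 2 / 2 : R); have b := sinD (pi / 2 / 2) (pi / 2 / 2 : R).
have d : pi / 2 / 2 + pi / 2 / 2 = pi / 2 :> R by field.
move: a b; rewrite d cos_pihalf sin_pihalf => a b.
by apply: complex_eqP; rewrite expr2 ?cReM ?cImM /=; lra.
Qed.

Opaque e2pi.

(** The product of the chosen roots of i/t and t is z = e(1/8). Hence e(-1/8) sqrt(t)^5 is z^4 times
    the inverse fifth power of [jb t], and z^4 = -1 matches the sign in [jx]. *)
Lemma jx_jw t : 0 < Im t -> jx t = jw t.
Proof.
move=> t0; have [s2 sr] := jbP t0; have [z [zE z2 z3 z4]] := eighth_root.
have r2 : sqrtc t ^+ 2 = t := sqr_sqrtc t.
have [r3 r4] : 0 <= Re (sqrtc t) /\ 0 <= Im (sqrtc t).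
  move: t0; case: (t) => a b /= b0; rewrite gt_eqF // gtr0_sg // mul1r !sqrtr_ge0.
have r5 : 0 < Re (sqrtc t) + Im (sqrtc t).
  have : Im (sqrtc t ^+ 2) > 0 by rewrite r2.
  rewrite expr2 cImM; nra.
have sz : jb t * sqrtc t = z.
  have : (jb t * sqrtc t) ^+ 2 = z ^+ 2.
    by rewrite exprMn s2 r2 z2 mulfVK // Im_gt0_neq0.
  move/eqP; rewrite eqf_sqr => /orP[/eqP //|/eqP e].
  (* The root of i/t lies in |Im| < Re and the principal root of t in the first quadrant, so the
     real and imaginary parts of the product have positive sum; this excludes -z. *)
  have : 0 < Re (jb t * sqrtc t) + Im (jb t * sqrtc t).
    rewrite cReM cImM; move: sr r3 r4 r5; rewrite ltr_norml.
    move: (Re _) (Im _) (Re _) (Im _) => u v p q /andP[h1 h2] u0 v0 uv.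
    have m1 : 0 <= u * (p + q) by apply: mulr_ge0 => //; lra.
    have m2 : 0 <= v * (p - q) by apply: mulr_ge0 => //; lra.
    have [u1|u1] := ltrP 0 u.
      have : 0 < u * (p + q) by apply: mulr_gt0 => //; lra.
      lra.
    have : 0 < v * (p - q) by apply: mulr_gt0; lra.
    lra.
  by rewrite e cReN cImN => hs; exfalso; lra.
have jn := jb_neq0 t0; have zn : z != 0 by apply: contraTneq z3 => ->; rewrite ltxx.
have zi : e2pi_rat R (- (1 / 8)) * z = 1 by rewrite zE /e2pi_rat -e2piD -rmorphD -rmorphD addNr !rmorph0 e2pi0.
have z8 : z ^+ 4 = -1 by rewrite (exprM _ 2 2) z2; apply: complex_eqP => /=; ring.
have -> : jw t = e2pi_rat R (- (1 / 8)) * z ^+ 5 / jb t ^+ 5.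
  by rewrite /jw -sz exprMn; field.
by rewrite exprS z8 mulrA zi /jx mul1r mulN1r.
Qed.

Lemma Xi_weil_law : xlaw jw (@K72 R) (@Xi72 R).
Proof. by move=> x t t0; rewrite Xi_law // jx_jw. Qed.

Lemma lead_sum (I : finType) (A : {set I}) (f : I -> C -> C) m l : (forall i, i \in A -> lead (f i) m l) ->
  lead (fun t => \sum_(i in A) f i t) m (#|A|%:R * l).
Proof.
move=> h; have /(_ _)/cid2 H : forall i : {i | i \in A}, exists2 a, hasq (f (val i)) a & vge m a /\ a m = l.
  by case=> i iA; have [a ha va] := h i iA; exists a.
pose a i := if insub i is Some u then projT1 (H u) else fun=> 0.
have ha i : i \in A -> [/\ hasq (f i) (a i), vge m (a i) & a i m = l].
  move=> iA; rewrite /a insubT; by case: (H _) => b /= hb [].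
exists (fun k => \sum_(i in A) a i k); first by apply: hasq_sum => i /ha[].
split; first by move=> k km; rewrite big1 // => i /ha[_ v _]; exact: v.
by rewrite (eq_bigr (fun=> l)) => [|i /ha[] //]; rewrite sumr_const mulr_natl.
Qed.

Lemma sq_lead0 (f : C -> C) m e : sq f m e -> lead f m 0 -> sq f m.+1 e.
Proof.
move=> [a [ha va ra]] hl; exists a; split=> // k; rewrite ltnS leq_eqVlt => /orP[/eqP ->|]; last exact: va.
exact: lead_coef hl ha.
Qed.

Definition x12 : 'I_3 * 'I_3 * 'I_2 * 'I_2 * 'I_2 := (inord 1, ord0, inord 1, ord0, ord0).

(** Residue 12 means one nonzero coordinate modulo 3 and one nonzero coordinate modulo 2; these
    twelve classes form a single orbit. *)
Lemma orbit12 (f : ('I_3 * 'I_3 * 'I_2 * 'I_2 * 'I_2)%type -> C -> C) : sinv (@K72 R) Q72 f -> forall x t, Q72 x = 12 %[mod 144] -> 0 < Im t -> f x t = f x12 t.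
Proof.
move=> si x t xq t0.
have iab y a b c : f (y, b, a, c) t = f (y, a, b, c) t by exact: (si _ (@isom72_ab R) (y, a, b, c) t t0).
have ibc y a b c : f (y, a, c, b) t = f (y, a, b, c) t by exact: (si _ (@isom72_bc R) (y, a, b, c) t t0).
have iy y y' a b c : f (y', y, a, b, c) t = f (y, y', a, b, c) t by exact: (si _ (@isom72_y R) (y, y', a, b, c) t t0).
have io y y' a b c : f (- y, y', a, b, c) t = f (y, y', a, b, c) t by exact: (si _ (@isom72_opp R) (y, y', a, b, c) t t0).
have e2 : inord 2 = - inord 1 :> 'I_3 by rewrite opp_inord.
have h1 y a b c : [|| (y == (inord 1, ord0)), (y == (inord 2, ord0)), (y == (ord0, inord 1)) | (y == (ord0, inord 2))] ->
    f (y, a, b, c) t = f (inord 1, ord0, a, b, c) t.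
  by rewrite e2 => /or4P[] /eqP -> //; rewrite ?[f (ord0, _, _, _, _) t]iy ?io.
case: x xq => [[[[y y'] a] b] c]; elim/I3P: y; elim/I3P: y'; elim/I2P: a; elim/I2P: b; elim/I2P: c;
  rewrite /Q72 /= ?inordK // => _; rewrite h1 ?eqxx ?orbT // /x12 ?[f (_, _, inord 1, ord0) t]iab //.
all: by rewrite ibc iab.
Qed.

Lemma Q72_12dvd x : (12 %| Q72 x)%N.
Proof. by rewrite /Q72; do 3 (apply: dvdn_add; last exact: dvdn_mulr); exact: dvdn_mulr. Qed.

Lemma dvd12_mod (k e : nat) : k = e %[mod 144] -> (12 %| e)%N -> (12 %| k)%N.
Proof. lia. Qed.

Lemma qm72_gt12 x : (Q72 x != 12 %[mod 144])%N -> (12 < qm (Q72 x))%N.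
Proof.
move=> q12; rewrite /qm; case: eqP => // /eqP q0; rewrite ltn_neqAle; apply/andP; split.
  by rewrite eq_sym; move: q12; rewrite (modn_small (m := 12)).
apply: dvdn_leq; first by rewrite lt0n.
by rewrite -(dvdn_addr _ (dvdn_mull (Q72 x %/ 144) (isT : 12 %| 144)%N)) -divn_eq Q72_12dvd.
Qed.

Definition XiP := avg (@K72 R) Q72 (@Xi72 R).

Lemma XiP_sq x : sq (XiP x) (qm (Q72 x)) (Q72 x).
Proof. by apply: avg_sq => y; exact: Xi_sq. Qed.

Lemma XiP_law : xlaw jw (@K72 R) XiP.
Proof. exact: avg_xlaw Xi_weil_law. Qed.

Lemma Q72_x12 : Q72 x12 = 12 %[mod 144].
Proof. by rewrite /Q72 /x12 /= !inordK. Qed.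

Lemma XiP_lead : lead (XiP x12) 12 (#|isoms (@K72 R) Q72|%:R * - 2%:R).
Proof.
apply: lead_sum => p /isomsP [_ pq _]; have [h _ _] := Xi_lead R (p x12); apply: h.
by rewrite pq Q72_x12.
Qed.

(** Subtracting the multiple with the same coefficient at w^12 raises the order of every component
    to 13: on the residue class 12 by transitivity, elsewhere because exponents are multiples of 12.
    Then [no_form72] applies. *)
Lemma invariant_multiple f : (forall x, sq (f x) (qm (Q72 x)) (Q72 x)) -> xlaw jw (@K72 R) f -> sinv (@K72 R) Q72 f ->
  exists c, forall x t, 0 < Im t -> f x t = c * XiP x t.
Proof.
move=> fq fs fi; pose al : C := #|isoms (@K72 R) Q72|%:R * - 2%:R.
have al0 : al != 0 by rewrite mulf_neq0 ?card_isoms_neq0 // oppr_eq0 pnatr_eq0.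
have qm12 x : Q72 x = 12 %[mod 144] -> qm (Q72 x) = 12%N by rewrite /qm => ->.
have [a [ha va _]] := fq x12; have fl : lead (f x12) 12 (a 12%N).
  by exists a => //; split=> //; rewrite -(qm12 x12 Q72_x12).
pose c := a 12%N / al; exists c.
pose D x t := f x t - c * XiP x t.
have Dq x : sq (D x) (qm (Q72 x)) (Q72 x) by apply: sqB; [exact: fq|apply: sqZ; exact: XiP_sq].
have Di : sinv (@K72 R) Q72 D by move=> s hs x t t0; rewrite /D (fi _ hs) // /XiP (avg_sinv _ hs).
have D12 : sq (D x12) 13 12.
  apply: sq_lead0.
    by apply: sq_mod (Q72_x12) _; have := Dq x12; rewrite qm12 //; exact: Q72_x12.
  have -> : 0 = a 12%N + - c * al by rewrite /c mulNr divfK // subrr.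
  apply: lead_ext (leadD fl (leadZ (- c) XiP_lead)) => t _.
  by rewrite /D mulNr.
have D0 : forall x, hzero (D x).
  apply: (no_form72 (f := D) _ _ Di).
  - exists jw => [t t0|x t t0]; first exact: md_jw.
    rewrite /D fs // XiP_law // (mulrCA c) -mulrBr; congr (_ * _).
    by rewrite mulr_sumr -sumrB; apply: eq_bigr => y _; ring.
  - move=> x; have [q12|q12] := eqVneq (Q72 x %% 144)%N (12 %% 144)%N; last exact: sq_le (qm72_gt12 q12) (Dq x).
    by apply: sq_mod (esym q12) _; apply: sq_ext D12 => t t0; rewrite (orbit12 Di q12).
by move=> x t t0; apply/eqP; rewrite -subr_eq0; apply/eqP; exact: D0.
Qed.

Lemma sum_Q72 (k : nat) : (k == 12)%N || (k == 24)%N -> (\sum_(x | k == Q72 x %[mod 144]) 1 = 12)%N.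
Proof.
move=> kk; rewrite big_mkcond !sum_pair !sumI3 !sumI2; cbv beta delta [Q72]; cbn [fst snd]; rewrite !inordK //.
by case/orP: kk => /eqP ->; vm_compute.
Qed.

Local Notation G0 := (gram 4 12 6 (-6) 0 (-6)).

Lemma norm2_G0 v : norm2 G0 v = 4 * v ord0 0 ^+ 2 + 12 * v (lift ord0 ord0) 0 ^+ 2 + 6 * v ord_max 0 ^+ 2
  - 12 * v ord0 0 * v (lift ord0 ord0) 0 - 12 * v (lift ord0 ord0) 0 * v ord_max 0.
Proof.
have e2 : lift ord0 (lift ord0 ord0) = ord_max :> 'I_3 by exact: val_inj.
rewrite /norm2 !mxE !big_ord_recl big_ord0 !mxE !big_ord_recl !big_ord0 !mxE /= e2; ring.
Qed.

Lemma gcd_entries_G0_even v : (2 %| gcd_entries (G0 *m v))%Z.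
Proof.
apply: (big_ind (fun x => 2 %| x)%Z) => [//|x y dx dy|i _]; first by rewrite dvdz_gcd dx.
rewrite mxE; apply: rpred_sum => k _; apply: dvdz_mulr.
by move: i k; apply: ord3P; apply: ord3P; rewrite mxE.
Qed.

Lemma menu_G0_values (k : nat) : menu G0 (k%:R / 144%:R) -> (12 %| k)%N -> k \in [:: 12; 24; 72]%N.
Proof.
move=> [v [_ n0 /dvdzP [q nd]] kE] /dvdnP [j kj].
have /dvdzP [d dE] := gcd_entries_G0_even v.
have g0 : gcd_entries (G0 *m v) != 0.
  apply: contraTneq n0 => gz; rewrite /norm2 -mulmxA mxE big1 ?ltxx // => i _.
  by have := gcd_entries_dvd (G0 *m v) i; rewrite gz dvd0z => /eqP ->; rewrite mulr0.
have n3 : exists w, norm2 G0 v = v ord0 0 ^+ 2 + 3 * w.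
  rewrite norm2_G0; move: (v ord0 0) (v (lift ord0 ord0) 0) (v ord_max 0) => x y z.
  by exists (x ^+ 2 + 4 * y ^+ 2 + 2 * z ^+ 2 - 4 * x * y - 4 * y * z); ring.
move: (norm2 G0 v) (gcd_entries (G0 *m v)) n0 nd kE dE g0 n3 => n g n0 nd kE gd g0 [w nw].
have kz : k%:Z * (2 * g ^+ 2) = 144 * n.
  (* The menu value k/144 = n/(2 g^2), cleared of denominators. *)
  apply/eqP; rewrite -(eqr_int rat); apply/eqP.
  have gq : (g%:~R : rat) != 0 by rewrite intr_eq0.
  have -> : (k%:Z * (2 * g ^+ 2))%:~R = (k%:R / 144%:R) * (144%:R * (2 * g%:~R ^+ 2)) :> rat.
    by rewrite expr2 !intrM -!pmulrn; field.
  by rewrite kE intrM -!pmulrn; field.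
have d0 : d != 0 by apply: contraNneq g0 => d0; rewrite gd d0 mul0r.
(* With k = 12j, g = 2d and 2g = q n the equation becomes j d q = 6, so j divides 6. *)
have e1 : j%:Z * (d * q) = 6.
  apply: (mulfI d0); move: nd kz; rewrite gd kj PoszM => nd kz.
  have : 96 * (d * (j%:Z * (d * q))) = 96 * (d * 6).
    transitivity (j%:Z * 12%:Z * (2 * (d * 2) ^+ 2) * q); first by ring.
    by rewrite kz mulrAC -mulrA -nd; ring.
  by move/mulfI; apply.
(* The case j = 3, that is the value 1/4, is the one to be excluded; it forces d q = 2 and n = 2
   d^2. *)
have {}kz : n = 2 * d ^+ 2 \/ j != 3%N.
  case: eqP => [j3|]; [left|by right]; have dq : d * q = 2 by move: e1; rewrite j3; lia.
  have : 2 * (2 * d ^+ 2) = 2 * n by rewrite -[in RHS]dq -mulrA -nd gd; ring.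
  by move/(mulfI (isT : (2 : int) != 0))/esym.
have x3 (x : int) : exists y, x ^+ 2 = 3 * y \/ x ^+ 2 = 3 * y + 1.
  have [y [xy|[xy|xy]]] : exists y, x = 3 * y \/ x = 3 * y + 1 \/ x = 3 * y + 2.
    exists (x %/ 3)%Z; lia.
  - by exists (3 * y ^+ 2); left; rewrite xy; ring.
  - by exists (3 * y ^+ 2 + 2 * y); right; rewrite xy; ring.
  - by exists (3 * y ^+ 2 + 4 * y + 1); right; rewrite xy; ring.
have j6 : (j %| 6)%N.
  by apply/dvdnP; exists (absz (d * q)); rewrite -[6%N]/(absz (6 : int)) -e1 abszM mulnC.
have : (j <= 6)%N by exact: dvdn_leq.
move: kj kz e1 j6; case: j => [|[|[|[|[|[|[|//]]]]]]] -> kz e1 j6 // _.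
case: kz => [nE|//]; have [y1 y2] := x3 (v ord0 0); have [z1 z2] := x3 d.
have dq : d * q = 2 by lia.
have dq2 : d ^+ 2 * q ^+ 2 = 4 by rewrite -exprMn dq.
by case: z2 => z2; move: dq2; rewrite ?z2 -?mulrA; case: y2 => y2; lia.
Qed.

Lemma menu_G0_e2 : menu G0 (24%:R / 144%:R).
Proof.
have n12 : norm2 G0 (colz [:: 0; 1; 0]) = 12 by rewrite norm2_G0 !mxE.
have g6 : gcd_entries (G0 *m colz [:: 0; 1; 0]) = 6.
  by rewrite /gcd_entries !big_ord_recl big_ord0 !mxE !big_ord_recl !big_ord0 !mxE.
exists (colz [:: 0; 1; 0]); last by rewrite n12 g6; field.
by split; rewrite ?n12 ?g6 // /gcd_entries !big_ord_recl big_ord0 !mxE.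
Qed.

Lemma menu_G0_e3 : menu G0 (12%:R / 144%:R).
Proof.
have n6 : norm2 G0 (colz [:: 0; 0; 1]) = 6 by rewrite norm2_G0 !mxE.
have g6 : gcd_entries (G0 *m colz [:: 0; 0; 1]) = 6.
  by rewrite /gcd_entries !big_ord_recl big_ord0 !mxE !big_ord_recl !big_ord0 !mxE.
exists (colz [:: 0; 0; 1]); last by rewrite n6 g6; field.
by split; rewrite ?n6 ?g6 // /gcd_entries !big_ord_recl big_ord0 !mxE.
Qed.

Lemma shadow_G0 : exists2 Xi, unique (@is_shadow R G0) Xi & Xi <> zero_form G0.
Proof.
have [psi [psi_bij psi_q psi_K]] := model_4_12_6_6_0_6 R.
have pushK (f : 'I_3 * 'I_3 * 'I_2 * 'I_2 * 'I_2 -> C -> C) x (t : C) : 0 < Im t -> pull psi (push psi_bij f) x t = f x t by exact: pull_push.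
have cX : cusp_form (push psi_bij (@Xi72 R)) := push_cusp psi_bij psi_q psi_K (@Xi_sq R) Xi_weil_law.
have cP : cusp_form (push psi_bij XiP) := push_cusp psi_bij psi_q psi_K XiP_sq XiP_law.
set X0 := push psi_bij (@Xi72 R) in cX; set XP := push psi_bij XiP in cP.
pose P : nat := #|isoms (@K72 R) Q72|; have P0 : P%:R != 0 :> C := card_isoms_neq0 _ _.
have lX : lambda X0 = 24%:R.
  have [a ha] := cusp_coefs psi_bij psi_q psi_K cX.
  have ms k l : (k == 12)%N || (k == 24)%N -> (forall x, Q72 x = k %[mod 144] -> lead (Xi72 x) k l) ->
      menu_sum X0 (k%:R / 144%:R) = 12%:R * l.
    move=> kk hl; rewrite (menu_sum_coef psi_bij psi_q cX ha) (eq_bigr (fun=> l)) => [|x /eqP xk].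
      transitivity ((\sum_(x | k == Q72 x %[mod 144]) 1)%N%:R * l); last by rewrite sum_Q72.
      by rewrite natr_sum mulr_suml; apply: eq_bigr => x _; rewrite mul1r.
    by apply: (lead_coef _ (ha x)); apply: lead_ext (hl x (esym xk)) => t t0; rewrite pushK.
  have m12 : menu_sum X0 (12%:R / 144%:R) = - 24%:R.
    rewrite (ms 12%N (- 2%:R)) => [|//|x xk]; first by ring.
    by have [h _ _] := Xi_lead R x; exact: h.
  have m24 : menu_sum X0 (24%:R / 144%:R) = 48%:R.
    rewrite (ms 24%N 4%:R) => [|//|x xk]; first by ring.
    by have [_ h _] := Xi_lead R x; exact: h.
  (* Membership of 1/2 in the menu is left undecided; its contribution is 0 in either case. *)
  have m72 : menu_sum X0 (72%:R / 144%:R) = 0.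
    rewrite (menu_sum_coef psi_bij psi_q cX ha) big1 // => x /eqP xk.
    apply: (lead_coef _ (ha x)); have [_ _ h] := Xi_lead R x.
    by apply: lead_ext (h (esym xk)) => t t0; rewrite pushK.
  have [u [v [ue ve uv]]] : exists u v : rat, [/\ u = 12%:R / 144%:R, v = 24%:R / 144%:R & u != v].
    by do 2!eexists.
  rewrite -ue -ve in m12 m24; have [u_menu v_menu] := (menu_G0_e3, menu_G0_e2); rewrite -ue -ve in u_menu v_menu.
  rewrite lambdaE (fsbigE [:: u; v]).
  - rewrite !big_cons big_nil m12 m24 (mem_set u_menu) (mem_set v_menu) -[LHS]/(- 24%:R + (48%:R + 0)); ring.
  - by rewrite /= inE uv.
  - by move=> m /=; rewrite !inE => /orP[] /eqP ->.
  - move=> m mM mr; apply/eqP; apply: contraNT mr => mn; have := menu_sum_supp psi_bij psi_q mn (menu_ge0 mM).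
    move=> [k mk [x kx]]; rewrite mk in mM mn *.
    have k12 := dvd12_mod kx (Q72_12dvd x).
    have [ke|[ke|ke]] : k = 12%N \/ k = 24%N \/ k = 72%N.
    + by have := menu_G0_values mM k12; rewrite !inE => /or3P[] /eqP; auto.
    + by rewrite ke -ue mem_head.
    + by rewrite ke -ve mem_seq2 eqxx orbT.
    + by move: mn; rewrite ke m72 eqxx.
have lP : P%:R * 24%:R = lambda XP.
  rewrite -lX -[RHS]mul1r; apply: (lambda_avg psi_bij psi_q psi_K cX cP) => x t t0.
  by rewrite mul1r pushK //; apply: eq_bigr => p _; rewrite pushK.
have [N NE _] := petersson_diag XP.
have XPn : exists2 t, 0 < Im t & XiP x12 t != 0.
  apply: contrapT => h; have z t : 0 < Im t -> XiP x12 t = 0.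
    by move=> t0; apply/eqP; apply: contraT => hn; case: h; exists t.
  have := lead_coef XiP_lead (hasq_ext (fun t t0 => esym (z t t0)) (zero_hasq R)).
  by move/esym/eqP; rewrite mulf_eq0 (negbTE P0) oppr_eq0 pnatr_eq0.
have [t0 i0 nz] := XPn.
have N0 : N%:C != 0 :> C.
  apply: contraNneq nz => N0; have := petersson_definite (cusp_hreg psi_bij psi_q psi_K cP) (etrans NE N0) (psi x12) i0.
  by move=> h; rewrite -(pushK XiP) // /pull -/XP h.
(* For every h the average is c times [XiP], and both P lambda(h) and P times the product of h with
   XP are c times a value at XP. Their quotient is 24P/N; the conjugate appears because the product
   is conjugate-linear in its second argument. *)
pose ka : C := conjc (P%:R * 24%:R / N%:C).
have ka0 : ka != 0.
  rewrite /ka -md_eq0 md_conj md_eq0; apply: mulf_neq0 (invr_neq0 N0).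
  by apply: mulf_neq0 P0 _; rewrite pnatr_eq0.
pose Xi t : group_space R G0 := [ffun g => ka * XP t g].
exists Xi.
  have sX : is_shadow Xi.
    split=> [|h hc]; first exact: (cusp_formZ psi_bij psi_q psi_K).
    have [hq hl] := cusp_pull psi_bij psi_q psi_K hc.
    have [c hcE] := invariant_multiple (avg_sq (@K72 R) hq) (avg_xlaw Q72 hl) (avg_sinv _).
    have hP x t : 0 < Im t -> avg (@K72 R) Q72 (pull psi h) x t = c * pull psi XP x t.
      by move=> t1; rewrite pushK // hcE.
    have siP : sinv (@K72 R) Q72 (pull psi XP).
      by move=> s hs x t t1; rewrite !pushK // /XiP (avg_sinv _ hs).
    have e1 := lambda_avg psi_bij psi_q psi_K hc cP hP; have e2 := petersson_avg psi_bij psi_q psi_K hc cP siP hP.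
    have -> : petersson h Xi = conjc ka * petersson h XP.
      apply: petersson_scale; try exact: (cusp_hreg psi_bij psi_q psi_K).
      move=> z _; rewrite /pint mulrA mulr_sumr; congr (_ * _); apply: eq_bigr => g _.
      by rewrite ffunE rmorphM mulrCA.
    apply: (mulfI P0); rewrite mulrCA e2 e1 -lP NE /ka conjcK; field; exact: N0.
  split=> // Xi'; exact: (shadow_unique psi_bij psi_q psi_K).
move=> e; have := congr1 (fun f : C -> group_space R G0 => f t0 (psi x12)) e.
have XPx : XP t0 (psi x12) = XiP x12 t0 := pushK XiP x12 t0 i0.
rewrite [LHS]ffunE [RHS]ffunE XPx => /eqP.
by rewrite mulf_eq0 (negbTE ka0) (negbTE nz).
Qed.

End Shadows.

Theorem theoremB (R : realType) :
  let G0 := gram 4 12 6 (-6) 0 (-6) in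
  [/\ G0 \in compact_grams, G0 \in chain_1213, \det G0 = -72 &
      forall G : 'M[int]_3, G \in compact_grams ->
        exists Xi : R[i] -> group_space R G,
          unique (@is_shadow R G) Xi /\
          (Xi <> (fun=> [ffun=> 0]) <-> G = G0)].
Proof.
move=> G0; split; [by rewrite /compact_grams mem_cat /chain_1213 !inE eqxx !orbT|by rewrite !inE eqxx !orbT|by rewrite det_gram|].
move=> G GC; have [->|/eqP Gn] := eqVneq G (gram 4 12 6 (-6) 0 (-6)).
  by have [Xi u nz] := shadow_G0 R; exists Xi.
have [X [K [Q [nf [psi [psi_bij psi_q psi_K]]]]]] := compact_model R GC Gn.
exists (fun=> [ffun=> 0]); split; first exact: (shadow_no_form psi_bij psi_q psi_K nf).
by split=> [|/Gn].
Qed.
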